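(* Let $X=H^2(\mathbb{C}_+)\cap A^2(\mathbb{C}_+)$ be the Hardy–Bergman space and let $C_\varphi$ be a bounded composition operator on $X$. (a) If $\varphi(s)=\mu s$ with $\mu>0$, then $\sigma(C_\varphi)$ is the annulus $$\sigma(C_\varphi)=\left\{z\in\mathbb{C}:\min\left\{\frac1\mu,\frac1{\sqrt\mu}\right\}\le|z|\le\max\left\{\frac1\mu,\frac1{\sqrt\mu}\right\}\right\}.$$ (b) If $\varphi(s)=\mu s+(x+iy)$ with $\mu,x>0$ and $y\in\mathbb{R}$, then $\sigma(C_\varphi)$ is the closed disc $$\sigma(C_\varphi)=\{z\in\mathbb{C}:|z|\le 1/\mu\}.$$ In all cases $\sigma_e(C_\varphi)=\sigma(C_\varphi)$.
   Context: $\mathbb{C}_+=\{z\in\mathbb{C}:\operatorname{Re}z>0\}$ is the right half-plane. $H^2(\mathbb{C}_+)$ is the Hardy space and $A^2(\mathbb{C}_+)$ the (unweighted) Bergman space of analytic functions on $\mathbb{C}_+$. The Hardy–Bergman space $X=H^2(\mathbb{C}_+)\cap A^2(\mathbb{C}_+)$ is a Hilbert space with norm $\|f\|_X^2=\|f\|_{H^2(\mathbb{C}_+)}^2+\|f\|_{A^2(\mathbb{C}_+)}^2$; up to an equivalent norm it is the image under the Laplace transform of $L^2(0,\infty,(1+1/t)\,dt)$. The composition operator is $C_\varphi f=f\circ\varphi$. $\sigma$ denotes the spectrum, and the essential spectrum $\sigma_e$ is the set of $\lambda\in\mathbb{C}$ such that $C_\varphi-\lambda I$ is not Fredholm.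
   Formalization: The two formulas for σ(C_φ) are stated only for μ ≠ 1, since they fail at μ = 1 (in (a) C_φ = I and σ = {1}; in (b) σ is the curve {e^{-(x+iy)t}: t ≥ 0} with 0, not a disc); σ_e = σ is kept for every μ > 0. *)

(* Defs.v *)
From HB Require Import structures.
From mathcomp Require Import all_boot all_order all_algebra.
From mathcomp Require Import all_classical all_reals all_analysis.
From mathcomp Require Import measurable_realfun complex ring lra.

Set Implicit Arguments.
Unset Strict Implicit.
Unset Printing Implicit Defensive.

Import Order.TTheory GRing.Theory Num.Theory.
Import numFieldNormedType.Exports.
Import ComplexField.Normc.

Local Open Scope classical_set_scope.
Local Open Scope ring_scope.
Local Open Scope complex_scope.

(* The analysis library does not equip R[i] itself with the topology of its
   norm, only the alias R[i]^o. *)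
HB.instance Definition _ (R : rcfType) := NormedModule.copy R[i] R[i]^o.

Section Operators.
Context {K : numFieldType} {V : normedModType K}.

(* A linear map between normed modules is bounded iff it is continuous
   (linear_bounded_continuous). *)
Definition spectrum (T : V -> V) : set K :=
  [set l | ~ exists S : {linear V -> V},
     [/\ continuous S, cancel (fun v => T v - l *: v) S
       & cancel S (fun v => T v - l *: v)]].

Definition lin_span n (e : 'I_n -> V) : set V :=
  [set \sum_i c i *: e i | c in [set: 'I_n -> K]].

Definition fin_dim (W : set V) := exists n (e : 'I_n -> V), W = lin_span e.

Definition fin_codim (W : set V) := exists n (e : 'I_n -> V),
  forall v, exists w u, [/\ W w, lin_span e u & v = w + u].

Definition fredholm (A : V -> V) :=
  [/\ fin_dim (A @^-1` [set 0]), closed (range A) & fin_codim (range A)].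

Definition essential_spectrum (T : V -> V) : set K :=
  [set l | ~ fredholm (fun v => T v - l *: v)].

End Operators.

Section HardyBergman.
Context {R : realType}.
Implicit Types (f g : R[i] -> R[i]) (x y t : R).
Local Notation leb := (@lebesgue_measure R).

Definition half_plane : set R[i] := [set z | 0 < complex.Re z].

Definition holomorphic_rhp f := forall z, half_plane z -> derivable f z 1.

(* The squared norms of f in the Hardy space (a supremum of L^2 norms on vertical
   lines) and in the unweighted Bergman space (area measure), both without the
   normalizing factor 1 / (2 pi) or 1 / pi that some authors use. *)
Definition hardy_sqnorm f : \bar R :=
  ereal_sup [set (\int[leb]_y (normc (f (x +i* y)) ^+ 2)%:E)%E
            | x in [set x | 0 < x]].

Definition bergman_sqnorm f : \bar R :=
  (\int[leb \x leb]_(p in [set p : R * R | (0 < p.1)%R])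
     (normc (f (p.1 +i* p.2)) ^+ 2)%:E)%E.

(* A function on the half-plane is represented by its extension by 0, so that
   equality in the space is equality on the half-plane. *)
Definition hardy_bergman_set : set (R[i] -> R[i]) :=
  [set f | [/\ (forall z, ~ half_plane z -> f z = 0),
               holomorphic_rhp f,
               (hardy_sqnorm f < +oo)%E & (bergman_sqnorm f < +oo)%E]].

Definition hardy_bergman_pred : {pred R[i] -> R[i]} := mem hardy_bergman_set.

Definition hb_sqnorm f : \bar R := (hardy_sqnorm f + bergman_sqnorm f)%E.

Let C_of (p : R * R) : R[i] := p.1 +i* p.2.

Lemma normc_le_ReIm (z : R[i]) :
  normc z <= `|complex.Re z| + `|complex.Im z|.
Proof.
case: z => a b /=.
rewrite -[leRHS]ger0_norm ?addr_ge0// -sqrtr_sqr ler_wsqrtr//.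
rewrite sqrrD !real_normK ?num_real// mulr2n.
have ab : 0 <= `|a| * `|b| by rewrite mulr_ge0.
lra.
Qed.

Lemma normc_ge0 (z : R[i]) : 0 <= normc z.
Proof. by case: z => a b /=; exact: sqrtr_ge0. Qed.

Lemma derivable_normc_cont f z : derivable f z 1 ->
  forall e, 0 < e -> exists2 d, 0 < d &
    forall w, normc (z - w) < d -> normc (f z - f w) < e.
Proof.
move=> /derivable1_diffP /differentiable_continuous fz e e0.
have e0' : 0 < e%:C :> R[i] by rewrite ltcR.
move/cvgrPdist_lt : (fz) => /(_ _ e0').
move/nbhs_normP => [d /= d0 dP].
move: d0; rewrite ltcE /= => /andP[/eqP dI d0].
exists (complex.Re d) => // w wd.
have := dP w; rewrite /= /ball_ /=.
have -> : d = (complex.Re d)%:C by case: d {d0 dP wd} dI => a b /= ->.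
by rewrite ltcR => /(_ wd); rewrite ltcR.
Qed.

Lemma derivable_normc_continuous f (p : R * R) : derivable f (C_of p) 1 ->
  {for p, continuous (fun q => normc (f (C_of q)))}.
Proof.
move=> /derivable_normc_cont fp; apply/cvgrPdist_lt => e e0.
have [d d0 dP] := fp _ e0.
have d20 : 0 < d / 2 by rewrite divr_gt0.
have c1 : (fun q : R * R => q.1) @ p --> p.1 by exact: cvg_fst.
have c2 : (fun q : R * R => q.2) @ p --> p.2 by exact: cvg_snd.
move/cvgrPdist_lt : c1 => /(_ _ d20) c1.
move/cvgrPdist_lt : c2 => /(_ _ d20) c2.
near=> q.
have H : normc (C_of p - C_of q) < d.
  apply: le_lt_trans (normc_le_ReIm _) _ => /=.
  by rewrite (splitr d) ltrD//; near: q.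
apply: le_lt_trans (dP _ H).
rewrite ler_norml lerBrDl; apply/andP; split.
- have := le_normcD (f (C_of q) - f (C_of p)) (f (C_of p)).
  by rewrite subrK -(normcN (_ - _)) opprB; lra.
- have := le_normcD (f (C_of p) - f (C_of q)) (f (C_of q)).
  by rewrite subrK; lra.
Unshelve. all: by end_near. Qed.

Lemma open_measurable2 (A : set (R * R)) : open A -> measurable A.
Proof.
move=> oA.
pose box (i : rat * rat * nat) : set (R * R) :=
  ball (ratr i.1.1 : R) i.2.+1%:R^-1 `*` ball (ratr i.1.2 : R) i.2.+1%:R^-1.
pose F i := if `[< box i `<=` A >] then box i else set0.
suff -> : A = \bigcup_i F i.
  apply: countable_bigcupT_measurable; first exact: countableP.
  move=> i; rewrite /F; case: ifPn => // _.
  by apply: measurableX; apply: open_measurable; apply: ball_open; rewrite invr_gt0.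
apply/seteqP; split=> [p Ap|p [i _]]; last first.
  by rewrite /F; case: ifPn => // /asboolP; exact.
have : nbhs p A by exact: open_nbhs_nbhs.
move=> /nbhs_ballP[e /= e0 eA].
have e20 : 0 < e / 2 by rewrite divr_gt0.
have [n /= nP] := filter_ex (near_infty_natSinv_lt (PosNum e20)).
have n0 : (0 : R) < n.+1%:R^-1 by rewrite invr_gt0.
have rat_near (x d : R) : 0 < d -> exists q : rat, `|x - ratr q| < d.
  move=> d0; have xx : x - d < x + d by lra.
  have [q] := rat_in_itvoo xx; rewrite in_itv/= => /andP[q1 q2]; exists q.
  by rewrite ltr_norml; apply/andP; split; lra.
have [q1 q1P] := rat_near p.1 _ n0.
have [q2 q2P] := rat_near p.2 _ n0.
exists (q1, q2, n) => //; rewrite /F ifT; last first.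
  apply/asboolP => -[a b] [/= aq bq]; apply: eA; split => /=.
  - apply: le_lt_trans (ler_distD (ratr q1) _ _) _.
    by rewrite (splitr e) ltrD// (lt_trans _ nP).
  - apply: le_lt_trans (ler_distD (ratr q2) _ _) _.
    by rewrite (splitr e) ltrD// (lt_trans _ nP).
by split => /=; rewrite /ball/= distrC.
Qed.

Let right_p : set (R * R) := [set p | 0 < p.1].

Lemma measurable_right_p : measurable right_p.
Proof.
have -> : right_p = [set x : R | 0 < x] `*` setT.
  by apply/seteqP; split => [p|p []].
by apply: measurableX => //; rewrite -set_itvoy.
Qed.

Lemma open_right_p : open right_p.
Proof.
apply: (@open_comp _ _ (fst : R * R -> R) [set x | 0 < x]).
  by move=> p _; exact: cvg_fst.
exact: open_gt.
Qed.

Lemma measurable_sqnorm_line f x : holomorphic_rhp f -> 0 < x ->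
  measurable_fun setT (fun y => normc (f (x +i* y)) ^+ 2).
Proof.
move=> hf x0; apply: measurable_funX.
apply: continuous_measurable_fun => y.
apply: (@continuous_comp _ _ _ (fun y : R => (x, y))
          (fun q : R * R => normc (f (C_of q)))).
  exact: (@cvg_pair _ _ _ (nbhs y) (nbhs x) (nbhs y) _ _ _
    (fun=> x) id (cvg_cst _) cvg_id).
by apply: derivable_normc_continuous; exact: hf.
Qed.

Lemma measurable_sqnorm_plane f : holomorphic_rhp f ->
  measurable_fun right_p (fun p => normc (f (p.1 +i* p.2)) ^+ 2).
Proof.
move=> hf; apply: measurable_funX.
apply: (measurability _ (RGenOpens.measurableE R)) => _ [_ [a [b ->] <-]].
apply: open_measurable2; rewrite openE => p [/= p0 pab].
apply: filterI; first exact: open_nbhs_nbhs (conj open_right_p p0).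
have fp := @derivable_normc_continuous f p (hf (C_of p) p0).
apply: fp; apply: open_nbhs_nbhs; split => //; exact: interval_open.
Qed.

Lemma le_integral_lin d (T : measurableType d)
    (mu : {measure set T -> \bar R}) (D : set T) (F G H : T -> R) (a b : R) :
  measurable D -> measurable_fun D F -> measurable_fun D G ->
  measurable_fun D H -> 0 <= a -> 0 <= b ->
  (forall z, 0 <= F z) -> (forall z, 0 <= G z) -> (forall z, 0 <= H z) ->
  (forall z, D z -> H z <= a * F z + b * G z) ->
  (\int[mu]_(z in D) (H z)%:E <=
   a%:E * \int[mu]_(z in D) (F z)%:E + b%:E * \int[mu]_(z in D) (G z)%:E)%E.
Proof.
move=> mD mF mG mH a0 b0 F0 G0 H0 le_H.
rewrite -!ge0_integralZl_EFin//; do ?[exact/measurable_EFinP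
  |by move=> z _; rewrite lee_fin].
rewrite -ge0_integralD//; first last.
- by apply/measurable_EFinP; exact: measurable_funM.
- by move=> z _; rewrite -EFinM lee_fin mulr_ge0.
- by apply/measurable_EFinP; exact: measurable_funM.
- by move=> z _; rewrite -EFinM lee_fin mulr_ge0.
apply: ge0_le_integral => //.
- by move=> z _; rewrite lee_fin.
- exact/measurable_EFinP.
- apply/measurable_EFinP/measurable_funD; exact: measurable_funM.
Qed.

Lemma holomorphic_rhpD f g : holomorphic_rhp f -> holomorphic_rhp g ->
  holomorphic_rhp (f + g).
Proof. by move=> hf hg z Dz; apply: derivableD; [exact: hf|exact: hg]. Qed.

Lemma holomorphic_rhpZ (a : R[i]) f : holomorphic_rhp f -> holomorphic_rhp (a *: f).
Proof. by move=> hf z Dz; apply: derivableZ; exact: hf. Qed.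

Lemma hardy_sqnorm_ge0 f : (0 <= hardy_sqnorm f)%E.
Proof.
apply: le_ereal_sup_tmp.
exists (\int[leb]_y (normc (f (1 +i* y)) ^+ 2)%:E)%E.
  by exists 1 => //=; exact: ltr01.
by apply: integral_ge0 => y _; rewrite lee_fin sqr_ge0.
Qed.

Lemma bergman_sqnorm_ge0 f : (0 <= bergman_sqnorm f)%E.
Proof. by apply: integral_ge0 => y _; rewrite lee_fin sqr_ge0. Qed.

Lemma hb_sqnorm_ge0 f : (0 <= hb_sqnorm f)%E.
Proof. by rewrite adde_ge0// ?hardy_sqnorm_ge0 ?bergman_sqnorm_ge0. Qed.

Lemma hb_sqnorm_lin f g h (a b : R) : holomorphic_rhp f -> holomorphic_rhp g -> holomorphic_rhp h ->
  0 <= a -> 0 <= b ->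
  (forall z, normc (h z) ^+ 2 <= a * normc (f z) ^+ 2 + b * normc (g z) ^+ 2) ->
  (hardy_sqnorm h <= a%:E * hardy_sqnorm f + b%:E * hardy_sqnorm g)%E /\
  (bergman_sqnorm h <= a%:E * bergman_sqnorm f + b%:E * bergman_sqnorm g)%E.
Proof.
move=> hf hg hh a0 b0 le_h; split.
  apply: ge_ereal_sup => _ [x x0 <-].
  apply: (@le_trans _ _ (a%:E * \int[leb]_y (normc (f (x +i* y)) ^+ 2)%:E +
                         b%:E * \int[leb]_y (normc (g (x +i* y)) ^+ 2)%:E)%E).
    apply: le_integral_lin => //; do ?[exact: measurable_sqnorm_line
      |by move=> z; exact: sqr_ge0].
  by apply: leeD; apply: lee_wpmul2l; rewrite ?lee_fin//;
    apply: ereal_sup_ubound; exists x.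
apply: le_integral_lin => //; do ?[exact: measurable_sqnorm_plane
  |by move=> z; exact: sqr_ge0|exact: measurable_right_p].
Qed.

Lemma hb_sqnorm_eq0 f z : holomorphic_rhp f -> (hb_sqnorm f <= 0)%E -> half_plane z ->
  f z = 0.
Proof.
move=> hf f0; case: z => x y Dz; apply: contrapT => /eqP fz.
have nz : 0 < normc (f (x +i* y)).
  by rewrite lt_def normc_ge0 andbT; apply: contra fz => /eqP/eq0_normc ->.
pose c := normc (f (x +i* y)) / 2.
have c0 : 0 < c by rewrite divr_gt0.
have [d d0 dP] := derivable_normc_cont (hf _ Dz) c0.
have x0 : 0 < x by [].
have mb : measurable (ball y d) by apply: open_measurable; exact: ball_open.
suff : (0 < hb_sqnorm f)%E by rewrite ltNge f0.
apply: (@lt_le_trans _ _ (hardy_sqnorm f)); last first.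
  by rewrite leeDl// bergman_sqnorm_ge0.
apply: (@lt_le_trans _ _ (\int[leb]_y (normc (f (x +i* y)) ^+ 2)%:E)%E); last first.
  by apply: ereal_sup_ubound; exists x.
apply: (@lt_le_trans _ _ (\int[leb]_(y in ball y d) (c ^+ 2)%:E)%E).
  rewrite integral_cst//.
  have lb := lebesgue_measure_ball y (ltW d0).
  apply: mule_gt0; first by rewrite lte_fin exprn_gt0.
  by apply: (@lt_le_trans _ _ (d *+ 2)%:E);
    rewrite ?lte_fin ?mulrn_wgt0// -lb; exact: lexx.
have mf := measurable_sqnorm_line hf x0.
apply: (@le_trans _ _ (\int[leb]_(y in ball y d) (normc (f (x +i* y)) ^+ 2)%:E)%E).
  apply: ge0_le_integral => //.
  - by move=> ? _; rewrite lee_fin sqr_ge0.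
  - by apply/measurable_EFinP; exact: measurable_funTS.
  move=> u /= uy; rewrite lee_fin lerXn2r ?nnegrE ?normc_ge0// ?ltW//.
  have /dP : normc ((x +i* y) - (x +i* u)) < d.
    have -> : (x +i* y) - (x +i* u) = 0 +i* (y - u) :> R[i].
      by apply/eqP; rewrite eq_complex /= subrr !eqxx.
    by rewrite /normc expr0n add0r sqrtr_sqr.
  have := le_normcD (f (x +i* y) - f (x +i* u)) (f (x +i* u)).
  by rewrite subrK /c; lra.
apply: ge0_subset_integral => //.
- exact/measurable_EFinP.
- by move=> ? _; rewrite lee_fin sqr_ge0.
Qed.

Lemma hardy_bergman_submod : submod_closed hardy_bergman_pred.
Proof.
split.
  apply/mem_set; split => //.
  - apply: (@le_lt_trans _ _ 0%E) => //; apply: ge_ereal_sup => _ [x x0 <-].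
    by rewrite integral0_eq// => y _; rewrite normc0 expr0n.
  - by rewrite /bergman_sqnorm integral0_eq// => y _; rewrite normc0 expr0n.
move=> a f g /set_mem[f0 hf Hf Bf] /set_mem[g0 hg Hg Bg]; apply/mem_set.
have hh : holomorphic_rhp (a *: f + g).
  exact: holomorphic_rhpD (@holomorphic_rhpZ a _ hf) hg.
pose c := 2 * normc a ^+ 2.
have c0 : 0 <= c by rewrite mulr_ge0// sqr_ge0.
have sqr_le (m p q : R) : 0 <= m -> m <= p + q ->
    m ^+ 2 <= 2 * p ^+ 2 + 2 * q ^+ 2.
  move=> m0 mpq; apply: (@le_trans _ _ ((p + q) ^+ 2)).
    by rewrite lerXn2r// nnegrE (le_trans m0).
  rewrite -subr_ge0 (_ : _ - _ = (p - q) ^+ 2) ?sqr_ge0//; ring.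
have [] := @hb_sqnorm_lin f g _ c 2 hf hg hh c0 (ler0n _ _).
  move=> z; have := le_normcD (a * f z) (g z); rewrite normcM => n1.
  rewrite -[(a *: f + g) z]/(a * f z + g z) /c -mulrA -exprMn.
  exact: sqr_le (normc_ge0 _) n1.
move=> H1 H2; split => //.
- by move=> z nz; rewrite -[LHS]/(a * f z + g z) f0// g0// mulr0 addr0.
- by apply: le_lt_trans H1 _; rewrite lte_add_pinfty// lte_mul_pinfty// lee_fin.
- by apply: le_lt_trans H2 _; rewrite lte_add_pinfty// lte_mul_pinfty// lee_fin.
Qed.

HB.instance Definition _ :=
  GRing.isSubmodClosed.Build _ _ hardy_bergman_pred hardy_bergman_submod.

End HardyBergman.

Record hardy_bergman (R : realType) := HardyBergman {
  hb_fun :> R[i] -> R[i];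
  _ : hb_fun \in hardy_bergman_pred }.

HB.instance Definition _ (R : realType) := [isSub for @hb_fun R].
HB.instance Definition _ (R : realType) := [Choice of hardy_bergman R by <:].
HB.instance Definition _ (R : realType) :=
  [SubChoice_isSubLmodule of hardy_bergman R by <:].

Section HardyBergmanNorm.
Context {R : realType}.
Implicit Types f g h : hardy_bergman R.

Definition hb_norm f : R := Num.sqrt (fine (hb_sqnorm f)).

Lemma hb_holomorphic f : holomorphic_rhp f.
Proof. by have /set_mem[] := valP f. Qed.

Lemma hb_sqnorm_fin f : hb_sqnorm f = (hb_norm f ^+ 2)%:E.
Proof.
rewrite /hb_norm sqr_sqrtr ?fine_ge0 ?hb_sqnorm_ge0// fineK//.
rewrite ge0_fin_numE ?hb_sqnorm_ge0//.
by have /set_mem[_ _ Hf Bf] := valP f; rewrite lte_add_pinfty.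
Qed.

Lemma hb_norm_ge0 f : 0 <= hb_norm f. Proof. exact: sqrtr_ge0. Qed.

Lemma hb_norm_lin f g h (a b : R) : 0 <= a -> 0 <= b ->
  (forall z, normc (h z) ^+ 2 <= a * normc (f z) ^+ 2 + b * normc (g z) ^+ 2) ->
  hb_norm h ^+ 2 <= a * hb_norm f ^+ 2 + b * hb_norm g ^+ 2.
Proof.
move=> a0 b0 le_h.
have [H1 H2] := hb_sqnorm_lin (@hb_holomorphic f) (@hb_holomorphic g)
  (@hb_holomorphic h) a0 b0 le_h.
rewrite -lee_fin EFinD (EFinM a) (EFinM b) -!hb_sqnorm_fin.
apply: le_trans (leeD H1 H2) _.
rewrite /hb_sqnorm (ge0_muleDr _ (hardy_sqnorm_ge0 f) (bergman_sqnorm_ge0 f)).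
rewrite (ge0_muleDr _ (hardy_sqnorm_ge0 g) (bergman_sqnorm_ge0 g)).
by rewrite addeACA.
Qed.

Lemma hb_norm_eq0 f : hb_norm f = 0 -> f = 0.
Proof.
move=> f0; apply/val_inj/funext => z /=.
have [Dz|nDz] := pselect (half_plane z); last first.
  by have /set_mem[fz _ _ _] := valP f; exact: fz.
apply: hb_sqnorm_eq0 => //; first exact: hb_holomorphic.
by rewrite hb_sqnorm_fin f0 expr0n.
Qed.

Lemma hb_normD f g : hb_norm (f + g) <= hb_norm f + hb_norm g.
Proof.
have [/eqP/hb_norm_eq0->|f0] := boolP (hb_norm f == 0).
  by rewrite add0r lerDr hb_norm_ge0.
have [/eqP/hb_norm_eq0->|g0] := boolP (hb_norm g == 0).
  by rewrite addr0 lerDl hb_norm_ge0.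
have {}f0 : 0 < hb_norm f by rewrite lt_def f0 hb_norm_ge0.
have {}g0 : 0 < hb_norm g by rewrite lt_def g0 hb_norm_ge0.
pose t := hb_norm g / hb_norm f.
have t0 : 0 < t by rewrite divr_gt0.
rewrite -(@ler_pXn2r _ 2)// ?nnegrE ?hb_norm_ge0 ?addr_ge0 ?hb_norm_ge0//.
have := @hb_norm_lin f g (f + g) (1 + t) (1 + t^-1).
have -> : (1 + t) * hb_norm f ^+ 2 + (1 + t^-1) * hb_norm g ^+ 2
    = (hb_norm f + hb_norm g) ^+ 2.
  by rewrite /t; field; rewrite !gt_eqF.
apply; rewrite ?addr_ge0 ?invr_ge0 ?ltW// => z.
rewrite -[(f + g) z]/(f z + g z).
have n1 := le_normcD (f z) (g z).
have n2 := normc_ge0 (f z + g z).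
apply: (@le_trans _ _ ((normc (f z) + normc (g z)) ^+ 2)).
  by rewrite lerXn2r// nnegrE (le_trans n2).
rewrite -subr_ge0.
have -> : (1 + t) * normc (f z) ^+ 2 + (1 + t^-1) * normc (g z) ^+ 2 -
    (normc (f z) + normc (g z)) ^+ 2 =
    t^-1 * (t * normc (f z) - normc (g z)) ^+ 2 by field; rewrite gt_eqF.
by rewrite mulr_ge0 ?sqr_ge0// invr_ge0 ltW.
Qed.

Lemma hb_normZ_le (a : R[i]) f : hb_norm (a *: f) <= normc a * hb_norm f.
Proof.
rewrite -(@ler_pXn2r _ 2)// ?nnegrE ?hb_norm_ge0 ?mulr_ge0 ?normc_ge0//;
  last exact: hb_norm_ge0.
have := @hb_norm_lin f f (a *: f) (normc a ^+ 2) 0 (sqr_ge0 _) (lexx _).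
rewrite mul0r addr0 exprMn; apply => z.
by rewrite -[(a *: f) z]/(a * f z) normcM exprMn mul0r addr0.
Qed.

Lemma hb_normZ (a : R[i]) f : hb_norm (a *: f) = normc a * hb_norm f.
Proof.
apply/eqP; rewrite eq_le hb_normZ_le /=.
have [->|a0] := eqVneq a 0; first by rewrite normc0 mul0r hb_norm_ge0.
have na : 0 < normc a.
  by rewrite lt_def normc_ge0 andbT; apply: contra a0 => /eqP/eq0_normc ->.
rewrite -ler_pdivlMl// -normcV.
by apply: le_trans (hb_normZ_le _ _); rewrite scalerA mulVf// scale1r.
Qed.

Lemma hb_normC_D f g : (hb_norm (f + g))%:C <= (hb_norm f)%:C + (hb_norm g)%:C.
Proof. by rewrite -rmorphD lecR hb_normD. Qed.

Lemma hb_normC_Z (a : R[i]) f : (hb_norm (a *: f))%:C = `|a| * (hb_norm f)%:C.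
Proof. by rewrite hb_normZ rmorphM; case: a. Qed.

Lemma hb_normC_eq0 f : (hb_norm f)%:C = 0 -> f = 0.
Proof. by move=> /complexI/hb_norm_eq0. Qed.

HB.instance Definition _ := @Lmodule_isNormed.Build R[i] (hardy_bergman R)
  (fun f => (hb_norm f)%:C) hb_normC_D hb_normC_Z hb_normC_eq0.

(* T is the composition operator C_phi; this determines T from phi, and asserts
   that f \o phi is in the space for every f in it. *)
Definition is_composition_operator (phi : R[i] -> R[i])
    (T : hardy_bergman R -> hardy_bergman R) :=
  forall f z, half_plane z -> T f z = f (phi z).

End HardyBergmanNorm.

(* Main.v *)
Require Import Defs.
From HB Require Import structures.
From mathcomp Require Import all_boot all_order all_algebra.
From mathcomp Require Import all_classical all_reals all_analysis.
From mathcomp Require Import complex.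
From mathcomp Require Import measurable_realfun ring lra.

(** The spectrum of a composition operator [T] with an affine symbol is shown to
    lie in the asserted set by estimating the iterates of [T], and conversely
    [T - l] is shown not to be Fredholm for every [l] in that set. As invertible
    operators are Fredholm, the spectrum and the essential spectrum then both
    equal the set ([spectrum_determined]).

    Upper bounds. A change of variables bounds the norm of [f (mu^n s + w_n)] by
    the larger of [mu^-n] and [mu^(-n/2)] ([affine_norm]), and the Neumann series
    ([neumann]) gives the outer radius of the annulus, the inner one coming from
    the inverse dilation. When the symbol has a real shift and [mu > 1], the
    iterates push the half-plane to distance of order [mu^n] from its boundary,
    where line integrals are controlled by the area integral ([line_le_bergman]);
    this improves the bound to a multiple of [mu^-n] ([affine_upper]).

    Lower bounds. In a space of finite codimension, any infinite family has a
    nontrivial combination in the range ([fin_codim_relation]). The families are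
    made of powers [(z + b)^(a + j q)], where [mu^a] is prescribed by [l] and [q] is
    imaginary with [mu^q = 1]; up to a common factor, a combination is then a
    polynomial in [x^q], which winds once around the unit circle between [1] and
    [mu], so that it suffices to show that it vanishes there
    ([imaginary_power_independent]).
    - Dilations ([dilation_not_fin_codim]): the equation telescopes along an orbit,
      which bounds the polynomial by the values of [f] at the two ends. Elements of
      the space are o(1 / Re z) at infinity by the area norm
      ([decay_at_infinity]), and o(x^(-1/2)) along suitable points at zero by the
      Fejer-Riesz inequality ([radial_small]); these two rates are the two radii
      of the annulus.
    - With a real shift, functions in the range of [T] are continuous at the
      boundary point zero and imaginary powers are not
      ([affine_not_fin_codim0]), so [l = 0] is in the essential spectrum.
    - For [mu > 1] the powers about the fixed point in the left half-plane are
      eigenfunctions for [|l| < 1 / mu], infinitely many for each [l]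
      ([expanding_kernel_not_fin_dim]). On the circle [|l| = 1 / mu] the operator
      is injective, and the range is not closed because of the eigenvalues nearby
      ([expanding_not_closed_range]).
    - For [mu < 1] the fixed point [s] of the symbol is in the half-plane and
      attracting. If [|l| > 1], differences of shifted powers have only preimages
      that decay too slowly ([contracting_not_fin_codim_outer]). If [|l| <= 1],
      pairing over a vertical line to the left of [s] with powers of [s - z]
      annihilates the range ([pairing_vanishes],
      [contracting_not_fin_codim_inner]).
    - For [mu = 1] and a real shift, a Fredholm [T - l] is invertible, because it
      commutes with vertical translations, which have no eigenvectors
      ([translation_not_fredholm]).

    The analysis behind this is built from Goursat's theorem: Cauchy's formula for
    rectangles, the mean value bound by area integrals ([area_bound]), and
    completeness of the space ([hb_complete]), on which the open mapping argument
    for operators with closed range ([bounded_below_of_closed_range]) rests. *)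

Set Implicit Arguments.
Unset Strict Implicit.
Unset Printing Implicit Defensive.
Import Order.TTheory GRing.Theory Num.Theory.
Import numFieldNormedType.Exports.
Import ComplexField.Normc.
Local Open Scope classical_set_scope.
Local Open Scope ring_scope.
Local Open Scope complex_scope.

(** * Complex moduli, continuity and differentiability *)

Section ComplexBasics.
Context {R : realType}.
Local Notation C := R[i].
Implicit Types (f g : C -> C) (z w : C).

Lemma normcB z w : normc (z - w) = normc (w - z).
Proof. by rewrite -normcN opprB. Qed.

Lemma normc_real (x : R) : normc x%:C = `|x|.
Proof. by rewrite /normc /= expr0n addr0 sqrtr_sqr. Qed.

Lemma normc_ReIm z : normc z = Num.sqrt (complex.Re z ^+ 2 + complex.Im z ^+ 2).
Proof. by case: z. Qed.

Lemma le_Re_normc z : `|complex.Re z| <= normc z.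
Proof. by rewrite normc_ReIm -sqrtr_sqr ler_wsqrtr// lerDl sqr_ge0. Qed.

Lemma le_Im_normc z : `|complex.Im z| <= normc z.
Proof. by rewrite normc_ReIm -sqrtr_sqr ler_wsqrtr// lerDr sqr_ge0. Qed.

Lemma normc_eq0 z : (normc z == 0) = (z == 0).
Proof. by apply/eqP/eqP => [/eq0_normc|->]; rewrite ?normc0. Qed.

Lemma normc_gt0 z : (0 < normc z) = (z != 0).
Proof. by rewrite lt_def normc_eq0 normc_ge0 andbT. Qed.

Lemma ler_normcB z w : normc z - normc w <= normc (z - w).
Proof. by rewrite lerBlDr; have := le_normcD (z - w) w; rewrite subrK. Qed.

Lemma normcX z n : normc (z ^+ n) = normc z ^+ n.
Proof.
by elim: n => [|n IH]; [rewrite !expr0 normc1 | rewrite !exprS normcM IH].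
Qed.

Lemma normc_conj z : normc (z^*) = normc z.
Proof. by case: z => a b /=; rewrite sqrrN. Qed.

Lemma normc_sum (I : Type) (r : seq I) (P : pred I) (F : I -> C) :
  normc (\sum_(i <- r | P i) F i) <= \sum_(i <- r | P i) normc (F i).
Proof.
elim/big_ind2 : _ => //; first by rewrite normc0.
by move=> x1 x2 y1 y2 h1 h2; apply: le_trans (le_normcD _ _) (lerD h1 h2).
Qed.

(** The norm of [R[i]] takes values in [R[i]] itself; this and the next lemma
    translate continuity to epsilon-delta statements with real numbers. *)
Lemma continuous_normcP f z : {for z, continuous f} <->
  forall e, 0 < e -> exists2 d, 0 < d &
    forall w, normc (w - z) < d -> normc (f w - f z) < e.
Proof.
split=> [/cvgrPdist_lt fz e e0|H].
  have e0' : 0 < e%:C :> C by rewrite ltcR.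
  have /nbhs_normP[d /= d0 dP] := fz _ e0'.
  move: d0; rewrite ltcE /= => /andP[/eqP dI d0].
  exists (complex.Re d) => // w wd.
  have := dP w; rewrite /= /ball_ /=.
  have -> : d = (complex.Re d)%:C by case: d {d0 dP wd} dI => a b /= ->.
  by rewrite normcB -ltcR in wd => /(_ wd); rewrite ltcR normcB.
apply: (@cvgrPdist_lt _ _ _ (nbhs z) _ f (f z)).2 => e.
rewrite ltcE /= => /andP[/eqP eI e0].
have [d d0 dP] := H _ e0.
apply/nbhs_normP; exists d%:C => /=; first by rewrite ltcR.
move=> w; rewrite /ball_ /= distrC ltcR => /dP.
have -> : e = (complex.Re e)%:C by case: e {e0 dP} eI => a b /= ->.
by rewrite distrC ltcR.
Qed.

Lemma continuous_realP (F : R -> C) (x : R) : {for x, continuous F} <->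
  forall e, 0 < e -> exists2 d, 0 < d &
    forall t, `|t - x| < d -> normc (F t - F x) < e.
Proof.
split=> [/cvgrPdist_lt fz e e0|H].
  have e0' : 0 < e%:C :> C by rewrite ltcR.
  have /nbhs_normP[d /= d0 dP] := fz _ e0'.
  exists d => // w wd.
  have := dP w; rewrite /= /ball_ /= distrC => /(_ wd).
  by rewrite distrC ltcR.
apply/cvgrPdist_lt => e; rewrite ltcE /= => /andP[/eqP eI e0].
have [d d0 dP] := H _ e0.
apply/nbhs_normP; exists d => //=.
move=> w; rewrite /ball_ /= distrC => /dP.
have -> : e = (complex.Re e)%:C by case: e {e0 dP} eI => a b /= ->.
by rewrite distrC ltcR.
Qed.

Lemma continuous_lipschitz (F : R -> C) (k : R) (x : R) :
  (forall t, normc (F t - F x) <= k * `|t - x|) -> {for x, continuous F}.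
Proof.
move=> H; apply/continuous_realP => e e0.
have k0 : 0 < `|k| + 1 by rewrite ltr_wpDl.
exists (e / (`|k| + 1)); first by rewrite divr_gt0.
move=> t; rewrite ltr_pdivlMr// => h; apply: le_lt_trans (H t) (le_lt_trans _ h).
by rewrite mulrC ler_wpM2l// (le_trans (ler_norm _))// lerDl.
Qed.

Lemma continuous_Re (F : R -> C) x : {for x, continuous F} ->
  {for x, continuous (fun t => complex.Re (F t))}.
Proof.
move=> /continuous_realP H; apply/cvgrPdist_lt => e e0.
have [d d0 dP] := H _ e0.
apply/nbhs_normP; exists d => //= t; rewrite /ball_ /= distrC => /dP h.
by apply: le_lt_trans h; rewrite distrC -raddfB; exact: le_Re_normc.
Qed.

Lemma continuous_Im (F : R -> C) x : {for x, continuous F} ->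
  {for x, continuous (fun t => complex.Im (F t))}.
Proof.
move=> /continuous_realP H; apply/cvgrPdist_lt => e e0.
have [d d0 dP] := H _ e0.
apply/nbhs_normP; exists d => //= t; rewrite /ball_ /= distrC => /dP h.
by apply: le_lt_trans h; rewrite distrC -raddfB; exact: le_Im_normc.
Qed.

Lemma continuous_normc (F : R -> C) x : {for x, continuous F} ->
  {for x, continuous (fun t => normc (F t))}.
Proof.
move=> /continuous_realP H; apply/cvgrPdist_lt => e e0.
have [d d0 dP] := H _ e0.
apply/nbhs_normP; exists d => //= t; rewrite /ball_ /= distrC => /dP h.
apply: le_lt_trans h; rewrite distrC ler_norml ler_normcB andbT.
by rewrite lerNl opprB normcB ler_normcB.
Qed.

Lemma continuous_hline (y x : R) : {for x, continuous (fun t : R => t +i* y : C)}.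
Proof.
apply: (@continuous_lipschitz _ 1) => t.
have -> : (t +i* y) - (x +i* y) = (t - x)%:C :> C.
  by apply/eqP; rewrite eq_complex /= subrr !eqxx.
by rewrite normc_real mul1r.
Qed.

Lemma continuous_vline (x y : R) : {for y, continuous (fun t : R => x +i* t : C)}.
Proof.
apply: (@continuous_lipschitz _ 1) => t.
have -> : (x +i* t) - (x +i* y) = (0 +i* (t - y)) :> C.
  by apply/eqP; rewrite eq_complex /= subrr !eqxx.
by rewrite normc_ReIm /= expr0n add0r sqrtr_sqr mul1r.
Qed.

Lemma ccont_cst (c z : C) : {for z, continuous (fun _ : C => c)}.
Proof. exact: cst_continuous. Qed.

Lemma ccont_id z : {for z, continuous (fun w : C => w)}.
Proof. exact: cvg_id. Qed.

Lemma ccontD f g z : {for z, continuous f} -> {for z, continuous g} ->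
  {for z, continuous (fun w => f w + g w)}.
Proof. by move=> cf cg; exact: (@continuousD _ _ _ f g z cf cg). Qed.

Lemma ccontB f g z : {for z, continuous f} -> {for z, continuous g} ->
  {for z, continuous (fun w => f w - g w)}.
Proof. by move=> cf cg; exact: (@continuousB _ _ _ f g z cf cg). Qed.

Lemma ccontN f z : {for z, continuous f} -> {for z, continuous (fun w => - f w)}.
Proof. by move=> cf; exact: (@continuousN _ _ _ f z cf). Qed.

Lemma ccontM f g z : {for z, continuous f} -> {for z, continuous g} ->
  {for z, continuous (fun w => f w * g w)}.
Proof. by move=> cf cg; exact: (@continuousM _ _ f g z cf cg). Qed.

Lemma ccontV f z : f z != 0 -> {for z, continuous f} ->
  {for z, continuous (fun w => (f w)^-1)}.
Proof. by move=> fz cf; exact: (@continuousV _ _ f z fz cf). Qed.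

Lemma rcont_comp (F : R -> C) f (t : R) : {for t, continuous F} ->
  {for F t, continuous f} -> {for t, continuous (fun s => f (F s))}.
Proof. by move=> cF cf; exact: (@continuous_comp _ _ _ F f t cF cf). Qed.

Lemma ccont_comp g f z : {for z, continuous g} ->
  {for g z, continuous f} -> {for z, continuous (fun s => f (g s))}.
Proof. by move=> cF cf; exact: (@continuous_comp _ _ _ g f z cF cf). Qed.

(** Caratheodory's form of differentiability: the slope function extends
    continuously, which turns rules of calculus into rules for continuity. *)
Definition has_cderiv f z D := exists phi : C -> C,
  [/\ forall w, f w = f z + phi w * (w - z), {for z, continuous phi} & phi z = D].

Lemma derivable_cderivP f z : derivable f z 1 <-> exists D, has_cderiv f z D.
Proof.
split.
  move=> /cvg_ex[D /= fD]; exists D.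
  exists (fun w => if w == z then D else (f w - f z) / (w - z)); split.
  - move=> w; case: eqVneq => [->|wz]; first by rewrite subrr mulr0 addr0.
    by rewrite divfK ?subr_eq0// addrC subrK.
  - apply/continuous_normcP => e e0; rewrite eqxx.
    have e0' : 0 < e%:C :> C by rewrite ltcR.
    move/cvgrPdist_lt : fD => /(_ _ e0') /nbhs_normP[d /=].
    rewrite ltcE /= => /andP[/eqP dI d0] dP.
    exists (complex.Re d) => // w wd; case: eqVneq => [_|wz].
      by rewrite subrr normc0.
    have := dP (w - z); rewrite /ball_ /= sub0r normrN.
    have -> : d = (complex.Re d)%:C by case: d {d0 dP wd} dI => a b /= ->.
    rewrite ltcR wd subr_eq0 wz => /(_ isT isT).
    by rewrite ltcR normcB /GRing.scale /= mulr1 subrK mulrC.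
  - by rewrite eqxx.
move=> [D [phi [fE cphi phiz]]]; apply/cvg_ex; exists D => /=.
apply/cvgrPdist_lt => e e0.
move/cvgrPdist_lt : cphi => /(_ _ e0) /nbhs_normP[d /= d0 dP].
apply/nbhs_normP; exists d => //= h; rewrite /ball_ /= sub0r normrN => hd h0.
rewrite /GRing.scale /= mulr1 (fE (h + z)) addrAC subrr add0r addrK.
rewrite mulrC mulfK// -phiz; apply: dP; rewrite /ball_ /= opprD addrCA subrr.
by rewrite addr0 normrN.
Qed.

Lemma cderiv_continuous f z D : has_cderiv f z D -> {for z, continuous f}.
Proof.
move=> [phi [fE cphi _]].
have -> : f = (fun w => f z + phi w * (w - z)) by apply/funext.
apply: ccontD; first exact: ccont_cst.
by apply: ccontM => [|]; [exact: cphi|apply: ccontB; [exact: ccont_id|exact: ccont_cst]].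
Qed.

Lemma derivable_continuous f z : derivable f z 1 -> {for z, continuous f}.
Proof. by move=> /derivable_cderivP[D] /cderiv_continuous. Qed.

Lemma cderiv_error f z D : has_cderiv f z D -> forall e, 0 < e ->
  exists2 d, 0 < d & forall w, normc (w - z) < d ->
    normc (f w - f z - D * (w - z)) <= e * normc (w - z).
Proof.
move=> [phi [fE /continuous_normcP cphi phiz]] e e0.
have [d d0 dP] := cphi _ e0; exists d => // w /dP wd.
rewrite (fE w) (addrAC (f z)) subrr add0r -mulrBl normcM ler_wpM2r ?normc_ge0//.
by rewrite -phiz ltW.
Qed.

Lemma cderiv_const (c : C) z : has_cderiv (fun=> c) z 0.
Proof.
exists (fun=> 0); split; [|exact: ccont_cst|by []].
by move=> w; rewrite mul0r addr0.
Qed.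

Lemma cderiv_id z : has_cderiv id z 1.
Proof.
exists (fun=> 1); split; [|exact: ccont_cst|by []].
by move=> w; rewrite mul1r addrC subrK.
Qed.

Lemma cderivD f g z D E : has_cderiv f z D -> has_cderiv g z E ->
  has_cderiv (fun w => f w + g w) z (D + E).
Proof.
move=> [p [fE cp pz]] [q [gE cq qz]]; exists (fun w => p w + q w); split.
- by move=> w; rewrite (fE w) (gE w); ring.
- exact: ccontD.
- by rewrite pz qz.
Qed.

Lemma cderivM f g z D E : has_cderiv f z D -> has_cderiv g z E ->
  has_cderiv (fun w => f w * g w) z (D * g z + f z * E).
Proof.
move=> hf hg; have cg := cderiv_continuous hg.
case: hf hg => [p [fE cp pz]] [q [gE cq qz]].
exists (fun w => p w * g w + f z * q w); split.
- by move=> w; rewrite (fE w) (gE w); ring.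
- apply: ccontD; first exact: ccontM.
  by apply: ccontM; [exact: ccont_cst|exact: cq].
- by rewrite pz qz.
Qed.

Lemma cderivZ (c : C) f z D : has_cderiv f z D ->
  has_cderiv (fun w => c * f w) z (c * D).
Proof.
by move=> hf; have := cderivM (cderiv_const c z) hf; rewrite mul0r add0r.
Qed.

Lemma cderivB f g z D E : has_cderiv f z D -> has_cderiv g z E ->
  has_cderiv (fun w => f w - g w) z (D - E).
Proof.
move=> hf hg; have := cderivD hf (cderivZ (-1) hg); rewrite mulN1r.
by under eq_fun do rewrite mulN1r.
Qed.

Lemma cderivV f z D : f z != 0 -> has_cderiv f z D ->
  has_cderiv (fun w => (f w)^-1) z (- D / f z ^+ 2).
Proof.
move=> fz hf; have cf := cderiv_continuous hf; case: hf => [p [fE cp pz]].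
have [near0 nP] : exists2 d, 0 < d & forall w, normc (w - z) < d -> f w != 0.
  have := (continuous_normcP f z).1 cf (normc (f z)).
  rewrite normc_gt0 fz => /(_ isT)[d d0 dP]; exists d => // w /dP.
  by apply: contraTneq => ->; rewrite sub0r normcN ltxx.
move=> H.
exists (fun w => if f w == 0 then ((f w)^-1 - (f z)^-1) / (w - z)
   else - p w * (f w)^-1 * (f z)^-1); split.
- move=> w; case: eqVneq => fw.
    have wz : w != z by apply: contra_eq_neq fw => ->.
    by rewrite divfK ?subr_eq0// addrC subrK.
  have {}fE := fE w; rewrite -mulrA [in LHS](_ : (f w)^-1 = (f z)^-1 +
    (f z - f w) * ((f w)^-1 * (f z)^-1)); last by field; rewrite fw fz.
  by rewrite [in X in _ + X * _]fE; ring.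
- apply/continuous_normcP => e e0.
  have c' : {for z, continuous (fun w => - p w * (f w)^-1 * (f z)^-1)}.
    apply: ccontM; last exact: ccont_cst.
    by apply: ccontM; [exact: ccontN|exact: ccontV].
  have [d d0 dP] := (continuous_normcP _ z).1 c' _ e0.
  exists (Num.min d near0); first by rewrite lt_min d0 nP.
  move=> w; rewrite lt_min => /andP[/dP wd /H fw].
  by rewrite (negbTE fw) (negbTE fz).
- by rewrite (negbTE fz) pz; field.
Qed.

Lemma cderiv_comp f g z D E : has_cderiv f z D -> has_cderiv g (f z) E ->
  has_cderiv (fun w => g (f w)) z (E * D).
Proof.
move=> hf [q [gE cq qz]]; have cf := cderiv_continuous hf.
case: hf => [p [fE cp pz]]; exists (fun w => q (f w) * p w); split.
- by move=> w; rewrite (gE (f w)) [in X in _ + _ * X](fE w); ring.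
- by apply: ccontM; [exact: ccont_comp|exact: cp].
- by rewrite qz pz.
Qed.

Lemma cderiv_near f g z D : (exists2 d, 0 < d &
    forall w, normc (w - z) < d -> f w = g w) ->
  has_cderiv f z D -> has_cderiv g z D.
Proof.
move=> [d d0 dP] [p [fE cp pz]].
have fgz : f z = g z by apply: dP; rewrite subrr normc0.
exists (fun w => if normc (w - z) < d then p w else (g w - g z) / (w - z)).
split.
- move=> w; case: ifPn => wd; first by rewrite -dP// -fgz (fE w).
  have wz : w - z != 0 by apply: contraNneq wd => ->; rewrite normc0.
  by rewrite divfK// addrC subrK.
- apply/continuous_normcP => e e0; rewrite subrr normc0 d0.
  have [d' d'0 d'P] := (continuous_normcP _ z).1 cp _ e0.
  exists (Num.min d d'); first by rewrite lt_min d0.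
  by move=> w; rewrite lt_min => /andP[wd wd']; rewrite wd; exact: d'P.
- by rewrite subrr normc0 d0.
Qed.

Lemma derivable_near f g z : (exists2 d, 0 < d &
    forall w, normc (w - z) < d -> f w = g w) ->
  derivable f z 1 -> derivable g z 1.
Proof.
by move=> H /derivable_cderivP[D hD]; apply/derivable_cderivP; exists D;
  exact: cderiv_near H hD.
Qed.

(** Used for [z |-> conj (f (conj z))], whose product with [f] is a square modulus
    on the real axis. *)
Lemma cderiv_conj f z D : has_cderiv f (z^*) D ->
  has_cderiv (fun w => (f (w^*))^*) z (D^*).
Proof.
move=> [p [fE cp pz]]; exists (fun w => (p (w^*))^*); split.
- by move=> w; rewrite (fE (w^*)) rmorphD rmorphM rmorphB /= !conjcK.
- apply/continuous_normcP => e e0.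
  have [d d0 dP] := (continuous_normcP _ _).1 cp _ e0; exists d => // w wd.
  by rewrite -rmorphB normc_conj; apply: dP; rewrite -rmorphB normc_conj.
- by rewrite pz.
Qed.

(** Turns complex derivatives into the real derivatives of the two components
    that the fundamental theorem of calculus needs. *)
Lemma cderiv_path (gam : R -> C) (v : C) g (t : R) D :
  (forall s, gam s = gam t + (s - t)%:C * v) -> has_cderiv g (gam t) D ->
  is_derive t 1 (fun s => complex.Re (g (gam s))) (complex.Re (D * v)) /\
  is_derive t 1 (fun s => complex.Im (g (gam s))) (complex.Im (D * v)).
Proof.
move=> gamE [p [gE cp pz]].
have cgam : {for t, continuous gam}.
  apply: (@continuous_lipschitz _ (normc v)) => s.
  by rewrite gamE addrAC subrr add0r normcM normc_real mulrC.
have cpg : {for t, continuous (fun s => p (gam s) * v)}.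
  apply: (@rcont_comp gam (fun w => p w * v)); first exact: cgam.
  by apply: ccontM; [exact: cp|exact: ccont_cst].
have slope h : g (gam (h + t)) - g (gam t) = h%:C * (p (gam (h + t)) * v).
  have e : gam (h + t) - gam t = h%:C * v.
    by rewrite gamE addrK addrAC subrr add0r.
  by rewrite [in LHS](gE (gam (h + t))) e; ring.
have cH (P : C -> R) : (forall h : R, forall z, P (h%:C * z) = h * P z) ->
   (forall x y, P (x - y) = P x - P y) ->
   {for t, continuous (fun s => P (p (gam s) * v))} ->
   h^-1 *: (P (g (gam (h *: 1 + t))) - P (g (gam t))) @[h --> 0^'] --> P (D * v).
  move=> PZ PB cP; apply/cvgrPdist_lt => e e0.
  move/cvgrPdist_lt : cP => /(_ _ e0) /nbhs_normP[d /= d0 dP].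
  apply/nbhs_normP; exists d => //= h; rewrite /ball_ /= sub0r normrN => hd h0.
  rewrite /GRing.scale /= mulr1 -PB slope PZ mulKf// -pz.
  by apply: dP; rewrite /ball_ /= opprD addrCA subrr addr0 normrN.
have HR := cH (@complex.Re R) (fun h z => ltac:(by case: z => a b /=; rewrite mul0r subr0))
  (fun x y => ltac:(by rewrite raddfB)) (continuous_Re cpg).
have HI := cH (@complex.Im R) (fun h z => ltac:(by case: z => a b /=; rewrite mul0r addr0))
  (fun x y => ltac:(by rewrite raddfB)) (continuous_Im cpg).
split; apply: DeriveDef.
- by apply/cvg_ex; exists (complex.Re (D * v)); exact: HR.
- by apply: cvg_lim; [|exact: HR].
- by apply/cvg_ex; exists (complex.Im (D * v)); exact: HI.
- by apply: cvg_lim; [|exact: HI].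
Qed.

End ComplexBasics.

(** * Integrals along the boundary of rectangles *)

Section ContourIntegral.
Context {R : realType}.
Local Notation C := R[i].
Local Notation leb := (@lebesgue_measure R).
Implicit Types (f g : C -> C) (F G : R -> C) (a b c d : R).

Definition continuous_on a b F := forall x, a <= x <= b -> {for x, continuous F}.

Lemma integrable_continuous a b (f : R -> R) :
  (forall x, a <= x <= b -> {for x, continuous f}) ->
  leb.-integrable `[a, b] (EFin \o f).
Proof.
move=> H; apply: continuous_compact_integrable; first exact: segment_compact.
apply: continuous_in_subspaceT => x /set_mem /=; rewrite in_itv /=.
exact: H.
Qed.

Lemma integrable_Re a b F : continuous_on a b F ->
  leb.-integrable `[a, b] (EFin \o (fun x => complex.Re (F x))).
Proof. by move=> H; apply: integrable_continuous => x /H; exact: continuous_Re. Qed.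

Lemma integrable_Im a b F : continuous_on a b F ->
  leb.-integrable `[a, b] (EFin \o (fun x => complex.Im (F x))).
Proof. by move=> H; apply: integrable_continuous => x /H; exact: continuous_Im. Qed.

Definition cint a b F : C :=
  (\int[leb]_(x in `[a, b]) complex.Re (F x)) +i*
  (\int[leb]_(x in `[a, b]) complex.Im (F x)).

Lemma eq_cint a b F G : (forall x, a <= x <= b -> F x = G x) -> cint a b F = cint a b G.
Proof.
move=> H; rewrite /cint; congr (_ +i* _); apply: eq_Rintegral => x /set_mem /=;
  by rewrite in_itv /= => /H ->.
Qed.

Lemma cintD a b F G : continuous_on a b F -> continuous_on a b G ->
  cint a b (fun x => F x + G x) = cint a b F + cint a b G.
Proof.
move=> cF cG; rewrite /cint /GRing.add /=; congr (_ +i* _).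
  rewrite -RintegralD//; [|exact: integrable_Re..].
  by apply: eq_Rintegral => x _; rewrite raddfD.
rewrite -RintegralD//; [|exact: integrable_Im..].
by apply: eq_Rintegral => x _; rewrite raddfD.
Qed.

Lemma integrableZr a b (k : R) (f : R -> R) :
  leb.-integrable `[a, b] (EFin \o f) ->
  leb.-integrable `[a, b] (EFin \o (fun x => k * f x)).
Proof.
move=> H; apply: (@eq_integrable _ _ _ leb _ _ (fun x => k%:E * (EFin \o f) x)%E) => //.
exact: integrableZl.
Qed.

Lemma cintZ a b (k : C) F : continuous_on a b F ->
  cint a b (fun x => k * F x) = k * cint a b F.
Proof.
move=> cF; rewrite /cint; case: k => u v.
have iR := integrable_Re cF; have iI := integrable_Im cF.
rewrite [RHS]/GRing.mul /=; congr (_ +i* _).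
  rewrite -!RintegralZl// -RintegralB//; [|exact: integrableZr..].
  by apply: eq_Rintegral => x _; case: (F x).
rewrite -!RintegralZl// -RintegralD//; [|exact: integrableZr..].
by apply: eq_Rintegral => x _; case: (F x).
Qed.

Lemma cint_split a m b F : a <= m <= b -> continuous_on a b F ->
  cint a b F = cint a m F + cint m b F.
Proof.
move=> /andP[am mb] cF; rewrite /cint /GRing.add /=.
have split (f : R -> R) : leb.-integrable `[a, b] (EFin \o f) ->
    \int[leb]_(x in `[a, b]) f x =
    \int[leb]_(x in `[a, m]) f x + \int[leb]_(x in `[m, b]) f x.
  move=> fi; apply/eqP; rewrite addrC -subr_eq; apply/eqP.
  rewrite Rintegral_itvB ?bnd_simp//.
  rewrite Rintegral_itv_obnd_cbnd//; apply: integrableS fi => //.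
  by apply: subset_itvr; rewrite bnd_simp.
by congr (_ +i* _); apply: split; [exact: integrable_Re|exact: integrable_Im].
Qed.

Lemma Rintegral_segment_cst a b (M : R) : a <= b ->
  \int[leb]_(x in `[a, b]) M = M * (b - a).
Proof.
move=> ab; rewrite Rintegral_cst//= lebesgue_measure_itv /= lte_fin.
by case: ltgtP ab => // -> _; rewrite subrr.
Qed.

Lemma normc_cint_le a b F (G : R -> R) : continuous_on a b F ->
  leb.-integrable `[a, b] (EFin \o G) ->
  (forall x, a <= x <= b -> normc (F x) <= G x) ->
  normc (cint a b F) <= 2 * \int[leb]_(x in `[a, b]) G x.
Proof.
move=> cF iG FG; apply: le_trans (normc_le_ReIm _) _; rewrite mulr2n mulrDl !mul1r.
rewrite /cint /=; apply: lerD.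
  apply: le_trans (le_normr_Rintegral _ (integrable_Re cF)) _ => //.
  apply: le_Rintegral => //; first exact: (integrable_abse (integrable_Re cF)).
  move=> x /=; rewrite in_itv /= => xab; exact: le_trans (le_Re_normc _) (FG _ xab).
apply: le_trans (le_normr_Rintegral _ (integrable_Im cF)) _ => //.
apply: le_Rintegral => //; first exact: (integrable_abse (integrable_Im cF)).
move=> x /=; rewrite in_itv /= => xab; exact: le_trans (le_Im_normc _) (FG _ xab).
Qed.

Lemma normc_cint_bound a b F (M : R) : a <= b -> continuous_on a b F ->
  (forall x, a <= x <= b -> normc (F x) <= M) ->
  normc (cint a b F) <= 2 * M * (b - a).
Proof.
move=> ab cF FM; rewrite -mulrA -Rintegral_segment_cst//.
apply: normc_cint_le => //; apply: integrable_continuous => x _; exact: cst_continuous.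
Qed.

Lemma Rintegral_FTC a b (f g : R -> R) : a <= b ->
  (forall x, a <= x <= b -> {for x, continuous f}) ->
  (forall t, a <= t <= b -> is_derive t 1 g (f t)) ->
  \int[leb]_(x in `[a, b]) f x = g b - g a.
Proof.
move=> ab cf dg; have [<-|/eqP/negPf ab'] := pselect (a = b).
  by rewrite set_itv1 Rintegral_set1 subrr.
have {}ab : a < b by rewrite lt_neqAle ab' ab.
have cg t : a <= t <= b -> {for t, continuous g}.
  by move=> /dg h; exact/differentiable_continuous/derivable1_diffP/ex_derive.
rewrite /Rintegral (@continuous_FTC2 _ f g)//.
- apply: continuous_in_subspaceT => x /set_mem /=; rewrite in_itv /=; exact: cf.
- split.
  + move=> x; rewrite in_itv /= => /andP[/ltW ax /ltW xb].
    have h := dg x; rewrite ax xb in h; exact: (@ex_derive _ _ _ _ _ _ _ (h isT)).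
  + by apply: cvg_at_right_filter; apply: cg; rewrite lexx ltW.
  + by apply: cvg_at_left_filter; apply: cg; rewrite lexx ltW.
- move=> x; rewrite in_itv /= => /andP[/ltW ax /ltW xb].
  have h := dg x; rewrite ax xb in h; rewrite derive1E.
  exact: (@derive_val _ _ _ _ _ _ _ (h isT)).
Qed.

Lemma cint_FTC a b F G : a <= b -> continuous_on a b F ->
  (forall t, a <= t <= b ->
    is_derive t 1 (fun s => complex.Re (G s)) (complex.Re (F t)) /\
    is_derive t 1 (fun s => complex.Im (G s)) (complex.Im (F t))) ->
  cint a b F = G b - G a.
Proof.
move=> ab cF dG; apply/eqP; rewrite eq_complex /= raddfB /= raddfB /=.
apply/andP; split; apply/eqP.
  apply: (Rintegral_FTC (f := fun s => complex.Re (F s)) (g := fun s => complex.Re (G s)) ab) => x xab;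
    last by case: (dG x xab).
  exact: continuous_Re (cF _ xab).
apply: (Rintegral_FTC (f := fun s => complex.Im (F s)) (g := fun s => complex.Im (G s)) ab) => x xab;
  last by case: (dG x xab).
exact: continuous_Im (cF _ xab).
Qed.

(** The boundary of [a, b] x [c, d] is run through anticlockwise. *)
Definition rectint f a b c d : C :=
  cint a b (fun x => f (x +i* c)) - cint a b (fun x => f (x +i* d)) +
  (0 +i* 1) * (cint c d (fun y => f (b +i* y)) - cint c d (fun y => f (a +i* y))).

Definition boundary_continuous f a b c d :=
  [/\ continuous_on a b (fun x => f (x +i* c)), continuous_on a b (fun x => f (x +i* d)),
      continuous_on c d (fun y => f (a +i* y)) & continuous_on c d (fun y => f (b +i* y))].

Lemma hline_continuous f x y : {for x +i* y, continuous f} ->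
  {for x, continuous (fun t => f (t +i* y))}.
Proof. by move=> cf; apply: rcont_comp cf; exact: continuous_hline. Qed.

Lemma vline_continuous f x y : {for x +i* y, continuous f} ->
  {for y, continuous (fun t => f (x +i* t))}.
Proof. by move=> cf; apply: rcont_comp cf; exact: continuous_vline. Qed.

Lemma continuous_boundary f a b c d : a <= b -> c <= d ->
  (forall x y, a <= x <= b -> c <= y <= d -> {for x +i* y, continuous f}) ->
  boundary_continuous f a b c d.
Proof.
move=> ab cd H; split => t tab; [apply: hline_continuous|apply: hline_continuous|
  apply: vline_continuous|apply: vline_continuous];
  by apply: H; rewrite ?lexx ?ab ?cd.
Qed.

Lemma eq_rectint f g a b c d : a <= b -> c <= d ->
  (forall x y, a <= x <= b -> c <= y <= d ->
     (x == a) || (x == b) || (y == c) || (y == d) -> f (x +i* y) = g (x +i* y)) ->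
  rectint f a b c d = rectint g a b c d.
Proof.
move=> ab cd H; rewrite /rectint; congr (_ - _ + _ * (_ - _)); apply: eq_cint => t tab;
  by apply: H; rewrite ?lexx ?eqxx ?orbT ?ab ?cd.
Qed.

Lemma rectintD f g a b c d :
  boundary_continuous f a b c d -> boundary_continuous g a b c d ->
  rectint (fun z => f z + g z) a b c d = rectint f a b c d + rectint g a b c d.
Proof.
move=> [f1 f2 f3 f4] [g1 g2 g3 g4]; rewrite /rectint.
rewrite (cintD f1 g1) (cintD f2 g2) (cintD f3 g3) (cintD f4 g4); ring.
Qed.

Lemma rectintZ (k : C) f a b c d : boundary_continuous f a b c d ->
  rectint (fun z => k * f z) a b c d = k * rectint f a b c d.
Proof.
move=> [f1 f2 f3 f4]; rewrite /rectint !cintZ//; ring.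
Qed.

Lemma rectint_hsplit f a m b c d : a <= m <= b ->
  continuous_on a b (fun x => f (x +i* c)) -> continuous_on a b (fun x => f (x +i* d)) ->
  rectint f a b c d = rectint f a m c d + rectint f m b c d.
Proof.
move=> amb h1 h2; rewrite /rectint (cint_split amb h1) (cint_split amb h2); ring.
Qed.

Lemma rectint_vsplit f a b c m d : c <= m <= d ->
  continuous_on c d (fun y => f (a +i* y)) -> continuous_on c d (fun y => f (b +i* y)) ->
  rectint f a b c d = rectint f a b c m + rectint f a b m d.
Proof.
move=> amb h1 h2; rewrite /rectint (cint_split amb h1) (cint_split amb h2); ring.
Qed.

Lemma normc_i : normc (0 +i* 1 : C) = 1.
Proof. by rewrite normc_ReIm /= expr0n add0r expr1n sqrtr1. Qed.

Lemma normc_rectint_bound f a b c d (M : R) : a <= b -> c <= d ->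
  boundary_continuous f a b c d ->
  (forall x y, a <= x <= b -> c <= y <= d ->
     (x == a) || (x == b) || (y == c) || (y == d) -> normc (f (x +i* y)) <= M) ->
  normc (rectint f a b c d) <= 4 * M * ((b - a) + (d - c)).
Proof.
move=> ab cd [f1 f2 f3 f4] H; rewrite /rectint.
apply: le_trans (le_normcD _ _) _.
rewrite normcM normc_i mul1r.
have bnd1 : normc (cint a b (fun x => f (x +i* c))) <= 2 * M * (b - a).
  by apply: normc_cint_bound => // x xab; apply: H; rewrite ?xab ?lexx ?eqxx ?orbT ?ab ?cd.
have bnd2 : normc (cint a b (fun x => f (x +i* d))) <= 2 * M * (b - a).
  by apply: normc_cint_bound => // x xab; apply: H; rewrite ?xab ?lexx ?eqxx ?orbT ?ab ?cd.
have bnd3 : normc (cint c d (fun y => f (a +i* y))) <= 2 * M * (d - c).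
  by apply: normc_cint_bound => // x xab; apply: H; rewrite ?xab ?lexx ?eqxx ?orbT ?ab ?cd.
have bnd4 : normc (cint c d (fun y => f (b +i* y))) <= 2 * M * (d - c).
  by apply: normc_cint_bound => // x xab; apply: H; rewrite ?xab ?lexx ?eqxx ?orbT ?ab ?cd.
have := le_normcD (cint a b (fun x => f (x +i* c))) (- cint a b (fun x => f (x +i* d))).
have := le_normcD (cint c d (fun y => f (b +i* y))) (- cint c d (fun y => f (a +i* y))).
rewrite !normcN; lra.
Qed.

(** Used for the affine part of a function in Goursat's argument. *)
Lemma rectint_primitive f g a b c d : a <= b -> c <= d ->
  (forall x y, a <= x <= b -> c <= y <= d -> has_cderiv g (x +i* y) (f (x +i* y))) ->
  (forall x y, a <= x <= b -> c <= y <= d -> {for x +i* y, continuous f}) ->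
  rectint f a b c d = 0.
Proof.
move=> ab cd dg cf.
have [f1 f2 f3 f4] := continuous_boundary ab cd cf.
have hor y : c <= y <= d -> continuous_on a b (fun x => f (x +i* y)) ->
    cint a b (fun x => f (x +i* y)) = g (b +i* y) - g (a +i* y).
  move=> ycd fc; apply: (@cint_FTC _ _ _ (fun x => g (x +i* y))); [exact: ab|exact: fc|move=> t tab].
  have := @cderiv_path _ (fun x => x +i* y) 1 g t _ _ (dg _ _ tab ycd).
  rewrite mulr1; apply => s; apply/eqP; rewrite eq_complex /=.
  by apply/andP; split; apply/eqP; ring.
have ver x : a <= x <= b -> continuous_on c d (fun y => f (x +i* y)) ->
    (0 +i* 1) * cint c d (fun y => f (x +i* y)) = g (x +i* d) - g (x +i* c).
  move=> xab fc; rewrite -(cintZ _ fc).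
  apply: (@cint_FTC _ _ _ (fun y => g (x +i* y))); first exact: cd.
    move=> t tcd; apply: (@rcont_comp _ (fun t => x +i* t) (fun z => (0 +i* 1) * f z)).
      exact: continuous_vline.
    apply: ccontM; first exact: ccont_cst.
    exact: cf.
  move=> t tcd.
  have := @cderiv_path _ (fun y => x +i* y) (0 +i* 1) g t _ _ (dg _ _ xab tcd).
  rewrite mulrC; apply => s; apply/eqP; rewrite eq_complex /=.
  by apply/andP; split; apply/eqP; ring.
have cc : c <= c <= d by rewrite lexx cd.
have dd : c <= d <= d by rewrite lexx cd.
have aa : a <= a <= b by rewrite lexx ab.
have bb : a <= b <= b by rewrite lexx ab.
rewrite /rectint mulrBr (hor _ cc f1) (hor _ dd f2) (ver _ aa f3) (ver _ bb f4).
ring.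
Qed.

End ContourIntegral.

Arguments cint : simpl never.
Arguments rectint : simpl never.
Arguments normc : simpl never.

(** * Goursat's theorem *)

Section Goursat.
Context {R : realType}.
Local Notation C := R[i].
Implicit Types (f g : C -> C) (a b c d : R).

Lemma nested_intervals (u : nat -> R * R) :
  (forall n, (u n).1 <= (u n).2) ->
  (forall n, (u n).1 <= (u n.+1).1) -> (forall n, (u n.+1).2 <= (u n).2) ->
  exists p, forall n, (u n).1 <= p <= (u n).2.
Proof.
move=> ule ul ur.
have mono1 m n : (m <= n)%N -> (u m).1 <= (u n).1.
  by move=> /subnK <-; elim: (n - m)%N => // k IH; rewrite addSn (le_trans IH).
have mono2 m n : (m <= n)%N -> (u n).2 <= (u m).2.
  by move=> /subnK <-; elim: (n - m)%N => // k IH; rewrite addSn (le_trans (ur _)).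
have cross m n : (u m).1 <= (u n).2.
  have [mn|/ltnW nm] := leqP m n.
    exact: le_trans (mono1 _ _ mn) (ule n).
  exact: le_trans (ule m) (mono2 _ _ nm).
pose A := range (fun n => (u n).1).
have A0 : A !=set0 by exists (u 0).1; exists 0%N.
have Aub n : ubound A (u n).2 by move=> _ [m _ <-].
exists (sup A) => n; apply/andP; split.
  by apply: ub_le_sup; [exists (u 0).2|exists n].
exact: ge_sup.
Qed.

Lemma pow2_archimedean (S d : R) : 0 <= S -> 0 < d -> exists n, S / 2 ^+ n < d.
Proof.
move=> S0 d0; exists (Num.bound (S / d)).
have p0 : 0 < 2 ^+ (Num.bound (S / d)) :> R by rewrite exprn_gt0.
rewrite ltr_pdivrMr// mulrC -ltr_pdivrMr//.
apply: lt_le_trans (archi_boundP _) _; first by rewrite divr_ge0// ltW.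
by rewrite -natrX ler_nat ltnW// ltn_expl.
Qed.

(** Goursat's bisection: a rectangle integral that survives on quarter after
    quarter shrinks no faster than the area, while differentiability at the
    limit point makes it smaller than any multiple of the area. *)
Theorem goursat f a b c d : a <= b -> c <= d ->
  (forall x y, a <= x <= b -> c <= y <= d -> derivable f (x +i* y) 1) ->
  rectint f a b c d = 0.
Proof.
move=> ab cd df; apply/eqP; rewrite -normc_eq0; apply/eqP.
have cf x y : a <= x <= b -> c <= y <= d -> {for x +i* y, continuous f}.
  by move=> hx hy; apply: derivable_continuous; exact: df.
pose inQ (Q : (R * R) * (R * R)) := [/\ a <= Q.1.1, Q.1.1 <= Q.1.2, Q.1.2 <= b &
  [/\ c <= Q.2.1, Q.2.1 <= Q.2.2 & Q.2.2 <= d]].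
pose V (Q : (R * R) * (R * R)) := normc (rectint f Q.1.1 Q.1.2 Q.2.1 Q.2.2).
pose child (u v : R * R) := [/\ u.1 <= v.1, v.2 <= u.2 & v.2 - v.1 = (u.2 - u.1) / 2].
have step Q : exists Q', inQ Q -> [/\ inQ Q', child Q.1 Q'.1, child Q.2 Q'.2 &
    V Q <= 4 * V Q'].
  have [iQ|] := pselect (inQ Q); last by exists Q.
  case: Q iQ => [[x1 x2] [y1 y2]] iQ; case: (iQ) => /= ax x12 xb [cy y12 yd].
  pose mx := (x1 + x2) / 2; pose my := (y1 + y2) / 2.
  have hx : x1 <= mx <= x2 by rewrite /mx; apply/andP; split; lra.
  have hy : y1 <= my <= y2 by rewrite /my; apply/andP; split; lra.
  have [hx1 hx2] := andP hx; have [hy1 hy2] := andP hy.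
  have hl y : y1 <= y <= y2 -> continuous_on x1 x2 (fun x => f (x +i* y)).
    move=> /andP[h1 h2] x /andP[h3 h4]; apply: hline_continuous; apply: cf.
      by rewrite (le_trans ax h3) (le_trans h4 xb).
    by rewrite (le_trans cy h1) (le_trans h2 yd).
  have vl x : x1 <= x <= x2 -> continuous_on y1 y2 (fun y => f (x +i* y)).
    move=> /andP[h3 h4] y /andP[h1 h2]; apply: vline_continuous; apply: cf.
      by rewrite (le_trans ax h3) (le_trans h4 xb).
    by rewrite (le_trans cy h1) (le_trans h2 yd).
  have e : rectint f x1 x2 y1 y2 =
      (rectint f x1 mx y1 my + rectint f x1 mx my y2) +
      (rectint f mx x2 y1 my + rectint f mx x2 my y2).
    have xx1 : x1 <= x1 <= x2 by rewrite lexx.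
    have xx2 : x1 <= x2 <= x2 by rewrite lexx x12.
    have yy1 : y1 <= y1 <= y2 by rewrite lexx.
    have yy2 : y1 <= y2 <= y2 by rewrite lexx y12.
    rewrite (rectint_hsplit hx (hl _ yy1) (hl _ yy2)).
    by rewrite (rectint_vsplit hy (vl _ xx1) (vl _ hx)) (rectint_vsplit hy (vl _ hx) (vl _ xx2)).
  have sub (Q' : (R * R) * (R * R)) : x1 <= Q'.1.1 -> Q'.1.2 <= x2 -> Q'.1.1 <= Q'.1.2 ->
      y1 <= Q'.2.1 -> Q'.2.2 <= y2 -> Q'.2.1 <= Q'.2.2 -> inQ Q'.
    move=> h1 h2 h3 h4 h5 h6; split => //; rewrite ?(le_trans ax h1) ?(le_trans h2 xb)//.
    by split=> //; rewrite ?(le_trans cy h4) ?(le_trans h5 yd).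
  have ex1 : mx - x1 = (x2 - x1) / 2 by rewrite /mx; lra.
  have ex2 : x2 - mx = (x2 - x1) / 2 by rewrite /mx; lra.
  have ey1 : my - y1 = (y2 - y1) / 2 by rewrite /my; lra.
  have ey2 : y2 - my = (y2 - y1) / 2 by rewrite /my; lra.
  have [h|h1] := leP (V ((x1, x2), (y1, y2))) (4 * V ((x1, mx), (y1, my))).
    by exists ((x1, mx), (y1, my)) => _; split; [exact: sub|by split|by split|exact: h].
  have [h|h2] := leP (V ((x1, x2), (y1, y2))) (4 * V ((x1, mx), (my, y2))).
    by exists ((x1, mx), (my, y2)) => _; split; [exact: sub|by split|by split|exact: h].
  have [h|h3] := leP (V ((x1, x2), (y1, y2))) (4 * V ((mx, x2), (y1, my))).
    by exists ((mx, x2), (y1, my)) => _; split; [exact: sub|by split|by split|exact: h].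
  exists ((mx, x2), (my, y2)) => _; split; [exact: sub|by split|by split|].
  move: h1 h2 h3; rewrite /V /=. rewrite e.
  have := le_normcD (rectint f x1 mx y1 my + rectint f x1 mx my y2)
      (rectint f mx x2 y1 my + rectint f mx x2 my y2).
  have := le_normcD (rectint f x1 mx y1 my) (rectint f x1 mx my y2).
  have := le_normcD (rectint f mx x2 y1 my) (rectint f mx x2 my y2).
  lra.
have [next nextP] := choice step.
pose Q0 : (R * R) * (R * R) := ((a, b), (c, d)).
pose q n := iter n next Q0.
have q_in n : inQ (q n).
  by elim: n => [|n IH]; [split => //=; split | have [] := nextP _ IH].
have qn n : [/\ inQ (q n.+1), child (q n).1 (q n.+1).1, child (q n).2 (q n.+1).2 &
  V (q n) <= 4 * V (q n.+1)] by exact: nextP (q_in n).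
have [px pxP] : exists p, forall n, (q n).1.1 <= p <= (q n).1.2.
  apply: (@nested_intervals (fun n => (q n).1)) => n; first by have [] := q_in n.
    by have [_ []] := qn n.
  by have [_ []] := qn n.
have [py pyP] : exists p, forall n, (q n).2.1 <= p <= (q n).2.2.
  apply: (@nested_intervals (fun n => (q n).2)) => n; first by have [_ _ _ []] := q_in n.
    by have [_ _ []] := qn n.
  by have [_ _ []] := qn n.
pose S := (b - a) + (d - c).
have S0 : 0 <= S by rewrite addr_ge0 ?subr_ge0.
have len n : ((q n).1.2 - (q n).1.1) + ((q n).2.2 - (q n).2.1) = S / 2 ^+ n.
  elim: n => [|n IH]; first by rewrite expr0 divr1.
  have [_ [_ _ e1] [_ _ e2] _] := qn n.
  by rewrite exprSr invfM mulrA -IH e1 e2 -mulrDl.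
have Vn n : V Q0 <= 4 ^+ n * V (q n).
  elim: n => [|n IH]; first by rewrite expr0 mul1r.
  have [_ _ _ h] := qn n; apply: le_trans IH _.
  by rewrite exprSr -mulrA ler_wpM2l// exprn_ge0.
have := df px py (pxP 0%N) (pyP 0%N) => /derivable_cderivP[D fD].
have small e : 0 < e -> V Q0 <= 4 * e * S ^+ 2.
  move=> e0; have [dl dl0 dlP] := cderiv_error fD e0.
  have [n nP] := pow2_archimedean S0 dl0.
  apply: le_trans (Vn n) _.
  have [ax x12 xb [cy y12 yd]] := q_in n.
  pose p := px +i* py.
  pose A w := f p + D * (w - p).
  have cA z : {for z, continuous A}.
    apply: ccontD; first exact: ccont_cst.
    apply: ccontM; first exact: ccont_cst.
    by apply: ccontB; [exact: ccont_id|exact: ccont_cst].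
  have cfq x y : (q n).1.1 <= x <= (q n).1.2 -> (q n).2.1 <= y <= (q n).2.2 ->
      {for x +i* y, continuous f}.
    move=> /andP[h1 h2] /andP[h3 h4]; apply: cf.
      by rewrite (le_trans ax h1) (le_trans h2 xb).
    by rewrite (le_trans cy h3) (le_trans h4 yd).
  have bE : boundary_continuous (fun w => f w - A w) (q n).1.1 (q n).1.2 (q n).2.1 (q n).2.2.
    apply: continuous_boundary; [exact: x12|exact: y12|move=> x y hx hy].
    by apply: ccontB; [exact: cfq|exact: cA].
  have bA : boundary_continuous A (q n).1.1 (q n).1.2 (q n).2.1 (q n).2.2.
    by apply: continuous_boundary; [exact: x12|exact: y12|move=> x y hx hy; exact: cA].
  (* The affine part has a primitive, hence integral zero. *)
  have A0 : rectint A (q n).1.1 (q n).1.2 (q n).2.1 (q n).2.2 = 0.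
    apply: (@rectint_primitive _ A (fun w => f p * w + D / 2 * ((w - p) * (w - p)))).
    - exact: x12.
    - exact: y12.
    - move=> x y _ _.
      have h1 := cderivB (cderiv_id (x +i* y)) (cderiv_const p (x +i* y)).
      have := cderivD (cderivZ (f p) (cderiv_id (x +i* y))) (cderivZ (D / 2) (cderivM h1 h1)).
      by congr has_cderiv; rewrite /A; field.
    - by move=> x y _ _; exact: cA.
  have -> : V (q n) = normc (rectint (fun w => f w - A w) (q n).1.1 (q n).1.2 (q n).2.1 (q n).2.2).
    congr normc; rewrite -[RHS]addr0 -[in X in _ + X]A0 -rectintD//.
    by apply: eq_rectint => // x y _ _ _; rewrite subrK.
  have S2 : 0 <= S / 2 ^+ n by rewrite divr_ge0// exprn_ge0.
  apply: (@le_trans _ _ (4 ^+ n * (4 * (e * (S / 2 ^+ n)) * (S / 2 ^+ n)))).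
    rewrite ler_wpM2l ?exprn_ge0// -[in leRHS]len; apply: normc_rectint_bound => //.
    move=> x y /andP[hx1 hx2] /andP[hy1 hy2] _.
    have wp : normc ((x +i* y) - p) <= S / 2 ^+ n.
      apply: le_trans (normc_le_ReIm _) _ => /=; rewrite -len.
      have /andP[p1 p2] := pxP n; have /andP[p3 p4] := pyP n.
      by apply: lerD; rewrite ler_norml; apply/andP; split; lra.
    rewrite len /A opprD addrA.
    by apply: le_trans (dlP _ (le_lt_trans wp nP)) _; rewrite ler_wpM2l// ltW.
  have -> : (4 : R) ^+ n = 2 ^+ n * 2 ^+ n by rewrite -exprMn; congr (_ ^+ n); ring.
  have p0 : (2 : R) ^+ n != 0 by rewrite expf_neq0.
  by rewrite le_eqVlt; apply/orP; left; apply/eqP; field.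
apply/eqP; rewrite eq_le normc_ge0 andbT -[normc _]/(V Q0).
apply/ler_addgt0Pl => e e0; rewrite addr0.
have k0 : 0 < 4 * S ^+ 2 + 1 by rewrite ltr_wpDl// mulr_ge0// sqr_ge0.
apply: le_trans (small (e / (4 * S ^+ 2 + 1)) _) _; first by rewrite divr_gt0.
rewrite -mulrA (mulrC _ (S ^+ 2)) mulrA mulrA ler_pdivrMr// mulrC ler_wpM2l ?ltW//.
lra.
Qed.

End Goursat.

(** * Cauchy's formula *)

Section CauchyFormula.
Context {R : realType}.
Local Notation C := R[i].
Local Notation leb := (@lebesgue_measure R).
Implicit Types (f g : C -> C) (a b c d r : R).

(** The four sides of a square about the pole are seen from it under the same
    angle; the primitive is an arctangent. *)
Lemma Rintegral_poisson (x0 r : R) : 0 < r ->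
  \int[leb]_(x in `[x0 - r, x0 + r]) (r / ((x - x0) ^+ 2 + r ^+ 2)) = pi / 2.
Proof.
move=> r0; have r20 (x : R) : 0 < (x - x0) ^+ 2 + r ^+ 2.
  by rewrite ltr_wpDl ?sqr_ge0// exprn_gt0.
have ab : x0 - r <= x0 + r by rewrite lerD2l; lra.
have cf x : x0 - r <= x <= x0 + r ->
    {for x, continuous (fun x => r / ((x - x0) ^+ 2 + r ^+ 2))}.
  move=> _; apply: cvgM; first exact: cvg_cst.
  apply: cvgV; first by rewrite gt_eqF.
  apply: cvgD; last exact: cvg_cst.
  have cB : {for x, continuous (fun x => x - x0)}.
    by apply: cvgB; [exact: cvg_id|exact: cvg_cst].
  exact: (cvgM cB cB).
have dg t : x0 - r <= t <= x0 + r ->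
    is_derive t 1 (fun x => atan ((x - x0) / r)) (r / ((t - x0) ^+ 2 + r ^+ 2)).
  move=> _; have -> : r / ((t - x0) ^+ 2 + r ^+ 2) = (1 + ((t - x0) / r) ^+ 2)^-1 * r^-1.
    by field; rewrite !gt_eqF//= addrC; exact: r20.
  apply: (@is_derive1_comp _ atan (fun x => (x - x0) / r)).
  have -> : (fun x => (x - x0) / r) = (fun x => r^-1 *: (x - x0)).
    by apply/funext => x; rewrite mulrC.
  by apply: is_derive_eq; rewrite subr0 scaler1.
rewrite (Rintegral_FTC ab cf dg).
rewrite addrAC subrr add0r (addrAC x0) subrr add0r divff ?gt_eqF//.
by rewrite mulNr divff ?gt_eqF// atanN atan1; field.
Qed.

(** By symmetry the real parts of opposite sides cancel, and each of the four
    sides contributes [pi / 2]. *)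
Lemma rectint_inv (x0 y0 r : R) : 0 < r ->
  rectint (fun w => (w - (x0 +i* y0))^-1) (x0 - r) (x0 + r) (y0 - r) (y0 + r) =
  0 +i* (2 * pi).
Proof.
move=> r0.
have invE (u v : R) : (u +i* v)^-1 = (u / (u ^+ 2 + v ^+ 2)) +i* (- (v / (u ^+ 2 + v ^+ 2))) :> C.
  by [].
have subE (x y : R) : (x +i* y) - (x0 +i* y0) = (x - x0) +i* (y - y0) :> C by [].
pose Ax := \int[leb]_(x in `[x0 - r, x0 + r]) ((x - x0) / ((x - x0) ^+ 2 + r ^+ 2)).
pose Ay := \int[leb]_(x in `[y0 - r, y0 + r]) (- ((x - y0) / ((x - y0) ^+ 2 + r ^+ 2))).
have P x1 := Rintegral_poisson x1 r0.
have PN x1 : \int[leb]_(x in `[x1 - r, x1 + r]) (- (r / ((x - x1) ^+ 2 + r ^+ 2))) = - (pi / 2).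
  rewrite -(P x1) -[RHS]mulN1r -RintegralZl//; last first.
    apply: integrable_continuous => x _.
    apply: cvgM; first exact: cvg_cst.
    apply: cvgV; first by rewrite gt_eqF// ltr_wpDl ?sqr_ge0// exprn_gt0.
    apply: cvgD; last exact: cvg_cst.
    have cB : {for x, continuous (fun x => x - x1)}.
      by apply: cvgB; [exact: cvg_id|exact: cvg_cst].
    exact: (cvgM cB cB).
  by apply: eq_Rintegral => x _; rewrite mulN1r.
rewrite /rectint.
have -> : cint (x0 - r) (x0 + r) (fun x => ((x +i* (y0 - r)) - (x0 +i* y0))^-1) = Ax +i* (pi / 2).
  rewrite /cint -(P x0); congr (_ +i* _); apply: eq_Rintegral => x _;
  by rewrite subE invE /= (addrAC y0) subrr add0r sqrrN ?mulNr ?opprK.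
have -> : cint (x0 - r) (x0 + r) (fun x => ((x +i* (y0 + r)) - (x0 +i* y0))^-1) = Ax +i* (- (pi / 2)).
  rewrite /cint -(PN x0); congr (_ +i* _); apply: eq_Rintegral => x _;
  by rewrite subE invE /= (addrAC y0) subrr add0r.
have -> : cint (y0 - r) (y0 + r) (fun y => (((x0 + r) +i* y) - (x0 +i* y0))^-1) = (pi / 2) +i* Ay.
  rewrite /cint -(P y0); congr (_ +i* _); apply: eq_Rintegral => x _;
  by rewrite subE invE /= (addrAC x0) subrr add0r (addrC (r ^+ 2)).
have -> : cint (y0 - r) (y0 + r) (fun y => (((x0 - r) +i* y) - (x0 +i* y0))^-1) = (- (pi / 2)) +i* Ay.
  rewrite /cint -(PN y0); congr (_ +i* _); apply: eq_Rintegral => x _;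
  by rewrite subE invE /= (addrAC x0) subrr add0r sqrrN (addrC (r ^+ 2)) ?mulNr.
by apply/eqP; rewrite eq_complex /=; apply/andP; split; apply/eqP; field.
Qed.

Lemma derivable_quotient f z w : w != z -> derivable f w 1 ->
  derivable (fun u => f u / (u - z)) w 1.
Proof.
move=> wz /derivable_cderivP[D fD]; apply/derivable_cderivP.
have h := cderivB (cderiv_id w) (cderiv_const z w).
have wz0 : w - z != 0 by rewrite subr_eq0.
by eexists; exact: (cderivM fD (@cderivV _ (fun u => u - z) w _ wz0 h)).
Qed.

(** Away from [z] the integrand is holomorphic, so the rectangle may be shrunk
    to a small square centred at [z], where only the pole contributes. *)
Theorem cauchy_formula f a b c d (x0 y0 : R) : a < x0 < b -> c < y0 < d ->
  (forall x y, a <= x <= b -> c <= y <= d -> derivable f (x +i* y) 1) ->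
  rectint (fun w => f w / (w - (x0 +i* y0))) a b c d = (0 +i* (2 * pi)) * f (x0 +i* y0).
Proof.
move=> /andP[ax xb] /andP[cy yd] df.
set z := x0 +i* y0; set F := fun w => f w / (w - z).
have neq x y : (x != x0) || (y != y0) -> x +i* y != z.
  by rewrite /z eq_complex /= negb_and.
have [D fD] := (derivable_cderivP f z).1 (df x0 y0 ltac:(by rewrite !ltW) ltac:(by rewrite !ltW)).
have [dl dl0 dlP] := cderiv_error fD ltr01.
pose M := normc D + 1.
have M0 : 0 <= M by rewrite addr_ge0// normc_ge0.
pose rho0 := Num.min (Num.min (x0 - a) (b - x0)) (Num.min (y0 - c) (d - y0)).
have rho00 : 0 < rho0 by rewrite !lt_min !subr_gt0 ax xb cy yd.
have dF x y : a <= x <= b -> c <= y <= d -> (x != x0) || (y != y0) ->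
    derivable F (x +i* y) 1.
  by move=> hx hy /neq nz; apply: derivable_quotient => //; exact: df.
have cF x y : a <= x <= b -> c <= y <= d -> (x != x0) || (y != y0) ->
    {for x +i* y, continuous F}.
  by move=> hx hy h; apply: derivable_continuous; exact: dF.
have hF y a' b' : c <= y -> y <= d -> y != y0 -> a <= a' -> b' <= b ->
    continuous_on a' b' (fun x => F (x +i* y)).
  move=> cy' yd' ny aa bb x /andP[x1 x2]; apply: hline_continuous; apply: cF.
  - by rewrite (le_trans aa x1) (le_trans x2 bb).
  - by rewrite cy' yd'.
  - by rewrite ny orbT.
have vF x c' d' : a <= x -> x <= b -> x != x0 -> c <= c' -> d' <= d ->
    continuous_on c' d' (fun y => F (x +i* y)).
  move=> ax' xb' nx cc dd y /andP[y1 y2]; apply: vline_continuous; apply: cF.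
  - by rewrite ax' xb'.
  - by rewrite (le_trans cc y1) (le_trans y2 dd).
  - by rewrite nx.
have gF a' b' c' d' : a <= a' -> a' <= b' -> b' <= b -> c <= c' -> c' <= d' -> d' <= d ->
    [|| b' < x0, x0 < a', d' < y0 | y0 < c'] -> rectint F a' b' c' d' = 0.
  move=> aa ab bb cc cd dd off; apply: goursat => // x y /andP[x1 x2] /andP[y1 y2].
  apply: dF; first by rewrite (le_trans aa x1) (le_trans x2 bb).
    by rewrite (le_trans cc y1) (le_trans y2 dd).
  case/or4P: off => h.
  - by rewrite lt_eqF// (le_lt_trans x2 h).
  - by rewrite gt_eqF// (lt_le_trans h x1).
  - by rewrite (lt_eqF (le_lt_trans y2 h)) orbT.
  - by rewrite (gt_eqF (lt_le_trans h y1)) orbT.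
have small rho : 0 < rho -> rho <= rho0 -> 2 * rho < dl ->
    normc (rectint F a b c d - (0 +i* (2 * pi)) * f z) <= 16 * M * rho.
  move=> r0 rr0 rdl.
  move: rr0; rewrite !le_min => /andP[/andP[r1 r2] /andP[r3 r4]].
  have [h1 h2 h3 h4] : [/\ a <= x0 - rho, x0 + rho <= b, c <= y0 - rho & y0 + rho <= d].
    by split; lra.
  have [xl xr yl yr] : [/\ x0 - rho < x0, x0 < x0 + rho, y0 - rho < y0 & y0 < y0 + rho].
    by split; lra.
  have xx := ltW (lt_trans xl xr); have yy := ltW (lt_trans yl yr).
  have [lb la ld lc] : [/\ x0 - rho <= b, a <= x0 + rho, y0 - rho <= d & c <= y0 + rho].
    by split; [exact: le_trans xx h2|exact: le_trans h1 xx|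
      exact: le_trans yy h4|exact: le_trans h3 yy].
  have [ab' cd'] := (le_trans h1 lb, le_trans h3 ld).
  have nc : c != y0 by rewrite lt_eqF.
  have nd : d != y0 by rewrite gt_eqF.
  have [nxl nxr nyl nyr] : [/\ x0 - rho != x0, x0 + rho != x0, y0 - rho != y0 & y0 + rho != y0].
    by split; rewrite ?(lt_eqF xl) ?(gt_eqF xr) ?(lt_eqF yl) ?(gt_eqF yr).
  have hh1 : a <= x0 - rho <= b by rewrite h1.
  have hh2 : x0 - rho <= x0 + rho <= b by rewrite xx.
  have hh3 : c <= y0 - rho <= d by rewrite h3.
  have hh4 : y0 - rho <= y0 + rho <= d by rewrite yy.
  have -> : rectint F a b c d =
      rectint F (x0 - rho) (x0 + rho) (y0 - rho) (y0 + rho).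
    rewrite (rectint_hsplit hh1 (hF _ _ _ (lexx c) cd' nc (lexx a) (lexx b))
      (hF _ _ _ cd' (lexx d) nd (lexx a) (lexx b))).
    rewrite (gF a (x0 - rho) c d)// ?xl// add0r.
    rewrite (rectint_hsplit hh2 (hF _ _ _ (lexx c) cd' nc h1 (lexx b))
      (hF _ _ _ cd' (lexx d) nd h1 (lexx b))).
    rewrite (gF (x0 + rho) b c d)// ?xr ?orbT// addr0.
    rewrite (rectint_vsplit hh3 (vF _ _ _ h1 lb nxl (lexx c) (lexx d))
      (vF _ _ _ la h2 nxr (lexx c) (lexx d))).
    rewrite (gF _ _ c (y0 - rho))// ?yl ?orbT// add0r.
    rewrite (rectint_vsplit hh4 (vF _ _ _ h1 lb nxl h3 (lexx d))
      (vF _ _ _ la h2 nxr h3 (lexx d))).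
    by rewrite (gF _ _ (y0 + rho) d)// ?yr ?orbT// addr0.
  have bF : boundary_continuous F (x0 - rho) (x0 + rho) (y0 - rho) (y0 + rho).
    by split; [exact: hF|exact: hF|exact: vF|exact: vF].
  have binv : boundary_continuous (fun w => (w - z)^-1)
      (x0 - rho) (x0 + rho) (y0 - rho) (y0 + rho).
    have cinv x y : (x != x0) || (y != y0) -> {for x +i* y, continuous (fun w => (w - z)^-1)}.
      move=> /neq nz; apply: ccontV; first by rewrite subr_eq0.
      by apply: ccontB; [exact: ccont_id|exact: ccont_cst].
    by split => t _; [apply: (@hline_continuous _ (fun w => (w - z)^-1))|
      apply: (@hline_continuous _ (fun w => (w - z)^-1))|
      apply: (@vline_continuous _ (fun w => (w - z)^-1))|
      apply: (@vline_continuous _ (fun w => (w - z)^-1))]; apply: cinv;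
      rewrite ?nxl ?nxr ?nyl ?nyr ?orbT.
  have bfinv : boundary_continuous (fun w => - f z * (w - z)^-1)
      (x0 - rho) (x0 + rho) (y0 - rho) (y0 + rho).
    case: binv => b1 b2 b3 b4.
    have cM (H : R -> C) t : {for t, continuous H} -> {for t, continuous (fun s => - f z * H s)}.
      move=> cH; apply: (@rcont_comp _ H (fun u => - f z * u) t cH).
      by apply: ccontM; [exact: ccont_cst|exact: ccont_id].
    by split => t ht; [exact: cM (b1 t ht)|exact: cM (b2 t ht)|exact: cM (b3 t ht)|exact: cM (b4 t ht)].
  have -> : rectint F (x0 - rho) (x0 + rho) (y0 - rho) (y0 + rho) - (0 +i* (2 * pi)) * f z =
      rectint (fun w => F w + - f z * (w - z)^-1) (x0 - rho) (x0 + rho) (y0 - rho) (y0 + rho).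
    by rewrite (rectintD bF bfinv) (rectintZ _ binv) rectint_inv// mulNr (mulrC (f z)).
  have bG : boundary_continuous (fun w => F w + - f z * (w - z)^-1)
      (x0 - rho) (x0 + rho) (y0 - rho) (y0 + rho).
    case: bF => b1 b2 b3 b4; case: bfinv => e1 e2 e3 e4.
    have cD (H K : R -> C) t : {for t, continuous H} -> {for t, continuous K} ->
        {for t, continuous (fun s => H s + K s)}.
      by move=> cH cK; exact: (@cvgD _ _ _ (nbhs t) _ H K _ _ cH cK).
    by split => t ht; [exact: cD (b1 t ht) (e1 t ht)|exact: cD (b2 t ht) (e2 t ht)|
      exact: cD (b3 t ht) (e3 t ht)|exact: cD (b4 t ht) (e4 t ht)].
  have -> : 16 * M * rho = 4 * M * ((x0 + rho - (x0 - rho)) + (y0 + rho - (y0 - rho))) by ring.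
  apply: normc_rectint_bound => // x y /andP[x1 x2] /andP[y1 y2] bd.
  have nz : x +i* y != z.
    apply: neq; rewrite -negb_and; apply/negP => /andP[/eqP xe /eqP ye].
    move: bd; rewrite xe ye ![x0 == _]eq_sym ![y0 == _]eq_sym.
    by rewrite (negbTE nxl) (negbTE nxr) (negbTE nyl) (negbTE nyr).
  set w := x +i* y.
  have -> : F w + - f z * (w - z)^-1 = (f w - f z - D * (w - z)) / (w - z) + D.
    by rewrite /F; field; rewrite subr_eq0.
  apply: le_trans (le_normcD _ _) _; rewrite addrC lerD2l normcM normcV.
  rewrite ler_pdivrMr ?normc_gt0 ?subr_eq0//.
  apply: dlP; apply: le_lt_trans rdl; apply: le_trans (normc_le_ReIm _) _ => /=.
  have near (u v : R) : v - rho <= u -> u <= v + rho -> `|u - v| <= rho.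
    by clear; move=> h1 h2; rewrite ler_norml; apply/andP; split; lra.
  by rewrite mulr_natl mulr2n; apply: lerD; exact: near.
clearbody rho0; apply/eqP; rewrite -subr_eq0 -normc_eq0 eq_le normc_ge0 andbT.
apply/ler_addgt0Pl => e e0; rewrite addr0.
pose rho := Num.min (Num.min rho0 (dl / 4)) (e / (16 * M + 1)).
have k0 : 0 < 16 * M + 1 by rewrite ltr_wpDl// mulr_ge0.
have r0 : 0 < rho by rewrite !lt_min rho00 !divr_gt0.
have r1 : rho <= rho0 by rewrite !ge_min lexx.
have r2 : rho <= dl / 4 by rewrite !ge_min lexx orbT.
have r3 : rho <= e / (16 * M + 1) by rewrite !ge_min lexx !orbT.
apply: le_trans (small rho r0 r1 _) _; first lra.
move: r3; rewrite ler_pdivlMr//; lra.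
Qed.

End CauchyFormula.

(** * Affine changes of variable *)

Section AffineInvariance.
Context {R : realType}.
Local Notation leb := (@lebesgue_measure R).
Local Open Scope ereal_scope.

Lemma measurable_affine (k b : R) : measurable_fun setT (fun x : R => k * x + b)%R.
Proof.
apply: measurable_funD; last exact: measurable_cst.
by apply: measurable_funM; [exact: measurable_cst|exact: measurable_id].
Qed.

Lemma ge0_integral_affine (k b : R) (h : R -> \bar R) : (0 < k)%R ->
  measurable_fun setT h -> (forall x, 0 <= h x) ->
  \int[leb]_x h x = k%:E * \int[leb]_x h (k * x + b)%R.
Proof.
move=> k0 mh h0.
pose phi (x : R) : measurableTypeR R := (k * x + b)%R.
have mphi : measurable_fun setT phi by exact: measurable_affine.
pose kn : {nonneg R} := NngNum (ltW k0).
pose m' : {measure set (measurableTypeR R) -> \bar R} := mscale kn (pushforward leb phi).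
pose m := m' mphi.
transitivity (integral m setT (h : measurableTypeR R -> \bar R)).
  apply: eq_measure_integral => A mA _.
  apply: (@lebesgue_measure_unique _ m) => // _ [[u v]] _ <-.
  rewrite /m /m' /mscale /= /pushforward.
  have pre : phi @^-1` `]u, v]%classic = `]((u - b) / k)%R, ((v - b) / k)%R]%classic.
    apply/seteqP; split => x /=; rewrite !in_itv /= /phi => /andP[h1 h2].
      by rewrite ltr_pdivrMr// ler_pdivlMr//; apply/andP; split; lra.
    move: h1 h2; rewrite ltr_pdivrMr// ler_pdivlMr// => h1 h2.
    by apply/andP; split; lra.
  rewrite [X in _ = _ * X](_ : _ = leb `]((u - b) / k)%R, ((v - b) / k)%R]%classic); last first.
    by congr (lebesgue_measure _); exact: pre.
  rewrite !lebesgue_measure_itv /= !lte_fin.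
  rewrite ltr_pdivrMr// divfK ?gt_eqF// ltrD2r.
  case: ifPn => uv; last by rewrite mule0.
  by rewrite -!EFinD -EFinM; congr EFin; field; rewrite gt_eqF.
rewrite /m /m' ge0_integral_mscale//; congr (_ * _).
by rewrite ge0_integral_pushforward.
Qed.

Lemma ge0_integral_opp (h : R -> \bar R) :
  measurable_fun setT h -> (forall x, 0 <= h x) ->
  \int[leb]_x h x = \int[leb]_x h (- x)%R.
Proof.
move=> mh h0.
have mo : measurable_fun setT (-%R : R -> measurableTypeR R).
  exact: oppr_measurable.
transitivity (\int[pushforward leb (-%R : R -> measurableTypeR R)]_x h x).
  by apply: eq_measure_integral => A mA _; exact/esym/lebesgue_measureN.
by rewrite ge0_integral_pushforward.
Qed.

Lemma ge0_integral_shift (b : R) (h : R -> \bar R) :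
  measurable_fun setT h -> (forall x, 0 <= h x) ->
  \int[leb]_x h (x + b)%R = \int[leb]_x h x.
Proof.
move=> mh h0; rewrite (@ge0_integral_affine 1 b h)// mul1e.
by apply: eq_integral => x _; rewrite mul1r.
Qed.

Lemma ge0_integral_reflect (b : R) (h : R -> \bar R) :
  measurable_fun setT h -> (forall x, 0 <= h x) ->
  \int[leb]_x h (b - x)%R = \int[leb]_x h x.
Proof.
move=> mh h0; rewrite -(ge0_integral_shift b mh h0).
rewrite [RHS]ge0_integral_opp//; last first.
  by apply: measurableT_comp => //; have := measurable_affine 1 b;
    under eq_fun do rewrite mul1r.
by apply: eq_integral => x _; rewrite addrC.
Qed.

End AffineInvariance.

(** * The mean value bound by area integrals *)

Section AreaBound.
Context {R : realType}.
Local Notation C := R[i].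
Local Notation leb := (@lebesgue_measure R).
Implicit Types (f g : C -> C) (a b c d r : R).

(** Cauchy's formula bounds [f] at the centre by its mean modulus on the sides.
    The squares come from [u <= A / 8 + 2 u^2 / A], with [A] the modulus at the
    centre, so that the first term can be absorbed on the left. *)
Lemma side_bound f (x0 y0 r : R) : 0 < r ->
  (forall x y, x0 - r <= x <= x0 + r -> y0 - r <= y <= y0 + r -> derivable f (x +i* y) 1) ->
  r * normc (f (x0 +i* y0)) ^+ 2 <= 2 * (
   \int[leb]_(x in `[x0 - r, x0 + r]) normc (f (x +i* (y0 - r))) ^+ 2 +
   \int[leb]_(x in `[x0 - r, x0 + r]) normc (f (x +i* (y0 + r))) ^+ 2 +
   \int[leb]_(y in `[y0 - r, y0 + r]) normc (f ((x0 - r) +i* y)) ^+ 2 +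
   \int[leb]_(y in `[y0 - r, y0 + r]) normc (f ((x0 + r) +i* y)) ^+ 2).
Proof.
move=> r0 df; set z := x0 +i* y0.
have [A0|A0] := eqVneq (normc (f z)) 0.
  rewrite A0 expr0n mulr0 mulr_ge0// !addr_ge0//;
  by apply: Rintegral_ge0 => x _; rewrite sqr_ge0.
have {}A0 : 0 < normc (f z) by rewrite lt_def A0 normc_ge0.
set A := normc (f z) in A0 *.
have rx : x0 - r < x0 < x0 + r by apply/andP; split; lra.
have ry : y0 - r < y0 < y0 + r by apply/andP; split; lra.
have := cauchy_formula rx ry df; rewrite -/z => CF.
have xx : x0 - r <= x0 + r by lra.
have yy : y0 - r <= y0 + r by lra.
have cf x y : x0 - r <= x <= x0 + r -> y0 - r <= y <= y0 + r -> {for x +i* y, continuous f}.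
  by move=> hx hy; apply: derivable_continuous; exact: df.
have [c1 c2 c3 c4] := continuous_boundary xx yy cf.
have side (a b : R) (gam : R -> C) : b - a = 2 * r -> continuous_on a b (fun t => f (gam t)) ->
    (forall t, {for t, continuous gam}) ->
    (forall t, a <= t <= b -> r <= normc (gam t - z)) ->
    normc (cint a b (fun t => f (gam t) / (gam t - z))) <=
    A / 2 + 4 / (r * A) * \int[leb]_(t in `[a, b]) normc (f (gam t)) ^+ 2.
  move=> ab cg cgam far.
  have nz t : a <= t <= b -> gam t - z != 0.
    by move=> /far h; rewrite -normc_gt0 (lt_le_trans r0).
  have i2 : leb.-integrable `[a, b] (EFin \o (fun t => normc (f (gam t)) ^+ 2)).
    apply: integrable_continuous => t /cg /continuous_normc h.
    exact: (cvgM h h).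
  have i1 : leb.-integrable `[a, b] (EFin \o (fun=> A / (8 * r))).
    by apply: integrable_continuous => t _; exact: cvg_cst.
  have i3 : leb.-integrable `[a, b]
      (EFin \o (fun t => 2 / (r * A) * normc (f (gam t)) ^+ 2)).
    exact: integrableZr.
  have -> : A / 2 + 4 / (r * A) * \int[leb]_(t in `[a, b]) normc (f (gam t)) ^+ 2 =
     2 * \int[leb]_(t in `[a, b]) (A / (8 * r) + 2 / (r * A) * normc (f (gam t)) ^+ 2).
    rewrite RintegralD// Rintegral_segment_cst; last by lra.
    by rewrite ab RintegralZl//; field; rewrite !gt_eqF.
  apply: normc_cint_le.
  - move=> t tab.
    apply: (@cvgM _ _ (nbhs t) _ (fun t => f (gam t)) (fun t => (gam t - z)^-1)).
      exact: cg.
    apply: (@rcont_comp _ gam (fun w => (w - z)^-1)); first exact: cgam.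
    by apply: ccontV; [exact: nz|apply: ccontB; [exact: ccont_id|exact: ccont_cst]].
  - apply: integrable_continuous => t /cg /continuous_normc h.
    apply: cvgD; first exact: cvg_cst.
    by apply: cvgM; [exact: cvg_cst|exact: (cvgM h h)].
  - move=> t tab; rewrite normcM normcV ler_pdivrMr ?normc_gt0 ?nz//.
    set u := normc (f (gam t)); have u0 : 0 <= u by exact: normc_ge0.
    apply: (@le_trans _ _ ((A / (8 * r) + 2 / (r * A) * u ^+ 2) * r)).
      rewrite -subr_ge0.
      have -> : (A / (8 * r) + 2 / (r * A) * u ^+ 2) * r - u =
          2 / A * (u - A / 4) ^+ 2 by field; rewrite !gt_eqF.
      by rewrite mulr_ge0 ?sqr_ge0// divr_ge0// ltW.
    apply: ler_wpM2l; last exact: far.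
    apply: addr_ge0; first by rewrite divr_ge0 ?mulr_ge0 ?ltW.
    by rewrite mulr_ge0 ?sqr_ge0// divr_ge0// mulr_ge0 ?ltW.
have len (u : R) : u + r - (u - r) = 2 * r by ring.
have dist_h (s x : R) : `|s| = r -> r <= normc ((x +i* (y0 + s)) - z).
  move=> <-; apply: le_trans (le_Im_normc _) => /=.
  by rewrite (addrC y0) addrK.
have dist_v (s y : R) : `|s| = r -> r <= normc (((x0 + s) +i* y) - z).
  move=> <-; apply: le_trans (le_Re_normc _) => /=.
  by rewrite (addrC x0) addrK.
have nr : `|- r| = r by rewrite normrN gtr0_norm.
have pr : `|r| = r by rewrite gtr0_norm.
have b1 := side _ _ (fun t => t +i* (y0 - r)) (len x0) c1
  (@continuous_hline R _) (fun t _ => dist_h _ t nr).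
have b2 := side _ _ (fun t => t +i* (y0 + r)) (len x0) c2
  (@continuous_hline R _) (fun t _ => dist_h _ t pr).
have b3 := side _ _ (fun t => (x0 - r) +i* t) (len y0) c3
  (@continuous_vline R _) (fun t _ => dist_v _ t nr).
have b4 := side _ _ (fun t => (x0 + r) +i* t) (len y0) c4
  (@continuous_vline R _) (fun t _ => dist_v _ t pr).
move: CF; rewrite /rectint.
move: b1 b2 b3 b4.
set I1 := \int[leb]_(x in _) _; set I2 := \int[leb]_(x in _) _.
set I3 := \int[leb]_(x in _) _; set I4 := \int[leb]_(x in _) _.
set B := cint _ _ _; set T := cint _ _ _; set L := cint _ _ _; set Rt := cint _ _ _.
move=> b1 b2 b3 b4 CF; clearbody I1 I2 I3 I4 B T L Rt.
have n2pi : normc (0 +i* (2 * pi)) = 2 * pi :> R.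
  by rewrite normc_ReIm /= expr0n add0r sqrtr_sqr ger0_norm// mulr_ge0// pi_ge0.
have := congr1 (@normc R) CF; rewrite normcM n2pi -/A => nCF.
have tri : 2 * pi * A <= normc B + normc T + normc L + normc Rt.
  rewrite -nCF; apply: le_trans (le_normcD _ _) _.
  rewrite normcM normc_i mul1r.
  have := le_normcD B (- T); have := le_normcD Rt (- L); rewrite !normcN; clear; lra.
have pi2 : 2 <= pi :> R by exact: pi_ge2.
have : 2 * 2 * A <= 2 * pi * A by rewrite ler_pM2r// ler_pM2l.
have e0 : 0 < 4 / (r * A) by rewrite divr_gt0// mulr_gt0.
rewrite expr2 => h4.
have : 2 * A <= 4 / (r * A) * (I1 + I2 + I3 + I4) by rewrite !mulrDr; move: b1 b2 b3 b4 tri h4; clear; lra.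
rewrite mulrAC ler_pdivlMr ?mulr_gt0//; clear; lra.
Qed.

(** Extension by zero lets Fubini and translation invariance be applied on the
    whole plane, without measurability side conditions on subsets. *)
Definition dens f : R * R -> \bar R :=
  (fun p => (normc (f (p.1 +i* p.2)) ^+ 2)%:E) \_ [set p | 0 < p.1].

Definition line_sqnorm f (x : R) : \bar R :=
  (\int[leb]_y (normc (f (x +i* y)) ^+ 2)%:E)%E.

Lemma dens_ge0 f p : (0 <= dens f p)%E.
Proof. by apply: erestrict_ge0 => q _; rewrite lee_fin sqr_ge0. Qed.

Lemma dens_right f x y : 0 < x -> dens f (x, y) = (normc (f (x +i* y)) ^+ 2)%:E.
Proof. by move=> x0; rewrite /dens patchE mem_set. Qed.

Lemma dens_left f x y : x <= 0 -> dens f (x, y) = 0%E.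
Proof. by move=> x0; rewrite /dens patchE memNset//= ltNge x0. Qed.

Lemma measurable_dens f : holomorphic_rhp f -> measurable_fun setT (dens f).
Proof.
move=> hf.
have mf : measurable_fun [set p : R * R | 0 < p.1]
    (EFin \o (fun p => normc (f (p.1 +i* p.2)) ^+ 2)).
  by apply/measurable_EFinP; exact: measurable_sqnorm_plane.
exact: ((measurable_restrictT _ (@measurable_right_p R)).1 mf).
Qed.

Lemma bergman_dens f : bergman_sqnorm f = (\int[leb \x leb]_p dens f p)%E.
Proof. by rewrite /bergman_sqnorm integral_mkcond. Qed.

Lemma line_dens f x : 0 < x -> line_sqnorm f x = (\int[leb]_y dens f (x, y))%E.
Proof. by move=> x0; apply: eq_integral => y _; rewrite dens_right. Qed.

Lemma bergman_line f : holomorphic_rhp f ->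
  bergman_sqnorm f = (\int[leb]_x \int[leb]_y dens f (x, y))%E.
Proof.
move=> hf; rewrite bergman_dens.
exact: (@fubini_tonelli1 _ _ _ _ _ leb leb _ (measurable_dens hf) (dens_ge0 f)).
Qed.

Definition box (x0 y0 d : R) : set (R * R) := `[x0 - d, x0 + d] `*` `[y0 - d, y0 + d].

Lemma measurable_box x0 y0 d : measurable (box x0 y0 d).
Proof. by apply: measurableX; exact: measurable_itv. Qed.

(** Averaging Cauchy's formula over concentric squares turns boundary integrals
    into an integral over the area. *)
Theorem area_bound f (x0 y0 d : R) : holomorphic_rhp f -> 0 < d -> d < x0 ->
  (((d * normc (f (x0 +i* y0))) ^+ 2)%:E <=
   32%:E * \int[leb \x leb]_(p in box x0 y0 d) dens f p)%E.
Proof.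
move=> hf d0 dx.
pose g := dens f \_ (box x0 y0 d).
have mg : measurable_fun setT g.
  exact: ((measurable_restrictT _ (measurable_box x0 y0 d)).1
    (measurable_funTS (measurable_dens hf))).
have g0 p : (0 <= g p)%E by apply: erestrict_ge0 => q _; exact: dens_ge0.
have -> : (\int[leb \x leb]_(p in box x0 y0 d) dens f p = \int[leb \x leb]_p g p)%E.
  by rewrite integral_mkcond.
set I := (\int[leb \x leb]_p g p)%E.
have mgh y : measurable_fun setT (fun x => g (x, y)).
  exact: (measurableT_comp mg (pair2_measurable y)).
have mgv x : measurable_fun setT (fun y => g (x, y)).
  exact: (measurableT_comp mg (pair1_measurable x)).
pose H y := (\int[leb]_x g (x, y))%E.
pose V x := (\int[leb]_y g (x, y))%E.
have mH : measurable_fun setT H by exact: (@measurable_fun_fubini_tonelli_G _ _ _ _ _ leb _ mg g0).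
have mV : measurable_fun setT V by exact: (@measurable_fun_fubini_tonelli_F _ _ _ _ _ leb _ mg g0).
have H0 y : (0 <= H y)%E by apply: integral_ge0.
have V0 x : (0 <= V x)%E by apply: integral_ge0.
have IH : I = (\int[leb]_y H y)%E by exact: (@fubini_tonelli2 _ _ _ _ _ leb leb _ mg g0).
have IV : I = (\int[leb]_x V x)%E by exact: (@fubini_tonelli1 _ _ _ _ _ leb leb _ mg g0).
pose A := normc (f (x0 +i* y0)).
(* Only radii in [d / 2, d] are averaged, so that the factor r is bounded below. *)
have inner r : d / 2 <= r <= d ->
    ((d / 2 * A ^+ 2)%R%:E <= 2%:E * (H (y0 - r)%R + H (y0 + r)%R + V (x0 - r)%R + V (x0 + r)%R))%E.
  move=> /andP[dr rd]; have r0 : 0 < r by lra.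
  have pos x : x0 - r <= x -> 0 < x by clear -dx rd; lra.
  have df x y : x0 - r <= x <= x0 + r -> y0 - r <= y <= y0 + r -> derivable f (x +i* y) 1.
    by move=> /andP[hx _] _; apply: hf; exact: pos hx.
  have cf x y : x0 - r <= x <= x0 + r -> y0 - r <= y <= y0 + r -> {for x +i* y, continuous f}.
    by move=> hx hy; apply: derivable_continuous; exact: df.
  have xx : x0 - r <= x0 + r by clear -r0; lra.
  have yy : y0 - r <= y0 + r by clear -r0; lra.
  have [c1 c2 c3 c4] := continuous_boundary xx yy cf.
  have side (a b : R) (gam : R -> C) (G : R -> \bar R) :
      continuous_on a b (fun t => f (gam t)) -> measurable_fun setT G -> (forall t, 0 <= G t)%E ->
      (forall t, a <= t <= b -> G t = (normc (f (gam t)) ^+ 2)%:E) ->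
      ((\int[leb]_(t in `[a, b]) normc (f (gam t)) ^+ 2)%:E <= \int[leb]_t G t)%E.
    move=> cg mG G0 GE.
    have i2 : leb.-integrable `[a, b] (EFin \o (fun t => normc (f (gam t)) ^+ 2)).
      apply: integrable_continuous => t /cg /continuous_normc h.
      exact: (cvgM h h).
    rewrite /Rintegral fineK; last exact: integrable_fin_num.
    rewrite (_ : integral _ _ _ = \int[leb]_(t in `[a, b]) G t)%E; last first.
      by apply: eq_integral => t /set_mem /=; rewrite in_itv /= => /GE ->.
    exact: ge0_subset_integral.
  have inbox x y : x0 - r <= x <= x0 + r -> y0 - r <= y <= y0 + r ->
      g (x, y) = (normc (f (x +i* y)) ^+ 2)%:E.
    move=> /andP[x1 x2] /andP[y1 y2]; rewrite /g patchE mem_set ?dens_right//; first exact: pos x1.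
    by split; rewrite /= in_itv /=; apply/andP; split; clear -x1 x2 y1 y2 rd; lra.
  have := @side_bound f x0 y0 r r0 df; rewrite -/A.
  set I1 := \int[leb]_(x in _) _; set I2 := \int[leb]_(x in _) _.
  set I3 := \int[leb]_(x in _) _; set I4 := \int[leb]_(x in _) _.
  move=> sb; apply: (@le_trans _ _ (2 * (I1 + I2 + I3 + I4))%R%:E).
    by rewrite lee_fin; apply: le_trans sb; rewrite ler_wpM2r// sqr_ge0.
  rewrite EFinM lee_pmul2l// !EFinD.
  have h1 : (I1%:E <= H (y0 - r)%R)%E.
    apply: (side _ _ (fun t => t +i* (y0 - r)) _ c1 (mgh _) (fun t => g0 _)) => t ht.
    by apply: (inbox _ _ ht _); rewrite lexx yy.
  have h2 : (I2%:E <= H (y0 + r)%R)%E.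
    apply: (side _ _ (fun t => t +i* (y0 + r)) _ c2 (mgh _) (fun t => g0 _)) => t ht.
    by apply: (inbox _ _ ht _); rewrite lexx yy.
  have h3 : (I3%:E <= V (x0 - r)%R)%E.
    apply: (side _ _ (fun t => (x0 - r) +i* t) _ c3 (mgv _) (fun t => g0 _)) => t ht.
    by apply: (inbox _ _ _ ht); rewrite lexx xx.
  have h4 : (I4%:E <= V (x0 + r)%R)%E.
    apply: (side _ _ (fun t => (x0 + r) +i* t) _ c4 (mgv _) (fun t => g0 _)) => t ht.
    by apply: (inbox _ _ _ ht); rewrite lexx xx.
  exact: (leeD (leeD (leeD h1 h2) h3) h4).
have mrefl (b : R) : measurable_fun setT (fun r : R => b - r).
  by apply: measurable_funB; [exact: measurable_cst|exact: measurable_id].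
have mtrans (b : R) : measurable_fun setT (fun r : R => b + r).
  by apply: measurable_funD; [exact: measurable_cst|exact: measurable_id].
have m1 : measurable_fun setT (fun r => H (y0 - r)) by exact: (measurableT_comp mH (mrefl y0)).
have m2 : measurable_fun setT (fun r => H (y0 + r)) by exact: (measurableT_comp mH (mtrans y0)).
have m3 : measurable_fun setT (fun r => V (x0 - r)) by exact: (measurableT_comp mV (mrefl x0)).
have m4 : measurable_fun setT (fun r => V (x0 + r)) by exact: (measurableT_comp mV (mtrans x0)).
pose S r := (H (y0 - r)%R + H (y0 + r)%R + V (x0 - r)%R + V (x0 + r)%R)%E.
have m12 := emeasurable_funD m1 m2; have m123 := emeasurable_funD m12 m3.
have mS : measurable_fun setT S := emeasurable_funD m123 m4.
have S12 r : (0 <= H (y0 - r)%R + H (y0 + r)%R)%E by exact: adde_ge0.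
have S123 r : (0 <= H (y0 - r)%R + H (y0 + r)%R + V (x0 - r)%R)%E by exact: adde_ge0.
have S0 r : (0 <= S r)%E by exact: adde_ge0.
have totS : (\int[leb]_r S r = I + I + I + I)%E.
  have E1 : (\int[leb]_r H (y0 - r)%R = I)%E by rewrite (ge0_integral_reflect y0 mH H0) -IH.
  have E3 : (\int[leb]_r V (x0 - r)%R = I)%E by rewrite (ge0_integral_reflect x0 mV V0) -IV.
  have E2 : (\int[leb]_r H (y0 + r)%R = I)%E.
    by rewrite IH -(ge0_integral_shift y0 mH H0); apply: eq_integral => r _; rewrite addrC.
  have E4 : (\int[leb]_r V (x0 + r)%R = I)%E.
    by rewrite IV -(ge0_integral_shift x0 mV V0); apply: eq_integral => r _; rewrite addrC.
  have e1 : (\int[leb]_r S r = \int[leb]_r (H (y0 - r)%R + H (y0 + r)%R + V (x0 - r)%R) +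
      \int[leb]_r V (x0 + r)%R)%E.
    by apply: (ge0_integralD leb measurableT (fun r _ => S123 r) m123 _ m4) => r _; exact: V0.
  have e2 : (\int[leb]_r (H (y0 - r)%R + H (y0 + r)%R + V (x0 - r)%R) =
      \int[leb]_r (H (y0 - r)%R + H (y0 + r)%R) + \int[leb]_r V (x0 - r)%R)%E.
    by apply: (ge0_integralD leb measurableT (fun r _ => S12 r) m12 _ m3) => r _; exact: V0.
  have e3 : (\int[leb]_r (H (y0 - r)%R + H (y0 + r)%R) =
      \int[leb]_r H (y0 - r)%R + \int[leb]_r H (y0 + r)%R)%E.
    by apply: (ge0_integralD leb measurableT _ m1 _ m2) => r _; exact: H0.
  by rewrite e1 e2 e3 E1 E2 E3 E4.
have step : ((d / 2 * A ^+ 2 * (d / 2))%R%:E <= 2%:E * (I + I + I + I))%E.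
  have d2 : 0 <= d / 2 by rewrite divr_ge0// ltW.
  have dA : 0 <= d / 2 * A ^+ 2 by rewrite mulr_ge0// sqr_ge0.
  apply: (@le_trans _ _ (\int[leb]_(r in `[(d / 2)%R, d]) (d / 2 * A ^+ 2)%R%:E)%E).
    rewrite integral_cst; last exact: measurable_itv.
    rewrite [X in (_ <= _ * X)%E]lebesgue_measure_itv /= lte_fin ifT; last by clear -d0; lra.
    rewrite -EFinB -EFinM lee_fin (_ : d - d / 2 = d / 2)//; clear -d0; lra.
  apply: (@le_trans _ _ (\int[leb]_(r in `[(d / 2)%R, d]) (2%:E * S r))%E).
    apply: ge0_le_integral.
    - exact: measurable_itv.
    - by move=> r _; rewrite lee_fin.
    - exact: measurable_cst.
    - by apply: measurable_funTS; exact: measurable_funeM.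
    - by move=> r /=; rewrite in_itv /=; exact: inner.
  rewrite ge0_integralZl; [|exact: measurable_itv|exact: measurable_funTS mS|by move=> r _; exact: S0|by []].
  rewrite lee_pmul2l//-totS; apply: ge0_subset_integral => //; exact: measurable_itv.
have -> : ((d * A) ^+ 2 = 4 * (d / 2 * A ^+ 2 * (d / 2)))%R by field.
have Ige0 : (0 <= I)%E by apply: integral_ge0.
rewrite EFinM; apply: le_trans (lee_wpmul2l _ step) _; first by rewrite lee_fin.
rewrite muleA -EFinM.
have -> : (I + I + I + I = 4%:E * I)%E.
  rewrite (_ : (4 = 1 + 1 + 1 + 1 :> R)%R); last by ring.
  by rewrite !EFinD !ge0_muleDl ?adde_ge0// mul1e.
by rewrite muleA -EFinM (_ : (4 * 2 * 4 = 32 :> R)%R)//; ring.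
Qed.

End AreaBound.

(** * Area measure *)

Section PlaneMeasure.
Context {R : realType}.
Local Notation leb := (@lebesgue_measure R).
Local Notation P := (measurableTypeR R * measurableTypeR R)%type.

Lemma sigma_finite_plane : sigma_finite [set: P] (leb \x leb)%E.
Proof.
exists (fun n : nat => (`[- n%:R, n%:R] `*` `[- n%:R, n%:R])%R).
  apply/esym/seteqP; split => // -[a b] _; exists (Num.bound (`|a| + `|b|)) => //.
  have h : `|a| + `|b| < (Num.bound (`|a| + `|b|))%:R.
    by apply: archi_boundP; rewrite addr_ge0.
  split; rewrite /= in_itv /= -ler_norml.
    by apply: le_trans (ltW h); rewrite lerDl.
  by apply: le_trans (ltW h); rewrite lerDr.
move=> n; split; first by apply: measurableX; exact: measurable_itv.
have fin : (leb [set` `[- n%:R, n%:R]%R] < +oo)%E.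
  by rewrite lebesgue_measure_itv; case: ifPn => _; rewrite ?ltry//= -EFinD ltry.
apply: (@le_lt_trans _ _ (leb [set` `[- n%:R, n%:R]%R] * leb [set` `[- n%:R, n%:R]%R])%E).
  by rewrite -product_measure1E//; exact: measurable_itv.
by rewrite lte_mul_pinfty// ge0_fin_numE.
Qed.
Let plane_measure0 : {measure set P -> \bar R} := (leb \x leb)%E.
(** Area measure packaged as a sigma-finite measure, so that Fubini's theorem can
    be applied to a line times the plane. *)
Definition plane_measure : {sigma_finite_measure set P -> \bar R} :=
  HB.pack_for (SigmaFiniteMeasure.type P R) (leb \x leb)%E (Measure.class plane_measure0) (Measure_isSigmaFinite.Build _ P R plane_measure0 sigma_finite_plane).

End PlaneMeasure.

(** * Pointwise bounds and the Fejer-Riesz inequality *)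

Section PointwiseBounds.
Context {R : realType}.
Local Notation C := R[i].
Local Notation leb := (@lebesgue_measure R).
Implicit Types (f g : hardy_bergman R).

Lemma bergman_le_norm f : (bergman_sqnorm f <= (hb_norm f ^+ 2)%:E)%E.
Proof. by rewrite -hb_sqnorm_fin leeDr// hardy_sqnorm_ge0. Qed.

Lemma hardy_le_norm f : (hardy_sqnorm f <= (hb_norm f ^+ 2)%:E)%E.
Proof. by rewrite -hb_sqnorm_fin leeDl// bergman_sqnorm_ge0. Qed.

Lemma line_le_hardy (h : C -> C) x : 0 < x -> (line_sqnorm h x <= hardy_sqnorm h)%E.
Proof. by move=> x0; apply: ereal_sup_ubound; exists x. Qed.

Lemma line_le_norm f x : 0 < x -> (line_sqnorm f x <= (hb_norm f ^+ 2)%:E)%E.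
Proof. by move=> /(line_le_hardy f) h; exact: le_trans h (hardy_le_norm f). Qed.

(** Elements of the space are bounded on smaller half-planes by their norm, so
    that convergence in norm implies locally uniform convergence. *)
Lemma pointwise_bound f x y : 0 < x -> x * normc (f (x +i* y)) <= 12 * hb_norm f.
Proof.
move=> x0; have d0 : 0 < x / 2 by rewrite divr_gt0.
have dx : x / 2 < x by lra.
have := area_bound y (@hb_holomorphic _ f) d0 dx => h.
have {}h : ((x / 2 * normc (f (x +i* y))) ^+ 2 <= 32 * hb_norm f ^+ 2)%R.
  rewrite -lee_fin; apply: le_trans h _; rewrite EFinM lee_pmul2l//.
  apply: le_trans (bergman_le_norm f); rewrite bergman_dens.
  apply: ge0_subset_integral => //; first exact: measurable_box.
    exact: measurable_dens (@hb_holomorphic _ f).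
  by move=> p _; exact: dens_ge0.
rewrite -(@ler_pXn2r _ 2)// ?nnegrE ?mulr_ge0 ?hb_norm_ge0 ?normc_ge0 ?(ltW x0)//.
rewrite [leRHS]exprMn; have := sqr_ge0 (hb_norm f).
have -> : (x * normc (f (x +i* y))) ^+ 2 = 4 * (x / 2 * normc (f (x +i* y))) ^+ 2 by field.
move: h; clear; lra.
Qed.

Lemma bergman_tail f (e : R) : 0 < e -> exists n : nat,
  (\int[leb \x leb]_(p in ~` box 0%R 0%R n%:R%R) dens f p <= e%:E)%E.
Proof.
move=> e0; pose F (n : nat) : set (R * R) := box 0 0 n%:R.
have hf := @hb_holomorphic _ f.
have md := measurable_dens hf.
have ndF : nondecreasing_seq F.
  move=> m n mn; apply/subsetPset => -[a b] [/= ]; rewrite !in_itv /= => /andP[a1 a2] /andP[b1 b2].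
  have mn' : m%:R <= n%:R :> R by rewrite ler_nat.
  by split; rewrite /= in_itv /=; apply/andP; split; clear -mn' a1 a2 b1 b2; lra.
have mF i : measurable (F i) by exact: measurable_box.
have mfF i : measurable_fun (F i) (dens f) by exact: measurable_funTS.
have f0F i (p : R * R) : F i p -> (0 <= dens f p)%E by move=> _; exact: dens_ge0.
have : (\int[leb \x leb]_(p in F i) dens f p @[i --> \oo] -->
    \int[leb \x leb]_(p in \bigcup_i F i) dens f p)%E.
  exact: ge0_nondecreasing_set_cvg_integral.
have -> : \bigcup_i F i = setT.
  apply/seteqP; split => // -[a b] _; exists (Num.bound (`|a| + `|b|)) => //.
  have : `|a| + `|b| < (Num.bound (`|a| + `|b|))%:R.
    by apply: archi_boundP; rewrite addr_ge0.
  move=> h; split; rewrite /= in_itv /= sub0r add0r -ler_norml.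
    by apply: le_trans (ltW h); rewrite lerDl.
  by apply: le_trans (ltW h); rewrite lerDr.
rewrite -bergman_dens => cvgF.
have Bfin : bergman_sqnorm f \is a fin_num.
  rewrite ge0_fin_numE ?bergman_sqnorm_ge0//.
  by apply: le_lt_trans (bergman_le_norm f) _; rewrite ltey.
have [n nP] : exists n, (bergman_sqnorm f - e%:E <= \int[leb \x leb]_(p in F n) dens f p)%E.
  apply: contrapT => /forallNP H.
  have : (bergman_sqnorm f <= bergman_sqnorm f - e%:E)%E.
    rewrite -{1}(cvg_lim _ cvgF)//; apply: lime_le.
      by apply/cvg_ex; exists (bergman_sqnorm f); exact: cvgF.
    by apply: nearW => n; have /negP := H n; rewrite -ltNge => /ltW.
  by rewrite leNgt lteBlDr// lteDl ?lte_fin ?e0//.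
exists n; rewrite -/(F n).
have split : (bergman_sqnorm f = \int[leb \x leb]_(p in F n) dens f p +
    \int[leb \x leb]_(p in ~` F n) dens f p)%E.
  rewrite bergman_dens -(setUv (F n)) ge0_integral_setU//.
  - exact: mF.
  - exact: measurableC (mF n).
  - exact: measurable_funTS md.
  - by move=> p _; exact: dens_ge0.
  - by rewrite disj_set2E setICr.
move: nP; rewrite leeBlDr// {1}split leeD2lE//.
rewrite ge0_fin_numE; last by apply: integral_ge0 => p _; exact: dens_ge0.
apply: (@le_lt_trans _ _ (bergman_sqnorm f)); last by rewrite -ge0_fin_numE// bergman_sqnorm_ge0.
by rewrite split leeDl//; apply: integral_ge0 => p _; exact: dens_ge0.
Qed.

(** The mean value bound on a square of half-width [Re z / 2] involves only the
    part of the area integral near [z], which is a tail of a convergent integral. *)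
Lemma decay_at_infinity f (e : R) : 0 < e -> exists M, forall x y, 0 < x ->
  M <= x + `|y| -> x * normc (f (x +i* y)) <= e.
Proof.
move=> e0; pose e1 := e ^+ 2 / 128.
have e10 : 0 < e1 by rewrite divr_gt0// exprn_gt0.
have [n nP] := bergman_tail f e10.
(* For x + |y| large the square of half-width x / 2 about (x, y) avoids the
   box of half-width n about 0. *)
exists (4 * n%:R + 1) => x y x0 Mxy.
have d0 : 0 < x / 2 by rewrite divr_gt0.
have dx : x / 2 < x by lra.
have h := area_bound y (@hb_holomorphic _ f) d0 dx.
have {}h : ((x / 2 * normc (f (x +i* y))) ^+ 2 <= 32 * e1)%R.
  rewrite -lee_fin; apply: le_trans h _; rewrite EFinM lee_pmul2l//.
  apply: le_trans nP; apply: ge0_subset_integral.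
  - exact: measurable_box.
  - by apply: measurableC; exact: measurable_box.
  - exact: measurable_funTS (measurable_dens (@hb_holomorphic _ f)).
  - by move=> p _; exact: dens_ge0.
  move=> [a b] [/=]; rewrite !in_itv /= => /andP[a1 a2] /andP[b1 b2] [/=].
  rewrite !in_itv /= => /andP[_ a3] /andP[b3 b4].
  have n0 : 0 <= n%:R :> R by [].
  by case: (ler0P y) Mxy => y0 Mxy; move: a1 a2 b1 b2 a3 b3 b4 n0 y0 Mxy x0; clear; lra.
rewrite -(@ler_pXn2r _ 2)// ?nnegrE ?mulr_ge0 ?normc_ge0 ?(ltW x0) ?(ltW e0)//.
have -> : (x * normc (f (x +i* y))) ^+ 2 = 4 * (x / 2 * normc (f (x +i* y))) ^+ 2 by field.
by move: h; rewrite /e1; clear; lra.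
Qed.

(** Integrating the mean value bound along the line: each point of the plane is
    counted for an interval of [y] of length [u]. *)
Lemma line_le_bergman (h : C -> C) (u : R) : holomorphic_rhp h -> 0 < u ->
  (u%:E * line_sqnorm h u <= 128%:E * bergman_sqnorm h)%E.
Proof.
move=> hh u0; pose d := u / 2.
have d0 : 0 < d by rewrite divr_gt0.
have du : d < u by rewrite /d; lra.
have md := measurable_dens hh.
pose W : set (R * (R * R)) := [set q | - d <= q.2.2 - q.1 <= d].
have mW : measurable W.
  have mg : measurable_fun setT (fun q : R * (R * R) => q.2.2 - q.1).
    apply: measurable_funB; last exact: measurable_fst.
    exact: (measurableT_comp measurable_snd measurable_snd).
  have := mg measurableT _ (measurable_itv `[- d, d]); rewrite setTI.
  by congr measurable; apply/seteqP; split => q /=; rewrite in_itv /=.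
pose K : R * (R * R) -> \bar R := (fun q => dens h q.2) \_ W.
have mK : measurable_fun setT K.
  apply: ((measurable_restrictT _ mW).1).
  apply: measurable_funTS; exact: (measurableT_comp md measurable_snd).
have K0 q : (0 <= K q)%E by apply: erestrict_ge0 => p _; exact: dens_ge0.
have lower y : (((d * normc (h (u +i* y))) ^+ 2)%:E <= 32%:E * \int[leb \x leb]_p K (y, p))%E.
  apply: le_trans (area_bound y hh d0 du) _; rewrite lee_pmul2l// integral_mkcond.
  apply: ge0_le_integral => //.
  - by move=> p _; apply: erestrict_ge0 => q _; exact: dens_ge0.
  - apply: ((measurable_restrictT _ (measurable_box u y d)).1).
    exact: measurable_funTS md.
  - exact: (measurableT_comp mK (pair1_measurable y)).
  move=> [a b] _; rewrite /K !patchE; case: ifPn => [/set_mem [/= _]|_]; last first.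
    by case: ifPn => // _; exact: dens_ge0.
  rewrite in_itv /= => /andP[b1 b2]; rewrite mem_set//=.
  by rewrite /W /=; apply/andP; split; move: b1 b2; clear; lra.
have mFK : measurable_fun setT (fun y => \int[leb \x leb]_p K (y, p))%E.
  exact: (@measurable_fun_fubini_tonelli_F _ _ _ _ _ (@plane_measure R) K mK K0).
have upper : (\int[leb]_y \int[leb \x leb]_p K (y, p) = u%:E * bergman_sqnorm h)%E.
  have -> : (\int[leb]_y \int[leb \x leb]_p K (y, p) =
      \int[leb \x leb]_p \int[leb]_y K (y, p))%E.
    exact: (@fubini_tonelli _ _ _ _ _ leb (@plane_measure R) K mK K0).
  rewrite bergman_dens -ge0_integralZl//; [|by move=> p _; exact: dens_ge0|by rewrite lee_fin ltW].
  apply: eq_integral => p _.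
  transitivity (\int[leb]_(y in `[(p.2 - d)%R, (p.2 + d)%R]) dens h p)%E.
    rewrite [RHS]integral_mkcond; apply: eq_integral => y _; rewrite /K !patchE /W.
    congr (if _ then _ else _); apply/idP/idP => /set_mem /=; rewrite ?in_itv /= => /andP[y1 y2];
      apply/mem_set; rewrite /= ?in_itv /=; apply/andP; split; move: y1 y2; clear; lra.
  rewrite integral_cst; last exact: measurable_itv.
  rewrite [X in (_ * X)%E]lebesgue_measure_itv /= lte_fin ifT; last by move: d0; clear; lra.
  by rewrite -EFinB muleC; congr (_%:E * _)%E; rewrite /d; field.
have mf : measurable_fun setT (fun y => (normc (h (u +i* y)) ^+ 2)%:E).
  by apply/measurable_EFinP; exact: measurable_sqnorm_line.
have main : ((d ^+ 2)%:E * line_sqnorm h u <= 32%:E * (u%:E * bergman_sqnorm h))%E.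
  rewrite -upper -!ge0_integralZl//.
  - apply: ge0_le_integral => //.
    + by move=> y _; rewrite -EFinM lee_fin mulr_ge0 ?sqr_ge0.
    + exact: measurable_funeM.
    + exact: measurable_funeM.
    + by move=> y _; rewrite -EFinM -exprMn; exact: lower.
  - by move=> y _; apply: integral_ge0.
  - by move=> y _; rewrite lee_fin sqr_ge0.
  - by rewrite lee_fin sqr_ge0.
have k0 : 0 < 4 / u by rewrite divr_gt0.
have := lee_wpmul2l _ main; move/(_ (4 / u)%:E); rewrite lee_fin (ltW k0) => /(_ isT).
rewrite !muleA -!EFinM.
have -> : (4 / u * d ^+ 2 = u)%R by rewrite /d; field; rewrite gt_eqF.
by have -> : (4 / u * 32 * u = 128)%R by field; rewrite gt_eqF.
Qed.

(** The Fejer-Riesz inequality: Cauchy's theorem in the first quadrant for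
    [f z * conj (f (conj z))], which is [|f x|^2] on the real axis. *)
Theorem fejer_riesz f (a b : R) : 0 < a -> a <= b ->
  \int[leb]_(x in `[a, b]) normc (f (x +i* 0)) ^+ 2 <= 4 * hb_norm f ^+ 2.
Proof.
move=> a0 ab; pose F (w : C) := f w * (f (w^*))^*.
have pos x : a <= x -> 0 < x by exact: lt_le_trans.
have dF x y : a <= x -> derivable F (x +i* y) 1.
  move=> /pos x0.
  have [D fD] := (derivable_cderivP f (x +i* y)).1 (@hb_holomorphic _ f (x +i* y) x0).
  have [E fE] := (derivable_cderivP f (x -i* y)).1 (@hb_holomorphic _ f (x -i* y) x0).
  by apply/derivable_cderivP; eexists; exact: (cderivM fD (@cderiv_conj _ f (x +i* y) _ fE)).
have cF x y : a <= x -> {for x +i* y, continuous F}.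
  by move=> ax; apply: derivable_continuous; exact: dF.
have cf x y : a <= x -> {for x +i* y, continuous f}.
  by move=> /pos ax; apply: derivable_continuous; exact: (@hb_holomorphic _ f (x +i* y)).
have nF x y : normc (F (x +i* y)) = normc (f (x +i* y)) * normc (f (x -i* y)).
  by rewrite normcM normc_conj.
have FE x : F (x +i* 0) = (normc (f (x +i* 0)) ^+ 2)%:C.
  rewrite /F /= oppr0; case: (f (x +i* 0)) => u v.
  apply/eqP; rewrite eq_complex /= sqr_sqrtr ?addr_ge0 ?sqr_ge0//.
  by apply/andP; split; apply/eqP; ring.
have side x Y : a <= x -> 0 <= Y ->
    normc (cint 0 Y (fun y => F (x +i* y))) <= 2 * hb_norm f ^+ 2.
  move=> ax Y0; have x0 := pos _ ax.
  have cl (s : R) : continuous_on 0 Y (fun y => f (x +i* (s * y))).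
    move=> y _; apply: (@rcont_comp _ (fun y => x +i* (s * y))); last exact: cf.
    apply: (@continuous_lipschitz _ _ `|s|) => t.
    have -> : (x +i* (s * t)) - (x +i* (s * y)) = (0 +i* (s * (t - y))) :> C.
      by apply/eqP; rewrite eq_complex /= subrr mulrBr !eqxx.
    by rewrite normc_ReIm /= expr0n add0r sqrtr_sqr normrM.
  have i2 (s : R) : leb.-integrable `[0, Y] (EFin \o (fun y => normc (f (x +i* (s * y))) ^+ 2)).
    apply: integrable_continuous => t /cl /continuous_normc h.
    exact: (cvgM (h s) (h s)).
  have half (s : R) : `|s| = 1 ->
      \int[leb]_(y in `[0, Y]) normc (f (x +i* (s * y))) ^+ 2 <= hb_norm f ^+ 2.
    move=> s1; rewrite -lee_fin; apply: le_trans (line_le_norm f x0).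
    rewrite /Rintegral fineK; last exact: integrable_fin_num (i2 s).
    have ml : measurable_fun setT (fun y => (normc (f (x +i* y)) ^+ 2)%:E).
      by apply/measurable_EFinP; exact: measurable_sqnorm_line (@hb_holomorphic _ f) x0.
    have ms : measurable_fun setT (fun y => (normc (f (x +i* (s * y))) ^+ 2)%:E).
      apply: (measurableT_comp ml).
      by apply: measurable_funM; [exact: measurable_cst|exact: measurable_id].
    apply: (@le_trans _ _ (\int[leb]_y (normc (f (x +i* (s * y))) ^+ 2)%:E)%E).
      apply: ge0_subset_integral => //.
      by move=> y _; rewrite lee_fin sqr_ge0.
    rewrite /line_sqnorm; move: s1 => /eqP; rewrite eqr_norml => /andP[/orP[]/eqP-> _].
      by under eq_integral do rewrite mul1r.
    rewrite [leRHS]ge0_integral_opp//; last by move=> y; rewrite lee_fin sqr_ge0.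
    by under eq_integral do rewrite mulN1r.
  have := half 1 (normr1 _); have := half (-1) ltac:(by rewrite normrN normr1).
  set J1 := Rintegral _ _ _; set J2 := Rintegral _ _ _ => h1 h2.
  apply: (@le_trans _ _ (2 * (2^-1 * (J2 + J1)))); last by move: h1 h2; clear; lra.
  have -> : 2^-1 * (J2 + J1) = \int[leb]_(y in `[0, Y])
     (2^-1 * (normc (f (x +i* (1 * y))) ^+ 2 + normc (f (x +i* (-1 * y))) ^+ 2)).
    rewrite RintegralZl//; last first.
      apply: integrable_continuous => t ht.
      have c1 := continuous_normc (cl 1 t ht); have c2 := continuous_normc (cl (-1) t ht).
      by apply: cvgD; [exact: (cvgM c1 c1)|exact: (cvgM c2 c2)].
    by rewrite RintegralD.
  apply: normc_cint_le.
  - by move=> y _; apply: vline_continuous; exact: cF.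
  - apply: integrable_continuous => t ht.
    have c1 := continuous_normc (cl 1 t ht); have c2 := continuous_normc (cl (-1) t ht).
    apply: cvgM; first exact: cvg_cst.
    by apply: cvgD; [exact: (cvgM c1 c1)|exact: (cvgM c2 c2)].
  - move=> y _; rewrite nF mul1r mulN1r.
    set p := normc _; set q := normc _; have := sqr_ge0 (p - q); rewrite sqrrB.
    by rewrite mulr2n; clear; lra.
apply/ler_addgt0Pl => e e0.
(* The threshold makes both factors of F small on the top side: one at most 1,
   the other at most e / k. *)
pose k := 2 * (b - a) + 1.
have k0 : 0 < k by rewrite /k; move: ab; clear; lra.
pose e1 := Num.min 1 (e / k) * a.
have m0 : 0 < Num.min 1 (e / k) by rewrite lt_min ltr01 divr_gt0.
have e10 : 0 < e1 by rewrite mulr_gt0.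
have [M MP] := decay_at_infinity f e10.
pose Y := `|M|.
have Y0 : 0 <= Y by exact: normr_ge0.
have := @goursat _ F a b 0 Y ab Y0 (fun x y h _ => dF x y (proj1 (andP h))).
rewrite /rectint.
set B := cint _ _ _; set T := cint _ _ _; set Rt := cint _ _ _; set L := cint _ _ _ => G0.
(* The vertical sides are bounded by the Hardy norm, and the top tends to zero. *)
have nL : normc L <= 2 * hb_norm f ^+ 2 by exact: side.
have nR : normc Rt <= 2 * hb_norm f ^+ 2 by exact: side.
have nT : normc T <= e.
  apply: (@le_trans _ _ (2 * (e / k) * (b - a))).
    apply: normc_cint_bound => // [x|x /andP[ax xb]].
      by move=> /andP[ax _]; apply: hline_continuous; exact: cF.
    have small s : `|s| = Y -> normc (f (x +i* s)) <= Num.min 1 (e / k).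
      move=> sY; have := MP x s (pos _ ax).
      rewrite sY => /(_ ltac:(rewrite (le_trans (ler_norm M))// lerDr ltW// pos//)) h.
      have : a * normc (f (x +i* s)) <= e1.
        by apply: le_trans h; rewrite ler_wpM2r ?normc_ge0.
      by rewrite /e1 mulrC ler_pM2r.
    rewrite nF.
    have s1 := small Y (ger0_norm Y0).
    have s2 := small (- Y) ltac:(by rewrite normrN ger0_norm).
    apply: (@le_trans _ _ (1 * (e / k))); last by rewrite mul1r.
    apply: ler_pM; rewrite ?normc_ge0//.
      by apply: le_trans s1 _; rewrite ge_min lexx.
    by apply: le_trans s2 _; rewrite ge_min lexx orbT.
  have -> : 2 * (e / k) * (b - a) = e / k * (2 * (b - a)) by ring.
  rewrite -[leRHS](divfK (lt0r_neq0 k0)) ler_pM2l ?divr_gt0//.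
  by rewrite /k lerDl.
have ReB : \int[leb]_(x in `[a, b]) normc (f (x +i* 0)) ^+ 2 = complex.Re B.
  by rewrite /B /cint /=; apply: eq_Rintegral => x _; rewrite FE.
rewrite ReB; apply: le_trans (ler_norm _) _; apply: le_trans (le_Re_normc _) _.
have -> : B = T - (0 +i* 1) * (Rt - L) by move: G0 => /eqP; rewrite addr_eq0 => /eqP <-; ring.
apply: le_trans (le_normcD _ _) _; rewrite normcN normcM normc_i mul1r.
have := le_normcD Rt (- L); rewrite normcN.
clearbody B T Rt L; move: nL nR nT; clear; lra.
Qed.

End PointwiseBounds.

(** * Uniform limits of holomorphic functions *)

Section UniformLimits.
Context {R : realType}.
Local Notation C := R[i].
Local Notation leb := (@lebesgue_measure R).
Implicit Types (f g : C -> C).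

(** A second-order error term is what expanding the Cauchy kernel, or the
    exponential series, produces. *)
Lemma cderiv_of_quadratic_error f z D (K d : R) : 0 < d ->
  (forall w, normc (w - z) < d -> normc (f w - f z - D * (w - z)) <= K * normc (w - z) ^+ 2) ->
  has_cderiv f z D.
Proof.
move=> d0 H; exists (fun w => if w == z then D else (f w - f z) / (w - z)); split.
- move=> w; case: eqVneq => [->|wz]; first by rewrite subrr mulr0 addr0.
  by rewrite divfK ?subr_eq0// addrC subrK.
- apply/continuous_normcP => e e0; rewrite eqxx.
  have K0 : 0 < `|K| + 1 by rewrite ltr_wpDl.
  exists (Num.min d (e / (`|K| + 1))); first by rewrite lt_min d0 divr_gt0.
  move=> w; rewrite lt_min => /andP[wd we]; case: eqVneq => [_|wz].
    by rewrite subrr normc0.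
  have wz0 : w - z != 0 by rewrite subr_eq0.
  have -> : (f w - f z) / (w - z) - D = (f w - f z - D * (w - z)) / (w - z) by field.
  rewrite normcM normcV ltr_pdivrMr ?normc_gt0//.
  apply: le_lt_trans (H w wd) _; rewrite expr2 mulrA ltr_pM2r ?normc_gt0//.
  move: we; rewrite ltr_pdivlMr// mulrC; apply: le_lt_trans.
  by apply: ler_wpM2r; [exact: normc_ge0|rewrite (le_trans (ler_norm _))// lerDl].
- by rewrite eqxx.
Qed.

Lemma normc_2pi : normc (0 +i* (2 * pi) : C) = 2 * pi.
Proof. by rewrite normc_ReIm /= expr0n add0r sqrtr_sqr ger0_norm// mulr_ge0// pi_ge0. Qed.

Lemma boundary_far (x0 y0 r x y : R) :
  0 <= r ->
  (x == x0 - r) || (x == x0 + r) || (y == y0 - r) || (y == y0 + r) ->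
  r <= normc ((x +i* y) - (x0 +i* y0)).
Proof.
move=> r0 bd.
have re := le_Re_normc ((x +i* y) - (x0 +i* y0)).
have im := le_Im_normc ((x +i* y) - (x0 +i* y0)).
move: re im => /= re im.
case/orP: bd => [/orP[/orP[]|]|] /eqP e.
- by apply: le_trans re; rewrite e addrAC subrr add0r normrN ger0_norm.
- by apply: le_trans re; rewrite e addrAC subrr add0r ger0_norm.
- by apply: le_trans im; rewrite e addrAC subrr add0r normrN ger0_norm.
- by apply: le_trans im; rewrite e addrAC subrr add0r ger0_norm.
Qed.

Lemma boundary_continuousM f g a b c d : boundary_continuous f a b c d ->
  boundary_continuous g a b c d -> boundary_continuous (fun w => f w * g w) a b c d.
Proof.
move=> [f1 f2 f3 f4] [g1 g2 g3 g4].
have cM (H K : R -> C) t : {for t, continuous H} -> {for t, continuous K} ->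
    {for t, continuous (fun s => H s * K s)}.
  by move=> cH cK; exact: (@cvgM _ _ (nbhs t) _ H K _ _ cH cK).
by split => t ht; [exact: cM (f1 t ht) (g1 t ht)|exact: cM (f2 t ht) (g2 t ht)|
  exact: cM (f3 t ht) (g3 t ht)|exact: cM (f4 t ht) (g4 t ht)].
Qed.

Lemma boundary_continuousP f a b c d : a <= b -> c <= d ->
  (forall x y, a <= x <= b -> c <= y <= d ->
     (x == a) || (x == b) || (y == c) || (y == d) -> {for x +i* y, continuous f}) ->
  boundary_continuous f a b c d.
Proof.
move=> ab cd H; split => t tab; [apply: hline_continuous|apply: hline_continuous|
  apply: vline_continuous|apply: vline_continuous]; apply: H;
  by rewrite ?tab ?lexx ?ab ?cd ?eqxx ?orbT.
Qed.

(** A Cauchy integral depends holomorphically on its pole: its difference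
    quotients are computed by expanding the kernel to second order. *)
Lemma cauchy_integral_derivable f (x0 y0 r : R) : 0 < r ->
  (forall x y, x0 - r <= x <= x0 + r -> y0 - r <= y <= y0 + r -> {for x +i* y, continuous f}) ->
  (forall z, normc (z - (x0 +i* y0)) < r / 2 ->
     rectint (fun w => f w / (w - z)) (x0 - r) (x0 + r) (y0 - r) (y0 + r) =
     (0 +i* (2 * pi)) * f z) ->
  derivable f (x0 +i* y0) 1.
Proof.
move=> r0 cf cauchy; set z0 := x0 +i* y0.
have xx : x0 - r <= x0 + r by lra.
have yy : y0 - r <= y0 + r by lra.
pose Q F := rectint F (x0 - r) (x0 + r) (y0 - r) (y0 + r).
pose bc F := boundary_continuous F (x0 - r) (x0 + r) (y0 - r) (y0 + r).
have c0 : (0 +i* (2 * pi) : C) != 0.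
  by rewrite eq_complex /= eqxx /= mulf_neq0// gt_eqF// pi_gt0.
have far x y : x0 - r <= x <= x0 + r -> y0 - r <= y <= y0 + r ->
  (x == x0 - r) || (x == x0 + r) || (y == y0 - r) || (y == y0 + r) ->
  r <= normc ((x +i* y) - z0) by move=> _ _; exact: boundary_far (ltW r0).
have bf : bc f by apply: (boundary_continuousP xx yy) => x y hx hy _; exact: cf.
have [M MP] : exists M, forall x y, x0 - r <= x <= x0 + r -> y0 - r <= y <= y0 + r ->
  (x == x0 - r) || (x == x0 + r) || (y == y0 - r) || (y == y0 + r) ->
  normc (f (x +i* y)) <= M.
  have bd (F : R -> C) a b : a <= b -> continuous_on a b F ->
      exists M, forall t, a <= t <= b -> normc (F t) <= M.
    move=> ab cF; have cn : {within `[a, b], continuous (fun t => normc (F t))}.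
      apply: continuous_in_subspaceT => t /set_mem /=; rewrite in_itv /= => tab.
      exact: continuous_normc (cF t tab).
    have [c _ cP] := EVT_max ab cn.
    by exists (normc (F c)) => t tab; apply: cP; rewrite in_itv.
  case: bf => f1 f2 f3 f4.
  have [M1 P1] := bd _ _ _ xx f1; have [M2 P2] := bd _ _ _ xx f2.
  have [M3 P3] := bd _ _ _ yy f3; have [M4 P4] := bd _ _ _ yy f4.
  exists (Num.max (Num.max M1 M2) (Num.max M3 M4)) => x y hx hy.
  rewrite !le_max => /orP[/orP[/orP[]|]|] /eqP e; rewrite e.
  - by rewrite P3// orbT.
  - by rewrite P4// !orbT.
  - by rewrite P1.
  - by rewrite P2// orbT.
have inv_c z : normc (z - z0) < r / 2 -> bc (fun w => (w - z)^-1).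
  move=> hz; apply: (boundary_continuousP xx yy) => x y hx hy hb.
  apply: ccontV; last by apply: ccontB; [exact: ccont_id|exact: ccont_cst].
  rewrite -normc_gt0; have h1 := far x y hx hy hb.
  have := ler_normcB ((x +i* y) - z0) (z - z0).
  have -> : (x +i* y) - z0 - (z - z0) = (x +i* y) - z by ring.
  by move: r0 hz h1; clear; lra.
have hz0 : normc (z0 - z0) < r / 2 by rewrite subrr normc0 divr_gt0.
have i0 := inv_c _ hz0.
pose G0 w := f w * (w - z0)^-1.
pose G1 w := G0 w * (w - z0)^-1.
have b0 : bc G0 := boundary_continuousM bf i0.
have b1 : bc G1 := boundary_continuousM b0 i0.
(* The derivative is the Cauchy integral with the square of the kernel. *)
pose D := (0 +i* (2 * pi))^-1 * Q G1.
apply/derivable_cderivP; exists D.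
have M0 : 0 <= M.
  by apply: le_trans (MP (x0 - r) y0 _ _ _); rewrite ?normc_ge0 ?lexx ?xx ?eqxx//;
    apply/andP; split; move: r0; clear; lra.
pose K := (2 * pi)^-1 * (4 * (M / r * r^-1 * (r / 2)^-1) * ((x0 + r - (x0 - r)) + (y0 + r - (y0 - r)))).
apply: (@cderiv_of_quadratic_error _ _ _ K (r / 2)); first by rewrite divr_gt0.
move=> z hz; have iz := inv_c _ hz.
pose G2 w := G1 w * (w - z)^-1.
have b2 : bc G2 := boundary_continuousM b1 iz.
have nz x y : x0 - r <= x <= x0 + r -> y0 - r <= y <= y0 + r ->
    (x == x0 - r) || (x == x0 + r) || (y == y0 - r) || (y == y0 + r) ->
    r <= normc ((x +i* y) - z0) /\ r / 2 <= normc ((x +i* y) - z).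
  move=> hx hy hb; have h1 := far x y hx hy hb; split => //.
  have := ler_normcB ((x +i* y) - z0) (z - z0).
  have -> : (x +i* y) - z0 - (z - z0) = (x +i* y) - z by ring.
  by move: hz h1; clear; lra.
have cz := cauchy z hz; have cz0 := cauchy z0 hz0.
have bcst (k : C) : bc (fun=> k).
  by apply: (boundary_continuousP xx yy) => *; exact: ccont_cst.
have bz1 : bc (fun w => (z - z0) * G1 w) := boundary_continuousM (bcst _) b1.
have bz2 : bc (fun w => (z - z0) ^+ 2 * G2 w) := boundary_continuousM (bcst _) b2.
have expand : Q (fun w => f w / (w - z)) = Q G0 + (z - z0) * Q G1 + (z - z0) ^+ 2 * Q G2.
  rewrite /Q -(rectintZ _ b1) -(rectintZ _ b2) -(rectintD b0 bz1).
  have b01 : bc (fun w => G0 w + (z - z0) * G1 w).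
    case: b0 => f1 f2 f3 f4; case: bz1 => g1 g2 g3 g4.
    have cD (H L : R -> C) t : {for t, continuous H} -> {for t, continuous L} ->
        {for t, continuous (fun s => H s + L s)}.
      by move=> cH cL; exact: (@cvgD _ _ _ (nbhs t) _ H L _ _ cH cL).
    by split => t ht; [exact: cD (f1 t ht) (g1 t ht)|exact: cD (f2 t ht) (g2 t ht)|
      exact: cD (f3 t ht) (g3 t ht)|exact: cD (f4 t ht) (g4 t ht)].
  rewrite -(rectintD b01 bz2); apply: (eq_rectint xx yy) => x y hx hy hb.
  have [h1 h2] := nz x y hx hy hb.
  rewrite /G2 /G1 /G0; set w := x +i* y in h1 h2 *.
  have n1 : w - z0 != 0 by rewrite -normc_gt0 (lt_le_trans r0 h1).
  have n2 : w - z != 0 by rewrite -normc_gt0 (lt_le_trans _ h2)// divr_gt0.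
  by field; rewrite n1 n2.
have -> : f z - f z0 - D * (z - z0) = (0 +i* (2 * pi))^-1 * ((z - z0) ^+ 2 * Q G2).
  have e1 : (0 +i* (2 * pi)) * f z = Q G0 + (z - z0) * Q G1 + (z - z0) ^+ 2 * Q G2.
    by rewrite -expand; exact/esym.
  have e0 : (0 +i* (2 * pi)) * f z0 = Q G0 by exact/esym.
  have eD : (0 +i* (2 * pi)) * D = Q G1 by rewrite /D mulrA divff// mul1r.
  apply: (mulfI c0); rewrite mulVKf// 2!mulrBr e1 e0 (mulrA _ D) eD.
  by move: (Q G0) (Q G1) (Q G2) => q0 q1 q2; ring.
rewrite normcM normcV normc_2pi normcM normcX /K -[leRHS]mulrA.
apply: ler_wpM2l; first by rewrite invr_ge0 mulr_ge0// pi_ge0.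
rewrite [leRHS]mulrC; apply: ler_wpM2l; first by rewrite exprn_ge0// normc_ge0.
apply: (normc_rectint_bound xx yy b2) => x y hx hy hb.
have [h1 h2] := nz x y hx hy hb.
rewrite /G2 /G1 /G0 !normcM !normcV.
have p1 : 0 < normc ((x +i* y) - z0) by exact: lt_le_trans h1.
have r2 : 0 < r / 2 by rewrite divr_gt0.
have p2 : 0 < normc ((x +i* y) - z) by exact: lt_le_trans h2.
apply: ler_pM; rewrite ?mulr_ge0 ?invr_ge0 ?normc_ge0//; last by rewrite lef_pV2 ?posrE.
apply: ler_pM; rewrite ?mulr_ge0 ?invr_ge0 ?normc_ge0//; last by rewrite lef_pV2 ?posrE.
by apply: ler_pM; rewrite ?invr_ge0 ?normc_ge0//; [exact: MP|rewrite lef_pV2 ?posrE].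
Qed.

(** Weierstrass: Cauchy's formula passes to uniform limits. *)
Theorem holomorphic_limit (fn : nat -> C -> C) f :
  (forall n, holomorphic_rhp (fn n)) ->
  (forall a e, 0 < a -> 0 < e -> exists N, forall n, (N <= n)%N ->
     forall z, a <= complex.Re z -> normc (fn n z - f z) <= e) ->
  holomorphic_rhp f.
Proof.
move=> hfn unif [x0 y0] x00; have {}x00 : 0 < x0 by [].
pose r := x0 / 4; have r0 : 0 < r by rewrite divr_gt0.
have cf z : x0 / 2 <= complex.Re z -> {for z, continuous f}.
  move=> hz; apply/continuous_normcP => e e0.
  have a0 : 0 < x0 / 4 by rewrite divr_gt0.
  have e30 : 0 < e / 4 by rewrite divr_gt0.
  have [N NP] := unif _ _ a0 e30.
  have cN : {for z, continuous (fn N)}.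
    apply: derivable_continuous; apply: hfn; rewrite /half_plane /=.
    by move: hz x00; clear; lra.
  have [d d0 dP] := (continuous_normcP _ _).1 cN _ e30.
  exists (Num.min d (x0 / 4)); first by rewrite lt_min d0.
  move=> w; rewrite lt_min => /andP[wd wx].
  have hw : x0 / 4 <= complex.Re w.
    have := le_lt_trans (le_Re_normc (w - z)) wx; rewrite raddfB /= ltr_norml => /andP[h1 _].
    by move: hz h1; clear; lra.
  have hz' : x0 / 4 <= complex.Re z by move: hz x00; clear; lra.
  have b1 := NP N (leqnn _) w hw; have b2 := NP N (leqnn _) z hz'; have b3 := dP w wd.
  have -> : f w - f z = (fn N w - fn N z) - (fn N w - f w) + (fn N z - f z) by ring.
  apply: le_lt_trans (le_normcD _ _) _.
  have := le_normcD (fn N w - fn N z) (- (fn N w - f w)); rewrite normcN.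
  by move: b1 b2 b3 e0; clear; lra.
have xx : x0 - r <= x0 + r by move: r0; clear; lra.
have yy : y0 - r <= y0 + r by move: r0; clear; lra.
have inr x : x0 - r <= x -> x0 / 2 <= x by rewrite /r; move: x00; clear; lra.
apply: (@cauchy_integral_derivable f x0 y0 r r0).
  by move=> x y /andP[hx _] _; apply: cf; exact: inr.
move=> z hz; have r20 : 0 < r / 2 by rewrite divr_gt0.
have far x y : x0 - r <= x <= x0 + r -> y0 - r <= y <= y0 + r ->
    (x == x0 - r) || (x == x0 + r) || (y == y0 - r) || (y == y0 + r) ->
    r / 2 <= normc ((x +i* y) - z).
  move=> hx hy hb; have h1 := boundary_far (ltW r0) hb.
  have := ler_normcB ((x +i* y) - (x0 +i* y0)) (z - (x0 +i* y0)).
  have -> : (x +i* y) - (x0 +i* y0) - (z - (x0 +i* y0)) = (x +i* y) - z by ring.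
  by move: hz h1; clear; lra.
have bi : boundary_continuous (fun w => (w - z)^-1) (x0 - r) (x0 + r) (y0 - r) (y0 + r).
  apply: (boundary_continuousP xx yy) => x y hx hy hb.
  apply: ccontV; last by apply: ccontB; [exact: ccont_id|exact: ccont_cst].
  by rewrite -normc_gt0 (lt_le_trans r20)// far.
have bf : boundary_continuous f (x0 - r) (x0 + r) (y0 - r) (y0 + r).
  by apply: (boundary_continuousP xx yy) => x y /andP[hx _] _ _; apply: cf; exact: inr.
have dfn n x y : x0 - r <= x <= x0 + r -> y0 - r <= y <= y0 + r -> derivable (fn n) (x +i* y) 1.
  move=> /andP[hx _] _; apply: hfn; rewrite /half_plane /=.
  by apply: lt_le_trans (inr _ hx); rewrite divr_gt0.
have bfn n : boundary_continuous (fn n) (x0 - r) (x0 + r) (y0 - r) (y0 + r).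
  by apply: (boundary_continuousP xx yy) => x y hx hy _; apply: derivable_continuous; exact: dfn.
have bcst (k : C) : boundary_continuous (fun=> k) (x0 - r) (x0 + r) (y0 - r) (y0 + r).
  by apply: (boundary_continuousP xx yy) => *; exact: ccont_cst.
have [zx zy] : x0 - r < complex.Re z < x0 + r /\ y0 - r < complex.Im z < y0 + r.
  have h1 := le_lt_trans (le_Re_normc _) hz; have h2 := le_lt_trans (le_Im_normc _) hz.
  move: h1 h2; rewrite !raddfB /= !ltr_norml => /andP[h1 h2] /andP[h3 h4].
  by split; apply/andP; split; move: h1 h2 h3 h4 r0; clear; lra.
have zE : complex.Re z +i* complex.Im z = z by case: (z).
apply/eqP; rewrite -subr_eq0 -normc_eq0 eq_le normc_ge0 andbT.
pose P := (x0 + r - (x0 - r)) + (y0 + r - (y0 - r)).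
pose K := 4 * (r / 2)^-1 * P + 2 * pi.
have P0 : 0 <= P by rewrite /P; move: r0; clear; lra.
have K0 : 0 < K + 1.
  by rewrite ltr_wpDl// addr_ge0// mulr_ge0 ?pi_ge0// mulr_ge0// invr_ge0 ltW.
apply/ler_addgt0Pl => e e0; rewrite addr0.
have e10 : 0 < e / (K + 1) by rewrite divr_gt0.
have [N NP] := unif _ _ (divr_gt0 x00 (ltr0n _ 2)) e10.
have := @cauchy_formula _ (fn N) _ _ _ _ _ _ zx zy (dfn N).
rewrite zE => CF.
have hzh : x0 / 2 <= complex.Re z by case/andP: zx => /ltW/inr.
have NPz := NP N (leqnn _) z hzh.
pose Q F := rectint F (x0 - r) (x0 + r) (y0 - r) (y0 + r).
pose E w := f w * (w - z)^-1 + -1 * (fn N w * (w - z)^-1).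
have b1 := boundary_continuousM bf bi.
have b2 := boundary_continuousM (bfn N) bi.
have b3 := boundary_continuousM (bcst (-1)) b2.
have EE : Q E = Q (fun w => f w / (w - z)) - (0 +i* (2 * pi)) * fn N z.
  by rewrite /Q (rectintD b1 b3) (rectintZ _ b2) CF mulN1r.
have bE : boundary_continuous E (x0 - r) (x0 + r) (y0 - r) (y0 + r).
  case: b1 => f1 f2 f3 f4; case: b3 => g1 g2 g3 g4.
  have cD (H L : R -> C) t : {for t, continuous H} -> {for t, continuous L} ->
      {for t, continuous (fun s => H s + L s)}.
    by move=> cH cL; exact: (@cvgD _ _ _ (nbhs t) _ H L _ _ cH cL).
  by split => t ht; [exact: cD (f1 t ht) (g1 t ht)|exact: cD (f2 t ht) (g2 t ht)|
    exact: cD (f3 t ht) (g3 t ht)|exact: cD (f4 t ht) (g4 t ht)].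
have nE : normc (Q E) <= 4 * (e / (K + 1) * (r / 2)^-1) * P.
  apply: (normc_rectint_bound xx yy bE) => x y hx hy hb.
  have -> : E (x +i* y) = - (fn N (x +i* y) - f (x +i* y)) / ((x +i* y) - z).
    by rewrite /E; ring.
  rewrite normcM normcN normcV; apply: ler_pM; rewrite ?invr_ge0 ?normc_ge0//.
    by apply: NP => //=; apply: inr; case/andP: hx.
  have h := far x y hx hy hb.
  by rewrite lef_pV2 ?posrE// (lt_le_trans r20 h).
have -> : rectint (fun w => f w / (w - z)) (x0 - r) (x0 + r) (y0 - r) (y0 + r) -
    (0 +i* (2 * pi)) * f z = Q E + (0 +i* (2 * pi)) * (fn N z - f z).
  by rewrite EE /Q mulrBr; ring.
apply: le_trans (le_normcD _ _) _; rewrite normcM normc_2pi.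
have h2 : 2 * pi * normc (fn N z - f z) <= 2 * pi * (e / (K + 1)).
  by rewrite ler_wpM2l// mulr_ge0// pi_ge0.
apply: le_trans (lerD nE h2) _.
have -> : 4 * (e / (K + 1) / (r / 2)) * P + 2 * pi * (e / (K + 1)) = e / (K + 1) * K.
  by rewrite /K; ring.
rewrite mulrAC ler_pdivrMr// ler_pM2l//; clear; lra.
Qed.

End UniformLimits.

(** * Completeness of the space *)

Section Completeness.
Context {R : realType}.
Local Notation C := R[i].
Local Notation leb := (@lebesgue_measure R).
Local Notation X := (hardy_bergman R).

Lemma real_cauchy_cvg (u : nat -> R) :
  (forall e, 0 < e -> exists N, forall m n, (N <= m)%N -> (N <= n)%N -> `|u m - u n| <= e) ->
  exists l : R, u @ \oo --> l.
Proof.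
move=> H; suff /cauchy_cvgP : cauchy (u @ \oo) by move=> h; exists (lim (u @ \oo)).
apply/cauchy_ballP => e e0.
have e20 : 0 < e / 2 by rewrite divr_gt0.
have [N NP] := H _ e20.
exists ([set x | exists2 n, (N <= n)%N & x = u n], [set x | exists2 n, (N <= n)%N & x = u n]).
  by split => /=; exists N => // n /= Nn; exists n.
move=> [x y] [/= [m Nm ->] [n Nn ->]]; rewrite /ball /=.
by apply: le_lt_trans (NP m n Nm Nn) _; move: e0; clear; lra.
Qed.

(** Fatou's lemma in the form used for completeness of the space. *)
Lemma fatou_bound d (T : measurableType d) (mu : {measure set T -> \bar R}) (D : set T)
    (hn : nat -> T -> R) (h : T -> R) (B : \bar R) :
  measurable D -> (forall n, measurable_fun D (hn n)) -> (forall n x, 0 <= hn n x) ->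
  (forall x, D x -> hn n x @[n --> \oo] --> h x) ->
  (forall n, \int[mu]_(x in D) (hn n x)%:E <= B)%E ->
  (\int[mu]_(x in D) (h x)%:E <= B)%E.
Proof.
move=> mD mhn hn0 cvg_h le_B.
have m n : measurable_fun D (fun x => (hn n x)%:E) by apply/measurable_EFinP.
have := @fatou _ _ _ mu D mD (fun n x => (hn n x)%:E) m (fun n x _ => ltac:(by rewrite lee_fin)).
have -> : (\int[mu]_(x in D) limn_einf (fun n => (hn n x)%:E) = \int[mu]_(x in D) (h x)%:E)%E.
  apply: eq_integral => x /set_mem Dx.
  have c : (hn n x)%:E @[n --> \oo] --> (h x)%:E.
    by apply: cvg_EFin; [exact: nearW|exact: cvg_h].
  rewrite is_cvg_limn_einfE; last by apply/cvg_ex; exists (h x)%:E.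
  exact: cvg_lim c.
move=> H; apply: le_trans H _; rewrite limn_einf_lim.
apply: lime_le; first exact: is_cvg_einfs.
apply: nearW => n; apply: le_trans (le_B n).
by apply: ereal_inf_lbound; exists n => /=.
Qed.

Lemma hb_of_fun (h : C -> C) : (forall z, ~ half_plane z -> h z = 0) ->
  holomorphic_rhp h -> (hardy_sqnorm h < +oo)%E -> (bergman_sqnorm h < +oo)%E ->
  exists f : X, forall z, f z = h z.
Proof.
move=> h0 hh Hh Bh; have hm : h \in hardy_bergman_pred by apply/mem_set; split.
by exists (HardyBergman hm).
Qed.

Lemma hb_outside (f : X) z : ~ half_plane z -> f z = 0.
Proof. by have /set_mem[f0 _ _ _] := valP f; exact: f0. Qed.

Lemma hb_eq (f g : X) : (forall z, half_plane z -> f z = g z) -> f = g.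
Proof.
move=> fg; apply/val_inj/funext => z /=.
by have [/fg//|nz] := pselect (half_plane z); rewrite !hb_outside.
Qed.

Lemma hbB (f g : X) z : (f - g) z = f z - g z. Proof. by []. Qed.
Lemma hbD (f g : X) z : (f + g) z = f z + g z. Proof. by []. Qed.
Lemma hbZ (a : C) (f : X) z : (a *: f) z = a * f z. Proof. by []. Qed.

Lemma hb_norm0 : hb_norm (0 : X) = 0.
Proof.
have := hb_normZ 0 (0 : X); rewrite normc0 mul0r => <-.
by rewrite scaler0.
Qed.

Lemma hb_normN (f : X) : hb_norm (- f) = hb_norm f.
Proof. by rewrite -scaleN1r hb_normZ normcN normc1 mul1r. Qed.

Lemma hb_normB (f g : X) : hb_norm (f - g) = hb_norm (g - f).
Proof. by rewrite -hb_normN opprB. Qed.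

Lemma hb_norm_le (f : X) (c : R) : 0 <= c ->
  (hardy_sqnorm f <= (c ^+ 2)%:E)%E -> (bergman_sqnorm f <= (c ^+ 2)%:E)%E ->
  hb_norm f <= 2 * c.
Proof.
move=> c0 H B; rewrite -(@ler_pXn2r _ 2)// ?nnegrE ?hb_norm_ge0 ?mulr_ge0//.
rewrite -lee_fin -hb_sqnorm_fin; apply: le_trans (leeD H B) _.
by rewrite -EFinD lee_fin exprMn; have := sqr_ge0 c; clear; lra.
Qed.

(** A Cauchy sequence converges uniformly on smaller half-planes, to a holomorphic
    function by Weierstrass; Fatou's lemma gives the convergence in norm, both on
    vertical lines and for the area. *)
Theorem hb_complete (u : nat -> X) :
  (forall e, 0 < e -> exists N, forall m n, (N <= m)%N -> (N <= n)%N ->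
     hb_norm (u m - u n) <= e) ->
  exists l : X, forall e, 0 < e -> exists N, forall n, (N <= n)%N -> hb_norm (u n - l) <= e.
Proof.
move=> cu.
have bound (f : X) z : half_plane z -> complex.Re z * normc (f z) <= 12 * hb_norm f.
  by case: z => x y hz; exact: pointwise_bound.
have cuz z : half_plane z -> forall e, 0 < e -> exists N, forall m n,
    (N <= m)%N -> (N <= n)%N -> normc (u m z - u n z) <= e.
  move=> hz e e0; have z0 : 0 < complex.Re z by [].
  have e'0 : 0 < complex.Re z * e / 12 by rewrite divr_gt0// mulr_gt0.
  have [N NP] := cu _ e'0; exists N => m n Nm Nn.
  rewrite -(ler_pM2l z0); apply: le_trans (bound (u m - u n) z hz) _.
  by rewrite -ler_pdivlMl// mulrC NP.
have lims z : exists l : C, half_plane z ->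
    (complex.Re (u n z) @[n --> \oo] --> complex.Re l) /\
    (complex.Im (u n z) @[n --> \oo] --> complex.Im l).
  have [hz|] := pselect (half_plane z); last by exists 0.
  have [a aP] : exists a : R, complex.Re (u n z) @[n --> \oo] --> a.
    apply: real_cauchy_cvg => e /(cuz z hz)[N NP]; exists N => m n Nm Nn.
    by rewrite -raddfB; apply: le_trans (le_Re_normc _) _; exact: NP.
  have [b bP] : exists b : R, complex.Im (u n z) @[n --> \oo] --> b.
    apply: real_cauchy_cvg => e /(cuz z hz)[N NP]; exists N => m n Nm Nn.
    by rewrite -raddfB; apply: le_trans (le_Im_normc _) _; exact: NP.
  by exists (a +i* b).
have [l0 l0P] := choice lims.
pose l z := if 0 < complex.Re z then l0 z else 0.
have lE z : half_plane z -> l z = l0 z by rewrite /l => ->.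
have cvg_dist (g : C) z : half_plane z -> normc (u n z - g) @[n --> \oo] --> normc (l z - g).
  move=> hz; rewrite lE//; have [cR cI] := l0P z hz.
  rewrite normc_ReIm !raddfB /=.
  under eq_fun do rewrite normc_ReIm !raddfB /=.
  apply: (@continuous_cvg _ _ _ _ _ _ Num.sqrt); first exact: sqrt_continuous.
  have c1 : (complex.Re (u n z) - complex.Re g) @[n --> \oo] --> complex.Re (l0 z) - complex.Re g.
    by apply: cvgB => //; exact: cvg_cst.
  have c2 : (complex.Im (u n z) - complex.Im g) @[n --> \oo] --> complex.Im (l0 z) - complex.Im g.
    by apply: cvgB => //; exact: cvg_cst.
  by apply: cvgD; [exact: (cvgM c1 c1)|exact: (cvgM c2 c2)].
have unif a e : 0 < a -> 0 < e -> exists N, forall n, (N <= n)%N ->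
    forall z, a <= complex.Re z -> normc (u n z - l z) <= e.
  move=> a0 e0; have e'0 : 0 < a * e / 12 by rewrite divr_gt0// mulr_gt0.
  have [N NP] := cu _ e'0; exists N => n Nn z az.
  have z0 : 0 < complex.Re z by exact: lt_le_trans az.
  rewrite normcB; apply: (ler_cvg_to (cvg_dist (u n z) z z0) (@cvg_cst _ e nat \oo _)).
  exists N => // m /= Nm.
  have h : a * normc (u m z - u n z) <= 12 * hb_norm (u m - u n).
    apply: le_trans (bound (u m - u n) z z0).
    by rewrite ler_wpM2r ?normc_ge0.
  have h2 := NP m n Nm Nn; rewrite -(ler_pM2l a0).
  by move: h h2; clear; lra.
have hl : holomorphic_rhp l.
  by apply: (@holomorphic_limit _ (fun n => u n : C -> C)) => // n; exact: hb_holomorphic.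
have close e : 0 < e -> exists N, forall m, (N <= m)%N ->
    (hardy_sqnorm (fun z => (l z - u m z)%R) <= (e ^+ 2)%:E)%E /\
    (bergman_sqnorm (fun z => (l z - u m z)%R) <= (e ^+ 2)%:E)%E.
  move=> e0; have [N NP] := cu _ e0; exists N => m Nm.
  have hN n : hb_norm (u (N + n)%N - u m) ^+ 2 <= e ^+ 2.
    by rewrite lerXn2r ?nnegrE ?hb_norm_ge0 ?(ltW e0)//; apply: NP; rewrite ?leq_addr.
  have cvgN z : half_plane z ->
      normc ((u (N + n)%N - u m) z) ^+ 2 @[n --> \oo] --> normc (l z - u m z) ^+ 2.
    move=> hz; have c := cvg_dist (u m z) z hz.
    have c' : normc (u (N + n)%N z - u m z) @[n --> \oo] --> normc (l z - u m z).
      by move: c; rewrite -(cvg_shiftn N); under eq_fun do rewrite addnC.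
    exact: (cvgM c' c').
  split.
    apply: ge_ereal_sup => _ [x x0 <-].
    apply: (@fatou_bound _ _ leb setT (fun n y => normc ((u (N + n)%N - u m) (x +i* y)) ^+ 2)).
    - exact: measurableT.
    - by move=> n; exact: (measurable_sqnorm_line (@hb_holomorphic _ (u (N + n)%N - u m)) x0).
    - by move=> n y; exact: sqr_ge0.
    - by move=> y _; exact: cvgN.
    - move=> n; apply: (@le_trans _ _ (hb_norm (u (N + n)%N - u m) ^+ 2)%:E).
        exact: line_le_norm.
      by rewrite lee_fin.
  apply: (@fatou_bound _ _ (leb \x leb)%E [set p : R * R | 0 < p.1]
    (fun n p => normc ((u (N + n)%N - u m) (p.1 +i* p.2)) ^+ 2)).
  - exact: measurable_right_p.
  - by move=> n; exact: (measurable_sqnorm_plane (@hb_holomorphic _ (u (N + n)%N - u m))).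
  - by move=> n y; exact: sqr_ge0.
  - by move=> [x y] /= x0; exact: cvgN.
  - move=> n; apply: (@le_trans _ _ (hb_norm (u (N + n)%N - u m) ^+ 2)%:E).
      exact: bergman_le_norm.
    by rewrite lee_fin.
have [N1 N1P] := close 1 ltr01.
have [H1 B1] := N1P N1 (leqnn _).
have l0out z : ~ half_plane z -> l z = 0.
  by rewrite /half_plane /= /l => /negP/negbTE ->.
have [g gE] : exists g : X, forall z, g z = l z - u N1 z.
  apply: hb_of_fun.
  - by move=> z nz; rewrite l0out// hb_outside// subrr.
  - have := holomorphic_rhpD hl (@holomorphic_rhpZ _ (-1) _ (@hb_holomorphic _ (u N1))).
    by congr holomorphic_rhp; apply/funext => z /=; rewrite /GRing.scale /= -[LHS]/(l z + -1 * u N1 z) mulN1r.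
  - by apply: le_lt_trans H1 _; rewrite ltry.
  - by apply: le_lt_trans B1 _; rewrite ltry.
exists (g + u N1) => e e0; have e20 : 0 < e / 2 by rewrite divr_gt0.
have [N NP] := close _ e20; exists N => n Nn.
have [Hn Bn] := NP n Nn.
have fE : (g + u N1 - u n : X) = (fun z => l z - u n z) :> (C -> C).
  by apply/funext => z; rewrite hbB hbD gE subrK.
rewrite hb_normB (_ : e = 2 * (e / 2)); last by field.
by apply: hb_norm_le; rewrite ?fE// ltW.
Qed.

End Completeness.

(** * Bounded operators, Fredholm relations and Neumann series *)

Section OperatorTheory.
Context {R : realType}.
Local Notation C := R[i].
Local Notation X := (hardy_bergman R).
Implicit Types (T : {linear X -> X}) (A : {linear X -> X}) (f g h : X).

Lemma hb_normE f : `|f| = (hb_norm f)%:C. Proof. by []. Qed.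

Lemma hb_norm_eq0P f : (hb_norm f == 0) = (f == 0).
Proof. by apply/eqP/eqP => [/hb_norm_eq0|->]; rewrite ?hb_norm0. Qed.

Lemma bounded_continuous A (c : R) :
  (forall f, hb_norm (A f) <= c * hb_norm f) -> continuous A.
Proof.
move=> H f; apply: (@cvgrPdist_lt _ _ _ (nbhs f) _ A (A f)).2 => e.
rewrite ltcE /= => /andP[/eqP eI e0].
have c0 : 0 < `|c| + 1 by rewrite ltr_wpDl.
have d0 : 0 < complex.Re e / (`|c| + 1) by rewrite divr_gt0.
apply: (nbhs_normP f _).2; exists (complex.Re e / (`|c| + 1))%:C => /=; first by rewrite ltcR.
move=> g; rewrite /ball_ /= hb_normE ltcR => fg.
have -> : e = (complex.Re e)%:C by case: (e) eI => a b /= ->.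
rewrite -linearB hb_normE ltcR; apply: le_lt_trans (H _) _.
move: fg; rewrite ltr_pdivlMr// mulrC; apply: le_lt_trans.
by apply: ler_wpM2r; [exact: hb_norm_ge0|rewrite (le_trans (ler_norm _))// lerDl].
Qed.

Lemma continuous_bounded A : continuous A ->
  exists2 c, 0 < c & forall f, hb_norm (A f) <= c * hb_norm f.
Proof.
move=> /(_ 0) cA.
have e10 : 0 < (1 : R)%:C :> C by rewrite ltcR.
have [d /=] := (nbhs_normP (0 : X) _).1 ((@cvgrPdist_lt _ _ _ (nbhs (0 : X)) _ A (A 0)).1 cA _ e10).
rewrite ltcE /= => /andP[/eqP dI d0] dP.
have dE : d = (complex.Re d)%:C by case: (d) dI => a b /= ->.
pose k := complex.Re d / 2; have k0 : 0 < k by rewrite divr_gt0.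
exists k^-1; first by rewrite invr_gt0.
move=> f; have [->|f0] := eqVneq f 0; first by rewrite linear0 hb_norm0 mulr0.
have nf : 0 < hb_norm f by rewrite lt_def hb_norm_ge0 hb_norm_eq0P f0.
pose s := k / hb_norm f; have s0 : 0 < s by rewrite divr_gt0.
have ns : normc s%:C = s by rewrite normc_real gtr0_norm.
have := dP (s%:C *: f); rewrite /ball_ /= !sub0r !normrN dE hb_normE hb_normZ ns ltcR.
rewrite /s divfK ?gt_eqF// => /(_ _).
have -> : k < complex.Re d by rewrite /k; move: d0; clear; lra.
move=> /(_ isT); rewrite linear0 sub0r normrN linearZ hb_normE hb_normZ ns ltcR => h.
rewrite -ler_pdivrMl ?invr_gt0// invrK.
by move: h; rewrite /s mulrAC ltr_pdivrMr// mul1r => /ltW.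
Qed.

Lemma closed_limit (W : set X) g : closed W ->
  (forall e, 0 < e -> exists2 w, W w & hb_norm (g - w) < e) -> W g.
Proof.
move=> cW H; apply: cW => B Bg; have [d /=] := (nbhs_normP g _).1 Bg.
rewrite ltcE /= => /andP[/eqP dI d0] dP.
have dE : d = (complex.Re d)%:C by case: (d) dI => a b /= ->.
have [w Ww wd] := H _ d0; exists w; split => //; apply: dP.
by rewrite /ball_ /= dE hb_normE ltcR.
Qed.

Lemma geometric_limit (v : nat -> X) (B q : R) : 0 <= B -> 0 <= q -> q < 1 ->
  (forall k, hb_norm (v k) <= B * q ^+ k) ->
  exists F, hb_norm F <= B / (1 - q) /\
    forall e, 0 < e -> exists N, forall n, (N <= n)%N -> hb_norm (\sum_(k < n) v k - F) <= e.
Proof.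
move=> B0 q0 q1 vB; have q10 : 0 < 1 - q by rewrite subr_gt0.
pose s n := \sum_(k < n) v k.
have tail m p : hb_norm (s (m + p)%N - s m) <= B / (1 - q) * q ^+ m.
  suff : hb_norm (s (m + p)%N - s m) <= B / (1 - q) * (q ^+ m - q ^+ (m + p)).
    move=> h; apply: le_trans h _; rewrite ler_wpM2l ?divr_ge0 ?(ltW q10)//.
    by rewrite lerBlDr lerDl exprn_ge0.
  elim: p => [|p IH]; first by rewrite addn0 !subrr hb_norm0 mulr0.
  rewrite addnS /s big_ord_recr /= -/(s (m + p)%N) addrAC.
  apply: le_trans (hb_normD _ _) _; apply: le_trans (lerD IH (vB _)) _.
  rewrite le_eqVlt; apply/orP; left; apply/eqP; rewrite exprS.
  by field; rewrite gt_eqF.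
have pw e : 0 < e -> exists N, forall m, (N <= m)%N -> B / (1 - q) * q ^+ m <= e.
  move=> e0; have K0 : 0 <= B / (1 - q) by rewrite divr_ge0// ltW.
  have := @cvg_geometric R (B / (1 - q)) q; rewrite ger0_norm// => /(_ q1) /cvgrPdist_le /(_ e e0).
  move=> [N _ NP]; exists N => m Nm; have := NP m Nm; rewrite /= sub0r normrN.
  by move=> h; apply: le_trans (ler_norm _) h.
have [F FP] : exists F : X, forall e, 0 < e -> exists N, forall n, (N <= n)%N -> hb_norm (s n - F) <= e.
  apply: hb_complete => e e0; have [N NP] := pw _ e0; exists N.
  have le m n : (N <= m)%N -> (m <= n)%N -> hb_norm (s m - s n) <= e.
    by move=> Nm /subnKC <-; rewrite hb_normB; apply: le_trans (tail _ _) _; exact: NP.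
  move=> m n Nm Nn; have [mn|/ltnW nm] := leqP m n; first exact: le.
  by rewrite hb_normB; exact: le.
exists F; split; last exact: FP.
apply/ler_addgt0Pl => e e0; have [N NP] := FP _ e0.
have -> : F = - (s N - F) + s N by rewrite opprB subrK.
apply: le_trans (hb_normD _ _) _; rewrite hb_normN; apply: lerD; first exact: NP.
by have := tail 0%N N; rewrite add0n expr0 mulr1 /s big_ord0 subr0.
Qed.

(** The lower bound gives injectivity and, read backwards, continuity of the
    inverse. *)
Lemma inverse_of_bounded_below A (c : R) : (forall f, hb_norm f <= c * hb_norm (A f)) ->
  (forall g, exists f, A f = g) ->
  exists S : {linear X -> X}, [/\ continuous S, cancel A S & cancel S A].
Proof.
move=> lb surj; have [S SP] := choice surj.
have inj f : A f = 0 -> f = 0.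
  move=> Af; apply: hb_norm_eq0; apply/eqP; rewrite eq_le hb_norm_ge0 andbT.
  by apply: le_trans (lb f) _; rewrite Af hb_norm0 mulr0.
have inj2 f g : A f = A g -> f = g.
  by move=> e; apply/eqP; rewrite -subr_eq0; apply/eqP/inj; rewrite linearB e subrr.
have Slin : linear S.
  by move=> a f g; apply: inj2; rewrite SP linearD linearZ !SP.
pose S' : {linear X -> X} := HB.pack S (GRing.isLinear.Build _ _ _ _ S Slin).
exists S'; split.
- by apply: (@bounded_continuous S' c) => f; rewrite -{2}(SP f).
- by move=> f; apply: inj2; rewrite SP.
- by move=> f; exact: SP.
Qed.

Definition shifted T (l : C) : X -> X := fun f => T f - l *: f.

Lemma shifted_linear T l : linear (shifted T l).
Proof.
move=> a f g; rewrite /shifted linearD linearZ /= scalerDr scalerBr !scalerA (mulrC l a).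
by rewrite opprD addrACA.
Qed.

HB.instance Definition _ T l := GRing.isLinear.Build _ _ _ _ (shifted T l) (shifted_linear T l).

Lemma shiftedB T l f g : shifted T l (f - g) = shifted T l f - shifted T l g.
Proof. by rewrite linearB. Qed.

Lemma shifted_bounded T l : continuous T ->
  exists2 c, 0 < c & forall f, hb_norm (shifted T l f) <= c * hb_norm f.
Proof.
move=> /continuous_bounded[c c0 cP]; exists (c + normc l); first by rewrite ltr_wpDr ?normc_ge0.
move=> f; apply: le_trans (hb_normD _ _) _; rewrite hb_normN hb_normZ mulrDl.
exact: lerD (cP f) (lexx _).
Qed.

Lemma notin_spectrumP T l : ~ spectrum T l <->
  exists S : {linear X -> X}, [/\ continuous S, cancel (shifted T l) S & cancel S (shifted T l)].
Proof. by split=> [/contrapT//|H]; apply. Qed.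

Lemma fredholm_of_invertible T l : ~ spectrum T l -> fredholm (shifted T l).
Proof.
move=> /notin_spectrumP[S [_ SA AS]].
have rT : range (shifted T l) = setT by apply/seteqP; split => // g _; exists (S g).
split.
- exists 0%N, (fun=> 0); apply/seteqP; split => [f /= f0|_ [c _ <-]].
    by exists (fun=> 0) => //; rewrite big_ord0 -(SA f) f0 linear0.
  by rewrite big_ord0 /preimage /= linear0.
- by rewrite rT; exact: closedT.
- exists 0%N, (fun=> 0) => v; exists v, 0; rewrite rT addr0; split => //.
  by exists (fun=> 0) => //; rewrite big_ord0.
Qed.

Lemma essential_sub_spectrum T : essential_spectrum T `<=` spectrum T.
Proof. by move=> l nf; apply: contrapT => /fredholm_of_invertible. Qed.

(** More vectors than the dimension are dependent: a matrix with more rows than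
    columns has a nonzero vector in its left kernel. *)
Lemma row_relation n (a : 'I_n.+1 -> 'I_n -> C) : exists c : 'I_n.+1 -> C,
  (exists i, c i != 0) /\ forall j, \sum_i c i * a i j = 0.
Proof.
pose A := \matrix_(i < n.+1, j < n) a i j.
have : kermx A != 0.
  by rewrite kermx_eq0 /row_free neq_ltn (leq_ltn_trans (rank_leq_col A)).
move=> /rowV0Pn[v vk v0]; exists (fun i => v 0 i); split.
  apply: contrapT => /forallNP H; move/negP: v0; apply; apply/eqP/rowP => i.
  by rewrite mxE; apply/eqP; have /negP := H i; rewrite negbK.
move=> j; have /sub_kermxP := vk => /matrixP /(_ 0 j); rewrite !mxE => vA.
by rewrite -[RHS]vA; apply: eq_bigr => i _; rewrite mxE.
Qed.

(** A family with more members than the dimension of the complement has dependent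
    components there. *)
Lemma fin_codim_relation A (g : nat -> X) : fin_codim (range A) ->
  exists n (c : 'I_n.+1 -> C), (exists i, c i != 0) /\ exists f, A f = \sum_i c i *: g i.
Proof.
move=> [n [e eP]]; exists n.
have : forall i : 'I_n.+1, exists fa : X * ('I_n -> C),
    g i = A fa.1 + \sum_j fa.2 j *: e j.
  by move=> i; have [_ [_ [[f _ <-] [a _ <-] ->]]] := eP (g i); exists (f, a).
move=> /choice[fa faP].
have [c [c0 cP]] := row_relation (fun i j => (fa i).2 j).
exists c; split => //; exists (\sum_i c i *: (fa i).1).
have -> : \sum_i c i *: g i = \sum_i (c i *: A (fa i).1 + \sum_j (c i * (fa i).2 j) *: e j).
  apply: eq_bigr => i _; rewrite faP scalerDr scaler_sumr; congr (_ + _).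
  by apply: eq_bigr => j _; rewrite scalerA.
rewrite big_split /= exchange_big /= [X in _ = _ + X]big1 ?addr0.
  by rewrite linear_sum; apply: eq_bigr => i _; rewrite linearZ.
by move=> j _; rewrite -scaler_suml cP scale0r.
Qed.

Lemma fin_dim_relation (W : set X) (g : nat -> X) : fin_dim W -> (forall i, W (g i)) ->
  exists n (c : 'I_n.+1 -> C), (exists i, c i != 0) /\ \sum_i c i *: g i = 0.
Proof.
move=> [n [e ->]] gW; exists n.
have : forall i : 'I_n.+1, exists a : 'I_n -> C, g i = \sum_j a j *: e j.
  by move=> i; have [a _ <-] := gW i; exists a.
move=> /choice[a aP].
have [c [c0 cP]] := row_relation a; exists c; split => //.
have -> : \sum_i c i *: g i = \sum_i \sum_j (c i * a i j) *: e j.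
  by apply: eq_bigr => i _; rewrite aP scaler_sumr; apply: eq_bigr => j _; rewrite scalerA.
by rewrite exchange_big /= big1// => j _; rewrite -scaler_suml cP scale0r.
Qed.

(** The partial sums of the Neumann series [- sum l^-(k+1) T^k g] give a bounded
    solution of the equation; uniqueness comes from the growth of the iterates.
    The constant [M] makes room for operators of norm larger than their spectral
    radius. *)
Lemma neumann T (M r : R) (l : C) : 0 <= M -> 0 <= r -> continuous T ->
  (forall n f, hb_norm (iter n T f) <= M * r ^+ n * hb_norm f) -> r < normc l ->
  ~ spectrum T l.
Proof.
move=> M0 r0 cT TB rl; apply/notin_spectrumP.
have l0 : 0 < normc l by exact: le_lt_trans rl.
have ln0 : l != 0 by rewrite -normc_gt0.
pose q := r / normc l.
have q0 : 0 <= q by rewrite divr_ge0// ltW.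
have q1 : q < 1 by rewrite ltr_pdivrMr// mul1r.
pose v g k := - ((l ^+ k.+1)^-1 *: iter k T g).
have vB g k : hb_norm (v g k) <= M / normc l * hb_norm g * q ^+ k.
  rewrite /v hb_normN hb_normZ normcV normcX.
  apply: (@le_trans _ _ ((normc l ^+ k.+1)^-1 * (M * r ^+ k * hb_norm g))).
    by rewrite ler_wpM2l// invr_ge0 exprn_ge0// normc_ge0.
  rewrite /q exprMn exprVn exprS le_eqVlt; apply/orP; left; apply/eqP.
  by field; rewrite expf_neq0 ?gt_eqF.
have tele g n : shifted T l (\sum_(k < n) v g k) = g - (l ^+ n)^-1 *: iter n T g.
  elim: n => [|n IH]; first by rewrite big_ord0 linear0 expr0 invr1 scale1r subrr.
  rewrite big_ord_recr linearD /= IH /shifted /v scalerN scalerA (linearN T) (linearZ_LR T).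
  have -> : l * (l ^+ n.+1)^-1 = (l ^+ n)^-1 by rewrite exprS invfM mulrA divff// mul1r.
  by rewrite opprK addrACA addNr addr0.
have surj g : exists f, shifted T l f = g /\ hb_norm f <= M / normc l / (1 - q) * hb_norm g.
  have B0 : 0 <= M / normc l * hb_norm g by rewrite mulr_ge0 ?divr_ge0 ?hb_norm_ge0// ltW.
  have [F [FB FP]] := geometric_limit B0 q0 q1 (vB g).
  exists F; split; last by rewrite mulrAC.
  have [c c0 cP] := shifted_bounded l cT.
  apply/eqP; rewrite -subr_eq0 -hb_norm_eq0P eq_le hb_norm_ge0 andbT.
  apply/ler_addgt0Pl => e e0; rewrite addr0.
  have e1 : 0 < e / 2 / c by rewrite !divr_gt0.
  have [N1 N1P] := FP _ e1.
  have e2 : 0 < e / 2 by rewrite divr_gt0.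
  have := @cvg_geometric R (M * hb_norm g) q; rewrite ger0_norm// => /(_ q1) /cvgrPdist_le /(_ _ e2).
  move=> [N2 _ N2P]; pose n := maxn N1 N2.
  have b1 := N1P n (leq_maxl _ _).
  have := N2P n (leq_maxr _ _); rewrite /= sub0r normrN => b2.
  have b3 : hb_norm ((l ^+ n)^-1 *: iter n T g) <= e / 2.
    apply: le_trans _ b2; apply: le_trans _ (ler_norm _).
    rewrite hb_normZ normcV normcX /q exprMn exprVn.
    rewrite [leRHS](_ : _ = (normc l ^+ n)^-1 * (M * r ^+ n * hb_norm g)); last by ring.
    by rewrite ler_wpM2l// invr_ge0 exprn_ge0// normc_ge0.
  have -> : shifted T l F - g = - (shifted T l (\sum_(k < n) v g k - F)) - (l ^+ n)^-1 *: iter n T g.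
    rewrite shiftedB tele !opprB -!addrA; congr (_ + _).
    by congr (_ + _); rewrite addrCA subrr addr0.
  apply: le_trans (hb_normD _ _) _; rewrite !hb_normN.
  have := cP (\sum_(k < n) v g k - F).
  have : c * hb_norm (\sum_(k < n) v g k - F) <= e / 2.
    by rewrite -ler_pdivlMl// mulrC.
  by move: b3; clear; lra.
have lower f : hb_norm f <= M / normc l / (1 - q) * hb_norm (shifted T l f).
  have [h [hA hB]] := surj (shifted T l f).
  suff e : f = h by rewrite {1}e.
  apply/eqP; rewrite -subr_eq0 -hb_norm_eq0P eq_le hb_norm_ge0 andbT.
  set d := f - h.
  have Td n : iter n T d = l ^+ n *: d.
    elim: n => [|n IH]; first by rewrite expr0 scale1r.
    rewrite iterS IH linearZ /= exprSr -scalerA; congr (_ *: _).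
    by apply/eqP; rewrite -subr_eq0 -/(shifted T l d) shiftedB hA subrr.
  apply/ler_addgt0Pl => e e0; rewrite addr0.
  have := @cvg_geometric R (M * hb_norm d) q; rewrite ger0_norm// => /(_ q1) /cvgrPdist_le /(_ _ e0).
  move=> [N _ /(_ N (leqnn _))]; rewrite /= sub0r normrN => b.
  apply: le_trans _ b; apply: le_trans _ (ler_norm _).
  have := TB N d; rewrite Td hb_normZ normcX => h1.
  rewrite /q exprMn exprVn mulrA ler_pdivlMr ?exprn_gt0// mulrC.
  by rewrite (mulrAC M).
by apply: (inverse_of_bounded_below lower) => g; have [f []] := surj g; exists f.
Qed.

End OperatorTheory.

Arguments shifted : simpl never.

(** * Injective operators with closed range *)

Section BoundedBelow.
Context {R : realType}.
Local Notation C := R[i].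
Local Notation X := (hardy_bergman R).
Implicit Types (A : {linear X -> X}) (f g h : X).

Lemma half_pow_small (e : R) : 0 < e -> exists N, forall n, (N <= n)%N -> 2^-1 ^+ n <= e.
Proof.
move=> e0; have h : `|2^-1 : R| < 1 by rewrite ger0_norm// invf_lt1// ltr1n.
have := @cvg_geometric R 1 2^-1 h; move=> /cvgrPdist_le /(_ e e0) [N _ NP].
exists N => n Nn; have := NP n Nn; rewrite /= sub0r normrN mul1r.
by apply: le_trans; exact: ler_norm.
Qed.

Lemma pow_unbounded (m M : R) : 1 < m -> exists N, forall n, (N <= n)%N -> M <= m ^+ n.
Proof.
move=> m1; have m0 : 0 < m by apply: lt_trans m1.
have h : `|m^-1| < 1 by rewrite ger0_norm ?invr_ge0 ?(ltW m0)// invf_lt1.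
have M10 : 0 < (`|M| + 1)^-1 by rewrite invr_gt0 ltr_wpDl.
have := @cvg_geometric R 1 m^-1 h; move=> /cvgrPdist_le /(_ _ M10) [N _ NP]; exists N => n Nn.
have := NP n Nn; rewrite /= sub0r normrN mul1r => hm.
have := le_trans (ler_norm _) hm; rewrite exprVn lef_pV2 ?posrE ?exprn_gt0// ?ltr_wpDl//.
by apply: le_trans; rewrite (le_trans (ler_norm M))// lerDl.
Qed.

(** The nested balls of the category argument, written with preimages since all
    centres lie in the range. *)
Lemma ball_seq_limit A (f : nat -> X) (r : nat -> R) : r 0%N <= 1 -> (forall k, 0 < r k) ->
  (forall k, r k.+1 <= r k / 2) -> (forall k, hb_norm (A (f k.+1) - A (f k)) <= r k / 2) ->
  exists y, (forall k, hb_norm (y - A (f k)) <= r k) /\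
    (forall e, 0 < e -> exists2 w, range A w & hb_norm (y - w) < e).
Proof.
move=> r1 r0 rh fh.
have tail m p : hb_norm (A (f (m + p)%N) - A (f m)) <= r m - r (m + p)%N.
  elim: p => [|p IH]; first by rewrite addn0 !subrr hb_norm0.
  have -> : A (f (m + p.+1)%N) - A (f m) =
      (A (f (m + p).+1) - A (f (m + p)%N)) + (A (f (m + p)%N) - A (f m)).
    by rewrite addnS addrA subrK.
  apply: le_trans (hb_normD _ _) _; have := lerD (fh (m + p)%N) IH.
  by rewrite addnS; have := rh (m + p)%N; clear; lra.
have rpow k : r k <= 2^-1 ^+ k.
  elim: k => [|k IH]; first by rewrite expr0.
  by rewrite exprSr; apply: le_trans (rh k) _; rewrite ler_pM2r// invr_gt0.
have tail2 m n : (m <= n)%N -> hb_norm (A (f n) - A (f m)) <= r m.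
  move=> /subnKC <-; apply: le_trans (tail _ _) _.
  by rewrite lerBlDr lerDl ltW.
have [y yP] : exists y : X, forall e, 0 < e -> exists N, forall n, (N <= n)%N ->
    hb_norm (A (f n) - y) <= e.
  apply: hb_complete => e e0; have [N NP] := half_pow_small e0; exists N => m n Nm Nn.
  have [mn|/ltnW nm] := leqP m n.
    by rewrite hb_normB; apply: le_trans (tail2 _ _ mn) _; apply: le_trans (rpow _) (NP _ Nm).
  by apply: le_trans (tail2 _ _ nm) _; apply: le_trans (rpow _) (NP _ Nn).
exists y; split=> [k|e e0].
  apply/ler_addgt0Pl => e e0; have [N NP] := yP _ e0.
  have -> : y - A (f k) = (y - A (f (maxn N k))) + (A (f (maxn N k)) - A (f k)) by rewrite addrA subrK.
  apply: le_trans (hb_normD _ _) _; rewrite (hb_normB y); apply: lerD.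
    exact: NP (leq_maxl _ _).
  exact: tail2 (leq_maxr _ _).
have e20 : 0 < e / 2 by rewrite divr_gt0.
have [N NP] := yP _ e20; exists (A (f N)); first by exists (f N).
by rewrite hb_normB; apply: le_lt_trans (NP N (leqnn _)) _; move: e0; clear; lra.
Qed.

(** The category argument: the range, a complete space, is the union of the
    images of the balls of integer radius, so one of these images is dense in
    some ball of the range. *)
Lemma dense_image_ball A : closed (range A) -> exists n : nat, exists f0, exists2 r : R, 0 < r &
  forall f1, hb_norm (A f1 - A f0) <= r -> forall e, 0 < e ->
    exists2 f, hb_norm f <= n%:R & hb_norm (A f1 - A f) <= e.
Proof.
move=> cA; apply: contrapT => H.
have step (p : nat * (X * R)) : exists q : X * R, 0 < p.2.2 ->
    [/\ 0 < q.2, q.2 <= p.2.2 / 2, hb_norm (A q.1 - A p.2.1) <= p.2.2 / 2 &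
      forall f, hb_norm f <= p.1%:R -> q.2 < hb_norm (A q.1 - A f)].
  case: p => n [f0 r] /=; have [r0|r0] := ltP 0 r; last by exists (0, 0).
  apply: contrapT => H2; apply: H; exists n, f0, (r / 2); first by rewrite divr_gt0.
  move=> f1 f1r e e0; apply: contrapT => H3; apply: H2.
  exists (f1, Num.min e (r / 2)) => _ /=; split => //.
  - by rewrite lt_min e0 divr_gt0.
  - by rewrite ge_min lexx orbT.
  - move=> f fn; rewrite ltNge; apply/negP => h; apply: H3; exists f => //.
    by apply: le_trans h _; rewrite ge_min lexx.
have [F FP] := choice step.
(* The sequence of balls avoids, at stage k, the images of the vectors of norm
   at most k. *)
pose s := fix s k := if k is k'.+1 then F (k', s k') else (0 : X, 1 : R).
have s0 k : 0 < (s k).2.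
  by elim: k => [|k IH] //=; have [] := FP (k, s k) IH.
have sP k : _ := FP (k, s k) (s0 k).
have [y [yP yA]] := @ball_seq_limit A (fun k => (s k).1) (fun k => (s k).2) (lexx _) s0
  (fun k => let: And4 _ h _ _ := sP k in h) (fun k => let: And4 _ _ h _ := sP k in h).
have [G _ GE] := closed_limit cA yA.
pose k := (Num.trunc (hb_norm G)).+1.
have Gk : hb_norm G <= k%:R by apply: ltW; exact: truncnS_gt.
have [_ _ _ /(_ G Gk)] := sP k; have := yP k.+1; rewrite -GE hb_normB /=.
by move=> h1 /(le_lt_trans h1); rewrite ltxx.
Qed.

(** The difference of two elements of the dense image of a ball approximates a
    multiple of the given vector of the range; rescaling gives a constant
    independent of that vector. *)
Lemma approximate_solution A : closed (range A) -> exists2 M : R, 0 <= M &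
  forall f e, 0 < e -> exists2 g, hb_norm g <= M * hb_norm (A f) & hb_norm (A (f - g)) <= e.
Proof.
move=> /dense_image_ball[n [f0 [r r0 H]]]; exists (2 * n%:R / r).
  by rewrite divr_ge0 ?mulr_ge0// ltW.
move=> f e e0; have [Af0|Af0] := eqVneq (A f) 0.
  by exists 0; rewrite ?hb_norm0 ?Af0 ?hb_norm0 ?mulr0// subr0 Af0 hb_norm0 ltW.
have nA : 0 < hb_norm (A f) by rewrite lt_def hb_norm_ge0 hb_norm_eq0P Af0.
pose s := r / hb_norm (A f); have s0 : 0 < s by rewrite divr_gt0.
have ns : normc s%:C = s by rewrite normc_real gtr0_norm.
have sn : s%:C != 0 :> C by rewrite -normc_gt0 ns.
have es : 0 < e * s / 2 by apply: divr_gt0 => //; exact: mulr_gt0.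
have [g1 g1n g1e] : exists2 g, hb_norm g <= n%:R & hb_norm (A (f0 + s%:C *: f) - A g) <= e * s / 2.
  apply: H => //; rewrite linearD addrAC subrr add0r linearZ hb_normZ ns.
  by rewrite /s divfK// gt_eqF.
have [g2 g2n g2e] : exists2 g, hb_norm g <= n%:R & hb_norm (A f0 - A g) <= e * s / 2.
  by apply: H => //; rewrite subrr hb_norm0 ltW.
exists (s%:C^-1 *: (g1 - g2)).
  rewrite hb_normZ normcV ns; apply: (@le_trans _ _ (s^-1 * (n%:R + n%:R))).
    rewrite ler_wpM2l ?invr_ge0 ?(ltW s0)//; apply: le_trans (hb_normD _ _) _.
    by rewrite hb_normN lerD.
  by rewrite /s invf_div le_eqVlt; apply/orP; left; apply/eqP; field; rewrite gt_eqF.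
have -> : f - s%:C^-1 *: (g1 - g2) = s%:C^-1 *: ((f0 + s%:C *: f - g1) - (f0 - g2)).
  have -> : f0 + s%:C *: f - g1 - (f0 - g2) = s%:C *: f - (g1 - g2).
    rewrite -(addrA f0) opprB (addrC g2) addrACA subrr add0r opprB -addrA.
    by rewrite (addrC g2).
  by rewrite [RHS]scalerBr (scalerA _ _ f) mulVf// scale1r.
rewrite linearZ hb_normZ normcV ns mulrC ler_pdivrMr// linearB.
apply: le_trans (hb_normD _ _) _; rewrite hb_normN !(linearB A).
by apply: le_trans (lerD g1e g2e) _; clear; lra.
Qed.

(** Summing approximate solutions with errors halved at each step gives a genuine
    solution of controlled norm; injectivity makes it the given vector. *)
Lemma bounded_below_of_closed_range A : continuous A -> (forall f, A f = 0 -> f = 0) ->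
  closed (range A) -> exists2 c, 0 < c & forall f, hb_norm f <= c * hb_norm (A f).
Proof.
move=> cA inj /approximate_solution[M M0 H].
have [K K0 AK] := continuous_bounded cA.
exists (2 * M + 1); first by rewrite ltr_wpDl ?mulr_ge0.
move=> f; have [Af0|Af0] := eqVneq (A f) 0.
  by rewrite (inj _ Af0) hb_norm0 mulr_ge0 ?hb_norm_ge0// addr_ge0 ?mulr_ge0.
have nA : 0 < hb_norm (A f) by rewrite lt_def hb_norm_ge0 hb_norm_eq0P Af0.
have step (p : nat * X) : exists g, hb_norm g <= M * hb_norm (A p.2) /\
    hb_norm (A (p.2 - g)) <= hb_norm (A f) * 2^-1 ^+ p.1.+1.
  have e0 : 0 < hb_norm (A f) * 2^-1 ^+ p.1.+1 by rewrite mulr_gt0// exprn_gt0// invr_gt0.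
  by have [g g1 g2] := H p.2 _ e0; exists g.
have [G GP] := choice step.
pose s := fix s k := if k is k'.+1 then s k' - G (k', s k') else f.
have sb k : hb_norm (A (s k)) <= hb_norm (A f) * 2^-1 ^+ k.
  by case: k => [|k] /=; [rewrite expr0 mulr1|have [] := GP (k, s k)].
have vb k : hb_norm (G (k, s k)) <= M * hb_norm (A f) * 2^-1 ^+ k.
  have [h _] := GP (k, s k); apply: le_trans h _; rewrite -mulrA.
  exact: (ler_wpM2l M0 (sb k)).
have h0 : 0 <= (2^-1 : R) by rewrite invr_ge0.
have h1 : (2^-1 : R) < 1 by rewrite invf_lt1// ltr1n.
have B0 : 0 <= M * hb_norm (A f) by rewrite mulr_ge0// hb_norm_ge0.
have [F [FB FP]] := geometric_limit B0 h0 h1 vb.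
have sumE n : \sum_(k < n) G (k : nat, s k) = f - s n.
  elim: n => [|n IH]; first by rewrite big_ord0 /= subrr.
  by rewrite big_ord_recr /= IH opprB addrA addrAC.
suff Ff : F = f.
  rewrite -{1}Ff; apply: le_trans FB _.
  have -> : 1 - 2^-1 = (2^-1 : R) by field.
  by rewrite invrK; move: nA; clear; lra.
apply/eqP; rewrite -subr_eq0; apply/eqP/inj; apply: hb_norm_eq0.
apply/eqP; rewrite eq_le hb_norm_ge0 andbT; apply/ler_addgt0Pl => e e0; rewrite addr0.
have e1 : 0 < e / 2 / K by rewrite !divr_gt0.
have e2 : 0 < e / 2 / hb_norm (A f) by rewrite !divr_gt0.
have [N1 N1P] := FP _ e1; have [N2 N2P] := half_pow_small e2.
pose n := maxn N1 N2; have := N1P n (leq_maxl _ _); rewrite sumE => b1.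
have b2 := N2P n (leq_maxr _ _).
have -> : F - f = - (f - s n - F) - s n.
  by rewrite !opprB -!addrA; congr (_ + _); rewrite addrCA subrr addr0.
rewrite linearB; apply: le_trans (hb_normD _ _) _; rewrite (linearN A) !hb_normN.
have b3 : hb_norm (A (f - s n - F)) <= e / 2.
  by apply: le_trans (AK _) _; rewrite mulrC -ler_pdivlMr.
have b4 : hb_norm (A (s n)) <= e / 2.
  by apply: le_trans (sb n) _; rewrite mulrC -ler_pdivlMr.
by move: b3 b4; clear; lra.
Qed.

End BoundedBelow.

(** * Composition with affine maps *)

Section AffineOperators.
Context {R : realType}.
Local Notation C := R[i].
Local Notation X := (hardy_bergman R).
Local Notation leb := (@lebesgue_measure R).
Implicit Types (f g h : X) (G H : C -> C) (z w : C).

Lemma complex_eta (z : C) : z = complex.Re z +i* complex.Im z.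
Proof. by case: z. Qed.

Lemma near_half_plane z w : half_plane z -> normc (w - z) < complex.Re z -> half_plane w.
Proof.
case: z w => [a b] [c d]; rewrite /half_plane /= => a0 h.
have := le_Re_normc ((c +i* d) - (a +i* b)); rewrite /= => h1.
have := le_lt_trans h1 h; rewrite ltr_norml => /andP[h2 _]; move: h2; clear; lra.
Qed.

Lemma eq_hardy_sqnorm G H : (forall z, half_plane z -> G z = H z) -> hardy_sqnorm G = hardy_sqnorm H.
Proof.
by move=> GH; congr ereal_sup; apply/seteqP; split => _ [x x0 <-];
  exists x => //; apply: eq_integral => y _; rewrite GH.
Qed.

Lemma eq_bergman_sqnorm G H : (forall z, half_plane z -> G z = H z) ->
  bergman_sqnorm G = bergman_sqnorm H.
Proof. by move=> GH; apply: eq_integral => p /set_mem p0; rewrite GH. Qed.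

Lemma eq_holomorphic_rhp G H : (forall z, half_plane z -> G z = H z) ->
  holomorphic_rhp G -> holomorphic_rhp H.
Proof.
move=> GH hG z z0; apply: derivable_near (hG z z0); exists (complex.Re z) => // w wz.
by apply: GH; exact: near_half_plane wz.
Qed.

Lemma hb_of_rhp G : holomorphic_rhp G -> (hardy_sqnorm G < +oo)%E -> (bergman_sqnorm G < +oo)%E ->
  exists f : X, forall z, half_plane z -> f z = G z.
Proof.
move=> hG HG BG; pose g z := if 0 < complex.Re z then G z else 0.
have gG z : half_plane z -> G z = g z by rewrite /g /half_plane /= => ->.
have [f fP] : exists f : X, forall z, f z = g z.
  apply: hb_of_fun.
  - by move=> z /negP; rewrite /g => /negbTE ->.
  - exact: eq_holomorphic_rhp gG hG.
  - by rewrite -(eq_hardy_sqnorm gG).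
  - by rewrite -(eq_bergman_sqnorm gG).
by exists f => z z0; rewrite fP gG.
Qed.

Lemma affine_half_plane (mu : R) (w z : C) : 0 < mu -> 0 <= complex.Re w -> half_plane z ->
  half_plane (mu%:C * z + w).
Proof.
case: z w => [a b] [c d]; rewrite /half_plane /= => mu0 c0 a0.
by rewrite mul0r subr0 ltr_pwDl// mulr_gt0.
Qed.

Lemma affineE (mu x y : R) (w : C) :
  mu%:C * (x +i* y) + w = (mu * x + complex.Re w) +i* (mu * y + complex.Im w).
Proof. by case: w => c d; apply/eqP; rewrite eq_complex /= !mul0r subr0 addr0 !eqxx. Qed.

Lemma holomorphic_affine G (mu : R) (w : C) : 0 < mu -> 0 <= complex.Re w -> holomorphic_rhp G ->
  holomorphic_rhp (fun z => G (mu%:C * z + w)%R).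
Proof.
move=> mu0 w0 hG z z0; have /derivable_cderivP[D GD] := hG _ (affine_half_plane mu0 w0 z0).
apply/derivable_cderivP; eexists.
exact: (cderiv_comp (cderivD (cderivZ mu%:C (cderiv_id z)) (cderiv_const w z)) GD).
Qed.

Lemma line_sqnorm_affine G (mu : R) (w : C) x : 0 < mu -> 0 <= complex.Re w ->
  holomorphic_rhp G -> 0 < x ->
  line_sqnorm G (mu * x + complex.Re w) =
  (mu%:E * line_sqnorm (fun z => G (mu%:C * z + w)%R) x)%E.
Proof.
move=> mu0 w0 hG x0; have X0 : 0 < mu * x + complex.Re w by rewrite ltr_pwDl// mulr_gt0.
rewrite /line_sqnorm (ge0_integral_affine (complex.Im w) mu0).
- by congr (_ * _)%E; apply: eq_integral => y _; rewrite affineE.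
- by apply/measurable_EFinP; exact: measurable_sqnorm_line.
- by move=> y; rewrite lee_fin sqr_ge0.
Qed.

Lemma line_sqnorm_affineV G (mu : R) (w : C) x : 0 < mu -> 0 <= complex.Re w ->
  holomorphic_rhp G -> 0 < x ->
  line_sqnorm (fun z => G (mu%:C * z + w)%R) x =
  (mu^-1%:E * line_sqnorm G (mu * x + complex.Re w)%R)%E.
Proof.
move=> mu0 w0 hG x0; rewrite (line_sqnorm_affine mu0 w0 hG x0) muleA -EFinM mulVf ?gt_eqF//.
by rewrite mul1e.
Qed.

Lemma hardy_affine G (mu : R) (w : C) : 0 < mu -> 0 <= complex.Re w -> holomorphic_rhp G ->
  (hardy_sqnorm (fun z => G (mu%:C * z + w)%R) <= mu^-1%:E * hardy_sqnorm G)%E.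
Proof.
move=> mu0 w0 hG; apply: ge_ereal_sup => _ [x x0 <-].
rewrite -/(line_sqnorm (fun z => G (mu%:C * z + w)%R) x) line_sqnorm_affineV//.
apply: lee_wpmul2l; first by rewrite lee_fin invr_ge0 ltW.
by apply: line_le_hardy; rewrite ltr_pwDl// mulr_gt0.
Qed.

Lemma bergman_affine G (mu : R) (w : C) : 0 < mu -> 0 <= complex.Re w -> holomorphic_rhp G ->
  (bergman_sqnorm (fun z => G (mu%:C * z + w)%R) <= (mu^-1 ^+ 2)%:E * bergman_sqnorm G)%E.
Proof.
move=> mu0 w0 hG; have hH := holomorphic_affine mu0 w0 hG; set H := fun z => _ in hH *.
pose D x := (\int[leb]_y dens G (x, y))%E.
have mg := measurable_dens hG; have g0 := dens_ge0 G.
have mD : measurable_fun setT D by exact: (@measurable_fun_fubini_tonelli_F _ _ _ _ _ leb _ mg g0).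
have D0 x : (0 <= D x)%E by apply: integral_ge0 => y _; exact: dens_ge0.
have iD : bergman_sqnorm G = (mu%:E * \int[leb]_x D (mu * x + complex.Re w)%R)%E.
  by rewrite (bergman_line hG) (ge0_integral_affine (complex.Re w) mu0).
have mV : (0 <= mu^-1%:E :> \bar R)%E by rewrite lee_fin invr_ge0 ltW.
have mDa : measurable_fun setT (fun x => D (mu * x + complex.Re w)%R).
  exact: (measurableT_comp mD (measurable_affine mu (complex.Re w))).
have -> : ((mu^-1 ^+ 2)%:E * bergman_sqnorm G =
    \int[leb]_x (mu^-1%:E * D (mu * x + complex.Re w)%R))%E.
  rewrite iD ge0_integralZl// muleA -EFinM; congr (_%:E * _)%E.
  by field; rewrite gt_eqF.
rewrite (bergman_line hH); apply: ge0_le_integral => //.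
- by move=> x _; apply: integral_ge0 => y _; exact: dens_ge0.
- exact: (@measurable_fun_fubini_tonelli_F _ _ _ _ _ leb _ (measurable_dens hH) (dens_ge0 H)).
- exact: measurable_funeM.
move=> x _; have [x0|x0] := ltP 0 x.
  rewrite -line_dens// line_sqnorm_affineV// /D -line_dens//.
  by rewrite ltr_pwDl// mulr_gt0.
rewrite integral0_eq; first by rewrite mule_ge0.
by move=> y _; exact: dens_left.
Qed.

(** A change of variables scales line integrals by [1 / mu] and the area integral
    by [1 / mu^2]; the real shift only moves lines and shrinks the domain. *)
Lemma affine_norm f h (mu : R) (w : C) (r : R) : 0 < mu -> 0 <= complex.Re w -> 0 <= r ->
  (forall z, half_plane z -> h z = f (mu%:C * z + w)) ->
  mu^-1 <= r ^+ 2 -> mu^-1 ^+ 2 <= r ^+ 2 -> hb_norm h <= r * hb_norm f.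
Proof.
move=> mu0 w0 r0 hf r1 r2; rewrite -(@ler_pXn2r _ 2)// ?nnegrE ?hb_norm_ge0 ?mulr_ge0 ?hb_norm_ge0//.
rewrite exprMn -lee_fin (EFinM (r ^+ 2)) -!hb_sqnorm_fin /hb_sqnorm.
rewrite (eq_hardy_sqnorm hf) (eq_bergman_sqnorm hf).
rewrite ge0_muleDr; [|exact: hardy_sqnorm_ge0|exact: bergman_sqnorm_ge0].
have hh := @hb_holomorphic _ f; apply: leeD.
  apply: le_trans (hardy_affine mu0 w0 hh) _.
  by apply: lee_wpmul2r; [exact: hardy_sqnorm_ge0|rewrite lee_fin].
apply: le_trans (bergman_affine mu0 w0 hh) _.
by apply: lee_wpmul2r; [exact: bergman_sqnorm_ge0|rewrite lee_fin].
Qed.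

Lemma hardy_fin f : (hardy_sqnorm f < +oo)%E.
Proof. by apply: le_lt_trans (hardy_le_norm f) _; rewrite ltry. Qed.

Lemma bergman_fin f : (bergman_sqnorm f < +oo)%E.
Proof. by apply: le_lt_trans (bergman_le_norm f) _; rewrite ltry. Qed.

Lemma affine_operator (mu : R) (w : C) : 0 < mu -> 0 <= complex.Re w ->
  exists T : {linear X -> X}, is_composition_operator (fun s => mu%:C * s + w) T /\ continuous T.
Proof.
move=> mu0 w0.
have H f : exists h, forall z, half_plane z -> h z = f (mu%:C * z + w).
  have hh := @hb_holomorphic _ f; apply: (hb_of_rhp (holomorphic_affine mu0 w0 hh)).
    by apply: le_lt_trans (hardy_affine mu0 w0 hh) _; rewrite lte_mul_pinfty ?lee_fin ?invr_ge0 ?(ltW mu0)// hardy_fin.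
  apply: le_lt_trans (bergman_affine mu0 w0 hh) _.
  by rewrite lte_mul_pinfty ?lee_fin ?sqr_ge0// bergman_fin.
have [T TP] := choice H.
have Tlin : linear T.
  by move=> a f g; apply: hb_eq => z z0; rewrite TP// !hbD !hbZ !TP.
pose T' : {linear X -> X} := HB.pack T (GRing.isLinear.Build _ _ _ _ T Tlin).
exists T'; split; first by move=> f z z0; exact: TP.
pose r := 1 + mu^-1; have v0 : 0 < mu^-1 by rewrite invr_gt0.
apply: (@bounded_continuous _ T' r) => f.
apply: (affine_norm mu0 w0 _ (TP f)); rewrite /r.
- by move: v0; clear; lra.
- by move: v0; clear; nra.
- by move: v0; clear; nra.
Qed.

Lemma comp_operator_ext (phi psi : C -> C) (T : X -> X) :
  (forall s, half_plane s -> phi s = psi s) -> is_composition_operator phi T ->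
  is_composition_operator psi T.
Proof. by move=> e TP f z z0; rewrite -e// TP. Qed.

Definition affine_shift (mu : R) (w : C) n : C := \sum_(k < n) (mu ^+ k)%:C * w.

Lemma affine_shift_ge0 (mu : R) (w : C) n : 0 < mu -> 0 <= complex.Re w ->
  0 <= complex.Re (affine_shift mu w n).
Proof.
move=> mu0 w0; elim: n => [|n IH]; first by rewrite /affine_shift big_ord0.
rewrite /affine_shift big_ord_recr /= -/(affine_shift mu w n).
rewrite raddfD /= addr_ge0//; case: w w0 {IH} => [c d] /= w0.
by rewrite mul0r subr0 mulr_ge0// exprn_ge0// ltW.
Qed.

Lemma iter_affine (mu : R) (w : C) (T : X -> X) n : 0 < mu -> 0 <= complex.Re w ->
  is_composition_operator (fun s => mu%:C * s + w) T ->
  is_composition_operator (fun s => (mu ^+ n)%:C * s + affine_shift mu w n) (iter n T).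
Proof.
move=> mu0 w0 TP; elim: n => [|n IH] f z z0.
  by rewrite /affine_shift big_ord0 /= expr0 mul1r addr0.
rewrite iterSr IH// TP; last by apply: affine_half_plane; rewrite ?exprn_gt0 ?affine_shift_ge0.
congr (f _); rewrite mulrDr mulrA -rmorphM -exprS -addrA; congr (_ + _).
rewrite /affine_shift big_ord_recl expr0 mul1r addrC; congr (_ + _).
rewrite mulr_sumr; apply: eq_bigr => i _.
by rewrite mulrA -rmorphM -exprS.
Qed.

End AffineOperators.

(** * Complex exponential, logarithm and powers *)

Section ComplexPowers.
Context {R : realType}.
Local Notation C := R[i].
Implicit Types (z w u a : C) (t : R).

Lemma MVT_any (f df : R -> R) (a b : R) : (forall x : R, is_derive x 1 f (df x)) ->
  exists2 c, `|c - a| <= `|b - a| & f b - f a = df c * (b - a).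
Proof.
move=> fd; have cf x y : {within `[x, y], continuous f}.
  apply: continuous_in_subspaceT => t _; apply: differentiable_continuous.
  by apply/derivable1_diffP; have [] := fd t.
have [ab|/ltW ba] := leP a b.
  have [c ci E] := MVT_segment ab (fun x _ => fd x) (cf a b); exists c => //.
  by move: ci; rewrite in_itv /= => /andP[h1 h2]; rewrite !ger0_norm ?subr_ge0// lerB.
have [c ci E] := MVT_segment ba (fun x _ => fd x) (cf b a); exists c.
  by move: ci; rewrite in_itv /= => /andP[h1 h2]; rewrite !ler0_norm ?subr_le0// lerN2 lerB.
by rewrite -opprB E -mulrN opprB.
Qed.

Lemma cos_quadratic t : `|cos t - 1| <= t ^+ 2.
Proof.
have [c ct E] := MVT_any 0 t (@is_derive_cos R); move: E ct; rewrite cos0 !subr0 => -> ct.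
rewrite normrM normrN -real_normK ?num_real// expr2 ler_pM//.
have [d dc E] := MVT_any 0 c (@is_derive_sin R); move: E dc; rewrite sin0 !subr0 => -> dc.
by rewrite normrM; apply: le_trans ct; rewrite ler_piMl// ler_norml cos_geN1 cos_le1.
Qed.

Lemma sin_quadratic t : `|sin t - t| <= t ^+ 2.
Proof.
have [c ct E] := MVT_any 0 t (@is_derive_sin R); move: E ct; rewrite sin0 !subr0 => E ct.
rewrite E -[X in _ - X]mul1r -mulrBl normrM -[leRHS]real_normK ?num_real// expr2 ler_wpM2r//.
have [d dc F] := MVT_any 0 c (@is_derive_cos R); move: F dc; rewrite cos0 !subr0 => -> dc.
rewrite normrM normrN; apply: le_trans ct; rewrite ler_piMl//.
by rewrite ler_norml sin_geN1 sin_le1.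
Qed.

Lemma expR_quadratic t : `|t| <= 2^-1 -> `|expR t - 1 - t| <= 2 * t ^+ 2.
Proof.
rewrite ler_norml => /andP[t1 t2]; have lo := expR_ge1Dx t.
have t10 : 0 < 1 - t by move: t2; clear; lra.
have : expR t <= (1 - t)^-1.
  rewrite -[leLHS]invrK -expRN lef_pV2 ?posrE ?expR_gt0//.
  by have := expR_ge1Dx (- t).
have hi : (1 - t)^-1 <= 1 + t + 2 * t ^+ 2.
  rewrite -div1r ler_pdivrMr//.
  have : 0 <= t ^+ 2 * (1 - 2 * t) by rewrite mulr_ge0 ?sqr_ge0//; move: t2; clear; lra.
  by clear; nra.
move=> up; rewrite ger0_norm; first by move: hi up; clear; lra.
by move: lo; clear; lra.
Qed.

Definition cexp z : C := (expR (complex.Re z))%:C * (cos (complex.Im z) +i* sin (complex.Im z)).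

Lemma cexpD z w : cexp (z + w) = cexp z * cexp w.
Proof.
case: z w => [a b] [c d]; rewrite /cexp /= expRD sinD cosD.
by apply/eqP; rewrite eq_complex /=; apply/andP; split; apply/eqP; ring.
Qed.

Lemma cexp0 : cexp 0 = 1.
Proof. by rewrite /cexp /= expR0 sin0 cos0 mul1r. Qed.

Lemma normc_cexp z : normc (cexp z) = expR (complex.Re z).
Proof.
rewrite /cexp normcM normc_real ger0_norm ?expR_ge0//.
by rewrite /normc cos2Dsin2 sqrtr1 mulr1.
Qed.

Lemma cexp_neq0 z : cexp z != 0.
Proof. by rewrite -normc_gt0 normc_cexp expR_gt0. Qed.

Lemma cexpN z : cexp (- z) = (cexp z)^-1.
Proof.
apply: (mulIf (cexp_neq0 z)); rewrite mulVf ?cexp_neq0//.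
by rewrite -cexpD addNr cexp0.
Qed.

Lemma cexpMn z n : cexp (n%:R * z) = cexp z ^+ n.
Proof.
elim: n => [|n IH]; first by rewrite mul0r cexp0 expr0.
by rewrite -natr1 mulrDl mul1r cexpD IH exprSr.
Qed.

Lemma cexp_real t : cexp t%:C = (expR t)%:C.
Proof. by rewrite /cexp /= sin0 cos0 mulr1. Qed.

(** The series of [exp], [cos] and [sin] are needed to second order only, which the
    mean value theorem provides. *)
Lemma cexp_quadratic z : normc z <= 2^-1 -> normc (cexp z - 1 - z) <= 8 * normc z ^+ 2.
Proof.
move=> z2; have a2 : `|complex.Re z| <= 2^-1 by apply: le_trans (le_Re_normc z) z2.
have b2 : `|complex.Im z| <= 2^-1 by apply: le_trans (le_Im_normc z) z2.
have N2 : normc z ^+ 2 = complex.Re z ^+ 2 + complex.Im z ^+ 2.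
  by rewrite normc_ReIm sqr_sqrtr ?addr_ge0 ?sqr_ge0.
rewrite N2; case: z z2 a2 b2 {N2} => a b /= _ a2 b2.
pose e := expR a - 1 - a; pose c := cos b - 1; pose s := sin b - b.
have he : `|e| <= 2 * a ^+ 2 by exact: expR_quadratic.
have hc : `|c| <= b ^+ 2 by exact: cos_quadratic.
have hs : `|s| <= b ^+ 2 by exact: sin_quadratic.
have E1 : `|expR a| <= 2.
  have -> : expR a = 1 + a + e by rewrite /e; ring.
  have := ler_normD (1 + a) e; have := ler_normD 1 a; rewrite normr1.
  move: a2 he; rewrite -(real_normK (num_real a)).
  have := normr_ge0 a; clear; move: `|a| => x; nra.
apply: le_trans (normc_le_ReIm _) _; rewrite /cexp /= !mul0r subr0 !addr0.
have -> : expR a * cos b - 1 - a = e + expR a * c by rewrite /e /c; ring.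
have -> : expR a * sin b - 0 - b = expR a * s + (a + e) * b by rewrite /e /s; ring.
have h1 : `|expR a * c| <= 2 * b ^+ 2 by rewrite normrM ler_pM.
have h2 : `|expR a * s| <= 2 * b ^+ 2 by rewrite normrM ler_pM.
have h3 : `|(a + e) * b| <= a ^+ 2 * 2 + b ^+ 2 * 2.
  rewrite normrM; have := ler_normD a e; move: he a2 b2.
  rewrite -(real_normK (num_real a)) -(real_normK (num_real b)).
  move: (normr_ge0 a) (normr_ge0 b) (normr_ge0 (a + e)); clear.
  move: `|a| `|b| `|e| `|a + e| => x y u v x0 y0 v0 h1 h2 h3 h4.
  have v2 : v <= 2 * x by nra.
  have : v * y <= 2 * x * y by rewrite ler_wpM2r.
  by have := sqr_ge0 (x - y); nra.
have := ler_normD e (expR a * c); have := ler_normD (expR a * s) ((a + e) * b).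
move: h1 h2 h3 he; have := sqr_ge0 a; have := sqr_ge0 b; clear.
by move: (a ^+ 2) (b ^+ 2) => A B; lra.
Qed.

Lemma cderiv_cexp z : has_cderiv cexp z (cexp z).
Proof.
apply: (@cderiv_of_quadratic_error _ _ _ _ (8 * normc (cexp z)) 2^-1); first by rewrite invr_gt0.
move=> w wz; have -> : cexp w - cexp z - cexp z * (w - z) = cexp z * (cexp (w - z) - 1 - (w - z)).
  rewrite -{1}(subrK z w) cexpD; ring.
by rewrite normcM (mulrC 8) -mulrA ler_wpM2l ?normc_ge0// cexp_quadratic// ltW.
Qed.

(** The principal logarithm on the right half-plane only, where the argument is
    the arctangent of the slope. *)
Definition clog z : C := ln (normc z) +i* atan (complex.Im z / complex.Re z).

Lemma clogK z : half_plane z -> cexp (clog z) = z.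
Proof.
move=> z0; have nz : 0 < normc z.
  rewrite normc_gt0; apply: contraTN z0 => /eqP ->; rewrite /half_plane /=.
  by apply/negP; rewrite ltxx.
rewrite /cexp /clog /= lnK ?posrE//; case: z z0 nz => x y; rewrite /half_plane /= => x0 nz.
set t := y / x; have q0 : 0 < Num.sqrt (1 + t ^+ 2) by rewrite sqrtr_gt0 ltr_wpDr ?sqr_ge0.
have nE : Num.sqrt (x ^+ 2 + y ^+ 2) = x * Num.sqrt (1 + t ^+ 2).
  rewrite -{2}(ger0_norm (ltW x0)) -sqrtr_sqr -sqrtrM ?sqr_ge0//.
  by congr Num.sqrt; rewrite /t; field; rewrite gt_eqF.
have c0 : cos (atan t) != 0 by rewrite cos_atan invr_eq0 gt_eqF.
have sE : sin (atan t) = t * cos (atan t) by rewrite -{2}(atanK t) /tan divfK.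
rewrite sE cos_atan normc_ReIm /= nE; apply/eqP; rewrite eq_complex /= !mul0r subr0 addr0.
by apply/andP; split; apply/eqP; rewrite /t; field; rewrite !gt_eqF.
Qed.

Lemma continuous_lipschitz_real (F : C -> R) z : (forall w, `|F w - F z| <= normc (w - z)) ->
  {for z, continuous F}.
Proof.
move=> H; apply: (@cvgrPdist_lt _ _ _ (nbhs z) _ F (F z)).2 => e e0.
apply: (nbhs_normP z _).2; exists e%:C => /=; first by rewrite ltcR.
move=> w; rewrite /ball_ /= => wz; rewrite distrC; apply: le_lt_trans (H w) _.
by rewrite normcB; move: wz; rewrite ltcR.
Qed.

Lemma clog_continuous z : half_plane z -> {for z, continuous clog}.
Proof.
move=> z0; have x0 : complex.Re z != 0 by rewrite gt_eqF.
have n0 : 0 < normc z.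
  by apply: lt_le_trans (le_Re_normc z); rewrite normr_gt0.
have cn : {for z, continuous (fun w : C => normc w)}.
  apply: continuous_lipschitz_real => w; rewrite ler_norml ler_normcB andbT lerNl opprB.
  by rewrite normcB ler_normcB.
have cRe : {for z, continuous (fun w : C => complex.Re w)}.
  by apply: continuous_lipschitz_real => w; rewrite -raddfB le_Re_normc.
have cIm : {for z, continuous (fun w : C => complex.Im w)}.
  by apply: continuous_lipschitz_real => w; rewrite -raddfB le_Im_normc.
have c1 : (fun w : C => ln (normc w)) @ z --> ln (normc z).
  exact: (continuous_comp cn (continuous_ln n0)).
have cq : {for z, continuous (fun w : C => complex.Im w / complex.Re w)}.
  have cV : (fun w : C => (complex.Re w)^-1) @ z --> (complex.Re z)^-1.
    by have := cvgV x0 cRe; apply; exact: nbhs_filter.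
  have cM := @cvgM _ _ (nbhs z) (nbhs_filter z) _ _ _ _ cIm cV.
  exact: cM.
have c2 : (fun w : C => atan (complex.Im w / complex.Re w)) @ z --> atan (complex.Im z / complex.Re z).
  exact: (continuous_comp cq (continuous_atan (x := _))).
apply/continuous_normcP => e e0; have e20 : 0 < e / 2 by rewrite divr_gt0.
have p1 := (@cvgrPdist_lt _ _ _ (nbhs z) (nbhs_filter z) _ _).1 c1 _ e20.
have p2 := (@cvgrPdist_lt _ _ _ (nbhs z) (nbhs_filter z) _ _).1 c2 _ e20.
have [d /=] := (nbhs_normP z _).1 (filterI p1 p2).
rewrite ltcE /= => /andP[/eqP dI d0] dP; exists (complex.Re d) => // w wz.
have [] := dP w; first by rewrite /ball_ /= (_ : d = (complex.Re d)%:C) ?ltcR ?(normcB z)//; case: (d) dI => p q /= ->.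
move=> /= h1 h2; rewrite normcB.
apply: le_lt_trans (normc_le_ReIm _) _; rewrite /clog /=.
by move: h1 h2; clear; lra.
Qed.

(** Caratheodory's criterion with a factorization that holds near [z] only. *)
Lemma cderiv_of_factor (f psi : C -> C) z (d : R) : 0 < d ->
  (forall w, normc (w - z) < d -> f w = f z + psi w * (w - z)) -> {for z, continuous psi} ->
  has_cderiv f z (psi z).
Proof.
move=> d0 H cpsi; exists (fun w => if w == z then psi z else (f w - f z) / (w - z)).
split; last by rewrite eqxx.
  move=> w; case: eqVneq => [->|wz]; first by rewrite subrr mulr0 addr0.
  by rewrite divfK ?subr_eq0// addrC subrK.
apply/continuous_normcP => e e0; have [d1 d10 d1P] := (continuous_normcP _ _).1 cpsi _ e0.
exists (Num.min d d1); first by rewrite lt_min d0 d10.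
move=> w; rewrite lt_min => /andP[wd wd1]; rewrite eqxx; case: eqVneq => [|wz].
  by rewrite subrr normc0.
by rewrite H// addrAC subrr add0r mulfK ?subr_eq0// d1P.
Qed.

(** The logarithm is differentiable as the inverse of the exponential. *)
Lemma cderiv_clog z : half_plane z -> has_cderiv clog z z^-1.
Proof.
move=> z0; have zn : z != 0.
  by apply: contraTN z0 => /eqP ->; rewrite /half_plane /=; apply/negP; rewrite ltxx.
have [phi [phiE cphi phiz]] := cderiv_cexp (clog z); rewrite clogK// in phiE phiz.
have cl := clog_continuous z0.
have cpl : {for z, continuous (fun w => phi (clog w))} by exact: (ccont_comp cl cphi).
have cpsi : {for z, continuous (fun w => (phi (clog w))^-1)}.
  by apply: ccontV cpl; rewrite phiz.
have nz : 0 < normc z by rewrite normc_gt0.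
have [d1 d10 d1P] := (continuous_normcP _ _).1 cpl _ nz.
have -> : z^-1 = (fun w => (phi (clog w))^-1) z by rewrite phiz.
have d0 : 0 < Num.min d1 (complex.Re z) by rewrite lt_min d10.
apply: (cderiv_of_factor d0 _ cpsi).
move=> w; rewrite lt_min => /andP[w1 w2]; have w0 := near_half_plane z0 w2.
have p0 : phi (clog w) != 0.
  apply/negP => /eqP p0; have := d1P w w1; rewrite p0 phiz sub0r normcN.
  by rewrite ltxx.
have := phiE (clog w); rewrite clogK// => wE.
have -> : w - z = phi (clog w) * (clog w - clog z) by rewrite {1}wE addrAC subrr add0r.
by rewrite mulKf// addrC subrK.
Qed.

Definition cpow z a : C := cexp (a * clog z).

Lemma cderiv_cpow z a : half_plane z -> has_cderiv (fun w => cpow w a) z (cpow z a * (a / z)).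
Proof.
move=> z0; exact: (cderiv_comp (cderivZ a (cderiv_clog z0)) (cderiv_cexp (a * clog z))).
Qed.

Lemma cpow_neq0 z a : cpow z a != 0. Proof. exact: cexp_neq0. Qed.

Lemma cpowD z a b : cpow z (a + b) = cpow z a * cpow z b.
Proof. by rewrite /cpow mulrDl cexpD. Qed.

Lemma cpow1 z : half_plane z -> cpow z 1 = z.
Proof. by move=> z0; rewrite /cpow mul1r clogK. Qed.

Lemma cpowMn z a n : cpow z (n%:R * a) = cpow z a ^+ n.
Proof. by rewrite /cpow -mulrA cexpMn. Qed.

Lemma clog_scale (m : R) z : 0 < m -> half_plane z -> clog (m%:C * z) = (ln m)%:C + clog z.
Proof.
move=> m0 z0; rewrite /clog normcM normc_real gtr0_norm// lnM ?posrE//; last first.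
  by apply: lt_le_trans (le_Re_normc z); rewrite normr_gt0 gt_eqF.
case: z z0 => x y; rewrite /half_plane /= => x0; apply/eqP; rewrite eq_complex /= eqxx add0r.
by apply/eqP; congr atan; rewrite !mul0r subr0 addr0; field; rewrite !gt_eqF.
Qed.

Lemma cpow_scale (m : R) z a : 0 < m -> half_plane z ->
  cpow (m%:C * z) a = cexp (a * (ln m)%:C) * cpow z a.
Proof. by move=> m0 z0; rewrite /cpow clog_scale// mulrDr cexpD. Qed.

Lemma atan_bound t : `|atan t| <= 2.
Proof.
have := atan_gtNpi2 t; have := atan_ltpi2 t; have /andP[_] := @pihalf_02 R.
by rewrite ler_norml; clear; move=> h1 h2 h3; apply/andP; split; lra.
Qed.

(** The argument of a point of the half-plane is bounded, so that the imaginary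
    part of the exponent changes the modulus by a bounded factor only. *)
Lemma normc_cpow z a : half_plane z ->
  normc (cpow z a) <= expR (2 * `|complex.Im a|) * (normc z `^ complex.Re a).
Proof.
move=> z0; have n0 : 0 < normc z.
  by apply: lt_le_trans (le_Re_normc z); rewrite normr_gt0 gt_eqF.
rewrite /powR gt_eqF// /cpow normc_cexp -expRD ler_expR; case: a => p q /=.
rewrite [leRHS]addrC lerD2l; apply: le_trans (ler_norm _) _; rewrite normrN normrM mulrC.
by rewrite ler_wpM2r// atan_bound.
Qed.

(** Some power of [i] rotates [z] into the half-plane, where [clog] is available. *)
Lemma cexp_surj z : z != 0 -> exists u, cexp u = z.
Proof.
move=> zn; pose I : C := cexp (0 +i* (pi / 2)).
have IE : I = 0 +i* 1 by rewrite /I /cexp /= expR0 mul1r cos_pihalf sin_pihalf.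
have [k kP] : exists k, half_plane (I ^+ k * z).
  rewrite IE; case: z zn => x y; rewrite eq_complex /half_plane /= => xy.
  have [x0|x0|x0] := ltgtP x 0.
  - by exists 2%N; rewrite expr2 /= ; move: x0; clear; lra.
  - by exists 0%N; rewrite expr0 mul1r.
  - rewrite x0 eqxx /= in xy *; have [y0|y0|y0] := ltgtP y 0.
    + by exists 1%N; rewrite expr1 /=; move: y0; clear; lra.
    + by exists 3%N; rewrite exprS expr2 /=; move: y0; clear; lra.
    + by rewrite y0 eqxx in xy.
exists (clog (I ^+ k * z) - k%:R * (0 +i* (pi / 2))).
rewrite cexpD cexpN clogK// cexpMn -/I mulrAC divff ?mul1r//.
by rewrite expf_neq0// cexp_neq0.
Qed.

(** Gives the exponent [a] for which [z^a] is multiplied by [l] under the dilation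
    by [mu]. *)
Lemma log_base (mu : R) (l : C) : 0 < mu -> mu != 1 -> l != 0 ->
  exists a, cexp (a * (ln mu)%:C) = l /\ mu `^ (complex.Re a) = normc l.
Proof.
move=> mu0 mu1 l0; have L0 : ln mu != 0.
  by rewrite -(ln1 R); apply: contra mu1 => /eqP h; apply/eqP; apply: ln_inj h => //; rewrite posrE.
have [u uE] := cexp_surj l0; exists (u / (ln mu)%:C).
have E : u / (ln mu)%:C * (ln mu)%:C = u.
  by rewrite divfK// -normc_gt0 normc_real normr_gt0.
rewrite E; split=> //; rewrite -uE normc_cexp /powR gt_eqF//; congr expR.
by rewrite -{2}E; case: (u / _) => p q /=; rewrite mulr0 subr0.
Qed.

Lemma cexp_2pi n : cexp (0 +i* (n%:R * (2 * pi))) = 1.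
Proof.
have -> : 0 +i* (n%:R * (2 * pi)) = n%:R * (0 +i* (2 * pi)) :> C.
  have -> : (n%:R : C) = (n%:R)%:C by rewrite rmorph_nat.
  by apply/eqP; rewrite eq_complex /= !mul0r mulr0 subr0 addr0 !eqxx.
rewrite cexpMn [cexp _](_ : _ = 1) ?expr1n// /cexp /= expR0 mul1r mulr_natl.
by rewrite cos2pi sin2pi.
Qed.

End ComplexPowers.

(** * Membership by decay *)

Section Membership.
Context {R : realType}.
Local Notation C := R[i].
Local Notation X := (hardy_bergman R).
Local Notation leb := (@lebesgue_measure R).
Implicit Types (z w : C) (b be : R).

Lemma powRN_anti b (u v : R) : 0 <= b -> 0 < u -> u <= v -> v `^ (- b) <= u `^ (- b).
Proof.
move=> b0 u0 uv; have v0 := lt_le_trans u0 uv.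
rewrite !powRN lef_pV2 ?posrE ?powR_gt0//.
by apply: ge0_ler_powR; rewrite ?nnegrE// ltW.
Qed.

Lemma powR_decay (be : R) : 0 < be -> (t `^ (- be)) @[t --> +oo] --> (0 : R).
Proof.
move=> be0; apply/cvgrPdist_le => e e0; exists (e `^ (- be^-1)); split; first exact: num_real.
move=> t /= te; have t0 : 0 < t by apply: lt_trans te; rewrite powR_gt0.
rewrite sub0r normrN ger0_norm ?powR_ge0//.
have -> : e = (e `^ (- be^-1)) `^ (- be).
  by rewrite -powRrM mulrNN mulVf ?gt_eqF// powRr1// ltW.
by apply: powRN_anti; rewrite ?powR_gt0// ltW.
Qed.

Lemma shifted_power_derive b be (t : R) : 0 < b + t -> be != 1 ->
  is_derive t 1 (fun t => (b + t) `^ (1 - be) / (1 - be)) ((b + t) `^ (- be)).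
Proof.
move=> bt be1; have n0 : 1 - be != 0 by rewrite subr_eq0 eq_sym.
have d1 : is_derive t 1 (fun t : R => b + t) 1.
  have h := is_deriveD (is_derive_cst b t 1) (is_derive_id t 1); rewrite add0r in h; exact: h.
have d2 := is_derive1_powR (1 - be) bt.
have d3 := is_derive1_comp d2 d1.
have d4 := is_deriveZ (1 - be)^-1 d3.
have -> : (b + t) `^ (- be) = (1 - be)^-1 *: (((1 - be) * (b + t) `^ (1 - be - 1)) * 1).
  by rewrite mulr1 /GRing.scale /= mulKf//; congr (_ `^ _); ring.
have -> : (fun t0 : R => (b + t0) `^ (1 - be) / (1 - be)) =
   (1 - be)^-1 \*: ((@powR R)^~ (1 - be) \o (fun t : R => b + t)).
  by apply/funext => s /=; rewrite mulrC.
exact: d4.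
Qed.

Lemma integral_power_fin b be : 0 < b -> 1 < be ->
  (\int[leb]_(t in `[0%R, +oo[) ((b + t) `^ (- be))%R%:E < +oo)%E.
Proof.
move=> b0 be1; have be1n : be != 1 by rewrite gt_eqF.
pose F t := (b + t) `^ (1 - be) / (1 - be).
have Fd (t : R) : 0 <= t -> is_derive t 1 F ((b + t) `^ (- be)).
  by move=> t0; apply: shifted_power_derive => //; rewrite ltr_pwDl.
have Fc (t : R) : 0 <= t -> {for t, continuous F}.
  move=> t0; apply: differentiable_continuous; apply/derivable1_diffP.
  by have [] := Fd t t0.
have fc (t : R) : 0 <= t -> {for t, continuous (fun t : R => (b + t) `^ (- be))}.
  move=> t0; have bt : 0 < b + t by rewrite ltr_pwDl.
  have c1 : {for t, continuous (fun t : R => b + t)}.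
    by apply: cvgD; [exact: cvg_cst|exact: cvg_id].
  have c2 : {for b + t, continuous ((@powR R)^~ (- be))}.
    apply: differentiable_continuous; apply/derivable1_diffP.
    by have [] := is_derive1_powR (- be) bt.
  exact: (continuous_comp c1 c2).
have Finf : F t @[t --> +oo] --> (0 : R).
  have h : (b + t) `^ (- (be - 1)) @[t --> +oo] --> (0 : R).
    have p := @powR_decay (be - 1) _; rewrite subr_gt0 in p.
    apply/cvgrPdist_le => e e0; have [M [Mr MP]] := (cvgrPdist_le _ _).1 (p be1) e e0.
    exists (M - b); split; first exact: num_real.
    by move=> t /= tM; apply: MP; rewrite addrC -ltrBlDr.
  have := cvgM h (cvg_cst (1 - be)^-1); rewrite mul0r opprB; exact.
rewrite (@ge0_continuous_FTC2y _ _ F 0 0) ?ltry//.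
- by move=> t _; exact: powR_ge0.
- apply/continuous_within_itvcyP; split; first by move=> t; rewrite in_itv /= andbT => /ltW/fc.
  by apply: cvg_at_right_filter; exact: fc.
- by move=> t /ltW /Fd[].
- by apply: cvg_at_right_filter; exact: Fc.
- by move=> t; rewrite in_itv /= andbT => /ltW/Fd[_ <-]; rewrite derive1E.
Qed.

Lemma measurable_shifted_power b be (f : R -> R) : measurable_fun setT f ->
  measurable_fun setT (fun t => ((b + f t) `^ (- be))%:E).
Proof.
move=> mf; apply/measurable_EFinP; have mbf : measurable_fun setT (fun t => b + f t) by exact: measurable_funD.
exact: (measurableT_comp (measurable_powR _) mbf).
Qed.

Lemma integral_abs_power_fin b be : 0 < b -> 1 < be ->
  (\int[leb]_t ((b + `|t|) `^ (- be))%R%:E < +oo)%E.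
Proof.
move=> b0 be1; pose h0 : R -> \bar R := (fun t : R => ((b + t) `^ (- be))%:E) \_ `[0, +oo[.
have h00 t : (0 <= h0 t)%E by apply: erestrict_ge0 => s _; rewrite lee_fin powR_ge0.
have mi : measurable (`[0, +oo[%classic : set R) by exact: measurable_itv.
have mh0 : measurable_fun setT h0.
  apply: ((measurable_restrictT _ mi).1); apply: measurable_funTS.
  exact: measurable_shifted_power.
have mh0N : measurable_fun setT (fun t : R => h0 (- t)).
  exact: (measurableT_comp mh0 (@oppr_measurable R setT)).
have i0 : (\int[leb]_t h0 t < +oo)%E.
  by rewrite /h0 -integral_mkcond; exact: integral_power_fin.
apply: (@le_lt_trans _ _ (\int[leb]_t (h0 t + h0 (- t)%R))%E).
  apply: ge0_le_integral => //.
  - by move=> t _; rewrite lee_fin powR_ge0.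
  - by apply: measurable_shifted_power; exact: normr_measurable.
  - by apply: emeasurable_funD.
  move=> t _; have hE s : 0 <= s -> h0 s = ((b + s) `^ (- be))%:E.
    by move=> s0; rewrite /h0 patchE mem_set//= in_itv /= s0.
  have [t0|t0] := leP 0 t; first by rewrite ger0_norm// (hE t)// leeDl.
  have t1 : 0 <= - t by rewrite oppr_ge0 ltW.
  by rewrite ltr0_norm// (hE (- t))// leeDr.
rewrite ge0_integralD// -ge0_integral_opp//.
by rewrite lte_add_pinfty.
Qed.

(** Decay faster than the inverse distance to a point left of the half-plane
    gives membership: half of the decay is spent on each of the two variables. *)
Lemma hb_of_decay (G : C -> C) b be K : 0 < b -> 1 < be -> 0 <= K -> holomorphic_rhp G ->
  (forall x y, 0 < x -> normc (G (x +i* y)) <= K * (x + b + `|y|) `^ (- be)) ->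
  exists f : X, forall z, half_plane z -> f z = G z.
Proof.
move=> b0 be1 K0 hG GB; have be0 : 0 <= be by rewrite (le_trans ler01)// ltW.
pose J := (\int[leb]_t ((b + `|t|) `^ (- be))%R%:E)%E.
have J0 : (0 <= J)%E by apply: integral_ge0 => t _; rewrite lee_fin powR_ge0.
have Jf : J \is a fin_num by rewrite ge0_fin_numE// integral_abs_power_fin.
pose j := fine J; have JE : J = j%:E by rewrite fineK.
have j0 : 0 <= j by apply: fine_ge0.
have line x : 0 < x -> (line_sqnorm G x <= (K ^+ 2 * j * (b + x) `^ (- be))%:E)%E.
  move=> x0; have bx : 0 < b + x by rewrite addr_gt0.
  have -> : (K ^+ 2 * j * (b + x) `^ (- be))%:E =
      (\int[leb]_t ((K ^+ 2 * (b + x) `^ (- be))%R%:E * ((b + `|t|) `^ (- be))%R%:E))%E.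
    rewrite ge0_integralZl_EFin//.
    - by rewrite -/J JE -EFinM; congr _%:E; ring.
    - by move=> t _; rewrite lee_fin powR_ge0.
    - by apply: measurable_shifted_power; exact: normr_measurable.
    - by rewrite mulr_ge0 ?sqr_ge0 ?powR_ge0.
  apply: ge0_le_integral => //.
  - by move=> y _; rewrite lee_fin sqr_ge0.
  - by apply/measurable_EFinP; exact: measurable_sqnorm_line.
  - apply: measurable_funeM; apply: measurable_shifted_power; exact: normr_measurable.
  move=> y _; rewrite -EFinM lee_fin.
  have p0 : 0 <= (x + b + `|y|) `^ (- be) by exact: powR_ge0.
  apply: (@le_trans _ _ ((K * (x + b + `|y|) `^ (- be)) ^+ 2)).
    by rewrite lerXn2r ?nnegrE ?normc_ge0 ?mulr_ge0// GB.
  rewrite exprMn -[leRHS]mulrA ler_wpM2l ?sqr_ge0// expr2 ler_pM//.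
    by apply: powRN_anti => //; rewrite (addrC x) lerDl.
  by apply: powRN_anti => //; rewrite ?ltr_wpDr// -addrA lerDr ltW.
apply: hb_of_rhp => //.
  apply: (@le_lt_trans _ _ (K ^+ 2 * j * b `^ (- be))%:E); last exact: ltry.
  apply: ge_ereal_sup => _ [x /= x0 <-]; apply: le_trans (line x x0) _.
  rewrite lee_fin ler_wpM2l ?mulr_ge0 ?sqr_ge0//.
  by apply: powRN_anti => //; rewrite lerDl ltW.
have mi : measurable (`[0, +oo[%classic : set R) by exact: measurable_itv.
rewrite (bergman_line hG).
apply: (@le_lt_trans _ _ (\int[leb]_(x in `[0%R, +oo[) ((K ^+ 2 * j)%R%:E * ((b + x) `^ (- be))%R%:E))%E).
  rewrite [leRHS]integral_mkcond; apply: ge0_le_integral => //.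
  - by move=> x _; apply: integral_ge0 => y _; exact: dens_ge0.
  - exact: (@measurable_fun_fubini_tonelli_F _ _ _ _ _ leb _ (measurable_dens hG) (dens_ge0 G)).
  - apply: ((measurable_restrictT _ mi).1); apply: measurable_funTS.
    by apply: measurable_funeM; exact: measurable_shifted_power.
  move=> x _; rewrite patchE; have [x0|x0] := ltP 0 x.
    rewrite -line_dens//; have -> : x \in `[0, +oo[%classic by rewrite mem_set//= in_itv /= ltW.
    exact: line.
  rewrite integral0_eq; last by move=> y _; exact: dens_left.
  by case: ifP => // _; rewrite -EFinM lee_fin mulr_ge0 ?mulr_ge0 ?sqr_ge0 ?powR_ge0.
rewrite ge0_integralZl_EFin//.
- by rewrite lte_mul_pinfty ?lee_fin ?mulr_ge0 ?sqr_ge0// integral_power_fin.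
- by move=> t _; rewrite lee_fin powR_ge0.
- by apply: measurable_funTS; exact: measurable_shifted_power.
- by rewrite mulr_ge0 ?sqr_ge0.
Qed.

(** Infinitely many roots are produced by the oscillation of imaginary powers. *)
Lemma poly_many_roots n (c : 'I_n -> C) (t : nat -> C) : injective t ->
  (forall k, \sum_j c j * t k ^+ j = 0) -> forall j, c j = 0.
Proof.
move=> tinj H j; pose p : {poly C} := \sum_j c j *: 'X^j.
have pE k : p.[t k] = 0.
  by rewrite -[RHS](H k) /p horner_sum; apply: eq_bigr => i _; rewrite hornerZ hornerXn.
have p0 : p = 0.
  apply: contrapT => /eqP p0.
  have := @max_poly_roots _ p (map t (iota 0 n)) p0.
  rewrite map_inj_uniq// iota_uniq size_map size_iota => H2.
  have : (n < size p)%N.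
    by apply: H2 => //; apply/allP => _ /mapP[k _ ->]; apply/eqP.
  rewrite ltnNge => /negP; apply; rewrite /p.
  apply: leq_trans (size_sum _ _ _) _; apply/bigmax_leqP => i _.
  by apply: leq_trans (size_scale_leq _ _) _; rewrite size_polyXn.
have := coef0 C j; rewrite -p0 /p coef_sum (bigD1 j)//= coefZ coefXn eqxx mulr1 big1 ?addr0//.
move=> i ij; rewrite coefZ coefXn; case: eqP => [/val_inj e|_]; last by rewrite mulr0.
by rewrite e eqxx in ij.
Qed.

Definition circle_point (k : nat) : C := 0 +i* (k.+1%:R^-1).

Lemma circle_point_inj : injective (fun k => cexp (circle_point k)).
Proof.
have in0pi (k : nat) : (k.+1%:R^-1 : R) \in `[0, pi].
  rewrite in_itv /= invr_ge0 ler0n /=; apply: (@le_trans _ _ 1).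
    by rewrite invf_le1// ler1n.
  by have := @pihalf_ge1 R; clear; lra.
move=> k m; rewrite /circle_point /cexp /= expR0 !mul1r => -[h _].
have /invr_inj/eqP := cos_inj (in0pi k) (in0pi m) h.
by rewrite eqr_nat => /eqP[].
Qed.

End Membership.

(** * Functions along the orbits of a dilation *)

Section Dilations.
Context {R : realType}.
Local Notation C := R[i].
Local Notation X := (hardy_bergman R).
Local Notation leb := (@lebesgue_measure R).
Implicit Types (f g : X) (T : {linear X -> X}) (l z : C) (mu s : R).

Lemma rcont_hb_sqr f (x : R) : 0 < x -> {for x, continuous (fun t : R => normc (f (t +i* 0)) ^+ 2)}.
Proof.
move=> x0; have c : {for x +i* 0, continuous f} by apply: derivable_continuous; exact: hb_holomorphic.
have cn := continuous_normc (hline_continuous c).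
have H : (fun t : R => normc (f (t +i* 0)) * normc (f (t +i* 0))) @ x --> normc (f (x +i* 0)) * normc (f (x +i* 0)).
  exact: (cvgM cn cn).
exact: H.
Qed.

Lemma Rintegral_split (h : R -> R) (a m b : R) : a <= m <= b ->
  leb.-integrable `[a, b] (EFin \o h) ->
  \int[leb]_(x in `[a, b]) h x = \int[leb]_(x in `[a, m]) h x + \int[leb]_(x in `[m, b]) h x.
Proof.
move=> /andP[am mb] fi; apply/eqP; rewrite addrC -subr_eq; apply/eqP.
rewrite Rintegral_itvB ?bnd_simp//.
rewrite Rintegral_itv_obnd_cbnd//; apply: integrableS fi => //.
by apply: subset_itvr; rewrite bnd_simp.
Qed.

Lemma Rintegral_split_ge (h : R -> R) (a u v b : R) : 0 < a -> a < u -> u <= v -> v <= b ->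
  (forall x, 0 < x -> {for x, continuous h}) -> (forall x, 0 <= h x) ->
  \int[leb]_(x in `[a, u]) h x + \int[leb]_(x in `[v, b]) h x <= \int[leb]_(x in `[a, b]) h x.
Proof.
move=> a0 au uv vb hc h0.
have hi x y : 0 < x -> leb.-integrable `[x, y] (EFin \o h).
  by move=> x0; apply: integrable_continuous => t /andP[xt _]; apply: hc; exact: lt_le_trans xt.
have u0 := lt_trans a0 au; have ub := le_trans uv vb.
rewrite (@Rintegral_split h a u b) ?(ltW au) ?ub//; last exact: hi.
rewrite (@Rintegral_split h u v b) ?uv ?vb//; last exact: hi.
by rewrite lerD2l lerDr; apply: Rintegral_ge0 => x _; exact: h0.
Qed.

(** By the Fejer-Riesz inequality [|f|^2] is integrable on the positive axis. If it
    exceeded [e mu^n] on nearly all the disjoint intervals from [s1 / mu^n] to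
    [s2 / mu^n], each of them would contribute at least [e (s2 - s1)]. *)
Lemma radial_small f mu s1 s2 (e : R) N : 1 < mu -> 0 < s1 -> s1 < s2 -> s2 <= mu * s1 -> 0 < e ->
  exists n s, [/\ (N <= n)%N, s1 <= s <= s2 & (mu ^+ n)^-1 * normc (f (((mu ^+ n)^-1 * s) +i* 0)) ^+ 2 <= e].
Proof.
move=> mu1 s10 s12 s21 e0; apply: contrapT => H.
have mu0 : 0 < mu by apply: lt_trans mu1.
have m0 n : 0 < (mu ^+ n)^-1 by rewrite invr_gt0 exprn_gt0.
pose h (x : R) := normc (f (x +i* 0)) ^+ 2.
have hc x : 0 < x -> {for x, continuous h} by exact: rcont_hb_sqr.
have h0 x : 0 <= h x by exact: sqr_ge0.
pose I n := \int[leb]_(x in `[(mu ^+ n)^-1 * s1, (mu ^+ n)^-1 * s2]) h x.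
have Ilow n : (N <= n)%N -> e * (s2 - s1) <= I n.
  move=> Nn.
  have -> : e * (s2 - s1) = (e * mu ^+ n) * ((mu ^+ n)^-1 * s2 - (mu ^+ n)^-1 * s1).
    by field; rewrite expf_neq0// gt_eqF.
  have le12 : (mu ^+ n)^-1 * s1 <= (mu ^+ n)^-1 * s2 by rewrite ler_pM2l// ltW.
  rewrite -(Rintegral_segment_cst _ le12); apply: le_Rintegral => //.
  - by apply: integrable_continuous => x _; exact: cvg_cst.
  - apply: integrable_continuous => x /andP[x1 _]; apply: hc; apply: lt_le_trans x1.
    by rewrite mulr_gt0.
  move=> x /=; rewrite in_itv /= => /andP[x1 x2]; rewrite leNgt; apply/negP => hx.
  apply: H; exists n, (mu ^+ n * x); split => //.
    by rewrite -ler_pdivrMl ?exprn_gt0// x1 -ler_pdivlMl ?exprn_gt0.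
  by rewrite mulKf ?expf_neq0 ?gt_eqF// mulrC ler_pdivrMr ?exprn_gt0// ltW.
have sum K : K%:R * (e * (s2 - s1)) <=
    \int[leb]_(x in `[(mu ^+ (N + K))^-1 * s1, (mu ^+ N)^-1 * s2]) h x.
  elim: K => [|K IH].
    by rewrite mul0r; apply: Rintegral_ge0 => x _; exact: h0.
  rewrite -natr1 mulrDl mul1r addrC addnS.
  apply: le_trans (lerD (Ilow (N + K).+1 _) IH) _; first by rewrite -addnS leq_addr.
  apply: Rintegral_split_ge => //.
  - by rewrite mulr_gt0.
  - by rewrite ltr_pM2l.
  - by rewrite exprSr invfM -mulrA ler_pM2l// ler_pdivrMl.
  - apply: ler_pM; rewrite ?(ltW (m0 _)) ?(ltW s10) ?(ltW s12)//.
    by rewrite lef_pV2 ?posrE ?exprn_gt0// ler_weXn2l ?(ltW mu1)// leq_addr.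
pose D := e * (s2 - s1); have D0 : 0 < D by rewrite mulr_gt0// subr_gt0.
pose K := (Num.trunc (4 * hb_norm f ^+ 2 / D)).+1.
have : 4 * hb_norm f ^+ 2 / D < K%:R by exact: truncnS_gt.
rewrite ltr_pdivrMr// ltNge => /negP; apply; apply: le_trans (sum K) _.
apply: fejer_riesz; first by rewrite mulr_gt0.
apply: ler_pM; rewrite ?(ltW (m0 _)) ?(ltW s10) ?(ltW s12)//.
by rewrite lef_pV2 ?posrE ?exprn_gt0// ler_weXn2l ?(ltW mu1)// leq_addr.
Qed.

Lemma normc_powRN_le z (be : R) : 0 < complex.Re z -> 0 <= be ->
  normc z `^ (- be) <= 2 `^ be * (complex.Re z + `|complex.Im z|) `^ (- be).
Proof.
move=> z0 be0; have n0 : 0 < normc z.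
  by apply: lt_le_trans (le_Re_normc z); rewrite normr_gt0 gt_eqF.
have r0 : 0 < complex.Re z + `|complex.Im z| by rewrite ltr_pwDl.
have le2 : complex.Re z + `|complex.Im z| <= 2 * normc z.
  have := le_Re_normc z; have := le_Im_normc z; rewrite (gtr0_norm z0); clear; lra.
have -> : normc z `^ (- be) = 2 `^ be * (2 * normc z) `^ (- be).
  rewrite powRM// ?(ltW n0)// mulrA (powRN 2) mulfV ?mul1r// gt_eqF//; exact: powR_gt0.
by rewrite ler_wpM2l ?powR_ge0//; exact: powRN_anti.
Qed.

Lemma half_plane_neq0 z : half_plane z -> z != 0.
Proof. by apply: contraTN => /eqP ->; apply/negP; rewrite /half_plane /= ltxx. Qed.

Lemma shiftedE T l f z : shifted T l f z = T f z - l * f z. Proof. by []. Qed.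

Lemma half_plane_scale (m : R) z : 0 < m -> half_plane z -> half_plane (m%:C * z).
Proof. by case: z => [a b] m0; rewrite /half_plane /= mul0r subr0 => a0; rewrite mulr_gt0. Qed.

Lemma half_planeD z w : half_plane z -> 0 <= complex.Re w -> half_plane (z + w).
Proof. by case: z w => [a b] [c d]; rewrite /half_plane /= => a0 c0; rewrite ltr_pwDl. Qed.

Lemma holomorphic_cpow (a : C) : holomorphic_rhp (fun z => cpow z a).
Proof. by move=> z z0; apply/derivable_cderivP; eexists; exact: cderiv_cpow. Qed.

Lemma holomorphicM (F G : C -> C) : holomorphic_rhp F -> holomorphic_rhp G ->
  holomorphic_rhp (fun z => F z * G z).
Proof.
move=> hF hG z z0; have /derivable_cderivP[D FD] := hF z z0.
have /derivable_cderivP[E GE] := hG z z0.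
by apply/derivable_cderivP; eexists; exact: cderivM FD GE.
Qed.

Lemma holomorphic_inv_shift (b : C) n : 0 <= complex.Re b -> holomorphic_rhp (fun z => ((z + b) ^+ n)^-1).
Proof.
move=> b0; elim: n => [|n IH] z z0.
  by apply/derivable_cderivP; eexists; apply: cderiv_near (cderiv_const 1 z); exists 1; rewrite // => w _; rewrite expr0 invr1.
have zb : z + b != 0 by apply: half_plane_neq0; exact: half_planeD.
have /derivable_cderivP[E GE] := IH z z0; apply/derivable_cderivP; eexists.
apply: cderiv_near; last exact: (cderivM (@cderivV _ (fun u => u + b) _ _ zb (cderivD (cderiv_id z) (cderiv_const b z))) GE).
by exists 1 => // w _; rewrite exprS invfM.
Qed.

(** Imaginary powers are bounded on the half-plane, so the factor [(z + 1)^-2]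
    alone puts them into the space. They are eigenfunctions of dilations. *)
Lemma imaginary_power_test (a : C) : complex.Re a = 0 ->
  exists g, forall z, half_plane z -> g z = cpow z a * ((z + 1) ^+ 2)^-1.
Proof.
move=> a0; pose K := expR (2 * `|complex.Im a|) * 2 `^ 2.
have K0 : 0 <= K by rewrite mulr_ge0 ?expR_ge0 ?powR_ge0.
have hG : holomorphic_rhp (fun z => cpow z a * ((z + 1) ^+ 2)^-1).
  by apply: holomorphicM; [exact: holomorphic_cpow|apply: holomorphic_inv_shift; exact: ler01].
have b1 : (1 : R) < 2 by rewrite ltr1n.
apply: (hb_of_decay ltr01 b1 K0 hG) => x y x0.
have z0 : half_plane (x +i* y) by [].
rewrite normcM normcV normcX /K -mulrA; apply: ler_pM; rewrite ?normc_ge0 ?invr_ge0 ?exprn_ge0 ?normc_ge0//.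
  by apply: le_trans (normc_cpow a z0) _; rewrite a0 powRr0 mulr1.
have z1 : 0 < complex.Re ((x +i* y) + 1) by rewrite /=; apply: addr_gt0.
have := normc_powRN_le z1 (ler0n R 2); rewrite powRN (powR_mulrn 2 (normc_ge0 _)) /=.
by rewrite addr0.
Qed.

(** Weighted by [l^-(k + 1)], the equation [T f - l f] telescopes along an orbit. *)
Lemma dilation_telescope T mu l f z n : 0 < mu -> l != 0 ->
  is_composition_operator (fun z => mu%:C * z) T -> half_plane z ->
  \sum_(k < n) l ^- k.+1 * shifted T l f ((mu ^+ k)%:C * z) = l ^- n * f ((mu ^+ n)%:C * z) - f z.
Proof.
move=> mu0 l0 TP z0; elim: n => [|n IH].
  by rewrite big_ord0 !expr0 invr1 !mul1r subrr.
have zn : half_plane ((mu ^+ n)%:C * z).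
  by apply: half_plane_scale => //; rewrite exprn_gt0.
have E : shifted T l f ((mu ^+ n)%:C * z) = f ((mu ^+ n.+1)%:C * z) - l * f ((mu ^+ n)%:C * z).
  by rewrite shiftedE TP// mulrA -rmorphM -exprS.
transitivity (l ^- n * f ((mu ^+ n)%:C * z) - f z +
    l ^- n.+1 * (f ((mu ^+ n.+1)%:C * z) - l * f ((mu ^+ n)%:C * z))).
  by rewrite big_ord_recr IH -E.
rewrite mulrBr mulrA.
have -> : l ^- n.+1 * l = l ^- n by rewrite exprSr invfM mulrAC -mulrA mulfV// mulr1.
by rewrite addrC addrA subrK.
Qed.

Lemma normc_cpow_imaginary (a : C) (x : R) : complex.Re a = 0 -> 0 < x -> normc (cpow x%:C a) = 1.
Proof.
move=> a0 x0; rewrite /cpow normc_cexp /clog /=; case: a a0 => p q /= ->.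
by rewrite !mul0r atan0 mulr0 subr0 expR0.
Qed.

Lemma half_plane_real (x : R) : 0 < x -> half_plane x%:C. Proof. by []. Qed.

(** After the phases are removed, all terms of the telescoping sum along the
    positive axis have the same sign, so a single term bounds the sum below. *)
Lemma dilation_lower_bound T mu l f (a : C) (P : C -> C) n (x : R) : 0 < mu -> l != 0 ->
  is_composition_operator (fun z => mu%:C * z) T ->
  complex.Re a = 0 -> cexp (a * (ln mu)%:C) = l / (normc l)%:C ->
  (forall z, half_plane z -> P (mu%:C * z) = P z) ->
  (forall z, half_plane z -> shifted T l f z = cpow z a * P z * ((z + 1) ^+ 2)^-1) ->
  (0 < n)%N -> 0 < x ->
  normc (P x%:C) / (normc l * (x + 1) ^+ 2) <=
    normc l ^- n * normc (f (mu ^+ n * x)%:C) + normc l ^+ n * normc (f ((mu ^+ n)^-1 * x)%:C).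
Proof.
move=> mu0 l0 TP a0 aE Pmu gE n0 x0; set y := (mu ^+ n)^-1 * x.
have L0 : 0 < normc l by rewrite normc_gt0.
have m0 k : 0 < mu ^+ k by rewrite exprn_gt0.
have y0 : 0 < y by rewrite mulr_gt0// invr_gt0.
have yx : mu ^+ n * y = x by rewrite /y mulVKf// gt_eqF.
clearbody y.
have P_iter k z : half_plane z -> P ((mu ^+ k)%:C * z) = P z.
  move=> z0; elim: k => [|k IH]; first by rewrite expr0 mul1r.
  by rewrite exprS rmorphM -mulrA Pmu ?IH//; exact: half_plane_scale.
have cpow_iter k z : half_plane z -> cpow ((mu ^+ k)%:C * z) a = (l / (normc l)%:C) ^+ k * cpow z a.
  move=> z0; elim: k => [|k IH]; first by rewrite !expr0 !mul1r.
  rewrite exprS rmorphM -mulrA cpow_scale//; last exact: half_plane_scale.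
  by rewrite aE IH exprS mulrA.
pose r k : R := normc l ^- k / (mu ^+ k * y + 1) ^+ 2.
have d0 k : 0 < mu ^+ k * y + 1 by rewrite addr_gt0// mulr_gt0.
have r0 k : 0 <= r k by rewrite divr_ge0 ?invr_ge0 ?exprn_ge0 ?(ltW L0) ?(ltW (d0 _)).
have term k : l ^- k.+1 * shifted T l f ((mu ^+ k)%:C * y%:C) = l^-1 * (cpow y%:C a * P y%:C) * (r k)%:C.
  have hk : half_plane ((mu ^+ k)%:C * y%:C) by exact: half_plane_scale.
  rewrite gE// P_iter// cpow_iter// /r rmorphM !fmorphV !rmorphXn rmorphD rmorphM rmorph1 !rmorphXn /=.
  have Ln : (normc l)%:C != 0 :> C by rewrite -normc_gt0 normc_real gtr0_norm.
  have dn : (mu%:C ^+ k * y%:C + 1) != 0 :> C.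
    rewrite -normc_gt0 -rmorphXn -rmorphM -(rmorph1 (real_complex R)) -rmorphD normc_real.
    by rewrite normr_gt0 gt_eqF.
  by rewrite exprMn exprS exprVn; field; rewrite !expf_neq0// l0 dn.
have E : \sum_(k < n + n) l ^- k.+1 * shifted T l f ((mu ^+ k)%:C * y%:C) =
    l^-1 * (cpow y%:C a * P y%:C) * (\sum_(k < n + n) r k)%:C.
  by rewrite rmorph_sum mulr_sumr; apply: eq_bigr => k _; exact: term.
have := dilation_telescope f (n + n) mu0 l0 TP (half_plane_real y0); rewrite E => {}E.
have PE : P y%:C = P x%:C by rewrite -yx rmorphM P_iter.
have := congr1 (@normc R) E; rewrite normcM normcM normcV (normcM (cpow _ _)) normc_cpow_imaginary// mul1r PE.
rewrite normc_real ger0_norm ?sumr_ge0// => NE.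
(* Only the term k = n is kept: its point of the orbit is x. *)
have low : normc l ^- n / (x + 1) ^+ 2 <= \sum_(k < n + n) r k.
  have nn : (n < n + n)%N by rewrite -addn1 leq_add2l.
  rewrite (bigD1 (Ordinal nn))//= {1}/r yx lerDl; apply: sumr_ge0 => k _; exact: r0.
have up := ler_normcB (l ^- (n + n) * f ((mu ^+ (n + n))%:C * y%:C)) (f y%:C).
have up2 : normc (l ^- (n + n) * f ((mu ^+ (n + n))%:C * y%:C) - f y%:C) <=
    normc l ^- (n + n) * normc (f (mu ^+ n * x)%:C) + normc (f y%:C).
  apply: le_trans (le_normcD _ _) _; rewrite normcN normcM normcV normcX.
  by rewrite -rmorphM (exprD mu) -(mulrA (mu ^+ n)) yx.
have step : normc l ^- 1 * normc (P x%:C) * (normc l ^- n / (x + 1) ^+ 2) <=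
    normc l ^- (n + n) * normc (f (mu ^+ n * x)%:C) + normc (f y%:C).
  apply: le_trans up2; rewrite -NE expr1; apply: ler_wpM2l low.
  by rewrite mulr_ge0 ?invr_ge0 ?normc_ge0.
have Ln : 0 < normc l ^+ n by rewrite exprn_gt0.
have := ler_wpM2l (ltW Ln) step; rewrite mulrDr.
have -> : normc l ^+ n * (normc l ^- 1 * normc (P x%:C) * (normc l ^- n / (x + 1) ^+ 2)) =
    normc (P x%:C) / (normc l * (x + 1) ^+ 2).
  by rewrite expr1; field; rewrite expf_neq0 ?gt_eqF// addr_gt0.
have -> : normc l ^+ n * (normc l ^- (n + n) * normc (f (mu ^+ n * x)%:C)) =
    normc l ^- n * normc (f (mu ^+ n * x)%:C).
  by rewrite exprD; field; rewrite expf_neq0 ?gt_eqF.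
by [].
Qed.

End Dilations.

(** * The spectrum of dilations *)

Section DilationSpectrum.
Context {R : realType}.
Local Notation C := R[i].
Local Notation X := (hardy_bergman R).
Implicit Types (f g : X) (T D : {linear X -> X}) (l z : C) (mu : R).

Lemma hb_sumE n (c : 'I_n -> C) (g : 'I_n -> X) z : (\sum_i c i *: g i) z = \sum_i c i * g i z.
Proof.
elim: n c g => [|n IH] c g; first by rewrite !big_ord0.
by rewrite !big_ord_recr hbD hbZ IH.
Qed.

Lemma unimodular_base mu l : 1 < mu -> l != 0 -> exists a,
  complex.Re a = 0 /\ cexp (a * (ln mu)%:C) = l / (normc l)%:C.
Proof.
move=> mu1 l0; have mu0 : 0 < mu by apply: lt_trans mu1.
have L0 : 0 < normc l by rewrite normc_gt0.
have Ln : (normc l)%:C != 0 :> C by rewrite -normc_gt0 normc_real gtr0_norm.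
have u0 : l / (normc l)%:C != 0 by rewrite mulf_neq0 ?invr_eq0.
have mun : mu != 1 by rewrite gt_eqF.
have [a [aE aN]] := log_base mu0 mun u0; exists a; split=> //.
move: aN; rewrite normcM normcV normc_real gtr0_norm// divff ?gt_eqF//.
rewrite /powR gt_eqF// => /(congr1 (@ln R)); rewrite expRK ln1 => /eqP.
by rewrite mulf_eq0 (gt_eqF (ln_gt0 mu1)) orbF => /eqP.
Qed.

(** The imaginary exponent [q] for which [z^q] is invariant under the dilation by
    [mu]. *)
Definition period_exponent mu : C := 0 +i* (2 * pi / ln mu).

Lemma cexp_period mu : 1 < mu -> cexp (period_exponent mu * (ln mu)%:C) = 1.
Proof.
move=> mu1; rewrite -[RHS](cexp_2pi 1); congr cexp; apply/eqP; rewrite eq_complex /=.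
have L0 : ln mu != 0 by rewrite gt_eqF// ln_gt0.
by rewrite !mul0r !mulr0 subr0 add0r mul1r divfK// !eqxx.
Qed.

Lemma ccont_sum n (c : 'I_n -> C) (F : 'I_n -> C -> C) z :
  (forall i, {for z, continuous (F i)}) -> {for z, continuous (fun w => \sum_i c i * F i w)}.
Proof.
elim: n c F => [|n IH] c F H.
  have -> : (fun w => \sum_(i < 0) c i * F i w) = (fun _ => 0) by apply/funext => w; rewrite big_ord0.
  exact: ccont_cst.
have -> : (fun w => \sum_(i < n.+1) c i * F i w) = (fun w => \sum_(i < n) c (widen_ord (leqnSn n) i) * F (widen_ord (leqnSn n) i) w + c ord_max * F ord_max w).
  by apply/funext => w; rewrite big_ord_recr.
pose w_ := widen_ord (leqnSn n).
have h1 : {for z, continuous (fun w => \sum_(i < n) c (w_ i) * F (w_ i) w)}.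
  exact: (IH (fun i => c (w_ i)) (fun i => F (w_ i)) (fun i => H (w_ i))).
have h2 : {for z, continuous (fun w => c ord_max * F ord_max w)}.
  exact: (@ccontM _ (fun _ => c ord_max) (F ord_max) z (@ccont_cst _ (c ord_max) z) (H ord_max)).
exact: (ccontD h1 h2).
Qed.

Lemma ccontX (F : C -> C) n z : {for z, continuous F} -> {for z, continuous (fun w => F w ^+ n)}.
Proof.
move=> cF; elim: n => [|n IH]; first exact: ccont_cst.
have -> : (fun w => F w ^+ n.+1) = (fun w => F w * F w ^+ n) by apply/funext => w; rewrite exprS.
exact: (ccontM cF IH).
Qed.

(** On ]1, mu[ the power [x^q] runs through the unit circle, so that the
    combination is a polynomial with infinitely many roots. *)
Lemma imaginary_power_independent mu n (c : 'I_n -> C) : 1 < mu ->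
  (forall x, 1 < x -> x < mu -> \sum_j c j * cpow x%:C (period_exponent mu) ^+ j = 0) ->
  forall j, c j = 0.
Proof.
move=> mu1 P0; have mu0 : 0 < mu by apply: lt_trans mu1.
apply: (poly_many_roots circle_point_inj) => k.
pose x := expR (ln mu * (k.+1%:R^-1 / (2 * pi))).
have p0 : 0 < 2 * pi :> R by rewrite mulr_gt0// pi_gt0.
have L : 0 < ln mu by rewrite ln_gt0.
have x1 : 1 < x by rewrite -(expR0 R) ltr_expR mulr_gt0// divr_gt0// invr_gt0.
have xm : x < mu.
  rewrite -[ltRHS]lnK ?posrE// ltr_expR gtr_pMr// ltr_pdivrMr// mul1r.
  apply: (@le_lt_trans _ _ 1); first by rewrite invf_le1// ler1n.
  by have := @pihalf_ge1 R; clear; lra.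
rewrite -[RHS](P0 x x1 xm); apply: eq_bigr => j _; congr (_ * _ ^+ _).
rewrite /cpow /clog /= normc_real ger0_norm ?expR_ge0// expRK mul0r atan0 /period_exponent /circle_point.
congr cexp; apply/eqP; rewrite eq_complex /= !mul0r mulr0 subr0 add0r eqxx /=.
have pi0 := @pi_gt0 R.
have k0 : (0 : R) < k.+1%:R by rewrite ltr0n.
clear - pi0 L k0; move: (pi : R) pi0 (ln mu) L (k.+1%:R : R) k0 => p p0 L L0 m m0.
by apply/eqP; field; rewrite !gt_eqF.
Qed.

(** With [a] imaginary chosen so that [mu^a] is the phase of [l], and [q] the
    imaginary exponent with [mu^q = 1], a function [z^a P(z^q) / (z + 1)^2] in the
    range would be [T f - l f]. Along the orbit [mu^k x] the telescoping sum bounds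
    [P] by [f] at the two far ends: at infinity [f] is o(1/x), which suffices for
    [|l| >= 1 / mu], and near zero it is o(x^(-1/2)) at suitable points, which
    suffices for [|l|^2 <= 1 / mu]. Hence [P = 0] on the positive axis. *)
Lemma dilation_not_fin_codim T mu l : 1 < mu -> is_composition_operator (fun z => mu%:C * z) T ->
  mu^-1 <= normc l -> normc l ^+ 2 <= mu^-1 -> ~ fin_codim (range (shifted T l)).
Proof.
move=> mu1 TP l1 l2 fc; have mu0 : 0 < mu by apply: lt_trans mu1.
have L0 : 0 < normc l by apply: lt_le_trans l1; rewrite invr_gt0.
have l0 : l != 0 by rewrite -normc_gt0.
have [a [a0 aE]] := unimodular_base mu1 l0.
pose q := period_exponent mu.
have gex j : exists g : X, forall z, half_plane z -> g z = cpow z (a + j%:R * q) * ((z + 1) ^+ 2)^-1.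
  apply: imaginary_power_test; rewrite raddfD /= a0 add0r.
  by rewrite -(rmorph_nat (real_complex R)) /= !mulr0 mul0r subr0.
have [g gE] := choice gex.
have [n [c [[i0 ci0] [f fE]]]] := fin_codim_relation g fc.
pose P z := \sum_j c j * cpow z q ^+ j.
have PE z : half_plane z -> shifted T l f z = cpow z a * P z * ((z + 1) ^+ 2)^-1.
  move=> z0; rewrite fE hb_sumE /P mulr_sumr mulr_suml; apply: eq_bigr => j _.
  by rewrite gE// cpowD cpowMn; ring.
have Pmu z : half_plane z -> P (mu%:C * z) = P z.
  by move=> z0; apply: eq_bigr => j _; rewrite cpow_scale// cexp_period// mul1r.
have Pc z : half_plane z -> {for z, continuous P}.
  move=> z0; apply: ccont_sum => i; apply: ccontX.
  exact: cderiv_continuous (cderiv_cpow q z0).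
suff P0 (x : R) : 1 < x -> x < mu -> P x%:C = 0.
  by move: ci0; rewrite (imaginary_power_independent mu1 P0) eqxx.
clearbody P; move=> x1 xmu; have x0 : 0 < x by apply: lt_trans x1.
apply/eqP; rewrite -normc_eq0 eq_le normc_ge0 andbT; apply/ler_addgt0Pl => e e0; rewrite addr0.
pose K := (mu + 1) ^+ 2; have K0 : 0 < K by rewrite exprn_gt0// addr_gt0.
pose d := e / (1 + 2 * K).
have d0 : 0 < d by rewrite divr_gt0// addr_gt0// mulr_gt0.
have dE : e = d + 2 * K * d by rewrite /d; field; rewrite gt_eqF// addr_gt0// mulr_gt0.
clearbody d.
have [r r0 rP] := (continuous_normcP _ _).1 (Pc x%:C (half_plane_real x0)) d d0.
(* On [s1, s2] the polynomial is within d of its value at x, so it is enough to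
   bound it at the point s of this interval where f is small. *)
pose s1 := Num.max (x - r / 2) 1; pose s2 := Num.min (x + r / 2) mu.
have s12 : s1 < s2.
  by rewrite lt_min !gt_max; move: r0 x1 xmu; clear; lra.
have s11 : 1 <= s1 by rewrite le_max lexx orbT.
have s2mu : s2 <= mu by rewrite ge_min lexx orbT.
have [M MP] := decay_at_infinity f d0.
have [N NM] := pow_unbounded M mu1.
have sm : s2 <= mu * s1 by apply: le_trans s2mu _; rewrite ler_pMr// ltW.
have s10 : 0 < s1 by apply: lt_le_trans s11.
have d20 : 0 < d ^+ 2 by rewrite exprn_gt0.
have [m [s [Nm /andP[ss1 ss2] sP]]] := radial_small f N.+1 mu1 s10 s12 sm d20.
have s0 : 0 < s by apply: lt_le_trans ss1.
have m0 : (0 < m)%N by apply: leq_ltn_trans Nm.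
have := dilation_lower_bound mu0 l0 TP a0 aE Pmu PE m0 s0.
have mm : 0 < mu ^+ m by rewrite exprn_gt0.
have b1 : normc l ^- m * normc (f (mu ^+ m * s)%:C) <= d.
  have ms : 0 < mu ^+ m * s by rewrite mulr_gt0.
  have s1' : 1 <= s by apply: le_trans ss1.
  apply: le_trans (MP _ 0 ms _); last first.
    by rewrite normr0 addr0; apply: le_trans (NM m (ltnW Nm)) _; rewrite ler_pMr.
  rewrite ler_wpM2r ?normc_ge0//; apply: (@le_trans _ _ (mu ^+ m)); last by rewrite ler_pMr.
  by rewrite -exprVn lerXn2r ?nnegrE ?invr_ge0 ?(ltW L0) ?(ltW mu0)// -[leRHS]invrK lef_pV2 ?posrE ?invr_gt0.
have b2 : normc l ^+ m * normc (f ((mu ^+ m)^-1 * s)%:C) <= d.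
  rewrite -(@ler_pXn2r _ 2)// ?nnegrE ?mulr_ge0 ?exprn_ge0 ?normc_ge0 ?(ltW d0)//.
  apply: le_trans sP; rewrite exprMn ler_wpM2r ?sqr_ge0// -exprM mulnC exprM -exprVn.
  by rewrite lerXn2r// nnegrE ?sqr_ge0// invr_ge0 ltW.
move=> h; have {}h := le_trans h (lerD b1 b2).
have ll1 : normc l <= 1.
  rewrite -(@ler_pXn2r _ 2)// ?nnegrE ?normc_ge0// expr1n; apply: le_trans l2 _.
  by rewrite invf_le1// ltW.
have : normc (P s%:C) <= 2 * K * d.
  have s1p : 0 < s + 1 by rewrite addr_gt0.
  move: h; rewrite ler_pdivrMr ?mulr_gt0 ?exprn_gt0// => h; apply: le_trans h _.
  rewrite mulrC [leRHS](_ : _ = 1 * K * (d + d)); last by ring.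
  rewrite ler_wpM2r ?addr_ge0 ?(ltW d0)//; apply: ler_pM; rewrite ?normc_ge0 ?exprn_ge0 ?(ltW s1p)//.
  rewrite lerXn2r ?nnegrE ?(ltW s1p) ?addr_ge0 ?(ltW mu0)// lerD2r.
  exact: le_trans s2mu.
have sx : normc (s%:C - x%:C) < r.
  rewrite -rmorphB normc_real; move: ss1 ss2; rewrite ge_max le_min => /andP[u1 _] /andP[u2 _].
  by rewrite ltr_norml; apply/andP; split; move: u1 u2 r0; clear; lra.
have := rP _ sx; have := ler_normcB (P x%:C) (P s%:C); rewrite (normcB (P x%:C)).
by rewrite dE; move=> h1 h2 h3; move: h1 h2 h3; clear; lra.
Qed.

Lemma dilation_upper T mu l : 0 < mu -> is_composition_operator (fun z => mu%:C * z) T ->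
  continuous T -> Num.max mu^-1 (Num.sqrt mu)^-1 < normc l -> ~ spectrum T l.
Proof.
move=> mu0 TP cT; set r := Num.max _ _ => rl.
have v0 : 0 < mu^-1 by rewrite invr_gt0.
have r1 : mu^-1 <= r by rewrite le_max lexx.
have r2 : (Num.sqrt mu)^-1 <= r by rewrite le_max lexx orbT.
have r0 : 0 <= r by apply: le_trans r1; exact: ltW.
have r3 : mu^-1 <= r ^+ 2.
  have -> : mu^-1 = (Num.sqrt mu)^-1 ^+ 2 by rewrite exprVn sqr_sqrtr// ltW.
  by rewrite lerXn2r// nnegrE invr_ge0 sqrtr_ge0.
have TP0 : is_composition_operator (fun z => mu%:C * z + 0) T.
  by move=> f z z0; rewrite addr0 TP.
clearbody r; apply: (@neumann _ T 1 r) => // n f; rewrite mul1r.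
have w0 : 0 <= complex.Re (0 : C) by exact: lexx.
have it := iter_affine n mu0 w0 TP0.
apply: (affine_norm (exprn_gt0 n mu0) (affine_shift_ge0 n mu0 w0) (exprn_ge0 n r0) (it f)).
  by rewrite -exprVn -exprM mulnC exprM lerXn2r// nnegrE ?sqr_ge0// ltW.
rewrite -exprVn lerXn2r ?nnegrE ?exprn_ge0 ?(ltW v0)//.
by rewrite lerXn2r// nnegrE ltW.
Qed.

Lemma shifted_inverse T D l f : cancel T D -> l != 0 ->
  shifted T l f = - l *: shifted D l^-1 (T f).
Proof.
move=> TD l0; rewrite /shifted TD scalerBr scalerA mulNr mulfV// !scaleNr scale1r opprK.
by rewrite addrC.
Qed.

Lemma shiftedZ T l (a : C) f : shifted T l (a *: f) = a *: shifted T l f.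
Proof. by rewrite linearZ. Qed.

(** Reduces the points inside the annulus to the points outside the annulus of the
    inverse dilation. *)
Lemma spectrum_inverse T D l : continuous D -> cancel T D -> cancel D T -> l != 0 ->
  ~ spectrum D l^-1 -> ~ spectrum T l.
Proof.
move=> cD TD DT l0 /notin_spectrumP[S [cS S1 S2]]; apply/notin_spectrumP.
have lin : linear (fun g => D (S ((- l)^-1 *: g))).
  by move=> a f g; rewrite scalerDr scalerA mulrC -scalerA !linearP.
pose S' : {linear X -> X} := HB.pack (fun g => D (S ((- l)^-1 *: g))) (GRing.isLinear.Build _ _ _ _ _ lin).
have nl0 : - l != 0 by rewrite oppr_eq0.
exists S'; split.
- have [c1 c10 c1P] := continuous_bounded cD; have [c2 c20 c2P] := continuous_bounded cS.
  apply: (@bounded_continuous _ S' (c1 * (c2 * normc (- l)^-1))) => g.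
  apply: le_trans (c1P _) _; rewrite -!mulrA ler_wpM2l ?(ltW c10)//.
  by apply: le_trans (c2P _) _; rewrite hb_normZ ler_wpM2l ?(ltW c20).
- move=> f; rewrite /S' /= (shifted_inverse _ TD l0) scalerA mulVf// scale1r.
  by rewrite S1 TD.
- move=> g; rewrite /S' /= (shifted_inverse _ TD l0) DT S2 scalerA mulfV//.
  by rewrite scale1r.
Qed.

Lemma fin_codim_sub (V W : set X) : V `<=` W -> fin_codim V -> fin_codim W.
Proof.
move=> VW [n [e eP]]; exists n, e => v; have [w [u [/VW Ww uE ->]]] := eP v.
by exists w, u.
Qed.

Lemma fin_codim_inverse T D l : cancel T D -> l != 0 ->
  fin_codim (range (shifted T l)) -> fin_codim (range (shifted D l^-1)).
Proof.
move=> TD l0; apply: fin_codim_sub => _ [f _ <-]; exists (- l *: T f) => //.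
by rewrite shiftedZ -shifted_inverse.
Qed.

Lemma essential_eq T : (forall l, spectrum T l -> ~ fredholm (shifted T l)) ->
  essential_spectrum T = spectrum T.
Proof.
by move=> H; apply/seteqP; split; [exact: essential_sub_spectrum|exact: H].
Qed.

Lemma spectrum_determined T (A : set C) : (forall l, A l -> ~ fredholm (shifted T l)) ->
  (forall l, ~ A l -> ~ spectrum T l) -> spectrum T = A /\ essential_spectrum T = spectrum T.
Proof.
move=> H1 H2; have E : spectrum T = A.
  apply/seteqP; split => l; first by move=> sl; apply: contrapT => /H2.
  by move=> /H1 nf; apply: contrapT => /fredholm_of_invertible.
by split=> //; apply: essential_eq => l; rewrite E; exact: H1.
Qed.

(** The imaginary powers are an infinite independent family; this is what makes
    the zero operator not Fredholm. *)
Lemma not_fin_codim0 : ~ fin_codim [set (0 : X)].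
Proof.
move=> fc; have mu1 : (1 : R) < 2 by rewrite ltr1n.
have gex j : exists g : X, forall z, half_plane z -> g z = cpow z (j%:R * period_exponent 2) * ((z + 1) ^+ 2)^-1.
  apply: imaginary_power_test.
  by rewrite -(rmorph_nat (real_complex R)) /= !mulr0 mul0r subr0.
have [g gE] := choice gex; pose Z : {linear X -> X} := shifted (idfun : {linear X -> X}) 1.
have ZE f : Z f = 0 by rewrite -[Z f]/(f - 1 *: f) scale1r subrr.
have {}fc : fin_codim (range Z).
  by apply: fin_codim_sub fc => _ ->; exists 0 => //; exact: ZE.
have [n [c [[i0 ci0] [f]]]] := fin_codim_relation g fc; rewrite ZE => e0.
suff : c i0 = 0 by move=> e; rewrite e eqxx in ci0.
apply: (imaginary_power_independent mu1) => x x1 _.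
have x0 : half_plane x%:C by apply: lt_trans x1.
have := congr1 (fun h : X => h x%:C) e0; rewrite hb_sumE => h.
have x10 : x%:C + 1 != 0 by apply: half_plane_neq0; apply: half_planeD => //; exact: ler01.
apply: (mulIf (_ : ((x%:C + 1) ^+ 2)^-1 != 0)); first by rewrite invr_eq0 expf_neq0.
rewrite mul0r [RHS]h mulr_suml; apply: eq_bigr => j _.
by rewrite gE// cpowMn mulrA.
Qed.

(** The inverse of a dilation is a dilation by [1 / mu], which exchanges the two
    bounding circles; so the upper bound on the spectrum and the case [mu > 1] of
    the lower bound give everything. *)
Theorem dilation_spectrum T mu : 0 < mu -> is_composition_operator (fun z => mu%:C * z) T ->
  continuous T ->
  (mu != 1 -> spectrum T = [set z : C | Num.min mu^-1 (Num.sqrt mu)^-1 <= normc z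
                          <= Num.max mu^-1 (Num.sqrt mu)^-1]) /\
  essential_spectrum T = spectrum T.
Proof.
move=> mu0 TP cT; have v0 : 0 < mu^-1 by rewrite invr_gt0.
have [m1|m1] := eqVneq mu 1.
  split=> //; apply: essential_eq => l sl [_ _ fc].
  have TE f : T f = f by apply: hb_eq => z z0; rewrite TP// m1 mul1r.
  have [l1|l1] := eqVneq l 1.
    apply: not_fin_codim0; apply: fin_codim_sub fc => _ [f _ <-].
    by rewrite /shifted TE l1 scale1r subrr.
  apply: sl; have n0 : 1 - l != 0 by rewrite subr_eq0 eq_sym.
  have lin : linear (fun g : X => (1 - l)^-1 *: g).
    by move=> a f g; rewrite scalerDr !scalerA mulrC.
  pose S : {linear X -> X} := HB.pack (fun g : X => (1 - l)^-1 *: g) (GRing.isLinear.Build _ _ _ _ _ lin).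
  have shE f : T f - l *: f = (1 - l) *: f by rewrite TE scalerBl scale1r.
  exists S; split.
  - by apply: (@bounded_continuous _ S (normc (1 - l)^-1)) => f; rewrite hb_normZ.
  - by move=> f; rewrite shE /S /= scalerA mulVf// scale1r.
  - by move=> f; rewrite shE /S /= scalerA mulfV// scale1r.
pose nu := mu^-1.
have w0 : 0 <= complex.Re (0 : C) by exact: lexx.
have [D [DP cD]] := affine_operator v0 w0.
have {}DP : is_composition_operator (fun z => nu%:C * z) D by move=> f z z0; rewrite DP// addr0.
have mn : mu%:C * nu%:C = 1 :> C by rewrite -rmorphM mulfV ?gt_eqF.
have TD : cancel T D.
  by move=> f; apply: hb_eq => z z0; rewrite DP// TP ?mulrA ?mn ?mul1r//; exact: half_plane_scale.
have DT : cancel D T.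
  by move=> f; apply: hb_eq => z z0; rewrite TP// DP ?mulrA ?(mulrC nu%:C) ?mn ?mul1r//; exact: half_plane_scale.
have q0 : 0 < Num.sqrt mu by rewrite sqrtr_gt0.
have qq : Num.sqrt mu ^+ 2 = mu by rewrite sqr_sqrtr// ltW.
have qV : Num.sqrt nu = (Num.sqrt mu)^-1 by rewrite sqrtrV// ltW.
set A := [set z : C | _].
suff [-> ->] : spectrum T = A /\ essential_spectrum T = spectrum T by [].
apply: spectrum_determined => l; last first.
  move=> nA; have [lm|lm] := ltP (Num.max mu^-1 (Num.sqrt mu)^-1) (normc l).
    exact: dilation_upper lm.
  have {}lm : normc l < Num.min mu^-1 (Num.sqrt mu)^-1.
    by rewrite ltNge; apply/negP => h; apply: nA; rewrite /A /= h.
  have [l0|l0] := eqVneq l 0.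
    by apply/notin_spectrumP; exists D; rewrite l0; split=> // f; rewrite /shifted scale0r subr0.
  have L0 : 0 < normc l by rewrite normc_gt0.
  apply: (spectrum_inverse cD TD DT l0); apply: dilation_upper DP cD _ => //.
  rewrite qV !invrK normcV; move: lm; rewrite lt_min gt_max => /andP[h1 h2].
  by apply/andP; split; rewrite -[ltLHS]invrK ltf_pV2 ?posrE ?invr_gt0.
rewrite /A /= => /andP[lmin lmax] [_ _ fc].
have [mu1|mu1] := ltP 1 mu.
  have qm : (Num.sqrt mu)^-1 >= mu^-1.
    rewrite lef_pV2 ?posrE// -{2}qq expr2 ler_peMr ?(ltW q0)//.
    by rewrite -(@ler_pXn2r _ 2)// ?nnegrE ?(ltW q0)// expr1n qq ltW.
  apply: (dilation_not_fin_codim mu1 TP _ _ fc); first by rewrite (min_idPl qm) in lmin.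
  rewrite (max_idPr qm) in lmax; by rewrite -qq -exprVn lerXn2r ?nnegrE ?normc_ge0 ?invr_ge0 ?(ltW q0).
have {}mu1 : mu < 1 by rewrite lt_neqAle m1.
have nu1 : 1 < nu by rewrite invf_gt1.
have qm : mu^-1 >= (Num.sqrt mu)^-1.
  rewrite lef_pV2 ?posrE// -{1}qq expr2 ler_piMr ?(ltW q0)//.
  by rewrite -(@ler_pXn2r _ 2)// ?nnegrE ?(ltW q0)// expr1n qq ltW.
rewrite (min_idPr qm) in lmin; rewrite (max_idPl qm) in lmax.
have L0 : 0 < normc l by apply: lt_le_trans lmin; rewrite invr_gt0.
have l0 : l != 0 by rewrite -normc_gt0.
apply: (dilation_not_fin_codim nu1 DP _ _ (fin_codim_inverse TD l0 fc)).
  by rewrite normcV lef_pV2 ?posrE.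
rewrite normcV invrK -qq lerXn2r ?nnegrE ?invr_ge0 ?(ltW L0) ?(ltW q0)//.
by rewrite -[leRHS]invrK lef_pV2 ?posrE ?invr_gt0.
Qed.

End DilationSpectrum.

(** * Affine symbols: zero and the spectral radius *)

Section AffineSymbols.
Context {R : realType}.
Local Notation C := R[i].
Local Notation X := (hardy_bergman R).
Implicit Types (f g h : X) (T : {linear X -> X}) (l z w b a : C) (mu : R).

(** Functions in the range extend continuously to the boundary point [0],
    whereas the imaginary powers oscillate there. *)
Lemma affine_not_fin_codim0 T mu w : 0 < mu -> half_plane w ->
  is_composition_operator (fun z => mu%:C * z + w) T -> ~ fin_codim (range (shifted T 0)).
Proof.
move=> mu0 w0 TP fc; have two1 : (1 : R) < 2 by rewrite ltr1n.
pose q : C := period_exponent 2.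
have gex (j : nat) : exists g : X, forall z, half_plane z -> g z = cpow z (j.+1%:R * q) * ((z + 1) ^+ 2)^-1.
  apply: imaginary_power_test.
  by rewrite -(rmorph_nat (real_complex R)) /= !mulr0 mul0r subr0.
have [g gE] := choice gex.
have [n [c [[i0 ci0] [f fE]]]] := fin_codim_relation g fc.
pose S z := \sum_j c j * cpow z q ^+ j.+1.
have SE z : half_plane z -> S z = (z + 1) ^+ 2 * f (mu%:C * z + w).
  move=> z0; have z1 : z + 1 != 0 by apply: half_plane_neq0; apply: half_planeD => //; exact: ler01.
  apply: (mulIf (_ : ((z + 1) ^+ 2)^-1 != 0)); first by rewrite invr_eq0 expf_neq0.
  rewrite mulrAC mulfV ?expf_neq0// mul1r.
  have := congr1 (fun h : X => h z) fE; rewrite shiftedE TP// mul0r subr0 hb_sumE => ->.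
  by rewrite /S mulr_suml; apply: eq_bigr => j _; rewrite gE// cpowMn mulrA.
have S2 z m : half_plane z -> S ((2 ^- m)%:C * z) = S z.
  move=> z0; elim: m => [|m IH]; first by rewrite expr0 invr1 mul1r.
  have m0 : 0 < 2 ^- m.+1 :> R by rewrite invr_gt0 exprn_gt0.
  rewrite -IH; have -> : (2 ^- m)%:C * z = 2%:R%:C * ((2 ^- m.+1)%:C * z).
    by rewrite mulrA -rmorphM; congr (_%:C * _); rewrite exprS; field; rewrite expf_neq0.
  apply: eq_bigr => j _; rewrite [in RHS]cpow_scale//; last exact: half_plane_scale.
  by rewrite cexp_period// mul1r.
have Fc : {for 0, continuous (fun z => (z + 1) ^+ 2 * f (mu%:C * z + w))}.
  have c1 : {for (0 : C), continuous (fun z => (z + 1) ^+ 2)}.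
    by apply: ccontX; exact: (ccontD (@ccont_id _ 0) (@ccont_cst _ 1 0)).
  have c2 : {for (0 : C), continuous (fun z => mu%:C * z + w)}.
    exact: (ccontD (ccontM (@ccont_cst _ mu%:C 0) (@ccont_id _ 0)) (@ccont_cst _ w 0)).
  have c3 : {for mu%:C * 0 + w, continuous f}.
    by rewrite mulr0 add0r; apply: derivable_continuous; exact: hb_holomorphic.
  exact: (ccontM c1 (ccont_comp c2 c3)).
(* S is invariant under z -> z / 2, so its values are limits at 0. *)
have Sw x : 0 < x -> S x%:C = f w.
  move=> x0; apply/eqP; rewrite -subr_eq0 -normc_eq0 eq_le normc_ge0 andbT.
  apply/ler_addgt0Pl => e e0; rewrite addr0.
  have [d d0 dP] := (continuous_normcP _ _).1 Fc e e0.
  have x20 : 0 < 2 * x by rewrite mulr_gt0.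
  have [N NP] := half_pow_small (divr_gt0 d0 x20).
  pose t := 2 ^- N * x; have t0 : 0 < t by rewrite mulr_gt0// invr_gt0 exprn_gt0.
  have td : normc (t%:C - 0) < d.
    rewrite subr0 normc_real gtr0_norm//; have := NP N (leqnn _); rewrite exprVn ler_pdivlMr ?mulr_gt0//.
    by rewrite /t; move: (2 ^- N) x0 d0 => u; clear; nra.
  have := dP _ td; rewrite -SE; last exact: half_plane_real.
  have -> : S t%:C = S x%:C by rewrite /t rmorphM S2//; exact: half_plane_real.
  by rewrite mulr0 !add0r expr1n mul1r => /ltW.
(* The constant value f w is absorbed as the coefficient of the power 0. *)
pose d (k : 'I_n.+2) : C := if unlift ord0 k is Some j then c j else - f w.
have dz : forall k, d k = 0.
  apply: (imaginary_power_independent two1) => x x1 _; rewrite big_ord_recl /d unlift_none expr0 mulr1.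
  rewrite -[X in - X](Sw x (lt_trans ltr01 x1)) addrC; apply/eqP; rewrite subr_eq0; apply/eqP.
  by apply: eq_bigr => j _; rewrite liftK.
by have := dz (lift ord0 i0); rewrite /d liftK => e; rewrite e eqxx in ci0.
Qed.

Lemma affine_shift_lower mu w n : 1 < mu -> half_plane w ->
  mu ^+ n * complex.Re w <= complex.Re (affine_shift mu w n.+1).
Proof.
move=> mu1 w0; rewrite /affine_shift big_ord_recr /= raddfD /=.
have -> : complex.Re ((mu ^+ n)%:C * w) = mu ^+ n * complex.Re w.
  by case: w {w0} => p q /=; rewrite mul0r subr0.
rewrite lerDr; apply: affine_shift_ge0; [exact: lt_trans mu1|exact: ltW].
Qed.

(** The image of the half-plane stays at distance [Re w] from the boundary, where
    single lines are controlled by the area integral. *)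
Lemma affine_smoothing f h mu w : 0 < mu -> half_plane w ->
  (forall z, half_plane z -> h z = f (mu%:C * z + w)) ->
  (hb_sqnorm h <= (mu^-1 * (128 / complex.Re w) + mu^-1 ^+ 2)%:E * bergman_sqnorm f)%E.
Proof.
move=> mu0 w0 hf; have hh := @hb_holomorphic _ f; have w0' : 0 <= complex.Re w by exact: ltW.
have v0 : 0 < mu^-1 by rewrite invr_gt0.
have B0 : (0 <= bergman_sqnorm f)%E by exact: bergman_sqnorm_ge0.
rewrite /hb_sqnorm (eq_hardy_sqnorm hf) (eq_bergman_sqnorm hf) EFinD ge0_muleDl; last 2 first.
- by rewrite lee_fin mulr_ge0 ?divr_ge0// ltW.
- by rewrite lee_fin sqr_ge0.
apply: leeD; last exact: bergman_affine.
apply: ge_ereal_sup => _ [x /= x0 <-].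
rewrite -/(line_sqnorm (fun z => f (mu%:C * z + w)%R) x) line_sqnorm_affineV//.
set u := (mu * x + complex.Re w)%R; have u0 : 0 < u by rewrite addr_gt0// mulr_gt0.
rewrite (EFinM mu^-1) -muleA; apply: lee_wpmul2l; first by rewrite lee_fin ltW.
rewrite mulrC EFinM -muleA lee_pdivlMl; last exact: w0.
apply: le_trans (line_le_bergman hh u0); apply: lee_wpmul2r.
  by apply: integral_ge0 => y _; rewrite lee_fin sqr_ge0.
by rewrite lee_fin /u lerDr mulr_ge0// ltW.
Qed.

Lemma affine_norm_smoothing f h mu w : 0 < mu -> half_plane w ->
  (forall z, half_plane z -> h z = f (mu%:C * z + w)) ->
  hb_norm h ^+ 2 <= (mu^-1 * (128 / complex.Re w) + mu^-1 ^+ 2) * hb_norm f ^+ 2.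
Proof.
move=> mu0 w0 hf; rewrite -lee_fin -hb_sqnorm_fin; apply: le_trans (affine_smoothing mu0 w0 hf) _.
rewrite [leRHS]EFinM; apply: lee_wpmul2l; last exact: bergman_le_norm.
have v0 : 0 < mu^-1 by rewrite invr_gt0.
by rewrite lee_fin addr_ge0 ?sqr_ge0// mulr_ge0 ?divr_ge0// ltW.
Qed.

(** For [mu < 1] the iterates have norm at most [mu^-n]. For [mu > 1] the Hardy part
    of the norm only gives [mu^(-n/2)], but the iterates move the boundary to
    distance about [mu^n], and the smoothing estimate restores [mu^-n]. *)
Lemma affine_upper T mu w l : 0 < mu -> mu != 1 -> half_plane w ->
  is_composition_operator (fun z => mu%:C * z + w) T -> continuous T ->
  mu^-1 < normc l -> ~ spectrum T l.
Proof.
move=> mu0 m1 w0 TP cT rl; have v0 : 0 < mu^-1 by rewrite invr_gt0.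
have w0' : 0 <= complex.Re w by exact: ltW.
have [mu1|mu1] := ltP 1 mu; last first.
  have v1 : 1 <= mu^-1 by rewrite invf_ge1.
  apply: (@neumann _ T 1 mu^-1) => //; first exact: ltW.
  move=> n f; rewrite mul1r.
  apply: (affine_norm (exprn_gt0 n mu0) (affine_shift_ge0 n mu0 w0') _ (iter_affine n mu0 w0' TP f)).
  - by rewrite exprn_ge0// ltW.
  - by rewrite exprVn; apply: ler_eXnr => //; rewrite -exprVn exprn_ege1.
  - by rewrite -exprVn.
(* For every n, the constant of the smoothing estimate for the n-th iterate is
   at most K mu^(-2 n). *)
pose K := 1 + 128 * mu / complex.Re w.
have K1 : 1 <= K by rewrite lerDl divr_ge0// mulr_ge0// ltW.
have K0 : 0 <= K by exact: le_trans K1.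
have sK : 1 <= Num.sqrt K by rewrite -(sqrtr1 R) ler_wsqrtr.
apply: (neumann (sqrtr_ge0 K) (ltW v0) cT _ rl).
move=> [|n] f; first by rewrite /= expr0 mulr1 ler_peMl ?hb_norm_ge0.
rewrite -(@ler_pXn2r _ 2)// ?nnegrE ?hb_norm_ge0 ?mulr_ge0 ?exprn_ge0 ?sqrtr_ge0 ?hb_norm_ge0 ?(ltW v0)//.
have s0 : half_plane (affine_shift mu w n.+1).
  by apply: lt_le_trans (affine_shift_lower n mu1 w0); rewrite mulr_gt0// exprn_gt0.
apply: le_trans (affine_norm_smoothing _ s0 (iter_affine n.+1 mu0 w0' TP f)) _.
  by rewrite exprn_gt0.
rewrite exprMn; apply: ler_wpM2r; first exact: sqr_ge0.
rewrite exprMn (sqr_sqrtr K0).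
have m0 : 0 < mu ^+ n by rewrite exprn_gt0.
have low := affine_shift_lower n mu1 w0.
have h : (complex.Re (affine_shift mu w n.+1))^-1 <= (mu ^+ n * complex.Re w)^-1.
  by rewrite lef_pV2// posrE// mulr_gt0.
apply: (@le_trans _ _ ((mu ^+ n.+1)^-1 * (128 / (mu ^+ n * complex.Re w)) + (mu ^+ n.+1)^-1 ^+ 2)).
  by rewrite lerD2r ler_wpM2l ?invr_ge0 ?exprn_ge0 ?(ltW mu0)// ler_wpM2l.
rewrite le_eqVlt; apply/orP; left; apply/eqP; rewrite /K (exprVn mu n.+1) !(exprS mu n).
have cw : 0 < complex.Re w by [].
clear -mu0 m0 cw; move: (mu ^+ n) m0 (complex.Re w) cw => m m0 c c0.
by field; rewrite !gt_eqF.
Qed.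

End AffineSymbols.

(** * Expanding affine symbols *)

Section ExpandingSymbols.
Context {R : realType}.
Local Notation C := R[i].
Local Notation X := (hardy_bergman R).
Implicit Types (f g h : X) (T : {linear X -> X}) (l z w b a : C) (mu : R).

(** Stated for a point [z] near [x + i y], rather than for [x + i y + b], so that one
    constant serves all the points of a segment of shifts. *)
Lemma normc_cpow_decay a z (x y rho nu : R) : complex.Re a <= 0 -> 0 < x -> 0 < rho -> 0 <= nu ->
  x + rho <= complex.Re z -> `|y| <= `|complex.Im z| + nu ->
  normc (cpow z a) <= expR (2 * `|complex.Im a|) * (2 * (1 + nu / rho)) `^ (- complex.Re a) *
    (x + rho + `|y|) `^ (complex.Re a).
Proof.
move=> a0 x0 rho0 nu0 zx zy; have z0 : half_plane z by apply: lt_le_trans zx; rewrite addr_gt0.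
apply: le_trans (normc_cpow _ z0) _; rewrite -[leRHS]mulrA ler_wpM2l ?expR_ge0//.
set k := 2 * (1 + nu / rho); have k0 : 0 < k by rewrite mulr_gt0// ltr_pwDl// divr_ge0// ltW.
have kE : k = 2 * (1 + nu / rho) by [].
clearbody k.
have u0 : 0 < x + rho + `|y| by rewrite ltr_pwDl// addr_gt0.
have -> : k `^ (- complex.Re a) * (x + rho + `|y|) `^ complex.Re a = (k^-1 * (x + rho + `|y|)) `^ complex.Re a.
  by rewrite powRM ?invr_ge0 ?(ltW k0) ?(ltW u0)// -(powR_inv1 (ltW k0)) -powRrM mulN1r.
rewrite -[in leLHS](opprK (complex.Re a)) -[in leRHS](opprK (complex.Re a)).
apply: powRN_anti; rewrite ?oppr_ge0// ?mulr_gt0 ?invr_gt0// ler_pdivrMl//.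
have h1 : nu <= nu / rho * normc z.
  rewrite mulrAC ler_pdivlMr// ler_wpM2l//; apply: le_trans (ler_norm _) (le_trans _ (le_Re_normc z)).
  by rewrite (gtr0_norm rho0) (gtr0_norm z0); apply: le_trans zx; rewrite lerDr ltW.
have := le_Re_normc z; have := le_Im_normc z; rewrite (gtr0_norm z0) kE.
by move: zx zy h1 nu0; clear; lra.
Qed.

Lemma shifted_power_bound b a : half_plane b -> 0 <= complex.Re a -> exists2 K, 0 <= K &
  forall x y, 0 < x -> normc (cpow ((x +i* y) + b) (- a)) <=
    K * (x + complex.Re b + `|y|) `^ (- complex.Re a).
Proof.
move=> b0 a0; have Ra : complex.Re (- a) = - complex.Re a by case: (a).
eexists; last first.
  move=> x y x0; rewrite -Ra; apply: (normc_cpow_decay (nu := `|complex.Im b|)) => //.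
  - by rewrite Ra oppr_le0.
  - by case: (b).
  - have -> : complex.Im ((x +i* y) + b) = y + complex.Im b by case: (b).
    by have := ler_normB (y + complex.Im b) (complex.Im b); rewrite addrK.
by rewrite mulr_ge0 ?expR_ge0 ?powR_ge0.
Qed.

Lemma holomorphic_shift (F : C -> C) b : 0 <= complex.Re b -> holomorphic_rhp F ->
  holomorphic_rhp (fun z => F (z + b)).
Proof.
move=> b0 hF; have := holomorphic_affine ltr01 b0 hF.
by apply: eq_holomorphic_rhp => z _; rewrite mul1r.
Qed.

Lemma shifted_power_in_space b a : half_plane b -> 1 < complex.Re a ->
  exists g, forall z, half_plane z -> g z = cpow (z + b) (- a).
Proof.
move=> b0 a1; have a0 : 0 <= complex.Re a by apply: ltW; apply: lt_trans a1.
have [K K0 KP] := shifted_power_bound b0 a0.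
apply: (hb_of_decay b0 a1 K0) => //.
by apply: (@holomorphic_shift (fun z => cpow z (- a))); [exact: ltW|exact: holomorphic_cpow].
Qed.

(** With [b] minus the fixed point of the symbol, which lies in the left
    half-plane, [z + b] is multiplied by [mu]; the bound on [l] is exactly the decay
    of the power needed for membership. *)
Lemma expanding_eigenfunction T mu w l b : 1 < mu -> half_plane w ->
  is_composition_operator (fun z => mu%:C * z + w) T ->
  mu%:C * b = w + b -> half_plane b -> l != 0 -> normc l < mu^-1 ->
  exists a, [/\ complex.Re a > 1, cexp (- a * (ln mu)%:C) = l &
    forall g, (forall z, half_plane z -> g z = cpow (z + b) (- a)) -> T g = l *: g].
Proof.
move=> mu1 w0 TP bE b0 l0 lm; have mu0 : 0 < mu by apply: lt_trans mu1.
have m1 : mu != 1 by rewrite gt_eqF.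
have [a [aE aN]] := log_base mu0 m1 l0; exists (- a); rewrite opprK; split => //.
- have -> : complex.Re (- a) = - complex.Re a by case: (a).
  have L : 0 < ln mu by rewrite ln_gt0.
  move: lm; rewrite -aN -powR_inv1 ?(ltW mu0)// /powR gt_eqF// ltr_expR ltr_pM2r//.
  by clear; lra.
- move=> g gE; apply: hb_eq => z z0; rewrite TP// hbZ !gE//; last first.
    exact: (affine_half_plane mu0 (ltW w0) z0).
  have -> : mu%:C * z + w + b = mu%:C * (z + b) by rewrite mulrDr bE addrA.
  by rewrite cpow_scale ?aE//; apply: half_planeD => //; exact: ltW.
Qed.

Lemma fixed_point_expanding mu w : 1 < mu -> half_plane w -> exists b,
  mu%:C * b = w + b /\ half_plane b.
Proof.
move=> mu1 w0; have m0 : 0 < mu - 1 by rewrite subr_gt0.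
exists ((mu - 1)^-1%:C * w); split; last by apply: half_plane_scale => //; rewrite invr_gt0.
have -> : mu%:C = (mu - 1)%:C + 1 :> C by rewrite rmorphB subrK.
by rewrite mulrDl mulrA mul1r -rmorphM mulfV ?gt_eqF// mul1r.
Qed.

(** Changing the exponent by multiples of the period gives infinitely many
    independent eigenfunctions. *)
Lemma expanding_kernel_not_fin_dim T mu w l : 1 < mu -> half_plane w ->
  is_composition_operator (fun z => mu%:C * z + w) T -> l != 0 -> normc l < mu^-1 ->
  ~ fin_dim (shifted T l @^-1` [set 0]).
Proof.
move=> mu1 w0 TP l0 lm fd; have mu0 : 0 < mu by apply: lt_trans mu1.
have [b [bE b0]] := fixed_point_expanding mu1 w0.
have [a [a1 aE aP]] := expanding_eigenfunction mu1 w0 TP bE b0 l0 lm.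
pose q := period_exponent mu.
have qre j : complex.Re (a - j%:R * q) = complex.Re a.
  rewrite -(rmorph_nat (real_complex R)) /q /period_exponent; case: (a) => u v /=.
  by rewrite mulr0 mul0r subrr oppr0 addr0.
have gex (j : nat) : exists g : X, forall z, half_plane z -> g z = cpow (z + b) (- (a - j%:R * q)).
  by apply: shifted_power_in_space; rewrite ?qre.
have [g gE] := choice gex.
have gK j : (shifted T l @^-1` [set 0]) (g j).
  rewrite /preimage /=; apply: hb_eq => z z0; rewrite shiftedE TP// !gE//; last first.
    exact: (affine_half_plane mu0 (ltW w0) z0).
  have -> : mu%:C * z + w + b = mu%:C * (z + b) by rewrite mulrDr bE addrA.
  rewrite cpow_scale//; last by apply: half_planeD => //; exact: ltW.
  have -> : - (a - j%:R * q) * (ln mu)%:C = - a * (ln mu)%:C + j%:R * (q * (ln mu)%:C) by ring.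
  by rewrite cexpD aE cexpMn cexp_period// expr1n mulr1 subrr.
have [n [c [[i0 ci0] c0]]] := fin_dim_relation fd gK.
move: ci0; suff -> : c i0 = 0 by rewrite eqxx.
apply: (imaginary_power_independent mu1) => x x1 _.
have x0 : 0 < x by apply: lt_trans x1.
have [N NP] : exists N, complex.Re b < mu ^+ N * x.
  have [N NP] := pow_unbounded (complex.Re b) mu1; exists N.
  by apply: le_lt_trans (NP N (leqnn N)) _; rewrite ltr_pMr// exprn_gt0.
set r := mu ^+ N * x.
have rE j : cpow x%:C q ^+ j = cpow r%:C q ^+ j.
  congr (_ ^+ _); rewrite /r; elim: (N) => [|m IH]; first by rewrite expr0 mul1r.
  by rewrite exprS -mulrA rmorphM cpow_scale ?cexp_period ?mul1r//; apply: half_plane_real; rewrite mulr_gt0// exprn_gt0.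
(* A point of the half-plane at which z + b is the positive number r. *)
pose z := (r - complex.Re b) +i* (- complex.Im b).
have z0 : half_plane z by rewrite /half_plane /z /= subr_gt0.
have zb : z + b = r%:C.
  by rewrite /z; case: (b) => u v; apply/eqP; rewrite eq_complex /= subrK addNr !eqxx.
have := congr1 (fun h : X => h z) c0; rewrite hb_sumE => h.
have {}h : \sum_i c i * g i z = 0 := h.
apply: (mulfI (cpow_neq0 r%:C (- a))); rewrite mulr0 -[RHS]h mulr_sumr; apply: eq_bigr => j _.
by rewrite gE// zb opprB addrC cpowD cpowMn rE mulrCA.
Qed.

Lemma iterate_eigenfunction T mu w f z l n : 0 < mu -> half_plane w ->
  is_composition_operator (fun z => mu%:C * z + w) T -> half_plane z -> shifted T l f = 0 ->
  f ((mu ^+ n)%:C * z + affine_shift mu w n) = l ^+ n * f z.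
Proof.
move=> mu0 w0 TP z0 f0; have w0' : 0 <= complex.Re w by exact: ltW.
rewrite -(iter_affine n mu0 w0' TP)//.
have Tf : T f = l *: f by apply/eqP; rewrite -subr_eq0; apply/eqP.
have -> : iter n T f = l ^+ n *: f.
  elim: n => [|n IH]; first by rewrite expr0 scale1r.
  by rewrite iterS IH linearZ /= Tf scalerA exprSr.
by rewrite hbZ.
Qed.

(** Along an orbit, [Re z] grows like [mu^n] and an eigenfunction is multiplied by
    [l^n], of modulus at least [mu^-n]: this contradicts o(1 / Re z) decay. *)
Lemma expanding_injective T mu w l : 1 < mu -> half_plane w ->
  is_composition_operator (fun z => mu%:C * z + w) T -> mu^-1 <= normc l ->
  forall f, shifted T l f = 0 -> f = 0.
Proof.
move=> mu1 w0 TP lm f f0; have mu0 : 0 < mu by apply: lt_trans mu1.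
have L0 : 0 < normc l by apply: lt_le_trans lm; rewrite invr_gt0.
apply: hb_eq => z z0; apply/eqP; rewrite -normc_eq0 eq_le normc_ge0 andbT.
apply/ler_addgt0Pl => e e0; rewrite addr0.
have rz : 0 < complex.Re z by [].
have e1 : 0 < e * complex.Re z by rewrite mulr_gt0.
have [M MP] := decay_at_infinity f e1.
have [N NM] : exists N, M <= mu ^+ N * complex.Re z.
  have [N NP] := pow_unbounded (M / complex.Re z) mu1; exists N.
  by rewrite -ler_pdivrMr//; exact: NP (leqnn N).
have := iterate_eigenfunction N mu0 w0 TP z0 f0; set u := _ + _ => uE.
have w0' : 0 <= complex.Re w by exact: ltW.
have ru : mu ^+ N * complex.Re z <= complex.Re u.
  rewrite /u raddfD /= (_ : complex.Re ((mu ^+ N)%:C * z) = mu ^+ N * complex.Re z).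
    by rewrite lerDl affine_shift_ge0.
  by case: (z) => p p' /=; rewrite mul0r subr0.
have mz : 0 < mu ^+ N * complex.Re z by rewrite mulr_gt0// exprn_gt0.
have u0 : 0 < complex.Re u by apply: lt_le_trans ru.
have := MP (complex.Re u) (complex.Im u) u0 _; rewrite -complex_eta uE normcM normcX => h.
have {}h := h _; have {}h : complex.Re u * (normc l ^+ N * normc (f z)) <= e * complex.Re z.
  by apply: h; apply: le_trans NM _; apply: le_trans ru _; rewrite lerDl.
have lN : 1 <= mu ^+ N * normc l ^+ N.
  by rewrite -exprMn exprn_ege1// -(mulfV (_ : mu != 0)) ?gt_eqF// ler_pM2l.
rewrite -(ler_pM2r rz); apply: le_trans h.
apply: (@le_trans _ _ (mu ^+ N * complex.Re z * (normc l ^+ N * normc (f z)))); last first.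
  by rewrite ler_wpM2r// mulr_ge0 ?exprn_ge0 ?normc_ge0.
rewrite [leRHS](_ : _ = (mu ^+ N * normc l ^+ N) * (normc (f z) * complex.Re z)); last by ring.
by rewrite ler_peMl// mulr_ge0 ?normc_ge0// ltW.
Qed.

(** On the boundary circle the operator is injective, so closed range would make
    it bounded below. Eigenfunctions for the eigenvalue [(1 - d) l] are almost
    annihilated by [T - l], which contradicts this for small [d]. *)
Lemma expanding_not_closed_range T mu w l : 1 < mu -> half_plane w -> continuous T ->
  is_composition_operator (fun z => mu%:C * z + w) T -> normc l = mu^-1 ->
  ~ closed (range (shifted T l)).
Proof.
move=> mu1 w0 cT TP lm cl; have mu0 : 0 < mu by apply: lt_trans mu1.
have L0 : 0 < normc l by rewrite lm invr_gt0.
have l0 : l != 0 by rewrite -normc_gt0.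
have inj := expanding_injective mu1 w0 TP (eq_ind_r (fun u => mu^-1 <= u) (lexx _) lm).
have [k k0 kP] := shifted_bounded l cT.
have [c c0 cP] := bounded_below_of_closed_range (bounded_continuous kP) inj cl.
pose d := Num.min (2^-1) (c * normc l)^-1 / 2.
have cl0 : 0 < (c * normc l)^-1 by rewrite invr_gt0 mulr_gt0.
have d0 : 0 < d by rewrite divr_gt0// lt_min invr_gt0 ltr0n.
have d1 : d < 1.
  rewrite /d; have : Num.min 2^-1 (c * normc l)^-1 <= 2^-1 by rewrite ge_min lexx.
  by clear; lra.
have dc : d * (c * normc l) < 1.
  rewrite -ltr_pdivlMr ?mulr_gt0// mul1r.
  rewrite /d; have : Num.min 2^-1 (c * normc l)^-1 <= (c * normc l)^-1 by rewrite ge_min lexx orbT.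
  by move: cl0; clear; lra.
have n1 : 0 < 1 - d by rewrite subr_gt0.
pose l' := (1 - d)%:C * l.
have l'0 : l' != 0 by rewrite mulf_neq0// -normc_gt0 normc_real gtr0_norm.
have l'm : normc l' < mu^-1.
  by rewrite normcM normc_real gtr0_norm// lm gtr_pMl ?invr_gt0// gtrBl.
have [b [bE b0]] := fixed_point_expanding mu1 w0.
have [a [a1 aE aP]] := expanding_eigenfunction mu1 w0 TP bE b0 l'0 l'm.
have [g gE] := shifted_power_in_space b0 a1.
have Tg := aP g gE.
have g0 : 0 < hb_norm g.
  rewrite lt_def hb_norm_ge0 hb_norm_eq0P andbT; apply/eqP => g0.
  have := gE 1 (ltr01 : half_plane 1); rewrite g0 => /esym/eqP.
  by rewrite (negbTE (cpow_neq0 _ _)).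
have {}cP : hb_norm g <= c * hb_norm (shifted T l g) := cP g.
move: cP; have -> : shifted T l g = (- (d%:C * l)) *: g.
  rewrite -[LHS]/(T g - l *: g) Tg -scalerBl; congr (_ *: _).
  by rewrite /l' rmorphB mulrBl mul1r addrAC subrr add0r.
rewrite hb_normZ normcN normcM normc_real (gtr0_norm d0) mulrA leNgt => /negP; apply.
by rewrite gtr_pMl// mulrCA.
Qed.

Theorem expanding_spectrum T mu w : 1 < mu -> half_plane w -> continuous T ->
  is_composition_operator (fun z => mu%:C * z + w) T ->
  spectrum T = [set z : C | normc z <= mu^-1] /\ essential_spectrum T = spectrum T.
Proof.
move=> mu1 w0 cT TP; have mu0 : 0 < mu by apply: lt_trans mu1.
apply: spectrum_determined => l.
  move=> /= lm [fd cl fc]; have [l0|l0] := eqVneq l 0.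
    by apply: (affine_not_fin_codim0 mu0 w0 TP); rewrite -l0.
  move: lm; rewrite le_eqVlt => /orP[/eqP lm|lm].
    exact: (expanding_not_closed_range mu1 w0 cT TP lm).
  exact: (expanding_kernel_not_fin_dim mu1 w0 TP l0 lm).
move=> /= /negP; rewrite -ltNge => lm; apply: (affine_upper mu0 _ w0 TP cT lm).
by rewrite gt_eqF.
Qed.

End ExpandingSymbols.

(** * Contracting affine symbols: multipliers outside the unit disc *)

Section ContractingOuter.
Context {R : realType}.
Local Notation C := R[i].
Local Notation X := (hardy_bergman R).
Implicit Types (f g h : X) (T : {linear X -> X}) (l z w b a p : C) (mu : R).

Lemma cpow_quotient z p : half_plane z -> cpow z p * (p / z) = p * cpow z (p - 1).
Proof.
move=> z0; have zn := half_plane_neq0 z0.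
have : cpow z p = cpow z (p - 1) * z by rewrite -{3}(cpow1 z0) -cpowD subrK.
by move=> ->; field.
Qed.

(** The difference is the integral of the derivative over a segment of shifts, and
    so decays one order faster than the powers themselves. *)
Lemma power_difference_in_space b b' p : half_plane b -> half_plane b' -> complex.Re p < 0 ->
  exists g, forall z, half_plane z -> g z = cpow (z + b) p - cpow (z + b') p.
Proof.
move=> b0 b'0 p0; pose rho := Num.min (complex.Re b) (complex.Re b').
have rho0 : 0 < rho by rewrite lt_min; apply/andP.
pose nu := `|complex.Im b| + `|complex.Im b'|; have nu0 : 0 <= nu by rewrite addr_ge0.
have Rp : complex.Re (p - 1) = complex.Re p - 1 by case: (p).
pose be := 1 - complex.Re p; have be1 : 1 < be by rewrite ltrDl oppr_gt0.
have ReN : complex.Re (p - 1) = - be by rewrite Rp /be opprB.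
pose K := expR (2 * `|complex.Im (p - 1)|) * (2 * (1 + nu / rho)) `^ be.
have K0 : 0 <= K by rewrite mulr_ge0 ?expR_ge0 ?powR_ge0.
pose M := 2 * (normc p * normc (b - b') * K).
have M0 : 0 <= M.
  by apply: mulr_ge0 => //; apply: mulr_ge0 K0; apply: mulr_ge0; exact: normc_ge0.
have hG : holomorphic_rhp (fun z => cpow (z + b) p - cpow (z + b') p).
  move=> z z0.
  have /derivable_cderivP[D1 h1] := @holomorphic_shift _ (fun z => cpow z p) b (ltW b0) (@holomorphic_cpow _ p) z z0.
  have /derivable_cderivP[D2 h2] := @holomorphic_shift _ (fun z => cpow z p) b' (ltW b'0) (@holomorphic_cpow _ p) z z0.
  by apply/derivable_cderivP; eexists; exact: (cderivB h1 h2).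
apply: (hb_of_decay rho0 be1 M0 hG) => x y x0; set z := x +i* y.
(* The difference is the integral of the derivative along the segment from
   z + b' to z + b. *)
pose gam (t : R) : C := (z + b') + t%:C * (b - b').
have gRe t : 0 <= t <= 1 -> x + rho <= complex.Re (gam t).
  move=> /andP[t0 t1]; have -> : complex.Re (gam t) = x + (t * complex.Re b + (1 - t) * complex.Re b').
    by rewrite /gam /z; case: (b) => u v; case: (b') => u' v' /=; ring.
  rewrite lerD2l; have h1 : rho <= complex.Re b by rewrite ge_min lexx.
  have h2 : rho <= complex.Re b' by rewrite ge_min lexx orbT.
  move: t0 t1 h1 h2; clear; move: rho (complex.Re b) (complex.Re b') => r u v; nra.
have gIm t : 0 <= t <= 1 -> `|y| <= `|complex.Im (gam t)| + nu.
  move=> /andP[t0 t1]; have -> : complex.Im (gam t) = y + (t * complex.Im b + (1 - t) * complex.Im b').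
    by rewrite /gam /z; case: (b) => u v; case: (b') => u' v' /=; ring.
  set e := t * _ + _; have h : `|e| <= nu.
    have t1' : 0 <= 1 - t by rewrite subr_ge0.
    apply: le_trans (ler_normD _ _) _; rewrite !normrM (ger0_norm t0) (ger0_norm t1').
    by apply: lerD; rewrite ler_piMl//; move: t0 t1; clear; lra.
  by have := ler_normB (y + e) e; rewrite addrK; move: h; clear; lra.
have gH t : 0 <= t <= 1 -> half_plane (gam t).
  by move=> t01; apply: lt_le_trans (gRe t t01); rewrite addr_gt0.
pose F (t : R) : C := p * cpow (gam t) (p - 1) * (b - b').
have gamc t : {for t, continuous gam}.
  apply: (@continuous_lipschitz _ _ (normc (b - b'))) => s.
  have -> : gam s - gam t = (s - t)%:C * (b - b').
    by rewrite /gam rmorphB; ring.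
  by rewrite normcM normc_real mulrC.
have Fc : continuous_on 0 1 F.
  move=> t t01; apply: (@rcont_comp _ gam (fun u => p * cpow u (p - 1) * (b - b'))); first exact: gamc.
  have c1 := cderiv_continuous (cderiv_cpow (p - 1) (gH t t01)).
  exact: (ccontM (ccontM (@ccont_cst _ p _) c1) (@ccont_cst _ (b - b') _)).
have FTC : cint 0 1 F = cpow (gam 1) p - cpow (gam 0) p.
  apply: (cint_FTC (G := fun t => cpow (gam t) p)); [exact: ler01|exact: Fc|].
  move=> t t01; have gl s : gam s = gam t + (s - t)%:C * (b - b') by rewrite /gam rmorphB; ring.
  have := cderiv_path gl (cderiv_cpow p (gH t t01)).
  by rewrite (cpow_quotient p (gH t t01)).
have g1 : gam 1 = z + b by rewrite /gam; ring.
have g0 : gam 0 = z + b' by rewrite /gam; ring.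
rewrite g1 g0 in FTC; rewrite -FTC.
have bd t : 0 <= t <= 1 -> normc (F t) <= normc p * normc (b - b') * K * (x + rho + `|y|) `^ (- be).
  move=> t01; rewrite /F (normcM _ (b - b')) (normcM p).
  have := normc_cpow_decay (a := p - 1) _ x0 rho0 nu0 (gRe t t01) (gIm t t01).
  rewrite ReN opprK oppr_le0 => /(_ (ltW (lt_trans ltr01 be1))) h.
  rewrite mulrAC -[leRHS]mulrA; apply: ler_wpM2l; last exact: h.
  by rewrite mulr_ge0 ?normc_ge0.
have := normc_cint_bound (@ler01 R) Fc bd; rewrite subr0 mulr1.
by rewrite /M -(mulrA 2).
Qed.

Lemma fixed_point_contracting mu w : mu < 1 -> half_plane w -> exists s,
  s = mu%:C * s + w /\ half_plane s.
Proof.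
move=> mu1 w0; have m0 : 0 < 1 - mu by rewrite subr_gt0.
exists ((1 - mu)^-1%:C * w); split; last by apply: half_plane_scale => //; rewrite invr_gt0.
have n0 : (1 - mu)%:C != 0 :> C by rewrite -normc_gt0 normc_real gtr0_norm.
rewrite fmorphV; apply: (mulfI n0); rewrite mulrDr [LHS]mulVKf// (mulrCA _ mu%:C) mulVKf//.
by rewrite -mulrDl -rmorphD addrC subrK mul1r.
Qed.

Lemma cexp_period_inv mu : 0 < mu -> mu < 1 -> cexp (period_exponent mu^-1 * (ln mu)%:C) = 1.
Proof.
move=> mu0 mu1; have m1 : 1 < mu^-1 by rewrite invf_gt1.
have := cexp_period m1; rewrite lnV ?posrE// rmorphN mulrN cexpN => /(congr1 GRing.inv).
by rewrite invrK invr1.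
Qed.

(** Along an orbit the values are multiplied by [l^n], while the points tend to the
    fixed point, near which [u] is bounded. *)
Lemma intertwined_zero (u : C -> C) mu s w l : 0 < mu -> mu < 1 -> half_plane w -> half_plane s ->
  s = mu%:C * s + w -> 1 < normc l -> {for s, continuous u} ->
  (forall z, half_plane z -> u (mu%:C * z + w) = l * u z) -> forall z, half_plane z -> u z = 0.
Proof.
move=> mu0 mu1 w0 s0 sE l1 cu uE z z0; have w0' : 0 <= complex.Re w by exact: ltW.
have orbit n : exists y, [/\ half_plane y, y = s + (mu ^+ n)%:C * (z - s) & u y = l ^+ n * u z].
  elim: n => [|n [y [y0 yE uy]]]; first by exists z; rewrite !expr0 !mul1r addrC subrK.
  exists (mu%:C * y + w); split; first exact: affine_half_plane.
    by rewrite exprS rmorphM {1}sE yE; ring.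
  by rewrite uE// uy exprS mulrA.
have [d d0 dP] := (continuous_normcP _ _).1 cu 1 ltr01.
have [N NP] : exists N, forall n, (N <= n)%N -> mu ^+ n * normc (z - s) < d.
  have m1 : 1 < mu^-1 by rewrite invf_gt1.
  have [N NP] := pow_unbounded (normc (z - s) / d + 1) m1; exists N => n /NP.
  rewrite exprVn => h; have mn : 0 < mu ^+ n by rewrite exprn_gt0.
  rewrite mulrC -ltr_pdivlMr// -ltr_pdivrMl//.
  by apply: lt_le_trans h; rewrite mulrC ltrDl.
have bd n : (N <= n)%N -> normc l ^+ n * normc (u z) <= normc (u s) + 1.
  move=> Nn; have [y [_ yE uy]] := orbit n.
  have ys : normc (y - s) < d.
    rewrite yE addrAC subrr add0r normcM normc_real gtr0_norm ?exprn_gt0//; exact: NP.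
  have := dP _ ys; have := ler_normcB (u y) (u s); rewrite uy normcM normcX.
  by clear; lra.
apply/eqP; rewrite -normc_eq0; apply/eqP; apply: le_anti; rewrite normc_ge0 andbT leNgt.
apply/negP => u0; have [N2 N2P] := pow_unbounded ((normc (u s) + 2) / normc (u z)) l1.
have := N2P (maxn N N2) (leq_maxr _ _); rewrite ler_pdivrMr// => h.
have := bd (maxn N N2) (leq_maxl _ _); move: h; clear; lra.
Qed.

(** With [mu^a = l], the difference [(z + b)^a - (z + b')^a], where
    [mu z + w + b = mu (z + b')], is formally in the range: it is [T h - l h] with
    [h = - (z + b)^a / l]. As [h] decays too slowly
    to lie in the space, a true preimage [f] differs from it by a function which
    is intertwined with the factor [l] and hence zero, so that [f = h]; decay at
    infinity then kills the combination of powers. *)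
Lemma contracting_not_fin_codim_outer T mu w l : 0 < mu -> mu < 1 -> half_plane w ->
  is_composition_operator (fun z => mu%:C * z + w) T -> 1 < normc l -> normc l <= mu^-1 ->
  ~ fin_codim (range (shifted T l)).
Proof.
move=> mu0 mu1 w0 TP l1 lm fc; have w0' : 0 <= complex.Re w by exact: ltW.
have m1 : mu != 1 by rewrite lt_eqF.
have v1 : 1 < mu^-1 by rewrite invf_gt1.
have l0 : l != 0 by rewrite -normc_gt0 (lt_trans ltr01).
have [a [aE aN]] := log_base mu0 m1 l0.
have L : ln mu < 0 by rewrite ln_lt0// mu0.
have [a0 a1] : complex.Re a < 0 /\ -1 <= complex.Re a.
  split.
    rewrite -(ltr_nM2r L) mul0r -ltr_expR expR0; move: l1.
    by rewrite -aN /powR gt_eqF.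
  rewrite -(ler_nM2r L) mulN1r -ler_expR -lnV ?posrE// lnK ?posrE ?invr_gt0//.
  by move: lm; rewrite -aN /powR gt_eqF.
have [s [sE s0]] := fixed_point_contracting mu1 w0.
(* Any b would do for membership; this one makes z + b positive on a horizontal
   ray towards infinity. *)
pose b := 1 +i* (- complex.Im s) : C; have b0 : half_plane b by exact: ltr01.
pose b' := mu^-1%:C * (w + b).
have b'0 : half_plane b'.
  by apply: half_plane_scale; [rewrite invr_gt0|apply: half_planeD => //; exact: ltW].
have bE z : mu%:C * z + w + b = mu%:C * (z + b').
  by rewrite mulrDr /b' mulrA -rmorphM mulfV ?gt_eqF// mul1r addrA.
pose q := period_exponent mu^-1.
have qre j : complex.Re (a + j%:R * q) = complex.Re a.
  rewrite -(rmorph_nat (real_complex R)) /q /period_exponent; case: (a) => u v /=.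
  by rewrite mulr0 mul0r subrr addr0.
have gex (j : nat) : exists g : X, forall z, half_plane z ->
    g z = cpow (z + b) (a + j%:R * q) - cpow (z + b') (a + j%:R * q).
  by apply: power_difference_in_space; rewrite ?qre.
have [g gE] := choice gex.
have [n [c [[i0 ci0] [f fE]]]] := fin_codim_relation g fc.
pose H b z := \sum_j c j * cpow (z + b) (a + j%:R * q).
have HE z : half_plane z -> H b (mu%:C * z + w) = l * H b' z.
  move=> z0; rewrite /H mulr_sumr; apply: eq_bigr => j _; rewrite bE cpow_scale//; last first.
    by apply: half_planeD => //; exact: ltW.
  have -> : (a + j%:R * q) * (ln mu)%:C = a * (ln mu)%:C + j%:R * (q * (ln mu)%:C) by ring.
  by rewrite cexpD aE cexpMn cexp_period_inv// expr1n mulr1 mulrCA.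
pose u z := f z + l^-1 * H b z.
have uE z : half_plane z -> u (mu%:C * z + w) = l * u z.
  move=> z0; have := congr1 (fun h : X => h z) fE; rewrite shiftedE TP// hb_sumE => h.
  have {}h : f (mu%:C * z + w) = l * f z + (H b z - H b' z).
    rewrite -[LHS](subrK (l * f z)) h addrC; congr (_ + _); rewrite /H -sumrB.
    by apply: eq_bigr => j _; rewrite gE// mulrBr.
  rewrite /u h HE// mulKf// mulrDr mulVKf//; ring.
have uc : {for s, continuous u}.
  have c1 : {for s, continuous f} by apply: derivable_continuous; exact: hb_holomorphic.
  have c2 : {for s, continuous (H b)}.
    apply: ccont_sum => j.
    have sb : half_plane (s + b) by apply: half_planeD => //; exact: ltW.
    have c3 : {for s, continuous (fun z => z + b)} by exact: (ccontD (@ccont_id _ s) (@ccont_cst _ b s)).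
    exact: (ccont_comp c3 (cderiv_continuous (cderiv_cpow (a + j%:R * q) sb))).
  exact: (ccontD c1 (ccontM (@ccont_cst _ l^-1 s) c2)).
have u0 := intertwined_zero mu0 mu1 w0 s0 sE l1 uc uE.
move: ci0; suff -> : c i0 = 0 by rewrite eqxx.
apply: (imaginary_power_independent v1) => x x1 _.
have x0 : 0 < x by apply: lt_trans x1.
set P := \sum_j _; apply/eqP; rewrite -normc_eq0 eq_le normc_ge0 andbT.
apply/ler_addgt0Pl => e e0; rewrite addr0.
have l2 : 0 < 2 * normc l by rewrite mulr_gt0// (lt_trans ltr01).
have e1 : 0 < e / (2 * normc l) by rewrite divr_gt0.
have [M MP] := decay_at_infinity f e1.
have [N NP] := pow_unbounded (Num.max 2 (M + 1)) v1.
pose r := mu^-1 ^+ N * x.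
have rN : mu^-1 ^+ N <= r by rewrite ler_pMr ?exprn_gt0 ?invr_gt0// ltW.
have [r2 rM] : 2 <= r /\ M + 1 <= r.
  by apply/andP; rewrite -ge_max; apply: le_trans rN; exact: NP (leqnn N).
have r0 : 0 < r by apply: lt_le_trans r2.
have rE j : cpow x%:C q ^+ j = cpow r%:C q ^+ j.
  congr (_ ^+ _); rewrite /r; elim: (N) => [|m IH]; first by rewrite expr0 mul1r.
  rewrite exprS -mulrA rmorphM cpow_scale ?invr_gt0 ?cexp_period ?mul1r//.
  by apply: half_plane_real; rewrite mulr_gt0// exprn_gt0// invr_gt0.
pose z := (r - 1) +i* complex.Im s.
have z0 : half_plane z by rewrite /half_plane /z /= subr_gt0; apply: lt_le_trans r2; rewrite ltr1n.
have zb : z + b = r%:C by rewrite /z /b; apply/eqP; rewrite eq_complex /= subrK subrr !eqxx.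
have HP : H b z = cpow r%:C a * P.
  rewrite /H /P mulr_sumr; apply: eq_bigr => j _; rewrite zb cpowD cpowMn rE; ring.
have fz : f z = - (l^-1 * (cpow r%:C a * P)).
  by have := u0 z z0; rewrite /u HP => /eqP; rewrite addr_eq0 => /eqP.
have := MP (r - 1) (complex.Im s) _ _; rewrite -/z fz normcN normcM normcV (normcM (cpow _ _)).
have -> : normc (cpow r%:C a) = r `^ complex.Re a.
  rewrite /cpow normc_cexp /clog /= normc_real gtr0_norm// mul0r atan0 /powR gt_eqF//.
  by case: (a) => a' a'' /=; rewrite mulr0 subr0.
move=> h; have {}h : (r - 1) * ((normc l)^-1 * (r `^ complex.Re a * normc P)) <= e / (2 * normc l).
  apply: h; first by move: r2; clear; lra.
  by apply: (@le_trans _ _ (r - 1)); [rewrite lerBrDr|rewrite lerDl].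
have ra : r^-1 <= r `^ complex.Re a.
  by rewrite -(powR_inv1 (ltW r0)) ler_powR// (le_trans _ r2)// ler1n.
have half : 2^-1 <= (r - 1) * r `^ complex.Re a.
  apply: (@le_trans _ _ ((r - 1) * r^-1)).
    by rewrite ler_pdivlMr//; move: r2; clear; lra.
  by rewrite ler_wpM2l//; move: r2; clear; lra.
have lp : 0 < (2 * normc l)^-1 by rewrite invr_gt0.
rewrite -(ler_pM2l lp) [leRHS]mulrC; apply: le_trans h.
rewrite [leRHS](_ : _ = (r - 1) * r `^ complex.Re a * ((normc l)^-1 * normc P)); last by ring.
rewrite invfM -[leLHS]mulrA; apply: ler_wpM2r half; apply: mulr_ge0; last exact: normc_ge0.
by rewrite invr_ge0 normc_ge0.
Qed.

End ContractingOuter.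

(** * Contracting affine symbols: multipliers in the unit disc *)

Section ContractingInner.
Context {R : realType}.
Local Notation C := R[i].
Local Notation X := (hardy_bergman R).
Local Notation leb := (@lebesgue_measure R).
Implicit Types (f g : X) (T : {linear X -> X}) (l z w b a p s : C) (mu : R).

Lemma Rintegral_scale (k u v : R) (g : R -> R) : 0 < k -> u <= v -> (forall x, {for x, continuous g}) ->
  \int[leb]_(x in `[k * u, k * v]) g x = k * \int[leb]_(x in `[u, v]) g (k * x).
Proof.
move=> k0 uv cg; pose F (x : R) := k * x.
have dF (x : R) : is_derive x 1 F k.
  have h := is_deriveZ k (is_derive_id x (1 : R)); rewrite /GRing.scale /= mulr1 in h; exact: h.
have FE : derive1 F = fun=> k by apply/funext => x; rewrite derive1E; exact: (@derive_val _ _ _ _ _ _ _ (dF x)).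
have cF x : {for x, continuous F}.
  by apply: differentiable_continuous; apply/derivable1_diffP; exact: (@ex_derive _ _ _ _ _ _ _ (dF x)).
have cgk x : {for x, continuous (fun x => g (k * x))} by exact: (continuous_comp (cF x) (cg _)).
have ig : leb.-integrable `[u, v] (EFin \o (fun x => g (k * x))).
  by apply: integrable_continuous => x _; exact: cgk.
rewrite -RintegralZl//; congr fine.
have subst := @integration_by_substitution_increasing _ F g u v uv.
rewrite -/(F u) -/(F v) subst.
- by apply: eq_integral => x _; rewrite FE /= /F mulrC.
- by move=> x y _ _ xy; rewrite /F ltr_pM2l.
- by move=> x _; rewrite FE; exact: cvg_cst.
- by rewrite FE; exact: is_cvg_cst.
- by rewrite FE; exact: is_cvg_cst.
- split; first by move=> x _; exact: (@ex_derive _ _ _ _ _ _ _ (dF x)).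
  + by apply: cvg_at_right_filter; exact: cF.
  + by apply: cvg_at_left_filter; exact: cF.
- by apply: continuous_in_subspaceT => x _; exact: cg.
Qed.

Lemma cint_scale (k u v : R) (F : R -> C) : 0 < k -> u <= v -> (forall x, {for x, continuous F}) ->
  cint (k * u) (k * v) F = k%:C * cint u v (fun x => F (k * x)).
Proof.
move=> k0 uv cF; have reE := Rintegral_scale k0 uv (fun x => continuous_Re (cF x)).
have imE := Rintegral_scale k0 uv (fun x => continuous_Im (cF x)).
by rewrite /cint reE imE; apply/eqP; rewrite eq_complex /= !mul0r subr0 addr0 !eqxx.
Qed.

Lemma rcontZ (k : C) (F : R -> C) (x : R) : {for x, continuous F} ->
  {for x, continuous (fun t => k * F t)}.
Proof.
by move=> cF; exact: (rcont_comp cF (ccontM (@ccont_cst _ k (F x)) (@ccont_id _ (F x)))).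
Qed.

(** Pairing over a vertical line with an analytic function that is homogeneous
    with respect to the fixed point annihilates the range: a change of variables
    turns the composition operator into a move of the line of integration. *)
Lemma pairing_vanishes T mu s w l f (h : C -> C) (K c : R) : 0 < mu -> mu < 1 -> half_plane w ->
  half_plane s -> s = mu%:C * s + w -> is_composition_operator (fun z => mu%:C * z + w) T ->
  (forall z, complex.Re z < complex.Re s -> h z = l * mu%:C * h (mu%:C * z + w)) ->
  (forall z, complex.Re z < complex.Re s -> derivable h z 1) ->
  (forall x y, x < complex.Re s -> 1 <= `|y| -> normc (h (x +i* (complex.Im s + y))) <= K / `|y|) ->
  0 < c -> c < complex.Re s -> forall e, 0 < e -> exists Y0, forall Y, Y0 <= Y ->
  normc (cint (- Y) Y (fun v => shifted T l f (c +i* (complex.Im s + v)) * h (c +i* (complex.Im s + v)))) <= e.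
Proof.
move=> mu0 mu1 w0 s0 sE TP hh dh hK c0 cs e e0.
pose sg := complex.Re s; pose th := complex.Im s.
have K0 : 0 <= K.
  have := hK (sg - 1) 1 _ _; rewrite normr1 divr1 => H.
  by apply: le_trans (normc_ge0 _) (H _ _) => //; rewrite /sg; clear; lra.
pose F0 z : C := f (z + (0 +i* th)) * h (z + (0 +i* th)).
pose c' := mu * c + complex.Re w.
have wE : complex.Re w = (1 - mu) * sg /\ complex.Im w = (1 - mu) * th.
  move: sE; rewrite /sg /th; case: (s) => p q; case: (w) => u v [] h1 h2 /=.
  by split; [rewrite {1}(_ : u = p - mu * p)|rewrite {1}(_ : v = q - mu * q)]; try ring;
    [rewrite {1}h1|rewrite {1}h2]; ring.
have [wR wI] := wE.
have sc0 : 0 < sg - c by rewrite subr_gt0.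
have cc' : c < c'.
  have : 0 < (1 - mu) * (sg - c) by rewrite mulr_gt0 ?subr_gt0.
  by rewrite /c' wR; clear; lra.
have c's : c' < sg by have := mulr_gt0 mu0 sc0; rewrite /c' wR; clear; lra.
have d0 x y : 0 < x -> x < sg -> derivable F0 (x +i* y) 1.
  move=> x0 xs; have zE : (x +i* y) + (0 +i* th) = x +i* (y + th) :> C.
    by apply/eqP; rewrite eq_complex /= addr0 !eqxx.
  have zz : half_plane (x +i* (y + th)) by [].
  have /derivable_cderivP[D1 h1] := @hb_holomorphic _ f _ zz.
  have /derivable_cderivP[D2 h2] := dh (x +i* (y + th)) xs.
  rewrite -zE in h1 h2; apply/derivable_cderivP; eexists.
  have sh := cderivD (cderiv_id (x +i* y)) (cderiv_const (0 +i* th) (x +i* y)).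
  exact: (cderivM (cderiv_comp sh h1) (cderiv_comp sh h2)).
have cF x y : 0 < x -> x < sg -> {for x +i* y, continuous F0}.
  by move=> x0 xs; apply: derivable_continuous; exact: d0.
have lineC x v : 0 < x -> x < sg -> {for v, continuous (fun y => F0 (x +i* y))}.
  by move=> x0 xs; apply: vline_continuous; exact: cF.
have FE x v : F0 (x +i* v) = f (x +i* (th + v)) * h (x +i* (th + v)).
  by rewrite /F0; have -> : (x +i* v) + (0 +i* th) = x +i* (th + v) :> C by apply/eqP; rewrite eq_complex /= addr0 addrC !eqxx.
pose I u Y := cint (- Y) Y (fun v => F0 (u +i* v)).
have TE v : shifted T l f (c +i* (th + v)) * h (c +i* (th + v)) =
    l * mu%:C * F0 (c' +i* (mu * v)) - l * F0 (c +i* v).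
  have zz : half_plane (c +i* (th + v)) by [].
  have phiE : mu%:C * (c +i* (th + v)) + w = c' +i* (th + mu * v).
    by rewrite affineE -/c' wI; congr (_ +i* _); ring.
  have hE := hh (c +i* (th + v)) cs; rewrite phiE in hE.
  rewrite !FE shiftedE TP// phiE mulrBl {1}hE; ring.
have split Y : 0 <= Y -> cint (- Y) Y (fun v => shifted T l f (c +i* (th + v)) * h (c +i* (th + v))) =
    l * (I c' (mu * Y) - I c Y).
  move=> Y0; have YY : - Y <= Y by move: Y0; clear; lra.
  rewrite (eq_cint (G := fun v => (l * mu%:C) * F0 (c' +i* (mu * v)) + (- l) * F0 (c +i* v))); last first.
    by move=> v _; rewrite TE mulNr.
  have c'0 : 0 < c' by apply: lt_trans cc'.
  have cs1 v : {for v, continuous (fun v => F0 (c' +i* (mu * v)))}.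
    apply: (@rcont_comp _ (fun v => c' +i* (mu * v)) F0); last exact: cF.
    apply: (@continuous_lipschitz _ _ mu) => t.
    have -> : (c' +i* (mu * t)) - (c' +i* (mu * v)) = mu%:C * (0 +i* (t - v)) :> C.
      by apply/eqP; rewrite eq_complex /= !mul0r mulr0 subrr subr0 addr0 eqxx mulrBr eqxx.
    by rewrite normcM normc_real gtr0_norm// normc_ReIm /= expr0n add0r sqrtr_sqr.
  have cs2 v : {for v, continuous (fun v => F0 (c +i* v))} by exact: lineC.
  have on1 : continuous_on (- Y) Y (fun v => F0 (c' +i* (mu * v))) by move=> v _; exact: cs1.
  have on2 : continuous_on (- Y) Y (fun v => F0 (c +i* v)) by move=> v _; exact: cs2.
  have onZ1 : continuous_on (- Y) Y (fun v => l * mu%:C * F0 (c' +i* (mu * v))) by move=> v _; exact: rcontZ (cs1 v).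
  have onZ2 : continuous_on (- Y) Y (fun v => - l * F0 (c +i* v)) by move=> v _; exact: rcontZ (cs2 v).
  rewrite (cintD onZ1 onZ2) (cintZ (l * mu%:C) on1) (cintZ (- l) on2).
  rewrite mulNr mulrBr; congr (_ - _); rewrite -mulrA; congr (_ * _).
  have sc : cint (mu * - Y) (mu * Y) (fun v => F0 (c' +i* v)) =
      mu%:C * cint (- Y) Y (fun v => F0 (c' +i* (mu * v))).
    exact: (cint_scale mu0 YY (fun v => lineC c' v c'0 c's)).
  by rewrite -sc /I mulrN.
pose Q := 4 * K * (c' - c) / c + 4 * K * (1 - mu) / (c * mu).
have Q0 : 0 <= Q.
  have cm0 : 0 < c * mu by rewrite mulr_gt0.
  have h1 : 0 <= c' - c by rewrite subr_ge0 ltW.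
  have h2 : 0 <= 1 - mu by rewrite subr_ge0 ltW.
  have K40 : 0 <= 4 * K by rewrite mulr_ge0.
  by apply: addr_ge0; apply: divr_ge0; rewrite ?(ltW cm0) ?(ltW c0)// mulr_ge0.
have q1 : 0 < normc l * Q + 1 by rewrite ltr_wpDl// mulr_ge0 ?normc_ge0.
pose e' := e / (normc l * Q + 1); have e'0 : 0 < e' by rewrite divr_gt0.
have e'E : e' * (normc l * Q + 1) = e by rewrite /e' divfK// gt_eqF.
have [M MP] := decay_at_infinity f e'0; clearbody e'.
have c'0 : 0 < c' by apply: lt_trans cc'.
have Fbd x y : c <= x <= c' -> Num.max 1 (M + `|th|) <= `|y| -> normc (F0 (x +i* y)) <= e' / c * (K / `|y|).
  move=> /andP[xc xc']; rewrite ge_max => /andP[y1 yM]; have x0 : 0 < x by apply: lt_le_trans xc.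
  rewrite FE normcM; apply: ler_pM; rewrite ?normc_ge0//; last by apply: hK => //; apply: le_lt_trans c's.
  have h1 : M <= x + `|th + y|.
    have := ler_normB (th + y) th; rewrite (addrC th) addrK; move: yM x0; clear; lra.
  have := MP x (th + y) x0 h1; rewrite ler_pdivlMr// mulrC; apply: le_trans.
  by rewrite ler_wpM2l ?normc_ge0.
pose Y0 := Num.max 1 (M + `|th|) / mu.
have Y00 : 0 < Y0 by rewrite divr_gt0// lt_max ltr01.
exists Y0 => Y YY0; have Yp : 0 < Y by apply: lt_le_trans YY0.
rewrite (split _ (ltW Yp)).
have muY : Num.max 1 (M + `|th|) <= mu * Y by rewrite -ler_pdivrMl// mulrC.
have muY1 : 1 <= mu * Y by apply: le_trans muY; rewrite le_max lexx.
have muYp : 0 < mu * Y by rewrite mulr_gt0.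
have muYY : mu * Y <= Y by rewrite ler_piMl// ltW.
have ec : 0 <= e' / c by rewrite divr_ge0// ltW.
have horiz : normc (I c' (mu * Y) - I c (mu * Y)) <= 4 * (e' / c * K) * (c' - c).
  have g0 : rectint F0 c c' (- (mu * Y)) (mu * Y) = 0.
    apply: goursat; [exact: ltW|by move: muYp; clear; lra|].
    move=> x y /andP[xc xc'] _; apply: d0; first exact: lt_le_trans xc.
    exact: le_lt_trans xc' c's.
  have hb y : `|y| = mu * Y -> normc (cint c c' (fun x => F0 (x +i* y))) <= 2 * (e' / c * K) * (c' - c).
    move=> yE; apply: normc_cint_bound; first exact: ltW.
      move=> x /andP[xc xc']; apply: hline_continuous; apply: cF; first exact: lt_le_trans xc.
      exact: le_lt_trans xc' c's.
    move=> x xx; apply: le_trans (Fbd x y xx _) _; first by rewrite yE.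
    rewrite yE ler_wpM2l// ler_pdivrMr// ler_peMr//.
  have h1 := hb (- (mu * Y)); rewrite normrN gtr0_norm// in h1; have {}h1 := h1 erefl.
  have h2 := hb (mu * Y); rewrite gtr0_norm// in h2; have {}h2 := h2 erefl.
  have -> : normc (I c' (mu * Y) - I c (mu * Y)) = normc ((0 +i* 1) * (I c' (mu * Y) - I c (mu * Y))).
    by rewrite normcM normc_i mul1r.
  move: g0; rewrite /rectint -/(I c' (mu * Y)) -/(I c (mu * Y)) addrC => /eqP; rewrite addr_eq0 => /eqP ->.
  rewrite normcN; apply: le_trans (le_normcD _ _) _; rewrite normcN.
  by move: h1 h2; clear; lra.
have tails : normc (I c (mu * Y) - I c Y) <= 4 * (e' / c * (K / (mu * Y))) * (Y - mu * Y).
  have lc u v : continuous_on u v (fun v => F0 (c +i* v)) by move=> x _; exact: lineC.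
  have tb u v : u <= v -> (forall t, u <= t <= v -> mu * Y <= `|t|) ->
      normc (cint u v (fun v => F0 (c +i* v))) <= 2 * (e' / c * (K / (mu * Y))) * (v - u).
    move=> uv H; apply: normc_cint_bound => // t /H tY.
    apply: le_trans (Fbd c t _ _) _; [by rewrite lexx ltW|exact: le_trans tY|].
    by rewrite ler_wpM2l// ler_wpM2l// lef_pV2// ?posrE//; apply: lt_le_trans tY.
  have E : I c Y = cint (- Y) (- (mu * Y)) (fun v => F0 (c +i* v)) +
      (I c (mu * Y) + cint (mu * Y) Y (fun v => F0 (c +i* v))).
    rewrite /I (@cint_split _ (- Y) (- (mu * Y)) Y)//; last by apply/andP; split; move: muYY muYp; clear; lra.
    congr (_ + _); apply: cint_split => //; apply/andP; split; move: muYY muYp; clear; lra.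
  have -> : I c (mu * Y) - I c Y = - (cint (- Y) (- (mu * Y)) (fun v => F0 (c +i* v)) + cint (mu * Y) Y (fun v => F0 (c +i* v))).
    by rewrite E; ring.
  rewrite normcN; apply: le_trans (le_normcD _ _) _.
  have t1 : normc (cint (- Y) (- (mu * Y)) (fun v => F0 (c +i* v))) <= 2 * (e' / c * (K / (mu * Y))) * (- (mu * Y) - - Y).
    apply: tb; first by move: muYY; clear; lra.
    by move=> t /andP[_ t2]; rewrite ler0_norm; move: t2 muYp; clear; lra.
  have t2 : normc (cint (mu * Y) Y (fun v => F0 (c +i* v))) <= 2 * (e' / c * (K / (mu * Y))) * (Y - mu * Y).
    by apply: tb => // t /andP[t1' _]; rewrite ger0_norm// (le_trans _ t1')// ltW.
  move: t1 t2; rewrite opprK (addrC (- (mu * Y))); clear; lra.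
rewrite normcM -e'E; have hQ : 4 * (e' / c * K) * (c' - c) + 4 * (e' / c * (K / (mu * Y))) * (Y - mu * Y) = e' * Q.
  by rewrite /Q; field; rewrite !gt_eqF.
have : normc (I c' (mu * Y) - I c Y) <= e' * Q.
  rewrite -hQ; have -> : I c' (mu * Y) - I c Y = (I c' (mu * Y) - I c (mu * Y)) + (I c (mu * Y) - I c Y) by rewrite addrA subrK.
  exact: le_trans (le_normcD _ _) (lerD horiz tails).
move=> hI; apply: (@le_trans _ _ (normc l * (e' * Q))); first by rewrite ler_wpM2l ?normc_ge0.
by clearbody Q; rewrite mulrCA mulrDr mulr1 lerDl ltW.
Qed.

(** A nonnegative continuous function positive somewhere has truncated integrals
    bounded away from zero; the pairing is known only as a limit of these. *)
Lemma bump_integral (r : R -> R) (v : R) : (forall x, {for x, continuous r}) -> (forall x, 0 <= r x) ->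
  0 < r v -> exists2 k, 0 < k & exists Y1, forall Y, Y1 <= Y -> k <= \int[leb]_(x in `[- Y, Y]) r x.
Proof.
move=> cr r0 rv; pose d := r v / 2; have d0 : 0 < d by rewrite divr_gt0.
have cz : {for v, continuous (fun x => (r x)%:C)}.
  apply/continuous_realP => e e0; have := (@cvgrPdist_lt _ _ _ (nbhs v) (nbhs_filter v) r (r v)).1 (cr v) e e0.
  move=> /(nbhs_normP v _).1[k /= k0 kP]; exists k => // t tv; rewrite -rmorphB normc_real distrC.
  by apply: kP; rewrite /ball_ /= distrC.
have [k k0 kP] := (continuous_realP _ _).1 cz d d0.
have k20 : 0 < k / 2 by rewrite divr_gt0.
exists (d * k); first by rewrite mulr_gt0.
exists (`|v| + k) => Y YY; have vY : - Y <= v - k / 2 /\ v + k / 2 <= Y.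
  by have := ler_norm v; have := ler_norm (- v); rewrite normrN; split; move: YY k20; lra.
have [Y1 Y2] := vY.
have ri x y : leb.-integrable `[x, y] (EFin \o r) by apply: integrable_continuous => t _; exact: cr.
have vk : v - k / 2 <= v + k / 2 by move: k20; clear; lra.
rewrite (@Rintegral_split _ r (- Y) (v - k / 2) Y) ?Y1 ?(le_trans vk)// (@Rintegral_split _ r (v - k / 2) (v + k / 2) Y) ?vk//.
have mid : d * k <= \int[leb]_(x in `[v - k / 2, v + k / 2]) r x.
  have -> : d * k = d * ((v + k / 2) - (v - k / 2)) by field.
  rewrite -(Rintegral_segment_cst _ vk); apply: le_Rintegral => //.
    by apply: integrable_continuous => x _; exact: cvg_cst.
  move=> x /=; rewrite in_itv /= => /andP[x1 x2].
  have xv : `|x - v| < k by rewrite ltr_norml; apply/andP; split; move: x1 x2 k20; clear; lra.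
  have := kP x xv; rewrite -rmorphB normc_real ltr_norml => /andP[h _]; move: h; rewrite /d; clear; lra.
have p1 : 0 <= \int[leb]_(x in `[- Y, v - k / 2]) r x by apply: Rintegral_ge0 => x _; exact: r0.
have p2 : 0 <= \int[leb]_(x in `[v + k / 2, Y]) r x by apply: Rintegral_ge0 => x _; exact: r0.
by move: mid p1 p2; clear; lra.
Qed.

(** The half-plane and the principal logarithm are symmetric in the real axis. *)
Lemma cpow_conj z p : cpow (z^*) (p^*) = (cpow z p)^*.
Proof.
have cexpC u : cexp (u^*) = (cexp u)^*.
  by case: u => u v; rewrite /cexp /= cosN sinN; apply/eqP; rewrite eq_complex /=; apply/andP; split; apply/eqP; ring.
have clogC u : clog (u^*) = (clog u)^*.
  by case: u => u v; rewrite /clog normc_conj /= mulNr atanN.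
by rewrite /cpow clogC -rmorphM cexpC.
Qed.

Lemma conjugate_power_test b p : half_plane b -> complex.Re p <= -1 ->
  exists g, forall z, half_plane z -> g z = cpow (z + b) p * (z + 1)^-1.
Proof.
move=> b0 p1; pose rho := Num.min (complex.Re b) 1.
have rho0 : 0 < rho by rewrite lt_min; apply/andP.
have p0 : complex.Re p <= 0 by move: p1; clear; lra.
have be1 : 1 < 1 - complex.Re p by move: p1; clear; lra.
have h1 : half_plane (1 : C) by exact: ltr01.
have hG : holomorphic_rhp (fun z => cpow (z + b) p * ((z + 1) ^+ 1)^-1).
  apply: holomorphicM; last by apply: holomorphic_inv_shift; exact: ler01.
  exact: (@holomorphic_shift _ (fun z => cpow z p) b (ltW b0) (@holomorphic_cpow _ p)).
pose nu := `|complex.Im b|; have nu0 : 0 <= nu by exact: normr_ge0.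
pose k := (2 * (1 + nu / rho)); pose K1 := expR (2 * `|complex.Im p|) * k `^ (- complex.Re p).
pose K2 := expR (2 * `|complex.Im (-1 : C)|) * k `^ (- complex.Re (-1 : C)).
have K10 : 0 <= K1 by rewrite mulr_ge0 ?expR_ge0 ?powR_ge0.
have K20 : 0 <= K2 by rewrite mulr_ge0 ?expR_ge0 ?powR_ge0.
have [g gP] : exists f : X, forall z, half_plane z -> f z = cpow (z + b) p * ((z + 1) ^+ 1)^-1.
  apply: (hb_of_decay rho0 be1 (mulr_ge0 K10 K20) hG) => x y x0; set z := x +i* y.
  have z0 : half_plane z by [].
  have z1 : half_plane (z + 1) by apply: half_planeD => //; exact: ler01.
  have i1 : ((z + 1) ^+ 1)^-1 = cpow (z + 1) (-1) by rewrite expr1 /cpow mulN1r cexpN clogK.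
  rewrite i1 (normcM (cpow (z + b) p)).
  have u0 : 0 < x + rho + `|y| by rewrite ltr_pwDl// addr_gt0.
  have -> : K1 * K2 * (x + rho + `|y|) `^ (- (1 - complex.Re p)) =
      (K1 * (x + rho + `|y|) `^ complex.Re p) * (K2 * (x + rho + `|y|) `^ complex.Re (-1 : C)).
    have -> : - (1 - complex.Re p) = complex.Re p + complex.Re (-1 : C) by rewrite /=; ring.
    rewrite powRD; last by apply/implyP => _; rewrite gt_eqF.
    ring.
  apply: ler_pM; rewrite ?normc_ge0//; apply: normc_cpow_decay => //.
  - have -> : complex.Re (z + b) = x + complex.Re b by rewrite /z; case: (b).
    by rewrite lerD2l ge_min lexx.
  - have -> : complex.Im (z + b) = y + complex.Im b by rewrite /z; case: (b).
    by have := ler_normB (y + complex.Im b) (complex.Im b); rewrite addrK.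
  - by rewrite /= oppr_le0.
  - by rewrite /z /= lerD2l ge_min lexx orbT.
  - by rewrite /z /= addr0 lerDl.
by exists g => z z0; rewrite gP.
Qed.

Lemma cderiv_sum n (e : 'I_n -> C) (F : nat -> C -> C) z : (forall j, exists D, has_cderiv (F j) z D) ->
  exists D, has_cderiv (fun w => \sum_j e j * F j w) z D.
Proof.
move=> H; elim: n e => [|n IH] e.
  have -> : (fun w => \sum_(j < 0) e j * F j w) = (fun=> 0) by apply/funext => w; rewrite big_ord0.
  by exists 0; exact: cderiv_const.
have [D1 h1] := IH (fun j => e (widen_ord (leqnSn n) j)); have [D2 h2] := H n.
exists (D1 + e ord_max * D2).
have -> : (fun w => \sum_(j < n.+1) e j * F j w) = (fun w => \sum_(j < n) e (widen_ord (leqnSn n) j) * F j w + e ord_max * F n w).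
  by apply/funext => w; rewrite big_ord_recr.
exact: (cderivD h1 (cderivZ (e ord_max) h2)).
Qed.

Lemma half_planeB s z : complex.Re z < complex.Re s -> half_plane (s - z).
Proof. by case: s z => [u v] [u' v'] /=; rewrite /half_plane /= subr_gt0. Qed.

(** The powers [h] of [s - z] about the fixed point [s], with exponents chosen from
    [mu^a = l], annihilate the range by pairing over the line [Re z = c]. The
    candidate elements of the range are built to be, on this line, the conjugate
    of [h] times [1 / (z + 1)], which has positive real part: the pairing is then
    the integral of a positive multiple of [|h|^2], and [h] vanishes. *)
Lemma contracting_not_fin_codim_inner T mu w l : 0 < mu -> mu < 1 -> half_plane w ->
  is_composition_operator (fun z => mu%:C * z + w) T -> l != 0 -> normc l <= 1 ->
  ~ fin_codim (range (shifted T l)).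
Proof.
move=> mu0 mu1 w0 TP l0 lm fc.
have m1 : mu != 1 by rewrite lt_eqF.
have v1 : 1 < mu^-1 by rewrite invf_gt1.
have [a [aE aN]] := log_base mu0 m1 l0.
have L : ln mu < 0 by rewrite ln_lt0// mu0.
have a0 : 0 <= complex.Re a.
  rewrite -(ler_nM2r L) mul0r -ler_expR expR0; move: lm.
  by rewrite -aN /powR gt_eqF.
have [s [sE s0]] := fixed_point_contracting mu1 w0.
pose sg := complex.Re s; pose th := complex.Im s; have sg0 : 0 < sg by [].
(* The line of integration lies in the half-plane, and c < Re s / 2 keeps the
   reflection of s in it to the left of the half-plane, as conjugation requires. *)
pose c := sg / 4; have c0 : 0 < c by rewrite divr_gt0.
have cs : c < sg by rewrite /c; move: sg0; clear; lra.
pose q := period_exponent mu^-1.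
(* The exponent - a - 1 accounts for the factor l mu of the homogeneity. *)
pose p (j : nat) := - a - 1 + j%:R * q.
have pRe j : complex.Re (p j) = - complex.Re a - 1.
  rewrite /p -(rmorph_nat (real_complex R)) /q /period_exponent; case: (a) => u v /=.
  by rewrite mulr0 mul0r subrr addr0.
(* On the line Re z = c the conjugate of s - z is z + b. *)
pose b := conjc s - (2 * c)%:C.
have b0 : half_plane b.
  have -> : b = (sg - 2 * c) +i* (- th) by rewrite /b /sg /th; case: (s) => u v; apply/eqP; rewrite eq_complex /= subr0 !eqxx.
  by rewrite /half_plane /= /c; move: sg0; clear; lra.
have gex (j : nat) : exists g : X, forall z, half_plane z -> g z = cpow (z + b) (conjc (p j)) * (z + 1)^-1.
  apply: conjugate_power_test => //; have -> : complex.Re (conjc (p j)) = complex.Re (p j) by case: (p j).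
  by rewrite pRe; move: a0; clear; lra.
have [g gE] := choice gex.
have [n [d [[i0 di0] [f fE]]]] := fin_codim_relation g fc.
pose h z := \sum_j conjc (d j) * cpow (s - z) (p j).
have hh z : complex.Re z < sg -> h z = l * mu%:C * h (mu%:C * z + w).
  move=> zs; have zz := half_planeB zs; rewrite /h mulr_sumr; apply: eq_bigr => j _.
  have -> : s - (mu%:C * z + w) = mu%:C * (s - z) by rewrite {1}sE; ring.
  rewrite cpow_scale//.
  have -> : cexp (p j * (ln mu)%:C) = l^-1 * mu%:C^-1.
    have -> : p j * (ln mu)%:C = - (a * (ln mu)%:C) + (- ln mu)%:C + j%:R * (q * (ln mu)%:C).
      by rewrite /p rmorphN; ring.
    rewrite !cexpD cexpN aE cexp_real expRN lnK ?posrE// cexpMn cexp_period_inv// expr1n mulr1.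
    by rewrite fmorphV.
  have mn : mu%:C != 0 :> C by rewrite -normc_gt0 normc_real gtr0_norm.
  by field; rewrite l0 mn.
have dh z : complex.Re z < sg -> derivable h z 1.
  move=> zs; have zz := half_planeB zs; apply/derivable_cderivP.
  have dj j : exists D, has_cderiv (fun z => cpow (s - z) (p j)) z D.
    eexists; exact: (cderiv_comp (cderivB (cderiv_const s z) (cderiv_id z)) (cderiv_cpow (p j) zz)).
  exact: (cderiv_sum (fun j => conjc (d j)) dj).
pose K := \sum_(j < n.+1) normc (d j) * expR (2 * `|complex.Im (p j)|).
have hK x y : x < sg -> 1 <= `|y| -> normc (h (x +i* (th + y))) <= K / `|y|.
  move=> xs y1; have y0 : 0 < `|y| by apply: lt_le_trans y1.
  have zz : half_plane (s - (x +i* (th + y))) by exact: half_planeB.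
  rewrite /h mulr_suml; apply: le_trans (normc_sum _ _ _) _; apply: ler_sum => j _.
  rewrite (normcM (conjc _)) normc_conj -mulrA ler_wpM2l ?normc_ge0//.
  apply: le_trans (normc_cpow _ zz) _; rewrite ler_wpM2l ?expR_ge0//.
  have yn : `|y| <= normc (s - (x +i* (th + y))).
    apply: le_trans (le_Im_normc _); have -> : complex.Im (s - (x +i* (th + y))) = - y.
      by rewrite /th; case: (s) => u v /=; ring.
    by rewrite normrN.
  have n1 : 1 <= normc (s - (x +i* (th + y))) by exact: le_trans yn.
  apply: (@le_trans _ _ (normc (s - (x +i* (th + y))) `^ (-1))).
    by rewrite ler_powR// pRe; move: a0; clear; lra.
  by rewrite powR_inv1 ?normc_ge0// lef_pV2// posrE (lt_le_trans _ yn).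
have claim := pairing_vanishes f mu0 mu1 w0 s0 sE TP hh dh hK c0 cs.
pose E v : C := c +i* (th + v).
have E0 v : half_plane (E v) by [].
have En v : E v + 1 != 0 by apply: half_plane_neq0; apply: half_planeD => //; exact: ler01.
have gh v : shifted T l f (E v) = conjc (h (E v)) * (E v + 1)^-1.
  rewrite fE hb_sumE /h rmorph_sum mulr_suml; apply: eq_bigr => j _.
  have conjM (u u' : C) : conjc (conjc u * u') = u * conjc u'.
    by case: u u' => [u1 u2] [u3 u4]; apply/eqP; rewrite eq_complex /=; apply/andP; split; apply/eqP; ring.
  have eE : conjc (s - E v) = E v + b.
    rewrite /E /b /th; case: (s) => u u'; apply/eqP; rewrite eq_complex /=.
    by apply/andP; split; apply/eqP; ring.
  have cE : conjc (conjc (d j) * cpow (s - E v) (p j)) = d j * cpow (E v + b) (conjc (p j)).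
    by rewrite conjM -cpow_conj eE.
  by rewrite gE// mulrA -cE.
pose r v : R := normc (h (E v)) ^+ 2 * ((c + 1) / ((c + 1) ^+ 2 + (th + v) ^+ 2)).
have den v : 0 < (c + 1) ^+ 2 + (th + v) ^+ 2.
  by rewrite ltr_pwDl ?sqr_ge0// exprn_gt0// addr_gt0.
have rE v : complex.Re (shifted T l f (E v) * h (E v)) = r v.
  rewrite gh /r normc_ReIm sqr_sqrtr ?addr_ge0 ?sqr_ge0//.
  have -> : (E v + 1)^-1 = ((c + 1) / ((c + 1) ^+ 2 + (th + v) ^+ 2)) +i* (- ((th + v) / ((c + 1) ^+ 2 + (th + v) ^+ 2))).
    by rewrite /E; apply/eqP; rewrite eq_complex /= addr0 !eqxx.
  by move: ((c + 1) / _) ((th + v) / _) => A B; case: (h (E v)) => u u' /=; ring.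
have cE v : {for v, continuous E}.
  apply: (@continuous_lipschitz _ _ 1) => t; rewrite /E mul1r.
  have -> : (c +i* (th + t)) - (c +i* (th + v)) = 0 +i* (t - v) :> C.
    by apply/eqP; rewrite eq_complex /= subrr eqxx /=; apply/eqP; ring.
  by rewrite normc_ReIm /= expr0n add0r sqrtr_sqr.
have cgh v : {for v, continuous (fun v => shifted T l f (E v) * h (E v))}.
  have c1 : {for E v, continuous (shifted T l f)} by apply: derivable_continuous; exact: hb_holomorphic.
  have c2 : {for E v, continuous h} by apply: derivable_continuous; exact: dh.
  exact: (rcont_comp (cE v) (ccontM c1 c2)).
have cr v : {for v, continuous r}.
  have := continuous_Re (cgh v); have -> : (fun t => complex.Re (shifted T l f (E t) * h (E t))) = r by apply/funext => t; exact: rE.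
  by [].
have r0 v : 0 <= r v by rewrite mulr_ge0 ?sqr_ge0// divr_ge0 ?ltW// addr_gt0.
have hz v : h (E v) = 0.
  apply/eqP; rewrite -normc_eq0; apply/eqP; apply: contrapT => /eqP hv.
  have rv : 0 < r v.
    have nv : 0 < normc (h (E v)) by rewrite lt_def hv normc_ge0.
    by rewrite mulr_gt0 ?exprn_gt0// divr_gt0// addr_gt0.
  have [k k0 [Y1 YP]] := bump_integral cr r0 rv.
  have k20 : 0 < k / 2 by rewrite divr_gt0.
  have [Y0 Y0P] := claim _ k20; pose Y := Num.max Y0 Y1.
  have h1 : k <= \int[leb]_(x in `[- Y, Y]) r x by apply: YP; rewrite le_max lexx orbT.
  have h2 : normc (cint (- Y) Y (fun v => shifted T l f (E v) * h (E v))) <= k / 2.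
    by apply: Y0P; rewrite le_max lexx.
  have h3 := le_trans (ler_norm _) (le_trans (le_Re_normc _) h2).
  have h4 : complex.Re (cint (- Y) Y (fun v => shifted T l f (E v) * h (E v))) = \int[leb]_(x in `[- Y, Y]) r x.
    by rewrite /cint /=; apply: eq_Rintegral => x _; exact: rE.
  by move: h1 h3; rewrite h4; move: k0; clear; lra.
pose t (k : nat) : C := cpow (s - E k%:R) q.
have tinj : injective t.
  have rho0 : 0 < sg - c by rewrite subr_gt0.
  have L1 : 0 < ln mu^-1 by rewrite ln_gt0.
  have sEk (k : nat) : s - E k%:R = (sg - c) +i* (- k%:R).
    by rewrite /E /sg /th; case: (s) => u v; apply/eqP; rewrite eq_complex /= eqxx; apply/eqP; ring.
  move=> k m /(congr1 (@normc R)); rewrite /t !sEk /cpow !normc_cexp => /expR_inj.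
  rewrite /q /period_exponent /clog /= !mul0r !sub0r => /oppr_inj.
  have t0 : 2 * pi / ln mu^-1 != 0 :> R by rewrite gt_eqF// divr_gt0// mulr_gt0// pi_gt0.
  move=> /(mulfI t0)/(can_inj (@atanK R)) /(divIf (lt0r_neq0 rho0)) /oppr_inj/eqP.
  by rewrite eqr_nat => /eqP.
have dz : forall j, conjc (d j) = 0.
  apply: (poly_many_roots tinj) => k.
  apply: (mulfI (cpow_neq0 (s - E k%:R) (- a - 1))); rewrite mulr0 -[RHS](hz k%:R) /h mulr_sumr.
  by apply: eq_bigr => j _; rewrite /p (cpowD _ (- a - 1)) cpowMn /t; ring.
by move: di0; rewrite -(@conjcK _ (d i0)) dz conjc0 eqxx.
Qed.

Theorem contracting_spectrum T mu w : 0 < mu -> mu < 1 -> half_plane w -> continuous T ->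
  is_composition_operator (fun z => mu%:C * z + w) T ->
  spectrum T = [set z : C | normc z <= mu^-1] /\ essential_spectrum T = spectrum T.
Proof.
move=> mu0 mu1 w0 cT TP; apply: spectrum_determined => l.
  move=> /= lm [_ _ fc]; have [l0|l0] := eqVneq l 0.
    by apply: (affine_not_fin_codim0 mu0 w0 TP); rewrite -l0.
  have [l1|l1] := ltP 1 (normc l).
    exact: (contracting_not_fin_codim_outer mu0 mu1 w0 TP l1 lm fc).
  exact: (contracting_not_fin_codim_inner mu0 mu1 w0 TP l0 l1 fc).
move=> /= /negP; rewrite -ltNge => lm; apply: (affine_upper mu0 _ w0 TP cT lm).
by rewrite lt_eqF.
Qed.

End ContractingInner.

(** * Polynomial relations modulo a subspace *)

Section PolynomialsInOperator.
Context {R : realType}.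
Local Notation C := R[i].
Local Notation X := (hardy_bergman R).
Context (V : {linear X -> X}).
Implicit Types (f g : X) (p : {poly C}) (c : C).

Definition poly_act p f : X := \sum_(i < size p) p`_i *: iter i V f.

Lemma poly_act_wide p n f : (size p <= n)%N -> poly_act p f = \sum_(i < n) p`_i *: iter i V f.
Proof.
move=> pn; rewrite /poly_act (big_ord_widen n (fun i => p`_i *: iter i V f) pn) big_mkcond /=.
apply: eq_bigr => i _; case: ltnP => // h.
by rewrite nth_default// scale0r.
Qed.

Lemma poly_act_factor p c f : poly_act (p * ('X - c%:P)) f = poly_act p (V f - c *: f).
Proof.
have szp : (size (p * ('X - c%:P))%R <= (size p).+1)%N.
  by apply: leq_trans (size_polyMleq _ _) _; rewrite size_XsubC addn2.
rewrite (poly_act_wide f szp) /poly_act.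
have it i : iter i V (V f - c *: f) = iter i.+1 V f - c *: iter i V f.
  by elim: i => [|i IH] //=; rewrite IH linearB linearZ.
transitivity (\sum_(i < size p) p`_i *: iter i.+1 V f - \sum_(i < size p) (p`_i * c) *: iter i V f); last first.
  by rewrite -sumrB; apply: eq_bigr => i _; rewrite it scalerBr scalerA.
have -> : \sum_(i < (size p).+1) (p * ('X - c%:P))`_i *: iter i V f =
    \sum_(i < (size p).+1) (p * 'X)`_i *: iter i V f - \sum_(i < (size p).+1) (p`_i * c) *: iter i V f.
  by rewrite -sumrB; apply: eq_bigr => i _; rewrite mulrBr coefB coefMC scalerBl.
congr (_ - _).
  rewrite big_ord_recl coefMX /= scale0r add0r; apply: eq_bigr => i _.
  by rewrite coefMX.
by rewrite big_ord_recr /= nth_default// mul0r scale0r addr0.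
Qed.

(** A linear relation between the iterates of a vector modulo [W] factors over
    the complex numbers, so it is enough to treat relations of degree one. *)
Lemma iterate_relation (W : set X) : (forall c g, W (V g - c *: g) -> W g) ->
  (forall c g, W g -> W (c *: g)) ->
  forall n (c : 'I_n -> C) g, (exists i, c i != 0) -> W (\sum_i c i *: iter i V g) -> W g.
Proof.
move=> W1 WZ n c g [i0 ci0] Wc.
pose p : {poly C} := \sum_(i < n) c i *: 'X^i.
have pc (i : 'I_n) : p`_i = c i.
  rewrite /p coef_sum (bigD1 i)//= coefZ coefXn eqxx mulr1 big1 ?addr0// => j ij.
  by rewrite coefZ coefXn; case: eqP => [/val_inj e|_]; [rewrite e eqxx in ij|rewrite mulr0].
have p0 : p != 0 by apply: contra ci0 => /eqP p0; rewrite -pc p0 coef0.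
have szp : (size p <= n)%N.
  rewrite /p; apply: leq_trans (size_sum _ _ _) _; apply/bigmax_leqP => i _.
  by apply: leq_trans (size_scale_leq _ _) _; rewrite size_polyXn.
have Wp : W (poly_act p g).
  by rewrite (poly_act_wide g szp); move: Wc; congr W; apply: eq_bigr => i _; rewrite pc.
have [r pE] := closed_field_poly_normal p.
have lc : lead_coef p != 0 by rewrite lead_coef_eq0.
have Wr : W (poly_act (\prod_(z <- r) ('X - z%:P)) g).
  have -> : poly_act (\prod_(z <- r) ('X - z%:P)) g = (lead_coef p)^-1 *: poly_act p g; last exact: WZ.
  rewrite {2}pE /poly_act size_scale// scaler_sumr; apply: eq_bigr => i _.
  by rewrite coefZ scalerA mulKf.
elim: r {pE} g Wr {Wc Wp} => [|z r IH] g.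
  by rewrite big_nil /poly_act size_poly1 big_ord1 coef1 scale1r.
by rewrite big_cons mulrC poly_act_factor => /IH; exact: W1.
Qed.

End PolynomialsInOperator.

(** * Translations *)

Section Translations.
Context {R : realType}.
Local Notation C := R[i].
Local Notation X := (hardy_bergman R).
Local Notation leb := (@lebesgue_measure R).
Implicit Types (f g h : X) (T V A : {linear X -> X}) (l z w c : C).

(** Along the orbit of the translation an eigenfunction does not decrease in
    modulus, whereas elements of the space vanish at infinity on vertical lines. *)
Lemma vertical_eigenvector V (t : R) c f : t != 0 ->
  (forall f z, half_plane z -> V f z = f (z + (0 +i* t))) ->
  1 <= normc c -> V f = c *: f -> f = 0.
Proof.
move=> t0 VP c1 Vf; have zn (n : nat) z : half_plane z -> half_plane (z + (0 +i* (n%:R * t))).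
  by move=> z0; apply: half_planeD => //; exact: lexx.
have it n z : half_plane z -> f (z + (0 +i* (n%:R * t))) = c ^+ n * f z.
  move=> z0; elim: n => [|n IH]; first by rewrite mul0r expr0 mul1r (_ : 0 +i* 0 = 0) ?addr0.
  have -> : z + (0 +i* (n.+1%:R * t)) = z + (0 +i* (n%:R * t)) + (0 +i* t).
    by case: (z) => u v; apply/eqP; rewrite eq_complex /= !addr0 eqxx -natr1 mulrDl mul1r addrA eqxx.
  by rewrite -VP ?Vf ?hbZ ?IH ?exprS ?mulrA//; exact: zn.
apply: hb_eq => z z0; apply/eqP; rewrite -normc_eq0 eq_le normc_ge0 andbT.
apply/ler_addgt0Pl => e e0; rewrite addr0.
have rz : 0 < complex.Re z by [].
have e1 : 0 < e * complex.Re z by rewrite mulr_gt0.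
have [M MP] := decay_at_infinity f e1.
have t0' : 0 < `|t| by rewrite normr_gt0.
pose n := (Num.trunc ((`|M| + `|complex.Im z|) / `|t|)).+1.
have nP : (`|M| + `|complex.Im z|) / `|t| < n%:R by exact: truncnS_gt.
have := MP (complex.Re z) (complex.Im z + n%:R * t) rz _.
have -> : complex.Re z +i* (complex.Im z + n%:R * t) = z + (0 +i* (n%:R * t)).
  by case: (z) => u v; apply/eqP; rewrite eq_complex /= addr0 !eqxx.
rewrite it// normcM normcX => h.
have {}h : complex.Re z * (normc c ^+ n * normc (f z)) <= e * complex.Re z.
  apply: h; move: nP; rewrite ltr_pdivrMr// => nP.
  have := ler_normB (complex.Im z + n%:R * t) (complex.Im z).
  rewrite addrAC subrr add0r normrM normr_nat; move: nP (ler_norm M) rz; clear; lra.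
move: h; rewrite mulrC ler_pM2r//; apply: le_trans.
by rewrite ler_peMl ?normc_ge0// exprn_ege1.
Qed.

Definition area f : R := fine (bergman_sqnorm f).

Lemma areaE f : bergman_sqnorm f = (area f)%:E.
Proof. by rewrite /area fineK// ge0_fin_numE ?bergman_sqnorm_ge0// bergman_fin. Qed.

Lemma area_ge0 f : 0 <= area f.
Proof. by apply: fine_ge0; exact: bergman_sqnorm_ge0. Qed.

(** The ergodic argument uses the area norm, which is a single integral: for the
    Hardy part, a supremum, the parallelogram law would need boundary values. *)
Lemma area_parallelogram f g : area (f + g) + area (f - g) = 2 * area f + 2 * area g.
Proof.
have m (h : X) : measurable_fun [set p : R * R | 0 < p.1] (fun p => (normc (h (p.1 +i* p.2)) ^+ 2)%:E).
  by apply/measurable_EFinP; apply: measurable_sqnorm_plane; exact: hb_holomorphic.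
have p0 (h : X) (p : R * R) : (0 <= (normc (h (p.1 +i* p.2)) ^+ 2)%:E)%E by rewrite lee_fin sqr_ge0.
have mr := @measurable_right_p R.
apply: EFin_inj; rewrite !EFinD !EFinM -!areaE /bergman_sqnorm.
have Z (h : X) : (2%:E * \int[leb \x leb]_(p in [set p : R * R | (0 < p.1)%R]) (normc (h (p.1 +i* p.2)) ^+ 2)%:E =
    \int[leb \x leb]_(p in [set p : R * R | (0 < p.1)%R]) (2%:E * (normc (h (p.1 +i* p.2)) ^+ 2)%:E))%E.
  by rewrite ge0_integralZl_EFin//; exact: m.
have p2 (h : X) (p : R * R) : (0 <= 2%:E * (normc (h (p.1 +i* p.2)) ^+ 2)%:E)%E by rewrite mule_ge0// lee_fin.
have m2 (h : X) : measurable_fun [set p : R * R | 0 < p.1] (fun p => (2%:E * (normc (h (p.1 +i* p.2)) ^+ 2)%:E)%E).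
  by apply: measurable_funeM; exact: m.
have D (F G : R * R -> \bar R) : (forall p, 0 <= F p)%E -> (forall p, 0 <= G p)%E ->
    measurable_fun [set p : R * R | 0 < p.1] F -> measurable_fun [set p : R * R | 0 < p.1] G ->
    (\int[leb \x leb]_(p in [set p : R * R | (0 < p.1)%R]) F p +
     \int[leb \x leb]_(p in [set p : R * R | (0 < p.1)%R]) G p =
     \int[leb \x leb]_(p in [set p : R * R | (0 < p.1)%R]) (F p + G p))%E.
  by move=> F0 G0 mF mG; rewrite ge0_integralD.
rewrite !Z; apply: etrans (D _ _ (p0 (f + g)) (p0 (f - g)) (m (f + g)) (m (f - g))) _.
apply: etrans _ (esym (D _ _ (p2 f) (p2 g) (m2 f) (m2 g))).
apply: eq_integral => p _; rewrite -!EFinM -!EFinD; congr _%:E.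
rewrite hbD hbB; case: (f _) => a b; case: (g _) => c d.
by rewrite !normc_ReIm !sqr_sqrtr ?addr_ge0 ?sqr_ge0//=; ring.
Qed.

Lemma areaZ c f : area (c *: f) = normc c ^+ 2 * area f.
Proof.
apply: EFin_inj; rewrite [RHS]EFinM -!areaE /bergman_sqnorm -ge0_integralZl_EFin//.
- by apply: eq_integral => p _; rewrite -EFinM hbZ normcM exprMn.
- exact: measurable_right_p.
- by move=> p _; rewrite lee_fin sqr_ge0.
- by apply/measurable_EFinP; apply: measurable_sqnorm_plane; exact: hb_holomorphic.
- exact: sqr_ge0.
Qed.

Section InvariantSubspace.
Context (Y : set X) (V : {linear X -> X}).
Context (Yc : closed Y) (YD : forall f g, Y f -> Y g -> Y (f + g))
  (YZ : forall c f, Y f -> Y (c *: f)) (YV : forall f, Y f -> Y (V f)).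
Context (Vn : forall f, hb_norm (V f) <= hb_norm f).

(** Modulo [Y] the vector [g] equals [c^-n V^n g], which tends to zero as [V] is a
    contraction. *)
Lemma invariant_expanding c g : 1 < normc c -> Y (V g - c *: g) -> Y g.
Proof.
move=> c1 Yg; have c0 : c != 0 by rewrite -normc_gt0 (lt_trans ltr01).
have itn n : hb_norm (iter n V g) <= hb_norm g.
  by elim: n => [|n IH] //=; apply: le_trans (Vn _) IH.
have Yn n : Y (g - c ^- n *: iter n V g).
  elim: n => [|n IH]; first by rewrite expr0 invr1 scale1r subrr -(scale0r (V g - c *: g)); exact: YZ.
  have -> : g - c ^- n.+1 *: iter n.+1 V g =
      c^-1 *: V (g - c ^- n *: iter n V g) + (- c^-1) *: (V g - c *: g).
    rewrite linearB (linearZ_LR V) /= !scalerBr !scalerA scaleNr mulNr mulVf// scaleNr scale1r opprK.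
    by rewrite -invfM -exprS addrACA subrr add0r addrC.
  by apply: YD; apply: YZ => //; exact: YV.
apply: (closed_limit Yc) => e e0.
have [N NP] := pow_unbounded (hb_norm g / e + 1) c1.
exists (g - c ^- N *: iter N V g); first exact: Yn.
rewrite opprB addrC subrK hb_normZ normcV normcX.
have cN : 0 < normc c ^+ N by rewrite exprn_gt0// (lt_trans ltr01).
rewrite mulrC ltr_pdivrMr//; apply: le_lt_trans (itn N) _.
by rewrite -ltr_pdivrMl// mulrC; apply: lt_le_trans (NP N (leqnn N)); rewrite ltrDl.
Qed.

(** Midpoint-convex hull of the orbit of [g]; midpoints suffice for the
    parallelogram argument. *)
Inductive orbit_hull c g : X -> Prop :=
| hull_base : orbit_hull c g g
| hull_step h of orbit_hull c g h : orbit_hull c g (c^-1 *: V h)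
| hull_mid h k of orbit_hull c g h & orbit_hull c g k : orbit_hull c g (2^-1 *: (h + k)).

(** Modulo an invariant subspace that contains [V g - c g], the operator [c^-1 V]
    fixes [g]. *)
Lemma hull_congruent c g h : c != 0 -> Y (V g - c *: g) -> orbit_hull c g h -> Y (g - h).
Proof.
move=> c0 Yg; elim=> [|k _ IH|k k' _ IH _ IH'].
- by rewrite subrr -(scale0r (V g - c *: g)); exact: YZ.
- have -> : g - c^-1 *: V k = (- c^-1) *: (V g - c *: g) + c^-1 *: V (g - k).
    rewrite (linearB V) !scalerBr scaleNr scalerA mulNr mulVf// scaleN1r opprK.
    by rewrite addrACA addNr add0r.
  by apply: YD; apply: YZ => //; exact: YV.
have -> : g - 2^-1 *: (k + k') = 2^-1 *: (g - k) + 2^-1 *: (g - k').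
  rewrite -scalerDr addrACA -opprD scalerBr; congr (_ - _).
  by rewrite scalerDr -scalerDl (_ : 2^-1 + 2^-1 = 1) ?scale1r//; field.
by apply: YD; exact: YZ.
Qed.

Context (Va : forall f, area (V f) <= area f).
Context (T : {linear X -> X}) (K : R).
Context (K0 : 0 < K) (TK : forall f, hb_norm (T f) ^+ 2 <= K * area f).
Context (TV : forall f, T (V f) = V (T f)) (YT : forall f, Y f -> Y (T f)).

(** Mean ergodic argument: elements of nearly minimal area in the hull of the
    orbit are close to each other, so their images converge to a fixed vector. *)
Lemma invariant_unimodular c g : normc c = 1 -> (forall f, V f = c *: f -> f = 0) ->
  Y (V g - c *: g) -> Y (T g).
Proof.
move=> c1 Veig Yg; have c0 : c != 0 by rewrite -normc_gt0 c1.
pose S : set R := [set area h | h in [set h | orbit_hull c g h]].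
have S0 : has_inf S.
  split; first by exists (area g), g => //; exact: hull_base.
  by exists 0 => _ [h _ <-]; exact: area_ge0.
have mP h : orbit_hull c g h -> inf S <= area h.
  by move=> hh; apply: ge_inf; [exact: S0.2|exists h].
(* The midpoint of two elements of nearly minimal area has area at least the
   infimum, so the parallelogram law leaves little area for their difference. *)
have close h k e : orbit_hull c g h -> orbit_hull c g k -> area h <= inf S + e ->
    area k <= inf S + e -> area (h - k) <= 4 * e.
  move=> hh hk h1 h2; have := area_parallelogram h k.
  have := mP _ (hull_mid hh hk); rewrite areaZ.
  have -> : normc (2^-1 : C) ^+ 2 = 4^-1.
    have -> : (2^-1 : C) = (2^-1)%:C by rewrite fmorphV rmorph_nat.
    by rewrite normc_real ger0_norm ?invr_ge0//; field.
  by move: h1 h2; lra.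
have ex n : exists h, orbit_hull c g h /\ area h <= inf S + 2^-1 ^+ n.
  have p0 : 0 < (2^-1 : R) ^+ n by rewrite exprn_gt0// invr_gt0.
  by have [_ [h hh <-] hn] := inf_adherent p0 S0; exists h; split => //; exact: ltW.
have [u uP] := choice ex.
have small e : 0 < e -> exists N, forall n, (N <= n)%N -> 4 * K * 2^-1 ^+ n <= e ^+ 2.
  move=> e0; have e1 : 0 < e ^+ 2 / (4 * K) by rewrite divr_gt0 ?exprn_gt0 ?mulr_gt0.
  have [N NP] := half_pow_small e1; exists N => n Nn.
  by rewrite mulrC -ler_pdivlMr ?mulr_gt0//; exact: NP.
have sq (x e : R) : 0 < e -> x ^+ 2 <= e ^+ 2 -> x <= e.
  move=> e0 h; case: (lerP 0 x) => [x0|x0]; last exact: ltW (lt_trans x0 e0).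
  by rewrite -(@ler_pXn2r _ 2)// nnegrE ltW.
have bound h k n e : orbit_hull c g h -> orbit_hull c g k -> area h <= inf S + 2^-1 ^+ n ->
    area k <= inf S + 2^-1 ^+ n -> 0 < e -> 4 * K * 2^-1 ^+ n <= e ^+ 2 -> hb_norm (T h - T k) <= e.
  move=> hh hk h1 h2 e0 ne; apply: sq => //; rewrite -linearB; apply: le_trans (TK _) _.
  apply: le_trans ne; rewrite -mulrA (mulrCA 4) ler_pM2l//; exact: close.
have mono n m : (n <= m)%N -> area (u m) <= inf S + 2^-1 ^+ n.
  by move=> nm; apply: le_trans (uP m).2 _; rewrite lerD2l ler_wiXn2l ?invr_ge0// invf_le1// ler1n.
have [k kP] : exists k, forall e, 0 < e -> exists N, forall n, (N <= n)%N -> hb_norm (T (u n) - k) <= e.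
  apply: hb_complete => e e0; have [N NP] := small e e0; exists N => i j Ni Nj.
  exact: (bound _ _ N e (uP i).1 (uP j).1 (mono _ _ Ni) (mono _ _ Nj) e0 (NP N (leqnn N))).
have k0 : k = 0.
  apply: Veig; apply/eqP; rewrite -subr_eq0 -hb_norm_eq0P eq_le hb_norm_ge0 andbT.
  apply/ler_addgt0Pl => e e0; rewrite addr0.
  have e3 : 0 < e / 3 by rewrite divr_gt0.
  have [N1 N1P] := small _ e3; have [N2 N2P] := kP _ e3.
  pose n := maxn N1 N2; have b1 := N2P n (leq_maxr _ _).
  have hs := hull_step (uP n).1.
  have as_ : area (c^-1 *: V (u n)) <= inf S + 2^-1 ^+ n.
    by rewrite areaZ normcV c1 invr1 expr1n mul1r; apply: le_trans (Va _) (uP n).2.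
  have b2 := bound _ _ n _ hs (uP n).1 as_ (uP n).2 e3 (N1P n (leq_maxl _ _)).
  have b2' : hb_norm (V (T (u n)) - c *: T (u n)) <= e / 3.
    have -> : V (T (u n)) - c *: T (u n) = c *: (T (c^-1 *: V (u n)) - T (u n)).
      by rewrite (linearZ_LR T) /= TV scalerBr scalerA mulfV// scale1r.
    by rewrite hb_normZ c1 mul1r.
  have -> : V k - c *: k = V (k - T (u n)) + (V (T (u n)) - c *: T (u n)) + c *: (T (u n) - k).
    by rewrite (linearB V) scalerBr !addrA !subrK.
  apply: le_trans (hb_normD _ _) _; rewrite hb_normZ c1 mul1r.
  have := hb_normD (V (k - T (u n))) (V (T (u n)) - c *: T (u n)).
  have := Vn (k - T (u n)); rewrite (hb_normB k); move: b1 b2'; lra.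
apply: (closed_limit Yc) => e e0; have e20 : 0 < e / 2 by rewrite divr_gt0.
have [N NP] := kP _ e20; exists (T (g - u N)); first by apply: YT; exact: hull_congruent (uP N).1.
rewrite linearB opprB addrC subrK; have := NP N (leqnn N); rewrite k0 subr0.
by move: e0; lra.
Qed.

End InvariantSubspace.

Lemma vertical_translation (t : R) : exists V : {linear X -> X},
  [/\ forall f z, half_plane z -> V f z = f (z + (0 +i* t)),
      forall f, hb_norm (V f) <= hb_norm f & forall f, area (V f) <= area f].
Proof.
have t0 : 0 <= complex.Re (0 +i* t : C) by exact: lexx.
have [V [VP _]] := affine_operator ltr01 t0.
have VE f z : half_plane z -> V f z = f (1%:C * z + (0 +i* t)) by exact: VP.
exists V; split=> [f z z0|f|f]; first by rewrite VP// mul1r.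
  by have := affine_norm ltr01 t0 ler01 (VE f); rewrite mul1r; apply; rewrite ?invr1 ?expr1n.
rewrite -lee_fin -!areaE (eq_bergman_sqnorm (VE f)).
apply: le_trans (bergman_affine ltr01 t0 (@hb_holomorphic _ f)) _.
by rewrite invr1 expr1n mul1e.
Qed.

(** For a symbol [z + w] the spectrum is not identified; a Fredholm [T - l] is shown
    to be invertible. Its kernel and range are invariant under the vertical
    translation [V], an isometry commuting with [T]. A finite-dimensional kernel
    would contain an eigenvector of [V], and there is none. Modulo a range of
    finite codimension every vector satisfies a polynomial relation in [V]; its
    linear factors are inverted one by one, with the mean ergodic argument when
    the root is on the unit circle. *)
Theorem translation_not_fredholm T w l : half_plane w -> continuous T ->
  is_composition_operator (fun z => z + w) T -> spectrum T l -> ~ fredholm (shifted T l).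
Proof.
move=> w0 cT TP sl [fd cl fc].
have TP1 : is_composition_operator (fun z => 1%:C * z + w) T by move=> f z z0; rewrite mul1r TP.
have l0 : l != 0.
  by apply/eqP => l0; apply: (affine_not_fin_codim0 ltr01 w0 TP1); rewrite -l0.
(* Translations by i and by -i are inverse to each other; the second is needed
   when the root has modulus less than one. *)
have [V [VP Vn Va]] := vertical_translation 1.
have [W [WP Wn Wa]] := vertical_translation (-1).
have wH z : half_plane z -> half_plane (z + w) by move=> z0; apply: half_planeD => //; exact: ltW.
have iH (t : R) z : half_plane z -> half_plane (z + (0 +i* t)).
  by move=> z0; apply: half_planeD => //; exact: lexx.
have ii : (0 +i* 1) + (0 +i* -1) = 0 :> C by apply/eqP; rewrite eq_complex /= addr0 subrr eqxx.
have VW : cancel W V.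
  by move=> f; apply: hb_eq => z z0; rewrite VP// (WP f _ (iH 1 z z0)) -addrA ii addr0.
have WV : cancel V W.
  by move=> f; apply: hb_eq => z z0; rewrite WP// (VP f _ (iH (-1) z z0)) -addrA (addrC (0 +i* -1)) ii addr0.
have TV f : T (V f) = V (T f).
  by apply: hb_eq => z z0; rewrite TP// (VP f _ (wH z z0)) VP// (TP f _ (iH 1 z z0)) addrAC.
have TW f : T (W f) = W (T f).
  by apply: hb_eq => z z0; rewrite TP// (WP f _ (wH z z0)) WP// (TP f _ (iH (-1) z z0)) addrAC.
have one_ne : (1 : R) != 0 by exact: oner_neq0.
have eigV c f : 1 <= normc c -> V f = c *: f -> f = 0 by exact: (vertical_eigenvector one_ne VP).
have eig c f : V f = c *: f -> f = 0.
  move=> Vf; have [c1|c1] := leP 1 (normc c); first exact: eigV Vf.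
  have : hb_norm f <= normc c * hb_norm f by rewrite -hb_normZ -Vf -{1}(WV f).
  have [/eqP|f0] := eqVneq (hb_norm f) 0; first by rewrite hb_norm_eq0P => /eqP.
  have fp : 0 < hb_norm f by rewrite lt_def f0 hb_norm_ge0.
  by rewrite -{1}(mul1r (hb_norm f)) ler_pM2r// leNgt c1.
have shV f : shifted T l (V f) = V (shifted T l f).
  by rewrite -[LHS]/(T (V f) - l *: V f) TV -(linearZ_LR V) -(linearB V).
have inj f : shifted T l f = 0 -> f = 0.
  move=> f0; pose N : set X := [set 0].
  have iN i : (shifted T l @^-1` [set 0]) (iter i V f).
    by elim: i => [|i IH]; [exact: f0|rewrite /preimage /= shV [shifted T l _]IH linear0].
  have [n [c [c0 c0E]]] := fin_dim_relation fd iN.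
  apply: (@iterate_relation _ V N _ _ n.+1 c f c0) => //.
  - by move=> e g /= /eqP; rewrite subr_eq0 => /eqP /eig.
  - by move=> e g /= ->; rewrite scaler0.
set Y := range (shifted T l).
have YD f g : Y f -> Y g -> Y (f + g).
  by move=> [f' _ <-] [g' _ <-]; exists (f' + g') => //; rewrite linearD.
have YZ c f : Y f -> Y (c *: f) by move=> [f' _ <-]; exists (c *: f') => //; rewrite linearZ.
have YV f : Y f -> Y (V f) by move=> [f' _ <-]; exists (V f').
have YW f : Y f -> Y (W f).
  move=> [f' _ <-]; exists (W f') => //.
  by rewrite -[LHS]/(T (W f') - l *: W f') TW -(linearZ_LR W) -(linearB W).
have YT f : Y f -> Y (T f).
  move=> [f' _ <-]; exists (T f') => //.
  by rewrite -[LHS]/(T (T f') - l *: T f') -(linearZ_LR T) -(linearB T).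
pose K := 128 / complex.Re w + 1.
have K0 : 0 < K by rewrite ltr_wpDl// divr_ge0// ltW.
have TK f : hb_norm (T f) ^+ 2 <= K * area f.
  have := affine_smoothing ltr01 w0 (TP1 f).
  by rewrite hb_sqnorm_fin areaE -EFinM lee_fin invr1 expr1n mul1r.
have step c g : Y (V g - c *: g) -> Y g.
  move=> Yg; have [c1|c1|c1] := ltgtP 1 (normc c).
  - exact: (invariant_expanding cl YD YZ YV Vn c1 Yg).
  - have [c0|c0] := eqVneq c 0.
      by move: Yg; rewrite c0 scale0r subr0 => /YW; rewrite WV.
    have ci : 1 < normc c^-1 by rewrite normcV invf_gt1// normc_gt0.
    apply: (invariant_expanding cl YD YZ YW Wn ci).
    have -> : W g - c^-1 *: g = (- c^-1) *: W (V g - c *: g).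
      rewrite (linearB W) (linearZ_LR W) /= WV scalerBr scalerA mulNr mulVf// !scaleNr scale1r opprK.
      by rewrite addrC.
    by apply: YZ; exact: YW.
  - have YTg := invariant_unimodular cl YD YZ YV Vn Va K0 TK TV YT (esym c1) (fun f => @eig c f) Yg.
    have Yr : Y (l^-1 *: (T g + (-1) *: shifted T l g)).
      have Ysh : Y (shifted T l g) by exists g.
      exact: (YZ _ _ (YD _ _ YTg (YZ _ _ Ysh))).
    have gE : l^-1 *: (T g + (-1) *: shifted T l g) = g.
      rewrite -[shifted T l g]/(T g - l *: g) scaleN1r opprB addrCA subrr addr0 scalerA mulVf//.
      by rewrite scale1r.
    by rewrite gE in Yr.
have surj g : Y g.
  have [n [c [c0 [f fE]]]] := fin_codim_relation (fun i => iter i V g) fc.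
  by apply: (@iterate_relation _ V Y step YZ n.+1 c g c0); exists f.
have [k k0 kP] := shifted_bounded l cT.
have [c c0 cP] := bounded_below_of_closed_range (bounded_continuous kP) inj cl.
apply: sl; apply: (inverse_of_bounded_below cP) => g.
by have [f _ fE] := surj g; exists f.
Qed.

End Translations.

(** * The spectra of affine composition operators *)

Theorem theorem3p7 (R : realType) (phi : R[i] -> R[i])
    (Cphi : {linear hardy_bergman R -> hardy_bergman R})
    (Cphi_comp : is_composition_operator phi Cphi)
    (Cphi_bounded : continuous Cphi) :
  (forall mu : R, 0 < mu ->
     (forall s, half_plane s -> phi s = mu%:C * s) ->
     (mu != 1 ->
        spectrum Cphi =
          [set z : R[i] | Num.min mu^-1 (Num.sqrt mu)^-1 <= normc z
                          <= Num.max mu^-1 (Num.sqrt mu)^-1]) /\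
     essential_spectrum Cphi = spectrum Cphi) /\
  (forall mu x y : R, 0 < mu -> 0 < x ->
     (forall s, half_plane s -> phi s = mu%:C * s + (x +i* y)) ->
     (mu != 1 ->
        spectrum Cphi = [set z : R[i] | normc z <= mu^-1]) /\
     essential_spectrum Cphi = spectrum Cphi).
Proof.
split=> [mu mu0 phiE|mu x y mu0 x0 phiE].
  exact: (dilation_spectrum mu0 (comp_operator_ext phiE Cphi_comp) Cphi_bounded).
have TP := comp_operator_ext phiE Cphi_comp.
have w0 : half_plane (x +i* y) by [].
have [mu1|mu1|mu1] := ltgtP mu 1.
- by have [-> ->] := contracting_spectrum mu0 mu1 w0 Cphi_bounded TP.
- by have [-> ->] := expanding_spectrum mu1 w0 Cphi_bounded TP.
split=> //; apply: essential_eq => l; apply: (translation_not_fredholm w0 Cphi_bounded).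
by apply: comp_operator_ext TP => z _; rewrite mu1 mul1r.
Qed.
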